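(* There exist constants $\varepsilon_0>0$ and $C>0$ such that for all $0<\varepsilon<\varepsilon_0$ and all $f\in L_2(\Omega_0)$, $$\big\|(\mathcal{H}^{\mathrm D}_{\varepsilon,\eta}-\mathrm{i})^{-1}f-(\mathcal{H}^{\mathrm D}_0-\mathrm{i})^{-1}f\big\|_{W_2^1(\Omega_\varepsilon)}\le C\,\eta(\varepsilon)^{1/2}\,\|f\|_{L_2(\Omega_0)} .$$ In particular $C$ is independent of $\varepsilon$ and $f$.
   Context: Coordinates are $x=(x_1,x_2)\in\mathbb{R}^2$; $\varepsilon>0$ is a small parameter; $\eta=\eta(\varepsilon)\ge 0$ is a function with $\eta(\varepsilon)\to0$ as $\varepsilon\to+0$; $b\in C^2(\mathbb{R})$ is real, non-negative and $1$-periodic; $d>0$ is a constant. Put $$\Omega_0=\{x:0<x_2<d\},\quad \Omega_\varepsilon=\{x:\eta(\varepsilon)b(x_1\varepsilon^{-1})<x_2<d\},$$ $$\Gamma=\{x_2=d\},\quad \Gamma_0=\{x_2=0\},\quad \Gamma_\varepsilon=\{x_2=\eta(\varepsilon)b(x_1\varepsilon^{-1})\}.$$ $W_2^j$ are the usual $L_2$-based Sobolev spaces (of complex-valued functions), $W_\infty^j$ the $L_\infty$-based ones, and $W_{2,0}^j(\Omega,S)$ is the space of functions in $W_2^j(\Omega)$ with zero trace on the curve $S$. Coefficients ($i,j=1,2$): $A_{ij}\in W_\infty^2(\Omega_0)$ and $A_j\in W_\infty^1(\Omega_0)$ are complex-valued, $A_0\in L_\infty(\Omega_0)$ is real-valued,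 and for some constant $c_0>0$ $$A_{ij}=\overline{A_{ji}},\qquad \sum_{i,j=1}^2A_{ij}(x)z_i\overline{z_j}\ge c_0(|z_1|^2+|z_2|^2),\quad x\in\Omega_0,\ z_1,z_2\in\mathbb{C}.$$ For $\Omega\in\{\Omega_\varepsilon,\Omega_0\}$ consider the sesquilinear form $$\mathfrak{h}_\Omega(u,v)=\sum_{i,j=1}^2\Big(A_{ij}\tfrac{\partial u}{\partial x_j},\tfrac{\partial v}{\partial x_i}\Big)_{L_2(\Omega)}+\sum_{j=1}^2\Big(A_j\tfrac{\partial u}{\partial x_j},v\Big)_{L_2(\Omega)}+\sum_{j=1}^2\Big(u,A_j\tfrac{\partial v}{\partial x_j}\Big)_{L_2(\Omega)}+(A_0u,v)_{L_2(\Omega)} .$$ $\mathcal{H}^{\mathrm D}_{\varepsilon,\eta}$ is the self-adjoint lower-semibounded operator in $L_2(\Omega_\varepsilon)$ associated with the closed symmetric lower-semibounded form $\mathfrak{h}_{\Omega_\varepsilon}$ with domain $W_{2,0}^1(\Omega_\varepsilon,\partial\Omega_\varepsilon)$ (Dirichlet condition on $\partial\Omega_\varepsilon=\Gamma\cup\Gamma_\varepsilon$). $\mathcal{H}^{\mathrm D}_0$ is the self-adjoint operator in $L_2(\Omega_0)$ associated with $\mathfrak{h}_{\Omega_0}$ with domain $W_{2,0}^1(\Omega_0,\partial\Omega_0)$. For $f\in L_2(\Omega_0)$, $(\mathcal{H}^{\mathrm D}_{\varepsilon,\eta}-\mathrm i)^{-1}f$ means the resolvent applied to the restriction $f|_{\Omega_\varepsilon}$,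 and $(\mathcal{H}^{\mathrm D}_0-\mathrm i)^{-1}f$ is restricted to $\Omega_\varepsilon$ when the norm of $W_2^1(\Omega_\varepsilon)$ is taken. *)

(* Defs.v *)
From HB Require Import structures.
From mathcomp Require Export all_boot all_order all_algebra.
From mathcomp Require Export all_classical all_reals all_analysis.
From mathcomp Require Export complex.

Set Implicit Arguments.
Unset Strict Implicit.
Unset Printing Implicit Defensive.
Import Order.TTheory GRing.Theory Num.Theory.
Import numFieldNormedType.Exports.

Local Open Scope classical_set_scope.
Local Open Scope ring_scope.

(* An element of a function space over Om (a set of points of R^2) is any
   function R * R -> R[i]; only its values on Om matter, and only up to a
   null set.  Restriction to a smaller domain therefore leaves the function
   unchanged. *)

Section LebesgueSpaces.
Context {R : realType}.

Definition leb1 : {measure set (measurableTypeR R) -> \bar R} :=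
  @lebesgue_measure R.

Definition leb2 : {measure set (measurableTypeR R * measurableTypeR R)%type
    -> \bar R} :=
  (@lebesgue_measure R \x @lebesgue_measure R)%E.

(* `|z| lives in R[i] with zero imaginary part; cnorm is its value in R. *)
Definition cnorm (z : R[i]) : R := Normc.normc z.

Definition cmeasurable_fun (Om : set (R * R)) (u : R * R -> R[i]) : Prop :=
  measurable_fun (Om : set (measurableTypeR R * measurableTypeR R))
    (fun x => complex.Re (u x) : measurableTypeR R) /\
  measurable_fun (Om : set (measurableTypeR R * measurableTypeR R))
    (fun x => complex.Im (u x) : measurableTypeR R).

Definition cint (Om : set (R * R)) (u : R * R -> R[i]) : R[i] :=
  Complex (\int[leb2]_(x in Om) complex.Re (u x)) (\int[leb2]_(x in Om) complex.Im (u x)).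

Definition Lpnorm (Om : set (R * R)) (p : \bar R) (u : R * R -> R[i]) : \bar R :=
  Lnorm leb2 p (EFin \o ((cnorm \o u) \_ Om)).

Definition Lp (Om : set (R * R)) (p : \bar R) (u : R * R -> R[i]) : Prop :=
  cmeasurable_fun Om u /\ (Lpnorm Om p u < +oo)%E.

Definition ip (Om : set (R * R)) (u v : R * R -> R[i]) : R[i] :=
  cint Om (fun x => u x * conjc (v x)).

Definition loc_integrable (Om : set (R * R)) (u : R * R -> R[i]) : Prop :=
  cmeasurable_fun Om u /\
  forall K : set (R * R), compact K -> K `<=` Om ->
    (\int[leb2]_(x in K) (cnorm (u x))%:E < +oo)%E.

End LebesgueSpaces.

Section SobolevSpaces.
Context {R : realType}.

Definition dir (j : 'I_2) : R * R := if j == ord0 then (1, 0) else (0, 1).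

Definition partials (s : seq 'I_2) (phi : R * R -> R) : R * R -> R :=
  foldr (fun j (g : R * R -> R) x => 'D_(dir j) g x) phi s.

Definition smooth (phi : R * R -> R) : Prop :=
  forall s : seq 'I_2, continuous (partials s phi) /\
    forall (j : 'I_2) (x : R * R), derivable (partials s phi) x (dir j).

Definition test_fun (Om : set (R * R)) (phi : R * R -> R) : Prop :=
  [/\ smooth phi,
      compact (closure [set x | phi x != 0]) &
      closure [set x | phi x != 0] `<=` Om].

Definition ctest_fun (Om : set (R * R)) (phi : R * R -> R[i]) : Prop :=
  test_fun Om (fun x => complex.Re (phi x)) /\ test_fun Om (fun x => complex.Im (phi x)).

(* Real test functions suffice, by linearity. *)
Definition is_wderiv (Om : set (R * R)) (j : 'I_2) (u w : R * R -> R[i]) : Prop :=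
  [/\ loc_integrable Om u, loc_integrable Om w &
      forall phi : R * R -> R, test_fun Om phi ->
        cint Om (fun x => u x * ('D_(dir j) phi x)%:C%C) =
        - cint Om (fun x => w x * (phi x)%:C%C)].

(* A weak derivative is unique only up to a null set: wderiv picks a
   representative, and is the zero function when there is none. *)
Definition wderiv (Om : set (R * R)) (j : 'I_2) (u : R * R -> R[i]) :
    R * R -> R[i] :=
  xget (fun=> 0) [set w | is_wderiv Om j u w].

Fixpoint sobolev (Om : set (R * R)) (p : \bar R) (k : nat)
    (u : R * R -> R[i]) : Prop :=
  match k with
  | 0%N => Lp Om p u
  | k'.+1 => Lp Om p u /\
      forall j : 'I_2, exists2 w, is_wderiv Om j u w & sobolev Om p k' w
  end.

(* Only meaningful for u in W_2^1, since wderiv is 0 where undefined. *)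
Definition W12norm (Om : set (R * R)) (u : R * R -> R[i]) : \bar R :=
  sqrte (Lpnorm Om 2%:E u ^+ 2 +
         \sum_(j < 2) Lpnorm Om 2%:E (wderiv Om j u) ^+ 2)%E.

(* The norm of L_2 of the curve x_2 = g(x_1), for its arc length, of a function
   given in the parameter x_1. *)
Definition curve_L2norm (g : R -> R) (tau : R -> R[i]) : \bar R :=
  sqrte (\int[leb1]_t
    (cnorm (tau t) ^+ 2 * Num.sqrt (1 + (derive1 g t) ^+ 2))%:E)%E.

(* The trace on the curve x_2 = g(x_1), as the extension by continuity, from
   W_2^1(Om) to L_2 of the curve, of the restriction map on C_c^oo(R^2). *)
Definition is_trace (Om : set (R * R)) (g : R -> R) (u : R * R -> R[i])
    (tau : R -> R[i]) : Prop :=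
  exists phi : nat -> R * R -> R[i],
    [/\ forall n, ctest_fun setT (phi n),
        W12norm Om (u \- phi n) @[n --> \oo] --> 0%E &
        curve_L2norm g (fun t => phi n (t, g t) - tau t) @[n --> \oo] --> 0%E].

(* S is the set of functions whose graphs make up the part of the boundary
   where the trace vanishes. *)
Definition W12_0 (Om : set (R * R)) (S : set (R -> R)) (u : R * R -> R[i]) :
    Prop :=
  sobolev Om 2%:E 1 u /\ forall g, S g -> is_trace Om g u (fun=> 0).

End SobolevSpaces.

Section Operators.
Context {R : realType}.

(* The operator in L_2(Om) associated with the form h with domain D, by its
   graph: H u = w iff u is in D and h(u, v) = (w, v) for all v in D. *)
Definition form_operator (Om : set (R * R))
    (h : (R * R -> R[i]) -> (R * R -> R[i]) -> R[i])
    (D : set (R * R -> R[i])) (u w : R * R -> R[i]) : Prop :=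
  [/\ D u, Lp Om 2%:E w & forall v, D v -> h u v = ip Om w v].

(* (H - z)^-1 f, up to a null set: the u in the domain of H with
   H u - z u = f almost everywhere in Om.  Such a u exists for every f in L_2
   when H is self-adjoint and z is not real; otherwise the value is a default. *)
Definition resolvent (Om : set (R * R))
    (H : (R * R -> R[i]) -> (R * R -> R[i]) -> Prop) (z : R[i])
    (f : R * R -> R[i]) : R * R -> R[i] :=
  xget (fun=> 0) [set u | exists2 w, H u w &
    {ae leb2, forall x, Om x -> w x - z * u x = f x}].

Definition hform (Om : set (R * R)) (A : 'I_2 -> 'I_2 -> R * R -> R[i])
    (a : 'I_2 -> R * R -> R[i]) (a0 : R * R -> R) (u v : R * R -> R[i]) : R[i] :=
  \sum_(i < 2) \sum_(j < 2)
     ip Om (fun x => A i j x * wderiv Om j u x) (wderiv Om i v)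
  + \sum_(j < 2) ip Om (fun x => a j x * wderiv Om j u x) v
  + \sum_(j < 2) ip Om u (fun x => a j x * wderiv Om j v x)
  + ip Om (fun x => (a0 x)%:C%C * u x) v.

Definition strip (g : R -> R) (d : R) : set (R * R) :=
  [set x | g x.1 < x.2 < d].

(* Dirichlet condition on the whole boundary of { x : g(x_1) < x_2 < d }. *)
Definition HD (g : R -> R) (d : R) (A : 'I_2 -> 'I_2 -> R * R -> R[i])
    (a : 'I_2 -> R * R -> R[i]) (a0 : R * R -> R) :
    (R * R -> R[i]) -> (R * R -> R[i]) -> Prop :=
  form_operator (strip g d) (hform (strip g d) A a a0)
    (W12_0 (strip g d) [set g; (fun=> d)]).

Definition resolventD (g : R -> R) (d : R) (A : 'I_2 -> 'I_2 -> R * R -> R[i])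
    (a : 'I_2 -> R * R -> R[i]) (a0 : R * R -> R) (z : R[i])
    (f : R * R -> R[i]) : R * R -> R[i] :=
  resolvent (strip g d) (HD g d A a a0) z f.

Definition osc (eta b : R -> R) (eps : R) : R -> R :=
  fun t => eta eps * b (t / eps).

Definition flat : R -> R := fun=> 0.

Definition Omega0 (d : R) : set (R * R) := strip flat d.

Definition Omega_eps (eta b : R -> R) (d eps : R) : set (R * R) :=
  strip (osc eta b eps) d.

Definition C2 (b : R -> R) : Prop :=
  [/\ forall x, derivable b x 1,
      forall x, derivable (derive1 b) x 1 &
      continuous (derive1 (derive1 b))].

(* For almost every x, since A consists of classes of functions; the complex
   order in the last clause also says that the left-hand side is real. *)
Definition hermitian_elliptic (Om : set (R * R))
    (A : 'I_2 -> 'I_2 -> R * R -> R[i]) (c0 : R) : Prop :=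
  {ae leb2, forall x, Om x ->
    (forall i j, A i j x = conjc (A j i x)) /\
    (forall z : 'I_2 -> R[i],
       c0%:C%C * \sum_(i < 2) `|z i| ^+ 2 <=
       \sum_(i < 2) \sum_(j < 2) A i j x * z i * conjc (z j))}.

End Operators.

(* Main.v *)
(** The limit problem is compared with the perturbed one without any regularity
    of its solution u beyond W_2^1 (Savare's translation trick).  The smaller
    domain carries fewer test functions, so by Cea's lemma the difference of the
    two resolvents is at most the distance of u to the Dirichlet space of the
    perturbed strip.  Competitors there are obtained from test functions phi near
    u by the stretching x_2 |-> d - k (d - x_2), with k - 1 = O(eta), which pushes
    the support above the oscillating curve.  Since u minimises a quadratic
    energy, the square of its distance to a competitor is bounded by the excess
    energy, and this is O(k - 1): differentiating the energy of the stretched phi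
    in k produces the x_2-derivative of a flux of size O(|grad phi|^2), which can
    be integrated by parts onto the W_oo^1 coefficients.  The square root of
    O(k - 1) is the rate eta^(1/2).

    In order to work with closures of test functions, elements of W_2^1 with zero
    trace on the two boundary curves are approximated by test functions of the
    strip, cutting off the functions that approximate them up to the boundary; the
    cost of the cut-off is controlled by their values on the curve. *)

Require Import Defs.
From mathcomp Require Import ring lra measurable_realfun ess_sup_inf.
Set Implicit Arguments.
Unset Strict Implicit.
Unset Printing Implicit Defensive.
Import Order.TTheory GRing.Theory Num.Theory.
Import numFieldNormedType.Exports.
Local Open Scope classical_set_scope.
Local Open Scope ring_scope.

(** * Hilbert spaces and the Lax-Milgram theorem *)

(** The form shifted by -i is not coercive. Multiplying the resolvent equation by z = 1 + iK makes
    it so: for a Hermitian form h the real part of z (h(u,u) - i |u|^2) is h(u,u) + K |u|^2, which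
    Garding's inequality bounds below. Lax-Milgram and Cea thus apply at the non-real point i
    without spectral theory, to a non-symmetric form, while energies are compared in the Hermitian
    form h + K, of which u is the minimiser for the load f + (K + i) u. Complex functions are
    vectors of a real Hilbert space under the real part of the L_2 product; testing with W and i W
    recovers complex identities. A function with its two derivatives is a triple in L_2 of the whole
    plane, extended by zero, so that the spaces of all domains lie in one space. The slope of the
    oscillating curve, of order eta / eps, may be unbounded. It serves only qualitative facts such
    as the density of test functions; the rate depends on the curve through its height alone. *)

Section Hilbert.
Context {R : realType} {V : lmodType R}.
Implicit Types (D : set V) (ip B : V -> V -> R) (F : V -> R).

Definition subspace D := D 0 /\ forall (a : R) u v, D u -> D v -> D (a *: u + v).

Definition linear_on D F := forall (a : R) u v, D u -> D v ->
  F (a *: u + v) = a * F u + F v.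

Definition cauchy_for ip (u : nat -> V) := forall e : R, 0 < e ->
  exists N, forall m n, (N <= m)%N -> (N <= n)%N ->
    ip (u m - u n) (u m - u n) < e.

Definition cvg_for ip (u : nat -> V) l := forall e : R, 0 < e ->
  exists N, forall n, (N <= n)%N -> ip (u n - l) (u n - l) < e.

(** No definiteness is asked for: functions equal almost everywhere are not identified, so limits
    are determined only up to null vectors. [D] is a predicate on a fixed module so that nested
    Dirichlet spaces share their vectors. *)
Record semi_hilbert D ip := SemiHilbert {
  sh_sub : subspace D;
  sh_lin : forall w, D w -> linear_on D (ip^~ w);
  sh_sym : forall u v, D u -> D v -> ip u v = ip v u;
  sh_pos : forall u, D u -> 0 <= ip u u;
  sh_complete : forall u, (forall n, D (u n)) -> cauchy_for ip u ->
    exists2 l, D l & cvg_for ip u l }.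

Lemma subspaceB D u v : subspace D -> D u -> D v -> D (u - v).
Proof. by move=> [_ DL] Du Dv; rewrite addrC -scaleN1r; exact: DL. Qed.

Lemma subspaceD D u v : subspace D -> D u -> D v -> D (u + v).
Proof. by move=> [_ DL] Du Dv; rewrite -[u]scale1r; exact: DL. Qed.

Lemma subspaceZ D (a : R) u : subspace D -> D u -> D (a *: u).
Proof. by move=> [D0 DL] Du; rewrite -[_ *: _]addr0; exact: DL. Qed.

Lemma linear_onB D F u v : linear_on D F -> D u -> D v -> F (u - v) = F u - F v.
Proof. by move=> FL Du Dv; rewrite addrC -scaleN1r FL// mulN1r addrC. Qed.

Lemma linear_onD D F u v : linear_on D F -> D u -> D v -> F (u + v) = F u + F v.
Proof. by move=> FL Du Dv; rewrite -[u in LHS]scale1r FL// mul1r. Qed.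

Lemma linear_on0 D F : subspace D -> linear_on D F -> F 0 = 0.
Proof.
by move=> [D0 _] FL; rewrite -[X in F X](subrr (0 : V)) (linear_onB FL)// subrr.
Qed.

Lemma linear_onZ D F a u : subspace D -> linear_on D F -> D u ->
  F (a *: u) = a * F u.
Proof.
move=> DS FL Du; have [D0 _] := DS.
by rewrite -[_ *: _]addr0 FL// (linear_on0 DS FL) addr0.
Qed.

Lemma quad_ge0_disc (a b c : R) : 0 <= a -> 0 <= c ->
  (forall t, 0 <= a * t ^+ 2 + 2 * b * t + c) -> b ^+ 2 <= a * c.
Proof.
move=> a0 c0 H; have [az|an0] := eqVneq a 0; last first.
  have ap : 0 < a by rewrite lt_def an0.
  have := H (- b / a).
  have -> : a * (- b / a) ^+ 2 + 2 * b * (- b / a) + c = (a * c - b ^+ 2) / a.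
    by field.
  by rewrite pmulr_lge0 ?invr_gt0// subr_ge0.
rewrite az mul0r; have [->|bn0] := eqVneq b 0; first by rewrite expr0n.
(* For [a = 0] the quadratic is affine, and this argument gives it the value -1 unless [b = 0]. *)
have := H (- (c + 1) / (2 * b)); rewrite az.
have -> : 0 * (- (c + 1) / (2 * b)) ^+ 2 + 2 * b * (- (c + 1) / (2 * b)) + c = -1.
  by field.
by rewrite ler0N1.
Qed.

Section cauchy_schwarz.
Variables (D : set V) (ip : V -> V -> R).
Hypotheses (DS : subspace D) (ipL : forall w, D w -> linear_on D (ip^~ w))
  (ipC : forall u v, D u -> D v -> ip u v = ip v u)
  (ip_ge0 : forall u, D u -> 0 <= ip u u).

Lemma ip_linr w : D w -> linear_on D (ip w).
Proof.
move=> Dw a u v Du Dv; have Dz : D (a *: u + v) by case: DS => _; exact.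
by rewrite (ipC Dw Dz) (ipL Dw)// (ipC Du Dw) (ipC Dv Dw).
Qed.

Lemma ip_sqr (t : R) u v : D u -> D v -> ip (t *: u + v) (t *: u + v) =
  ip u u * t ^+ 2 + 2 * ip u v * t + ip v v.
Proof.
move=> Du Dv; have Dw : D (t *: u + v) by case: DS => _; exact.
rewrite ipL// !ip_linr// (ipC Dv Du); ring.
Qed.

Lemma ip_cauchy_schwarz u v : D u -> D v -> ip u v ^+ 2 <= ip u u * ip v v.
Proof.
move=> Du Dv; apply: quad_ge0_disc; [exact: ip_ge0|exact: ip_ge0|] => t.
by rewrite -ip_sqr// ip_ge0//; case: DS => _; exact.
Qed.

(** Cauchy-Schwarz takes the place of definiteness; identities are transferred through this lemma in
    a space whose null vectors need not be 0. *)
Lemma ip_null u v : D u -> D v -> ip u u = 0 -> ip u v = 0.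
Proof.
move=> Du Dv u0; have := ip_cauchy_schwarz Du Dv.
by rewrite u0 mul0r => h; apply/eqP; rewrite -sqrf_eq0 eq_le h sqr_ge0.
Qed.

End cauchy_schwarz.

(** The representative is the limit of a minimising sequence of [J v = ip v v - 2 * F v]: the bound
    on [F] keeps [J] bounded below, and the parallelogram identity makes the sequence Cauchy. *)
Lemma riesz D ip F (C : R) : semi_hilbert D ip -> linear_on D F ->
  (forall v, D v -> F v ^+ 2 <= C * ip v v) -> 0 <= C ->
  exists2 r, D r & forall v, D v -> ip r v = F v.
Proof.
move=> [DS ipL ipC ip0 cplt] FL FC C0.
pose J v := ip v v - 2 * F v.
have JC v : D v -> - C <= J v.
  move=> Dv; have h := FC _ Dv; have p := ip0 _ Dv.
  rewrite /J lerBrDr; have [Fn|Fp] := leP (F v) 0; first by nra.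
  rewrite -[leRHS]addr0 -subr_ge0.
  have : 2 * F v <= ip v v + C.
    rewrite -(@ler_pXn2r _ 2)// ?nnegrE; [|lra|lra].
    have := sqr_ge0 (ip v v - C); nra.
  lra.
have [D0 DL] := DS.
pose E := [set J v | v in D].
have E0 : E !=set0 by exists (J 0), 0.
have lE : has_lbound E by exists (- C) => _ [v Dv <-]; exact: JC.
have infE : has_inf E by [].
pose m := inf E.
have mJ v : D v -> m <= J v by move=> Dv; apply: ge_inf => //; exists v.
have /choice[v_ v_E] n : exists v, D v /\ J v < m + n.+1%:R^-1.
  have n0 : 0 < n.+1%:R^-1 :> R by rewrite invr_gt0.
  by have [_ [v Dv <-] h] := inf_adherent n0 infE; exists v.
have vD n : D (v_ n) by have [] := v_E n.
have vJ n : J (v_ n) < m + n.+1%:R^-1 by have [] := v_E n.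
have ipS := ip_sqr DS ipL ipC.
have cs := ip_cauchy_schwarz DS ipL ipC ip0.
have JE t u v : D u -> D v ->
    J (t *: u + v) = ip u u * t ^+ 2 + 2 * (ip v u - F u) * t + J v.
  by move=> Du Dv; rewrite /J ipS// FL// (ipC _ _ Du Dv); ring.
(* [J] stays above its infimum along [v_ n + t v], while [J (v_ n)] exceeds it by less than 1/(n+1).
   The resulting quadratic in [t] is nonnegative, and its discriminant bounds the defect in the
   Euler equation. *)
have ub n v : D v -> (ip (v_ n) v - F v) ^+ 2 <= ip v v * n.+1%:R^-1.
  move=> Dv; apply: quad_ge0_disc; [exact: ip0|by rewrite invr_ge0|] => t.
  have := mJ _ (DL t _ _ Dv (vD n)); rewrite JE//; have := vJ n.
  set x := J _; set q := _^-1; set y := _ * t ^+ 2; set z := _ * t.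
  by move: (x) (y) (z) (q) => ? ? ? ? ? ?; lra.
have cau : cauchy_for ip v_.
  move=> e e0.
  have [N _ HN] : \forall n \near \oo, (n.+1%:R^-1 : R) < e / 4.
    by apply: (near_infty_natSinv_lt (PosNum (divr_gt0 e0 _))).
  exists N => i j Ni Nj; set u := v_ i - v_ j.
  have Du : D u by apply: subspaceB.
  (* The midpoint of [v_ i] and [v_ j]: comparing its value with those at both ends gives
     [ip u u < 2 (1/(i+1) + 1/(j+1))]. *)
  have h1 := mJ _ (DL (2^-1) _ _ Du (vD j)); rewrite JE// in h1.
  have vi : v_ i = 1 *: u + v_ j by rewrite scale1r subrK.
  have h2 := vJ i; rewrite vi JE// expr1n !mulr1 in h2.
  have h3 : i.+1%:R^-1 < e / 4 := HN _ Ni.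
  have h4 : j.+1%:R^-1 < e / 4 := HN _ Nj.
  have h5 := vJ j.
  move: h1 h2 h3 h4 h5.
  move: (ip (v_ j) u - F u) (ip u u) (J (v_ j)) (i.+1%:R^-1) (j.+1%:R^-1).
  by move=> ? ? ? ? ?; lra.
have [r Dr vr] := cplt _ vD cau.
exists r => // v Dv; apply/eqP; rewrite -subr_eq0; apply/eqP.
have Fr n : ip r v - F v = (ip (v_ n) v - F v) - ip (v_ n - r) v.
  by rewrite (linear_onB (ipL v Dv))//; ring.
apply/eqP; rewrite -sqrf_eq0 eq_le sqr_ge0 andbT; apply/ler_addgt0Pl => e e0.
rewrite addr0; set p := ip v v.
have p0 : 0 <= p by exact: ip0.
have e1 : 0 < e / (4 * (p + 1)) by rewrite divr_gt0// mulr_gt0//; lra.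
have [N1 _ HN1] : \forall n \near \oo, (n.+1%:R^-1 : R) < e / (4 * (p + 1)).
  by apply: (near_infty_natSinv_lt (PosNum e1)).
have [N2 HN2] := vr _ e1.
pose n := maxn N1 N2.
have h1 := HN1 n (leq_maxl _ _); have h2 := HN2 n (leq_maxr _ _).
have h3 := ub n _ Dv; have h4 := cs _ _ (subspaceB DS (vD n) Dr) Dv.
rewrite (Fr n).
set x := ip (v_ n) v - F v in h3 *; set y := ip (v_ n - r) v in h4 *.
rewrite -/p in h3 h4; move: h1 h2; set q := e / _ => /= h1 h2.
have qe : q * (4 * (p + 1)) = e by rewrite /q divfK// mulf_neq0//; lra.
have hx : x ^+ 2 <= p * q by apply: (le_trans h3); rewrite ler_wpM2l// ltW.
have hy : y ^+ 2 <= q * p by apply: (le_trans h4); rewrite ler_wpM2r// ltW.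
have := sqr_ge0 (x + y); have : 0 <= q by rewrite ltW//.
nra.
Qed.

(** Riesz is applied twice. Let [S] represent [B] and [f] represent [F]. By coercivity
    [ip (S u) (S v)] is again a complete product on [D], and representing [v |-> ip f (S v)] in it
    solves the normal equations; coercivity then removes the outer [S]. *)
Lemma lax_milgram D ip B F (c M C : R) : semi_hilbert D ip ->
  (forall w, D w -> linear_on D (B^~ w)) -> (forall w, D w -> linear_on D (B w)) ->
  0 < c -> (forall u, D u -> c * ip u u <= B u u) ->
  0 <= M -> (forall u v, D u -> D v -> B u v ^+ 2 <= M * (ip u u * ip v v)) ->
  0 <= C -> linear_on D F -> (forall v, D v -> F v ^+ 2 <= C * ip v v) ->
  exists2 u, D u & forall v, D v -> B u v = F v.
Proof.
move=> H BL BR c0 Bc M0 BM C0 FL FC; have [DS ipL ipC ip0 cplt] := H.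
have [D0 DL] := DS.
have cs := ip_cauchy_schwarz DS ipL ipC ip0.
have /choice[S S_] u : exists s, D u -> D s /\ forall v, D v -> ip s v = B u v.
  have [Du|nDu] := pselect (D u); last by exists 0.
  have Mu : 0 <= M * ip u u by rewrite mulr_ge0// ip0.
  have [v Dv|s Ds sE] := riesz H (BR _ Du) _ Mu; last by exists s.
  by rewrite -mulrA; exact: BM.
have SD u : D u -> D (S u) by move=> /S_[].
have SE u v : D u -> D v -> ip (S u) v = B u v by move=> /S_[_]; exact.
have [f Df fE] := riesz H FL FC C0.
pose ip' u v := ip (S u) (S v).
have ip'ge u : D u -> c ^+ 2 * ip u u <= ip' u u.
  move=> Du; rewrite /ip'; have h1 := Bc _ Du; rewrite -SE// in h1.
  have h2 := cs _ _ (SD _ Du) Du; have p := ip0 _ Du; have q := ip0 _ (SD _ Du).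
  have [->|pn0] := eqVneq (ip u u) 0; first by rewrite mulr0.
  have pp : 0 < ip u u by rewrite lt_def pn0.
  rewrite -(ler_pM2r pp); apply: le_trans h2.
  rewrite (_ : _ * _ * _ = (c * ip u u) ^+ 2); last by ring.
  by rewrite ler_pXn2r// nnegrE// ?mulr_ge0// ?(ltW c0)// (le_trans _ h1)// mulr_ge0// ltW.
have ip'le u : D u -> ip' u u <= M * ip u u.
  move=> Du; rewrite /ip'; have q := ip0 _ (SD _ Du).
  have := BM _ _ Du (SD _ Du); rewrite -SE//; last exact: SD.
  have [-> _|qn0] := eqVneq (ip (S u) (S u)) 0; first by rewrite mulr_ge0// ip0.
  have qp : 0 < ip (S u) (S u) by rewrite lt_def qn0.
  by rewrite expr2 mulrA ler_pM2r.
have H' : semi_hilbert D ip'.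
  split => //.
  - move=> w Dw a u v Du Dv; have Dz := DL a _ _ Du Dv; have Sw := SD _ Dw.
    by rewrite /ip' !SE// BL.
  - by move=> u v Du Dv; apply: ipC; exact: SD.
  - by move=> u Du; apply: ip0; exact: SD.
  - move=> u uD cau; have [|l Dl ul] := cplt _ uD.
      move=> e e0; have [|N HN] := cau (c ^+ 2 * e); first by rewrite mulr_gt0// exprn_gt0.
      exists N => m n Nm Nn; have := HN m n Nm Nn.
      move=> /(le_lt_trans (ip'ge _ (subspaceB DS (uD m) (uD n)))).
      by rewrite ltr_pM2l// exprn_gt0.
    exists l => // e e0; have e1 : 0 < e / (M + 1) by rewrite divr_gt0//; lra.
    have [N HN] := ul _ e1; exists N => n Nn.
    have Dd := subspaceB DS (uD n) Dl.
    apply: (le_lt_trans (ip'le _ Dd)); have := HN n Nn.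
    rewrite ltr_pdivlMr; last lra.
    by have := ip0 _ Dd; nra.
have FS : linear_on D (fun v => ip f (S v)).
  move=> a u v Du Dv; have Dz := DL a _ _ Du Dv.
  have Su := SD _ Du; have Sv := SD _ Dv; have Sz := SD _ Dz.
  by rewrite !(ipC f)// !SE// BL.
have ff0 := ip0 _ Df.
have [v Dv|u Du uE] := riesz H' FS _ ff0; first exact/cs/SD.
exists u => // v Dv.
(* The residual is orthogonal to the range of [S], in particular to [S r]; since
   [ip (S r) r = B r r], coercivity makes it a null vector. *)
pose r := S u - f.
have Dr : D r by apply: subspaceB => //; exact: SD.
have r0 : ip r (S r) = 0.
  rewrite (linear_onB (ipL _ (SD _ Dr)))//; last exact: SD.
  by have := uE _ Dr; rewrite /ip' => ->; rewrite subrr.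
have rr0 : ip r r = 0.
  have h := Bc _ Dr; have := ip0 _ Dr; move: h.
  rewrite -SE// (ipC _ _ (SD _ Dr) Dr) r0 pmulr_rle0// => h1 h2.
  by apply/eqP; rewrite eq_le h1 h2.
have := ip_null DS ipL ipC ip0 Dr Dv rr0.
rewrite (linear_onB (ipL _ Dv))//; last exact: SD.
by rewrite SE// fE// => /eqP; rewrite subr_eq0 => /eqP.
Qed.

End Hilbert.

(** * Square-integrable functions *)

Section SquareIntegrable.
Context d (T : measurableType d) (R : realType) (mu : {measure set T -> \bar R}).
Implicit Types f g : T -> R.

Definition sqint f := measurable_fun setT f /\
  mu.-integrable setT (EFin \o (fun x => f x ^+ 2)).

Lemma le_integrable_real f g : measurable_fun setT f ->
  mu.-integrable setT (EFin \o g) -> (forall x, `|f x| <= g x) ->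
  mu.-integrable setT (EFin \o f).
Proof.
move=> mf ig fg; apply: (le_integrable measurableT _ _ ig).
  exact/measurable_EFinP.
by move=> x _ /=; rewrite lee_fin (le_trans (fg x))// ler_norm.
Qed.

Lemma ge0_integrable f : measurable_fun setT f -> (forall x, 0 <= f x) ->
  (\int[mu]_x (f x)%:E < +oo)%E -> mu.-integrable setT (EFin \o f).
Proof.
move=> mf f0 foo; apply/integrableP; split; first exact/measurable_EFinP.
rewrite (eq_integral (fun x => (f x)%:E))// => x _ /=.
by rewrite ger0_norm.
Qed.

Lemma integrable_lin (a b : R) f g : mu.-integrable setT (EFin \o f) ->
  mu.-integrable setT (EFin \o g) ->
  mu.-integrable setT (EFin \o (fun x => a * f x + b * g x)).
Proof.
move=> i j; have := integrableD measurableT (integrableZl measurableT a i)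
  (integrableZl measurableT b j).
by apply: eq_integrable => // x _ /=; rewrite EFinD !EFinM.
Qed.

Lemma sqint_lin (a b : R) f g : sqint f -> sqint g ->
  sqint (fun x => a * f x + b * g x).
Proof.
move=> [mf iff] [mg ig]; split.
  by apply: measurable_funD; apply: measurable_funM => //; exact: measurable_cst.
apply: (@le_integrable_real _ (fun x => (2 * a ^+ 2) * f x ^+ 2 + (2 * b ^+ 2) * g x ^+ 2)).
- apply: measurable_funX; apply: measurable_funD; apply: measurable_funM => //;
  exact: measurable_cst.
- exact: integrable_lin.
- move=> x; rewrite ger0_norm ?sqr_ge0//.
  by have := sqr_ge0 (a * f x - b * g x); lra.
Qed.

Lemma sqint_mul f g : sqint f -> sqint g ->
  mu.-integrable setT (EFin \o (fun x => f x * g x)).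
Proof.
move=> [mf iff] [mg ig].
apply: (@le_integrable_real _ (fun x => 1 * f x ^+ 2 + 1 * g x ^+ 2)).
- exact: measurable_funM.
- exact: integrable_lin.
- move=> x; rewrite ler_norml; apply/andP.
  have h1 := sqr_ge0 (f x - g x); have h2 := sqr_ge0 (f x + g x).
  have h3 := sqr_ge0 (f x); have h4 := sqr_ge0 (g x).
  by split; nra.
Qed.

Lemma sqintB f g : sqint f -> sqint g -> sqint (fun x => f x - g x).
Proof.
move=> sf sg; have := sqint_lin 1 (-1) sf sg.
by congr sqint; apply/funext => x; rewrite mul1r mulN1r.
Qed.

Lemma Rintegral_EFin f : (forall x, 0 <= f x) -> mu.-integrable setT (EFin \o f) ->
  (\int[mu]_x f x)%:E = (\int[mu]_x (f x)%:E)%E.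
Proof. by move=> f0 intf; rewrite fineK//; apply: integrable_fin_num. Qed.

Lemma Rintegral_eq0_ae f : (forall x, 0 <= f x) ->
  mu.-integrable setT (EFin \o f) -> \int[mu]_x f x = 0 ->
  {ae mu, forall x, f x = 0}.
Proof.
move=> f0 intf If; have mf : measurable_fun setT (fun x => (f x)%:E).
  by have /integrableP[] := intf.
have : (\int[mu]_x `|(f x)%:E| = 0)%E.
  rewrite (eq_integral (fun x => (f x)%:E)); first by rewrite -Rintegral_EFin// If.
  by move=> x _; rewrite gee0_abs// lee_fin.
by move/(ae_eq_integral_abs mu measurableT mf); apply: filterS => x /(_ I)/= [].
Qed.

(** Riesz-Fischer: a fast subsequence converges almost everywhere, and Fatou's lemma carries the
    Cauchy bound over to the limit. *)
Lemma sqint_complete (f_ : nat -> T -> R) : (forall n, sqint (f_ n)) ->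
  (forall e : R, 0 < e -> exists N, forall m n, (N <= m)%N -> (N <= n)%N ->
    \int[mu]_x (f_ m x - f_ n x) ^+ 2 < e) ->
  exists2 f, sqint f & forall e : R, 0 < e -> exists N, forall n, (N <= n)%N ->
    \int[mu]_x (f_ n x - f x) ^+ 2 < e.
Proof.
move=> sf cau.
(* The rate 8^-k leaves 2^-k after the weight 4^k of [D_], which is summable, while the weight
   itself yields pointwise increments of order 2^-k. *)
have /choice[N_ N_E] k : exists N, forall m n, (N <= m)%N -> (N <= n)%N ->
    \int[mu]_x (f_ m x - f_ n x) ^+ 2 < 8^-1 ^+ k by exact/cau/exprn_gt0.
pose n_ k := (\max_(i < k.+1) N_ i + k)%N.
have Nn_ i k : (i <= k)%N -> (N_ i <= n_ k)%N.
  move=> ik; rewrite (leq_trans _ (leq_addr _ _))//.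
  by apply: (@leq_bigmax _ (fun i : 'I_k.+1 => N_ i) (Ordinal (ik : i < k.+1)%N)).
pose g_ k := f_ (n_ k).
have mg k : measurable_fun setT (g_ k) by have [] := sf (n_ k).
pose D_ k x : R := 4 ^+ k * (g_ k.+1 x - g_ k x) ^+ 2.
have mD k : measurable_fun setT (D_ k).
  apply: measurable_funM; first exact: measurable_cst.
  by apply: measurable_funX; exact: measurable_funB.
have D0 k x : 0 <= D_ k x by rewrite mulr_ge0// sqr_ge0.
have iD k : (\int[mu]_x (D_ k x)%:E <= (2^-1 ^+ k)%:E)%E.
  have [_ ii] := sqintB (sf (n_ k.+1)) (sf (n_ k)).
  under eq_integral do rewrite EFinM.
  rewrite ge0_integralZl_EFin//; last 2 first.
  - by move=> x _; rewrite lee_fin sqr_ge0.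
  - by apply/measurable_EFinP; apply: measurable_funX; exact: measurable_funB.
  rewrite -Rintegral_EFin//; last by move=> x; exact: sqr_ge0.
  rewrite -EFinM lee_fin.
  have -> : (2^-1 ^+ k : R) = 4 ^+ k * 8^-1 ^+ k.
    by rewrite -exprMn; congr (_ ^+ k); lra.
  by rewrite ler_pM2l ?exprn_gt0// ltW// N_E// Nn_.
pose G x : \bar R := (\sum_(0 <= k <oo) (D_ k x)%:E)%E.
have mG : measurable_fun setT G.
  apply: (@ge0_emeasurable_sum _ _ _ _ _ xpredT) => [k x _ _|k _].
    by rewrite lee_fin.
  exact/measurable_EFinP.
have iG : mu.-integrable setT G.
  apply/integrableP; split => //.
  rewrite (eq_integral G); last first.
    by move=> x _; rewrite gee0_abs// nneseries_ge0// => k _ _; rewrite lee_fin.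
  rewrite integral_nneseries//; [|by move=> k; exact/measurable_EFinP|by move=> k x _; rewrite lee_fin].
  apply: (@le_lt_trans _ _ (\sum_(0 <= k <oo) (2^-1 ^+ k)%:E)%E).
    apply: lee_nneseries => [k _ _|k _]; last exact: iD.
    by apply: integral_ge0 => x _; rewrite lee_fin.
  have /cvg_lim h : (fun n => (\sum_(0 <= k < n) (2^-1 ^+ k)%:E)%E) @ \oo --> (1 / (1 - 2^-1) : R)%:E.
    under eq_fun do rewrite sumEFin.
    apply: cvg_EFin; first exact: nearW.
    have /(@cvg_geometric_series R 1) : `|2^-1 : R| < 1 by rewrite ger0_norm//; lra.
    by rewrite /series /geometric/=; under eq_fun do under eq_bigr do rewrite mul1r.
  by rewrite h// ltry.
(* An upper limit is measurable without discarding the null set of divergence. *)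
pose f x := fine (limn_esup (fun k => (g_ k x)%:E)).
have mf : measurable_fun setT f.
  apply: (measurableT_comp (@fine_measurable R _ measurableT)) => //.
  by apply: measurable_fun_limn_esup => k; exact/measurable_EFinP.
have gf : {ae mu, forall x, g_ ^~ x @ \oo --> f x}.
  have := integrable_ae measurableT iG; apply: filterS => x /(_ I) Gx.
  suff : cvgn (g_ ^~ x).
    move=> gx; rewrite /f.
    have /cvg_limn_einf_sup[_ ->] : (EFin \o g_ ^~ x) k @[k --> \oo] --> (limn (g_ ^~ x))%:E.
      by apply: cvg_EFin; first exact: nearW.
    exact: gx.
  pose C := Num.sqrt (fine (G x)).
  have DC k : D_ k x <= fine (G x).
    rewrite -lee_fin fineK// /G.
    apply: le_trans (@nneseries_lim_ge _ _ xpredT 0 k.+1 _); last by move=> i _; rewrite lee_fin.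
    rewrite big_nat_recr//= leeDr// sume_ge0// => i _; exact: D0.
  have Ck k : `|g_ k.+1 x - g_ k x| <= geometric C 2^-1 k.
    have := DC k; rewrite /D_ /geometric/= => h.
    have G0 : 0 <= fine (G x) by apply: le_trans h; rewrite mulr_ge0 ?sqr_ge0 ?exprn_ge0.
    rewrite -(@ler_pXn2r _ 2)// ?nnegrE ?mulr_ge0 ?exprn_ge0 ?sqrtr_ge0//.
    rewrite exprMn sqr_sqrtr// real_normK ?num_real//.
    have -> : ((2^-1 : R) ^+ k) ^+ 2 = (4 ^+ k)^-1.
      by rewrite -exprM mulnC exprM -exprVn; congr (_ ^+ _); lra.
    by rewrite ler_pdivlMr ?exprn_gt0// mulrC.
  have : cvgn [normed series (telescope (g_ ^~ x))].
    apply: (@series_le_cvg _ _ (geometric C 2^-1)).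
    - by move=> n /=.
    - by move=> n; rewrite /geometric/= mulr_ge0 ?sqrtr_ge0// exprn_ge0.
    - exact: Ck.
    - by apply: is_cvg_geometric_series; rewrite ger0_norm//; lra.
  move=> /normed_cvg; rewrite telescopeK => /= h.
  have -> : g_ ^~ x = (fun n => (g_ n x - g_ 0%N x) + g_ 0%N x).
    by apply/funext => n; rewrite subrK.
  by apply: is_cvgD => //; exact: is_cvg_cst.
have key (e : R) : 0 < e -> exists N, forall n, (N <= n)%N ->
    (\int[mu]_x ((f_ n x - f x) ^+ 2)%:E <= e%:E)%E.
  move=> e0; have [N HN] := cau _ e0; exists N => n Nn.
  have mf_ k : measurable_fun setT (fun x => (f_ n x - g_ k x) ^+ 2).
    by apply: measurable_funX; apply: measurable_funB => //; have [] := sf n.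
  have mq k : measurable_fun setT (fun x => ((f_ n x - g_ k x) ^+ 2)%:E).
    exact/measurable_EFinP.
  have q0 k x : setT x -> (0 <= ((f_ n x - g_ k x) ^+ 2)%:E)%E.
    by rewrite lee_fin sqr_ge0.
  (* Fatou in [k] with [n] fixed, so that the threshold [N] of the Cauchy condition survives the
     limit. *)
  apply: (@le_trans _ _ (\int[mu]_x limn_einf (fun k => ((f_ n x - g_ k x) ^+ 2)%:E))%E).
    apply: ae_ge0_le_integral => //.
    - by move=> x _; rewrite lee_fin sqr_ge0.
    - apply/measurable_EFinP; apply: measurable_funX.
      by apply: measurable_funB => //; have [] := sf n.
    - move=> x _; rewrite limn_einf_lim; apply: lime_ge; first exact: is_cvg_einfs.
      apply: nearW => k; apply: le_ereal_inf_tmp => _ [m _ <-].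
      by rewrite lee_fin sqr_ge0.
    - have -> : (fun x => limn_einf (fun k => ((f_ n x - g_ k x) ^+ 2)%:E)) =
          (fun x => - limn_esup (fun k => - ((f_ n x - g_ k x) ^+ 2)%:E))%E.
        apply/funext => x; rewrite -limn_einfN; congr limn_einf.
        by apply/funext => k; rewrite /comp oppeK.
      apply: (measurableT_comp (@oppe_measurable _ _)).
      apply: measurable_fun_limn_esup => k.
      by apply: (measurableT_comp (@oppe_measurable _ _)); exact/measurable_EFinP.
    - move: gf; apply: filterS => x gx _.
      have /cvg_limn_einf_sup[-> _] : ((f_ n x - g_ k x) ^+ 2)%:E @[k --> \oo] -->
        ((f_ n x - f x) ^+ 2)%:E => //.
      apply: cvg_EFin; first exact: nearW.
      by apply: cvgM; apply: cvgB => //; exact: cvg_cst.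
  apply: (le_trans (fatou mu measurableT mq q0)).
  rewrite limn_einf_lim; apply: lime_le; first exact: is_cvg_einfs.
  exists N => // k /= Nk.
  apply: (@le_trans _ _ (\int[mu]_x ((f_ n x - g_ k x) ^+ 2)%:E)%E).
    by apply: ereal_inf_lbound; exists k => /=.
  have [_ ii] := sqintB (sf n) (sf (n_ k)).
  rewrite -Rintegral_EFin//; last by move=> x; exact: sqr_ge0.
  by rewrite lee_fin ltW// HN// (leq_trans Nk)// leq_addl.
have mff n : measurable_fun setT (fun x => (f_ n x - f x) ^+ 2).
  by apply: measurable_funX; apply: measurable_funB => //; have [] := sf n.
have iff n : (\int[mu]_x ((f_ n x - f x) ^+ 2)%:E < +oo)%E ->
    mu.-integrable setT (EFin \o (fun x => (f_ n x - f x) ^+ 2)).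
  by apply: ge0_integrable => // x; exact: sqr_ge0.
exists f.
  have [N /(_ N (leqnn _)) HN] := key 1 ltr01.
  have : sqint (fun x => f_ N x - (f_ N x - f x)).
    apply: sqintB => //; split; first by apply: measurable_funB => //; have [] := sf N.
    by apply: iff; rewrite (le_lt_trans HN)// ltry.
  by congr sqint; apply/funext => x; rewrite opprB addrC subrK.
move=> e e0; have [N HN] := key (e / 2) (divr_gt0 e0 (ltr0Sn _ 1)).
exists N => n Nn; have h := HN n Nn.
rewrite -lte_fin Rintegral_EFin//.
- by rewrite (le_lt_trans h)// lte_fin; lra.
- by move=> x; exact: sqr_ge0.
- by apply: iff; rewrite (le_lt_trans h)// ltry.
Qed.
End SquareIntegrable.

(** * Complex square-integrable functions as a real Hilbert space *)

Section ComplexL2.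
Context {R : realType}.
Local Notation mu := (@leb2 R).
Local Notation T2 := (measurableTypeR R * measurableTypeR R)%type.
Local Notation re := (@complex.Re R).
Local Notation im := (@complex.Im R).
Implicit Types (u v w : R * R -> Rcomplex R) (z : R[i]).

(** The real part of [z] times the conjugate of [z']. The imaginary part is not lost: it is the
    value of [rdot] with ['i] times the second argument. *)
Definition rdot (z z' : R[i]) : R := re z * re z' + im z * im z'.

Definition l2 u := sqint mu (re \o u) /\ sqint mu (im \o u).

Definition rip u v : R := \int[mu]_x rdot (u x) (v x).

Definition nsq u := rip u u.

Definition zext (D : set (R * R)) (u : R * R -> R[i]) : R * R -> R[i] :=
  fun x => if x \in D then u x else 0.

Lemma re_scale (a : R) (z : Rcomplex R) : re (a *: z) = a * re z.
Proof. by case: z. Qed.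

Lemma im_scale (a : R) (z : Rcomplex R) : im (a *: z) = a * im z.
Proof. by case: z. Qed.

Lemma reD z z' : re (z + z') = re z + re z'.
Proof. by case: z z' => [? ?] [? ?]. Qed.

Lemma imD z z' : im (z + z') = im z + im z'.
Proof. by case: z z' => [? ?] [? ?]. Qed.

Lemma reN z : re (- z) = - re z. Proof. by case: z. Qed.

Lemma imN z : im (- z) = - im z. Proof. by case: z. Qed.

Lemma reM z z' : re (z * z') = re z * re z' - im z * im z'.
Proof. by case: z z' => [? ?] [? ?]. Qed.

Lemma imM z z' : im (z * z') = re z * im z' + im z * re z'.
Proof. by case: z z' => [? ?] [? ?]. Qed.

Lemma re_conj z : re (conjc z) = re z. Proof. by case: z. Qed.

Lemma im_conj z : im (conjc z) = - im z. Proof. by case: z. Qed.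

Definition reimE := (reD, imD, reN, imN, reM, imM, re_conj, im_conj).

Lemma cnorm_sqr z : cnorm z ^+ 2 = rdot z z.
Proof.
by case: z => a b; rewrite /cnorm /= sqr_sqrtr ?addr_ge0 ?sqr_ge0// /rdot/= !expr2.
Qed.

Lemma cnorm_ge0 z : 0 <= cnorm z.
Proof. by case: z => a b; rewrite /cnorm/= sqrtr_ge0. Qed.

Lemma cnorm0 : cnorm (0 : R[i]) = 0.
Proof. by rewrite /cnorm/= expr0n/= addr0 sqrtr0. Qed.

Lemma rdot_ge0 z : 0 <= rdot z z.
Proof. by rewrite addr_ge0// -expr2 sqr_ge0. Qed.

Lemma rdotC z z' : rdot z z' = rdot z' z.
Proof. by rewrite /rdot; ring. Qed.

Lemma rdotM z z' : rdot (z * z') (z * z') = rdot z z * rdot z' z'.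
Proof. by rewrite /rdot !reimE; ring. Qed.

Lemma re_le_cnorm z : `|re z| <= cnorm z.
Proof.
rewrite -(@ler_pXn2r _ 2)// ?nnegrE ?cnorm_ge0// cnorm_sqr real_normK ?num_real//.
by rewrite /rdot expr2 lerDl -expr2 sqr_ge0.
Qed.

Lemma im_le_cnorm z : `|im z| <= cnorm z.
Proof.
rewrite -(@ler_pXn2r _ 2)// ?nnegrE ?cnorm_ge0// cnorm_sqr real_normK ?num_real//.
by rewrite /rdot expr2 lerDr -expr2 sqr_ge0.
Qed.

Lemma l2_lin (a : R) u v : l2 u -> l2 v -> l2 (a *: u + v).
Proof.
move=> [ru iu] [rv iv]; split.
  have := sqint_lin a 1 ru rv.
  by congr sqint; apply/funext => x; rewrite /= reD re_scale mul1r.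
have := sqint_lin a 1 iu iv.
by congr sqint; apply/funext => x; rewrite /= imD im_scale mul1r.
Qed.

Lemma l2_0 : l2 0.
Proof.
have s0 : sqint mu (fun=> 0).
  split; first exact: measurable_cst.
  rewrite (_ : _ \o _ = cst 0%E); first exact: integrable0.
  by apply/funext => x /=; rewrite expr0n.
by split.
Qed.

Lemma l2_subspace : subspace l2.
Proof. by split; [exact: l2_0|move=> *; exact: l2_lin]. Qed.

Lemma l2B u v : l2 u -> l2 v -> l2 (u - v).
Proof. exact: subspaceB l2_subspace. Qed.

Lemma l2D u v : l2 u -> l2 v -> l2 (u + v).
Proof. exact: subspaceD l2_subspace. Qed.

Lemma rip_integrable u v : l2 u -> l2 v ->
  mu.-integrable setT (EFin \o (fun x => rdot (u x) (v x))).
Proof.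
move=> [ru iu] [rv iv].
have := integrable_lin 1 1 (sqint_mul ru rv) (sqint_mul iu iv).
by apply: eq_integrable => // x _ /=; rewrite !mul1r.
Qed.

Lemma rip_lin w : l2 w -> linear_on l2 (rip^~ w).
Proof.
move=> lw a u v lu lv; rewrite /rip -RintegralZl//; last exact: rip_integrable.
rewrite -RintegralD//; last 2 first.
- have := integrableZl measurableT a (rip_integrable lu lw).
  by apply: eq_integrable => // x _ /=; rewrite EFinM.
- exact: rip_integrable.
by apply: eq_Rintegral => x _; rewrite /rdot reD imD re_scale im_scale; ring.
Qed.

Lemma ripC u v : rip u v = rip v u.
Proof. by apply: eq_Rintegral => x _; exact: rdotC. Qed.

Lemma nsq_ge0 u : 0 <= nsq u.
Proof. by apply: Rintegral_ge0 => x _; exact: rdot_ge0. Qed.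

Lemma rip_cauchy_schwarz u v : l2 u -> l2 v -> rip u v ^+ 2 <= nsq u * nsq v.
Proof.
apply: (ip_cauchy_schwarz l2_subspace rip_lin) => [? ? ? ?|? ?].
  exact: ripC.
exact: nsq_ge0.
Qed.

Lemma rip_le u v (a b : R) : l2 u -> l2 v -> 0 <= a -> 0 <= b ->
  nsq u <= a ^+ 2 -> nsq v <= b ^+ 2 -> `|rip u v| <= a * b.
Proof.
move=> lu lv a0 b0 ua vb; rewrite -(@ler_pXn2r _ 2)// ?nnegrE ?mulr_ge0//.
rewrite real_normK ?num_real// (le_trans (rip_cauchy_schwarz lu lv))//.
by rewrite exprMn ler_pM// nsq_ge0.
Qed.

Lemma l2_measurable u : l2 u -> cmeasurable_fun setT u.
Proof. by move=> [[? _] [? _]]. Qed.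

Lemma le_nsq u v : l2 u -> l2 v -> (forall x, rdot (u x) (u x) <= rdot (v x) (v x)) ->
  nsq u <= nsq v.
Proof. by move=> lu lv uv; apply: le_Rintegral => //; exact: rip_integrable. Qed.

Lemma nsqD u v : l2 u -> l2 v -> nsq (u + v) <= 2 * nsq u + 2 * nsq v.
Proof.
move=> lu lv; rewrite /nsq /rip -!RintegralZl//; [|exact: rip_integrable..].
rewrite -RintegralD//; last 2 first.
- have := integrableZl measurableT 2 (rip_integrable lu lu).
  by apply: eq_integrable => // x _ /=; rewrite EFinM.
- have := integrableZl measurableT 2 (rip_integrable lv lv).
  by apply: eq_integrable => // x _ /=; rewrite EFinM.
apply: le_Rintegral => //.
- by apply: rip_integrable; exact: l2D.
- exact: (integrable_lin 2 2 (rip_integrable lu lu) (rip_integrable lv lv)).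
- move=> x _; rewrite /rdot reD imD.
  have := sqr_ge0 (re (u x) - re (v x)); have := sqr_ge0 (im (u x) - im (v x)).
  by lra.
Qed.

Lemma cmeasurableM u v : cmeasurable_fun setT u -> cmeasurable_fun setT v ->
  cmeasurable_fun setT (fun x => u x * v x).
Proof.
move=> [ru iu] [rv iv]; split.
  rewrite (_ : (fun _ => _) = (fun x => re (u x) * re (v x) - im (u x) * im (v x))).
    by apply: measurable_funB; exact: measurable_funM.
  by apply/funext => x; rewrite reM.
rewrite (_ : (fun _ => _) = (fun x => re (u x) * im (v x) + im (u x) * re (v x))).
  by apply: measurable_funD; exact: measurable_funM.
by apply/funext => x; rewrite imM.
Qed.

Lemma l2P u : l2 u <-> cmeasurable_fun setT u /\
  (\int[mu]_x (rdot (u x) (u x))%:E < +oo)%E.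
Proof.
split=> [lu|[[mr mi] uoo]].
  split; first exact: l2_measurable.
  rewrite -Rintegral_EFin ?ltry//; last exact: rip_integrable.
  by move=> x; exact: rdot_ge0.
have iu : mu.-integrable setT (EFin \o (fun x => rdot (u x) (u x))).
  apply: ge0_integrable => // [|x]; last exact: rdot_ge0.
  by apply: measurable_funD; exact: measurable_funM.
split; split => //; apply: (le_integrable_real _ iu).
- exact: measurable_funX.
- by move=> x; rewrite ger0_norm ?sqr_ge0// /rdot expr2 lerDl -expr2 sqr_ge0.
- exact: measurable_funX.
- by move=> x; rewrite ger0_norm ?sqr_ge0// /rdot expr2 lerDr -expr2 sqr_ge0.
Qed.

Lemma l2_le (M : R) u v : cmeasurable_fun setT u -> l2 v ->
  (forall x, rdot (u x) (u x) <= M * rdot (v x) (v x)) ->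
  l2 u /\ nsq u <= M * nsq v.
Proof.
move=> mcu lv uv; have iv := rip_integrable lv lv.
have iMv : mu.-integrable setT (EFin \o (fun x => M * rdot (v x) (v x))).
  have := integrableZl measurableT M iv.
  by apply: eq_integrable => // x _ /=; rewrite EFinM.
have iu : mu.-integrable setT (EFin \o (fun x => rdot (u x) (u x))).
  apply: (le_integrable_real _ iMv).
    have [? ?] := mcu.
    by apply: measurable_funD; exact: measurable_funM.
  by move=> x; rewrite ger0_norm ?rdot_ge0.
split; last by rewrite /nsq /rip -RintegralZl//; exact: le_Rintegral.
apply/l2P; split => //.
by rewrite -Rintegral_EFin ?ltry// => x; exact: rdot_ge0.
Qed.

Lemma l2_mul (M : R) (m : R * R -> R[i]) u : cmeasurable_fun setT m ->
  (forall x, rdot (m x) (m x) <= M) -> l2 u ->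
  l2 (fun x => m x * u x) /\ nsq (fun x => m x * u x) <= M * nsq u.
Proof.
move=> mm mM lu; apply: l2_le => //.
  by apply: cmeasurableM => //; exact: l2_measurable.
by move=> x; rewrite rdotM ler_wpM2r// rdot_ge0.
Qed.

Lemma cmeasurable_restrict (D : set T2) (u : T2 -> R[i]) : measurable D ->
  cmeasurable_fun D u <-> cmeasurable_fun setT (zext D u).
Proof.
move=> mD.
have E (f : R[i] -> R) : f 0 = 0 ->
    measurable_fun D (f \o u : T2 -> measurableTypeR R) <->
    measurable_fun setT (f \o zext D u : T2 -> measurableTypeR R).
  move=> f0; rewrite (measurable_restrictT _ mD).
  rewrite (_ : f \o zext D u = (f \o u) \_ D)//.
  by apply/funext => x; rewrite /= patchE /zext; case: ifP.
by split=> -[h1 h2]; split; apply/E.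
Qed.

Lemma l2_restrict (D : set T2) u : measurable D -> l2 u ->
  l2 (zext D u) /\ nsq (zext D u) <= nsq u.
Proof.
move=> mD lu; have := @l2_le 1 (zext D u) u; rewrite mul1r; apply => //.
  have [mr mi] := l2_measurable lu; apply/(cmeasurable_restrict u mD).
  by split; exact: measurable_funTS.
by move=> x; rewrite mul1r /zext; case: ifP => // _; rewrite {1}/rdot/= !mul0r addr0 rdot_ge0.
Qed.

Lemma eq_ae_rip u u' v v' : cmeasurable_fun setT u -> cmeasurable_fun setT u' ->
  cmeasurable_fun setT v -> cmeasurable_fun setT v' ->
  {ae mu, forall x, u x = u' x} -> {ae mu, forall x, v x = v' x} ->
  rip u v = rip u' v'.
Proof.
move=> [mu1 mu2] [mu1' mu2'] [mv1 mv2] [mv1' mv2'] uu' vv'; congr fine.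
apply: ae_eq_integral => //.
- by apply/measurable_EFinP; apply: measurable_funD; exact: measurable_funM.
- by apply/measurable_EFinP; apply: measurable_funD; exact: measurable_funM.
- move: uu' vv'; apply: (@filterS2 _ _ (ae_filter_ringOfSetsType mu)) => x e1 e2 _ /=.
  by rewrite e1 e2.
Qed.

Lemma nsq_eq0 u : l2 u -> nsq u = 0 -> {ae mu, forall x, u x = 0}.
Proof.
move=> lu nu.
have := @Rintegral_eq0_ae _ T2 R mu _ (fun x => rdot_ge0 (u x)) (rip_integrable lu lu) nu.
apply: (@filterS _ _ (ae_filter_ringOfSetsType mu)) => x /eqP.
rewrite /rdot -!expr2 paddr_eq0 ?sqr_ge0// !sqrf_eq0.
by case: (u x) => a b /= /andP[/eqP-> /eqP->].
Qed.

Lemma l2_complete (u_ : nat -> R * R -> Rcomplex R) : (forall n, l2 (u_ n)) ->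
  cauchy_for rip u_ -> exists2 u, l2 u & cvg_for rip u_ u.
Proof.
move=> lu cau.
have iB (f g : R * R -> Rcomplex R) : l2 f -> l2 g ->
    \int[mu]_x (re (f x) - re (g x)) ^+ 2 + \int[mu]_x (im (f x) - im (g x)) ^+ 2
    = rip (f - g) (f - g).
  move=> [rf if_] [rg ig]; have [_ i1] := sqintB rf rg; have [_ i2] := sqintB if_ ig.
  rewrite -RintegralD//; apply: eq_Rintegral => x _.
  by rewrite /rdot !reimE !expr2.
have [|f sf fE] := sqint_complete (fun n => (lu n).1).
  move=> e /cau[N HN]; exists N => m n Nm Nn; apply: le_lt_trans (HN _ _ Nm Nn).
  by rewrite -iB// lerDl Rintegral_ge0// => x _; exact: sqr_ge0.
have [|g sg gE] := sqint_complete (fun n => (lu n).2).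
  move=> e /cau[N HN]; exists N => m n Nm Nn; apply: le_lt_trans (HN _ _ Nm Nn).
  by rewrite -iB// lerDr Rintegral_ge0// => x _; exact: sqr_ge0.
have lfg : l2 (fun x => Complex (f x) (g x)) by [].
exists (fun x => Complex (f x) (g x)) => // e e0.
have e2 : 0 < e / 2 by lra.
have [N1 H1] := fE _ e2; have [N2 H2] := gE _ e2.
exists (maxn N1 N2) => n; rewrite geq_max => /andP[n1 n2].
by rewrite -iB//=; have := H1 _ n1; have := H2 _ n2; rewrite /=; lra.
Qed.

End ComplexL2.

(** * Smooth functions and test functions of the plane *)

Section ExpStep.
Context {R : realType}.
Implicit Types t : R.

(** The functions t^-n exp(-1/t), continued by 0: derivatives are linear combinations of members of
    the same family, so one induction gives smoothness for all [n]. *)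
Definition expinv (n : nat) t : R := if 0 < t then t^-1 ^+ n * expR (- t^-1) else 0.

Lemma pow_expR_le (m : nat) (y : R) : 0 <= y -> y ^+ m * expR (- y) <= m%:R ^+ m.
Proof.
case: m => [|m] y0; first by rewrite !expr0 mul1r -expR0 ler_expR oppr_le0.
have h : y ^+ m.+1 <= m.+1%:R ^+ m.+1 * expR y.
  have -> : expR y = expR (y / m.+1%:R) ^+ m.+1.
    by rewrite -expRM_natl mulrC divfK// pnatr_eq0.
  rewrite -exprMn ler_pXn2r ?nnegrE ?mulr_ge0 ?expR_ge0//.
  rewrite -ler_pdivrMl ?ltr0n// mulrC.
  by apply: le_trans (expR_ge1Dx _); rewrite lerDr.
by rewrite expRN ler_pdivrMr ?expR_gt0.
Qed.

Lemma expinv_ge0 n t : 0 <= expinv n t.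
Proof.
by rewrite /expinv; case: ifPn => // t0; rewrite mulr_ge0 ?expR_ge0 ?exprn_ge0 ?invr_ge0 ?ltW.
Qed.

Lemma expinv_le n t : expinv n t <= n%:R ^+ n.
Proof.
rewrite /expinv; case: ifPn => [t0|_]; last by rewrite exprn_ge0.
by apply: pow_expR_le; rewrite invr_ge0 ltW.
Qed.

Lemma expinv_le0 n t : t <= 0 -> expinv n t = 0.
Proof. by rewrite /expinv leNgt => /negbTE ->. Qed.

(** Quadratic smallness at the origin makes the difference quotients there tend to 0. *)
Lemma expinv_sqr n t : expinv n t <= (n.+2)%:R ^+ n.+2 * t ^+ 2.
Proof.
rewrite /expinv; case: ifPn => [t0|_]; last by rewrite mulr_ge0 ?sqr_ge0 ?exprn_ge0.
rewrite -ler_pdivrMr ?exprn_gt0//.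
apply: le_trans (@pow_expR_le n.+2 t^-1 _); last by rewrite invr_ge0 ltW.
by rewrite -exprVn mulrAC -exprD addn2.
Qed.

Lemma is_derive_expinv n t :
  is_derive t 1 (expinv n) (expinv n.+2 t - n%:R * expinv n.+1 t).
Proof.
have [t0|t0|->] := ltgtP t 0.
- rewrite !expinv_le0 ?ltW// mulr0 subrr.
  apply: (@near_eq_is_derive _ _ _ (cst 0)) => //.
  near=> s; rewrite expinv_le0//= ltW//; near: s; exact: lt_nbhsl.
- have tn0 : t != 0 by rewrite gt_eqF.
  rewrite /expinv t0.
  apply: (@near_eq_is_derive _ _ _ (fun s : R => s^-1 ^+ n * expR (- s^-1))).
    by near=> s; rewrite ifT//; near: s; exact: lt_nbhsr.
  have dV : is_derive t 1 (fun s : R => s^-1) (- t^-1 ^+ 2).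
    by apply: (is_derive_eq (is_deriveV tn0 (is_derive_id _ _))); rewrite /GRing.scale/= mulr1 exprVn.
  have dX : is_derive t 1 (fun s : R => s^-1 ^+ n) (- n%:R * t^-1 ^+ n.+1).
    case: n => [|n].
      under eq_fun do rewrite expr0; rewrite oppr0 mul0r; exact: is_derive_cst.
    have -> : (fun s : R => s^-1 ^+ n.+1) = (fun s : R => s^-1) ^+ n.+1.
      by apply/funext => s; rewrite fctE.
    apply: (is_derive_eq (is_deriveX n.+1 dV)).
    by rewrite /GRing.scale/= (exprS _ n.+1) (exprS _ n); ring.
  have dE : is_derive t 1 (fun s : R => expR (- s^-1)) (expR (- t^-1) * (t^-1 ^+ 2)).
    apply: (@is_derive1_comp _ expR (fun s => - s^-1)).
    by apply: (is_derive_eq (is_deriveN dV)); rewrite opprK.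
  apply: (is_derive_eq (is_deriveM dX dE)).
  by rewrite /GRing.scale/= !exprS; ring.
- rewrite !expinv_le0// mulr0 subrr.
  have cv : h^-1 *: (expinv n (h *: 1 + 0) - expinv n 0) @[h --> 0^'] --> (0 : R).
    apply/cvgr0Pnorm_le => e e0 /=.
    pose C : R := n.+2%:R ^+ n.+2.
    have C0 : 0 < C by rewrite exprn_gt0.
    near=> h.
    have hn0 : h != 0 by near: h; exact: nbhs_dnbhs_neq.
    rewrite addr0 /GRing.scale/= mulr1 (@expinv_le0 n 0)// subr0.
    rewrite normrM (ger0_norm (expinv_ge0 _ _)).
    apply: (@le_trans _ _ (`|h^-1| * (C * h ^+ 2))).
      by rewrite ler_wpM2l ?normr_ge0//; exact: expinv_sqr.
    rewrite -real_normK ?num_real// expr2 normfV mulrCA mulKf ?normr_eq0//.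
    rewrite -ler_pdivlMl//.
    near: h; apply: dnbhs0_le; rewrite mulr_gt0// invr_gt0//.
  apply: DeriveDef.
    by apply/cvg_ex; exists 0.
  by apply/cvg_lim => //.
Unshelve. all: by end_near. Qed.

End ExpStep.

(** * Calculus of smooth functions of two variables *)

Section SmoothPlane.
Context {R : realType}.
Local Notation dir := (@dir R).
Implicit Types (f g : R * R -> R) (j : 'I_2) (x : R * R).

(** Along a line a directional derivative is an ordinary one, which gives access to the one-variable
    chain rule. *)
Lemma is_derive_line f (v x : R * R) (t d : R) :
  is_derive t 1 (fun s : R => f (s *: v + x)) d <-> is_derive (t *: v + x) v f d.
Proof.
have E : (fun h : R => h^-1 *: (((fun s => f (s *: v + x)) \o shift t) (h *: (1 : R)) -
      f (t *: v + x))) =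
    (fun h : R => h^-1 *: ((f \o shift (t *: v + x)) (h *: v) - f (t *: v + x))).
  apply/funext => h /=; have -> : h *: (1 : R) = h by rewrite /GRing.scale/= mulr1.
  by rewrite scalerDl addrA.
have D1 : derivable (fun s : R => f (s *: v + x)) t 1 = derivable f (t *: v + x) v.
  by rewrite /derivable E.
have D2 : 'D_1 (fun s : R => f (s *: v + x)) t = 'D_v f (t *: v + x).
  by rewrite /derive E.
split=> -[h1 h2]; apply: DeriveDef.
- by rewrite D1 in h1.
- by rewrite D2 in h2.
- by rewrite D1.
- by rewrite D2.
Qed.

Lemma is_derive_comp1 (h : R -> R) f x (v : R * R) (d d' : R) :
  is_derive (f x) 1 h d' -> is_derive x v f d ->
  is_derive x v (fun y => h (f y)) (d' * d).
Proof.
move=> hd fd.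
have x0 : 0 *: v + x = x by rewrite scale0r add0r.
rewrite -x0; apply/is_derive_line.
apply: (@is_derive1_comp _ h (fun s => f (s *: v + x))); first by rewrite x0.
by apply/is_derive_line; rewrite x0.
Qed.

(** The recursion differentiates first and descends afterwards, which suits inductions for products
    and compositions, whereas [partials] puts each further derivative outside. [smooth] is the
    conjunction of [Ck k] over all [k]. *)
Fixpoint Ck (k : nat) f : Prop := continuous f /\
  match k with
  | 0 => True
  | k'.+1 => forall j, (forall x, derivable f x (dir j)) /\ Ck k' ('D_(dir j) f)
  end.

Lemma Ck_continuous k f : Ck k f -> continuous f.
Proof. by case: k => [|k] []. Qed.

Lemma CkW k f : Ck k.+1 f -> Ck k f.
Proof.
elim: k f => [|k IH] f; first by move=> /Ck_continuous.
by move=> [cf H]; split => // j; have [df /IH] := H j.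
Qed.

Lemma CkS k f (df : 'I_2 -> R * R -> R) : continuous f ->
  (forall j x, is_derive x (dir j) f (df j x)) -> (forall j, Ck k (df j)) ->
  Ck k.+1 f.
Proof.
move=> cf dfE Cdf; split => // j; split.
  by move=> x; have [] := dfE j x.
rewrite (_ : 'D_(dir j) f = df j)//.
by apply/funext => x; have [_] := dfE j x.
Qed.

Lemma Ck_is_derive k f j x : Ck k.+1 f -> is_derive x (dir j) f ('D_(dir j) f x).
Proof. by move=> [_ /(_ j)[df _]]; exact/derivableP. Qed.

Lemma partials_rcons s j f : partials (rcons s j) f = partials s ('D_(dir j) f).
Proof. by rewrite /partials foldr_rcons. Qed.

Lemma smoothP f : smooth f <-> forall k, Ck k f.
Proof.
split=> [sf k|H s].
  elim: k f sf => [|k IH] f sf; first by split => //; have [] := sf [::].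
  split; first by have [] := sf [::].
  move=> j; split; first by have [_ h] := sf [::]; exact: h.
  by apply: IH => s; rewrite -partials_rcons.
have {}H k : Ck k (partials s f).
  by elim: s k => [//|j s IH] k; have [_ /(_ j)[]] := IH k.+1.
split; first exact: Ck_continuous (H 0%N).
by move=> j x; have [_ /(_ j)[]] := H 1%N.
Qed.

Lemma smooth_Ck k f : smooth f -> Ck k f.
Proof. by move=> /smoothP. Qed.

Lemma Ck_cst k (c : R) : Ck k (fun=> c).
Proof.
elim: k c => [|k IH] c; first by split => // x; exact: cvg_cst.
apply: (@CkS _ _ (fun _ _ => 0)).
- by move=> x; exact: cvg_cst.
- by move=> j; exact: (IH 0).
Qed.

Lemma CkD k f g : Ck k f -> Ck k g -> Ck k (fun x => f x + g x).
Proof.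
elim: k f g => [|k IH] f g Cf Cg.
  by split => // x; apply: cvgD; [exact: Ck_continuous Cf x|exact: Ck_continuous Cg x].
apply: (@CkS _ _ (fun j x => 'D_(dir j) f x + 'D_(dir j) g x)).
- by move=> x; apply: cvgD; [exact: Ck_continuous Cf x|exact: Ck_continuous Cg x].
- by move=> j x; exact: is_deriveD (Ck_is_derive j x Cf) (Ck_is_derive j x Cg).
- by move=> j; apply: IH; [have [_ /(_ j)[]] := Cf|have [_ /(_ j)[]] := Cg].
Qed.

Lemma CkM k f g : Ck k f -> Ck k g -> Ck k (fun x => f x * g x).
Proof.
elim: k f g => [|k IH] f g Cf Cg.
  by split => // x; apply: cvgM; [exact: Ck_continuous Cf x|exact: Ck_continuous Cg x].
apply: (@CkS _ _ (fun j x => f x * 'D_(dir j) g x + g x * 'D_(dir j) f x)).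
- by move=> x; apply: cvgM; [exact: Ck_continuous Cf x|exact: Ck_continuous Cg x].
- by move=> j x; exact: is_deriveM (Ck_is_derive j x Cf) (Ck_is_derive j x Cg).
- move=> j; have [_ /(_ j)[_ C1]] := Cf; have [_ /(_ j)[_ C2]] := Cg.
  by apply: CkD; apply: IH => //; exact: CkW.
Qed.

Lemma Ck_expinv k n f : Ck k f -> Ck k (fun x => expinv n (f x)).
Proof.
have ce m t : {for t, continuous (@expinv R m)}.
  apply: differentiable_continuous; apply/derivable1_diffP.
  by have [] := is_derive_expinv m t.
elim: k n f => [|k IH] n f Cf.
  by split => // x; apply: continuous_comp; [exact: Ck_continuous Cf x|exact: ce].
apply: (@CkS _ _ (fun j x => (expinv n.+2 (f x) + - n%:R * expinv n.+1 (f x)) *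
    'D_(dir j) f x)).
- by move=> x; apply: continuous_comp; [exact: Ck_continuous Cf x|exact: ce].
- move=> j x; apply: is_derive_comp1 (Ck_is_derive j x Cf).
  by rewrite mulNr; exact: is_derive_expinv.
- move=> j; have [_ /(_ j)[_ C1]] := Cf; apply: CkM => //.
  apply: CkD; first by apply: IH; exact: CkW.
  by apply: CkM; [exact: Ck_cst|apply: IH; exact: CkW].
Qed.

Lemma Ck_inv k f : (forall x, f x != 0) -> Ck k f -> Ck k (fun x => (f x)^-1).
Proof.
move=> f0; elim: k => [|k IH] Cf.
  by split => // x; apply: cvgV => //; exact: Ck_continuous Cf x.
apply: (@CkS _ _ (fun j x => - 1 * ((f x)^-1 * (f x)^-1) * 'D_(dir j) f x)).
- by move=> x; apply: cvgV => //; exact: Ck_continuous Cf x.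
- move=> j x; apply: (@is_derive_comp1 (fun t => t^-1) _ _ _ _ _ _ (Ck_is_derive j x Cf)).
  apply: (is_derive_eq (is_deriveV (f0 x) (is_derive_id _ _))).
  by rewrite /GRing.scale/= mulr1 mulN1r -expr2 exprVn.
- move=> j; have [_ /(_ j)[_ C1]] := Cf; have := IH (CkW Cf) => C2.
  by apply: CkM => //; apply: CkM; [exact: Ck_cst|exact: CkM].
Qed.

Lemma is_derive_fst j x :
  is_derive x (dir j) (fst : R * R -> R) (if j == ord0 then 1 else 0).
Proof.
have -> : x = 0 *: dir j + x by rewrite scale0r add0r.
apply/is_derive_line.
rewrite (_ : (fun s => _) = (fun s : R => s * (dir j).1 + x.1))//.
have -> : (if j == ord0 then 1 else 0) = (dir j).1 by rewrite /Defs.dir; case: ifP.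
have -> : (fun s : R => s * (dir j).1 + x.1) = (id * cst (dir j).1 + cst x.1).
  by apply/funext => s; rewrite fctE.
by apply: is_derive_eq; rewrite /GRing.scale/= mulr0 mulr1 add0r addr0.
Qed.

Lemma is_derive_snd j x :
  is_derive x (dir j) (snd : R * R -> R) (if j == ord0 then 0 else 1).
Proof.
have -> : x = 0 *: dir j + x by rewrite scale0r add0r.
apply/is_derive_line.
rewrite (_ : (fun s => _) = (fun s : R => s * (dir j).2 + x.2))//.
have -> : (if j == ord0 then 0 else 1) = (dir j).2 by rewrite /Defs.dir; case: ifP.
have -> : (fun s : R => s * (dir j).2 + x.2) = (id * cst (dir j).2 + cst x.2).
  by apply/funext => s; rewrite fctE.
by apply: is_derive_eq; rewrite /GRing.scale/= mulr0 mulr1 add0r addr0.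
Qed.

Lemma Ck_fst k : Ck k (fst : R * R -> R).
Proof.
case: k => [|k]; first by split => // x; exact: cvg_fst.
apply: (CkS _ is_derive_fst); first by move=> x; exact: cvg_fst.
by move=> j; exact: Ck_cst.
Qed.

Lemma Ck_snd k : Ck k (snd : R * R -> R).
Proof.
case: k => [|k]; first by split => // x; exact: cvg_snd.
apply: (CkS _ is_derive_snd); first by move=> x; exact: cvg_snd.
by move=> j; exact: Ck_cst.
Qed.

End SmoothPlane.

(** * The smooth step and the vertical stretching *)

Section Step.
Context {R : realType}.
Local Notation dir := (@dir R).
Implicit Types (t : R) (f g : R * R -> R).

Definition sstep t := expinv 0 t * (expinv 0 t + expinv 0 (1 - t))^-1.

Lemma expinv0_ge t : 2^-1 <= t -> expR (- 2) <= expinv 0 t.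
Proof.
move=> th; have t0 : 0 < t by apply: lt_le_trans th; rewrite invr_gt0.
rewrite /expinv t0 expr0 mul1r ler_expR lerN2 -[leRHS]invrK lef_pV2 ?posrE//.
Qed.

(** One of [t] and [1 - t] is at least 1/2. *)
Lemma sstep_den t : expR (- 2) <= expinv 0 t + expinv 0 (1 - t).
Proof.
have [h|h] := leP 2^-1 t.
  by apply: (le_trans (expinv0_ge h)); rewrite lerDl expinv_ge0.
have h' : 2^-1 <= 1 - t by lra.
by apply: (le_trans (expinv0_ge h')); rewrite lerDr expinv_ge0.
Qed.

Lemma sstep_den_gt0 t : 0 < expinv 0 t + expinv 0 (1 - t).
Proof. by apply: lt_le_trans (sstep_den t); exact: expR_gt0. Qed.

Lemma sstep_ge0 t : 0 <= sstep t.
Proof. by rewrite mulr_ge0 ?expinv_ge0// invr_ge0 ltW// sstep_den_gt0. Qed.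

Lemma sstep_le1 t : sstep t <= 1.
Proof. by rewrite ler_pdivrMr ?sstep_den_gt0// mul1r lerDl expinv_ge0. Qed.

Lemma sstep_eq0 t : t <= 0 -> sstep t = 0.
Proof. by move=> t0; rewrite /sstep expinv_le0// mul0r. Qed.

Lemma sstep_eq1 t : 1 <= t -> sstep t = 1.
Proof.
move=> t1; have := sstep_den_gt0 t; rewrite /sstep (@expinv_le0 _ _ (1 - t)) ?subr_le0//.
by rewrite addr0 => h; rewrite divff// gt_eqF.
Qed.

(** In the derivative of the quotient the numerator is at most 4 + 4, since [expinv 0 <= 1] and
    [expinv 2 <= 2 ^ 2], and the squared inverse of the denominator is at most exp(4). *)
Definition sstep_bound : R := 8 * expR 4.

Lemma is_derive_sstep t : exists d : R, [/\ is_derive t 1 sstep d, `|d| <= sstep_bound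
  & ~~ (0 < t < 1) -> d = 0].
Proof.
pose e s := expinv 0 s : R; pose D s := e s + e (1 - s).
have de (s : R) : is_derive s (1 : R) e (expinv 2 s).
  by apply: (is_derive_eq (is_derive_expinv 0 s)); rewrite mul0r subr0.
have de1 : is_derive t 1 (fun s => e (1 - s)) (- expinv 2 (1 - t)).
  rewrite -mulrN1; apply: (@is_derive1_comp _ e (fun s => 1 - s)).
  have : is_derive t (1 : R) ((cst 1 : R -> R) - id) (0 - 1) by exact: is_deriveB.
  by rewrite sub0r.
have dD := is_deriveD (de t) de1.
have D0 s : 0 < D s by exact: sstep_den_gt0.
have dV := is_deriveV (lt0r_neq0 (D0 t)) dD.
pose v := e t * (- D t ^- 2 * (expinv 2 t - expinv 2 (1 - t))) + (D t)^-1 * expinv 2 t.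
have vE : v = (e t * expinv 2 (1 - t) + e (1 - t) * expinv 2 t) * (D t)^-1 ^+ 2.
  have := lt0r_neq0 (D0 t); rewrite /v /D; set a := e t; set b := e (1 - t) => h.
  by rewrite exprVn; field.
have e0 s : 0 <= e s by exact: expinv_ge0.
exists v; split; first by apply: (is_derive_eq (is_deriveM (de t) dV)).
  rewrite vE; clear v vE.
have e1 s : e s <= 1 by have := @expinv_le R 0 s; rewrite expr0.
have e20 s : 0 <= expinv 2 s :> R by exact: expinv_ge0.
have e24 s : expinv 2 s <= 4 :> R by have := @expinv_le R 2 s; rewrite -natrX.
have Di : (D t)^-1 <= expR 2.
  by rewrite -[leRHS]invrK -expRN lef_pV2 ?posrE ?expR_gt0//; exact: sstep_den.
rewrite ger0_norm; last by rewrite mulr_ge0 ?sqr_ge0// addr_ge0// mulr_ge0.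
  rewrite /sstep_bound ler_pM ?sqr_ge0//.
  - by rewrite addr_ge0// mulr_ge0.
  - have h1 : e t * expinv 2 (1 - t) <= 1 * 4 by apply: ler_pM.
    have h2 : e (1 - t) * expinv 2 t <= 1 * 4 by apply: ler_pM.
    by lra.
  - have -> : expR 4 = expR 2 ^+ 2 :> R by rewrite -expRM_natl; congr expR; lra.
    by rewrite ler_pXn2r ?nnegrE ?expR_ge0// invr_ge0 ltW.
rewrite vE negb_and -!leNgt => /orP[h|h].
  by rewrite /e !(expinv_le0 _ h) mul0r mulr0 addr0 mul0r.
have h' : 1 - t <= 0 by lra.
by rewrite /e !(expinv_le0 _ h') mulr0 mul0r addr0 mul0r.
Qed.

Lemma Ck_sstep k f : Ck k f -> Ck k (fun x => sstep (f x)).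
Proof.
move=> Cf; apply: CkM; first exact: Ck_expinv.
apply: Ck_inv; first by move=> x; rewrite gt_eqF// sstep_den_gt0.
apply: CkD; first exact: Ck_expinv.
apply: Ck_expinv; apply: CkD; first exact: Ck_cst.
rewrite (_ : (fun x => - f x) = (fun x => -1 * f x)).
  by apply: CkM => //; exact: Ck_cst.
by apply/funext => x; rewrite mulN1r.
Qed.

(** The line x_2 = d is fixed. Composition with this map for [s >= 1] draws supports towards that
    line, away from the oscillating curve. *)
Definition stretch (d s : R) (x : R * R) : R * R := (x.1, d - s * (d - x.2)).

Lemma is_derive_stretch d s f j x df : is_derive (stretch d s x) (dir j) f df ->
  is_derive x (dir j) (fun y => f (stretch d s y)) ((if j == ord0 then 1 else s) * df).
Proof.
move=> fd; rewrite -[x in is_derive x](add0r x) -(scale0r (dir j)).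
apply/is_derive_line; pose p t := f (t *: dir j + stretch d s x).
have dp : is_derive (0 : R) (1 : R) p df by apply/is_derive_line; rewrite scale0r add0r.
have -> : (fun t => f (stretch d s (t *: dir j + x))) =
    (fun t => p ((if j == ord0 then 1 else s) * t)).
  have sA (r : R) : r%:A = r :> R^o by rewrite /GRing.scale/= mulr1.
  apply/funext => t; rewrite /p; congr f; rewrite /stretch /Defs.dir.
  by case: (j == ord0); congr pair; rewrite /= ?sA ?scaler0; ring.
rewrite mulrC; apply: (@is_derive1_comp _ p); first by rewrite mulr0.
set c : R := if _ then _ else _.
have : is_derive (0 : R) (1 : R) ((cst c : R -> R) * id) (c *: 1 + 0 *: 0).
  exact: is_deriveM.
by rewrite /GRing.scale/= mulr0 addr0 mulr1.
Qed.

Lemma continuous_stretch d s : continuous (stretch d s).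
Proof.
move=> x.
have c1 : y.1 @[y --> x] --> x.1 by exact: cvg_fst.
have c2 : (d - s * (d - y.2)) @[y --> x] --> d - s * (d - x.2).
  apply: cvgB; first exact: cvg_cst.
  apply: cvgM; first exact: cvg_cst.
  apply: cvgB; first exact: cvg_cst.
  exact: cvg_snd.
exact: cvg_pair c1 c2.
Qed.

Lemma Ck_stretch k d s f : Ck k f -> Ck k (fun x => f (stretch d s x)).
Proof.
elim: k f => [|k IH] f Cf.
  split => // x; apply: continuous_comp; first exact: continuous_stretch.
  exact: Ck_continuous Cf _.
apply: (@CkS _ _ _ (fun j x => (if j == ord0 then 1 else s) * 'D_(dir j) f (stretch d s x))).
- move=> x; apply: continuous_comp; first exact: continuous_stretch.
  exact: Ck_continuous Cf _.
- by move=> j x; exact: is_derive_stretch (Ck_is_derive j _ Cf).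
- move=> j; have [_ /(_ j)[_ C1]] := Cf.
  by apply: CkM (IH _ C1); exact: Ck_cst.
Qed.

End Step.

(** * Test functions *)

Section TestFunctions.
Context {R : realType}.
Local Notation dir := (@dir R).
Implicit Types (phi psi f : R * R -> R) (Om K : set (R * R)).

Lemma plane_hausdorff : hausdorff_space (R * R)%type.
Proof. exact: norm_hausdorff. Qed.

(** Any compact carrier will do, which spares computing the exact supports of sums, products and
    derivatives. *)
Lemma test_funP Om phi : test_fun Om phi <-> smooth phi /\
  exists K, [/\ compact K, K `<=` Om & forall x, ~ K x -> phi x = 0].
Proof.
split=> [[sp cp pO]|[sp [K [cK KO K0]]]].
  split => //; exists (closure [set x | phi x != 0]); split => // x nx.
  apply: contra_notP nx => /eqP nx; exact: subset_closure.
have cl : closure [set x | phi x != 0] `<=` K.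
  have clK : closed K by exact: (compact_closed plane_hausdorff).
  rewrite [X in _ `<=` X]((closure_id K).1 clK).
  by apply: closure_subset => x /= /eqP nx; apply: contra_notP nx; exact: K0.
split => //; last exact: subset_trans KO.
by apply: (subclosed_compact _ cK cl); exact: closed_closure.
Qed.

Lemma test_funW Om Om' phi : Om `<=` Om' -> test_fun Om phi -> test_fun Om' phi.
Proof. by move=> OO [sp cp pO]; split => //; exact: subset_trans OO. Qed.

Lemma test_fun_eq0 Om phi x : test_fun Om phi -> ~ Om x -> phi x = 0.
Proof. by move=> /test_funP[_ [K [_ KO K0]]] nx; apply: K0 => /KO. Qed.

Lemma test_funM Om phi f : test_fun Om phi -> smooth f -> test_fun Om (fun x => f x * phi x).
Proof.
move=> /test_funP[sp [K [cK KO K0]]] sf; apply/test_funP; split.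
  by apply/smoothP => k; apply: CkM; exact: smooth_Ck.
by exists K; split => // x /K0 ->; rewrite mulr0.
Qed.

Lemma test_funD Om phi psi : test_fun Om phi -> test_fun Om psi ->
  test_fun Om (fun x => phi x + psi x).
Proof.
move=> /test_funP[sp [K [cK KO K0]]] /test_funP[sp' [K' [cK' KO' K0']]].
apply/test_funP; split.
  by apply/smoothP => k; apply: CkD; exact: smooth_Ck.
exists (K `|` K'); split; first exact: compactU.
  by move=> x [/KO|/KO'].
by move=> x; rewrite not_orE => -[/K0 -> /K0' ->]; rewrite addr0.
Qed.

Lemma test_fun_derive Om phi j : test_fun Om phi -> test_fun Om ('D_(dir j) phi).
Proof.
move=> /test_funP[sp [K [cK KO K0]]]; apply/test_funP; split.
  by apply/smoothP => k; move/smoothP/(_ k.+1) : sp => [_ /(_ j)[]].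
exists K; split => // x nKx.
rewrite (@near_eq_derive _ _ _ _ (cst 0)); first exact: derive_cst.
have oK : open (~` K) by apply: closed_openC; exact: (compact_closed plane_hausdorff).
by near=> y; apply: K0; near: y; exact: open_nbhs_nbhs.
Unshelve. all: by end_near. Qed.

Lemma smooth_cst (c : R) : smooth (fun=> c).
Proof. by apply/smoothP => k; exact: Ck_cst. Qed.

Lemma test_fun_is_derive Om phi j x : test_fun Om phi ->
  is_derive x (dir j) phi ('D_(dir j) phi x).
Proof. by move=> [/smoothP/(_ 1%N) h _ _]; exact: Ck_is_derive j x h. Qed.

Lemma test_fun_continuous Om phi : test_fun Om phi -> continuous phi.
Proof. by move=> [/smoothP/(_ 0%N) h _ _]; exact: Ck_continuous h. Qed.

End TestFunctions.

(** * Integration in the plane and the fundamental lemma of the calculus of variations *)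

Section ZeroIntegral.
Context d (T : measurableType d) (R : realType) (mu : {measure set T -> \bar R}).

(** The measurable sets over which [f] integrates to zero form a lambda-system: differences use
    additivity, and increasing unions use dominated convergence with [|f|]. *)
Lemma Rintegral_eq0_pi_lambda (G : set (set T)) (f : T -> R) :
  @measurable _ T = <<s G >> -> setI_closed G ->
  mu.-integrable setT (EFin \o f) -> \int[mu]_x f x = 0 ->
  (forall A, G A -> \int[mu]_(x in A) f x = 0) ->
  forall E, measurable E -> \int[mu]_(x in E) f x = 0.
Proof.
move=> mG GI intf f0 Gf0 E mE.
pose H := [set A : set T | measurable A /\ \int[mu]_(x in A) f x = 0].
suff /(_ E) : <<s G >> `<=` H by rewrite -mG => /(_ mE)[].
apply: lambda_system_subset => //; last first.
  by move=> A GA; split; [rewrite mG; exact: sub_sigma_algebra|exact: Gf0].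
split => //.
- move=> A B BA [mA A0] [mB B0]; have mAB := measurableD mA mB; split => //.
  have AE : A = (A `\` B) `|` B by rewrite setDKU.
  rewrite AE Rintegral_setU// ?B0 ?addr0// -?AE in A0.
    by apply: integrableS intf.
  by apply/disj_setPS => x [[_ nB] Bx].
- move=> F ndF HF; have mF n : measurable (F n) by have [] := HF n.
  have mUF : measurable (\bigcup_i F i) by exact: bigcupT_measurable.
  split => //.
  have mf : measurable_fun setT (EFin \o f) by have /integrableP[] := intf.
  have mr (S : set T) : measurable S -> measurable_fun setT ((EFin \o f) \_ S).
    by move=> mS; apply/(measurable_restrictT _ mS).1; exact: measurable_funTS.
  have c1 : {ae mu, forall x, setT x ->
      ((EFin \o f) \_ (F n)) x @[n --> \oo] --> ((EFin \o f) \_ (\bigcup_i F i)) x}.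
    apply: aeW => x _.
    have [[n _ Fnx]|nx] := pselect ((\bigcup_i F i) x).
      apply: cvg_near_cst; exists n => // m /= nm.
      have Fm : F m x by have /subsetPset := ndF _ _ nm; exact.
      by rewrite !patchE !mem_set//; exists n.
    rewrite patchE memNset//; apply: cvg_near_cst; apply: nearW => m.
    by rewrite patchE memNset// => Fm; apply: nx; exists m.
  have c2 : {ae mu, forall x n, setT x ->
      (`|((EFin \o f) \_ (F n)) x| <= (abse \o (EFin \o f)) x)%E}.
    apply: aeW => x n _; rewrite patchE; case: ifP => _ //=.
    by rewrite normr0 lee_fin.
  have [_ _ h] := dominated_convergence measurableT (fun n => mr _ (mF n))
    (mr _ mUF) c1 (integrable_abse intf) c2.
  rewrite /Rintegral integral_mkcond.
  move/cvg_lim : h => <-//.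
  have -> : [sequence (\int[mu]_x ((EFin \o f) \_ (F n)) x)%E]_n = cst 0%E.
    apply/funext => n /=; rewrite -integral_mkcond.
    have [_] := HF n; rewrite /Rintegral => h0.
    rewrite -[LHS]fineK ?h0//; apply: integrable_fin_num => //.
    exact: integrableS intf.
  by rewrite lim_cst//; exact: ereal_hausdorff.
Qed.
End ZeroIntegral.

Section Plane.
Context {R : realType}.
Local Notation mu := (@leb2 R).
Local Notation T2 := (measurableTypeR R * measurableTypeR R)%type.

Definition orect (a1 b1 a2 b2 : R) : set (R * R) := `]a1, b1[ `*` `]a2, b2[.
Definition crect (a1 b1 a2 b2 : R) : set (R * R) := `[a1, b1] `*` `[a2, b2].

Lemma crect_compact a1 b1 a2 b2 : compact (crect a1 b1 a2 b2).
Proof. by apply: compact_setX; exact: segment_compact. Qed.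

Lemma orect_measurable a1 b1 a2 b2 : measurable (orect a1 b1 a2 b2 : set T2).
Proof. by apply: measurableX; exact: measurable_itv. Qed.

Lemma crect_measurable a1 b1 a2 b2 : measurable (crect a1 b1 a2 b2 : set T2).
Proof. by apply: measurableX; exact: measurable_itv. Qed.

Lemma orect_crect a1 b1 a2 b2 : orect a1 b1 a2 b2 `<=` crect a1 b1 a2 b2.
Proof. by move=> x [? ?]; split; exact: subset_itv_oo_cc. Qed.

Lemma crect_finite a1 b1 a2 b2 : (mu (crect a1 b1 a2 b2) < +oo)%E.
Proof.
have -> : mu (crect a1 b1 a2 b2) =
    (@lebesgue_measure R `[a1, b1] * @lebesgue_measure R `[a2, b2])%E.
  by apply: product_measure1E; exact: measurable_itv.
by rewrite !lebesgue_measure_itv/=; case: ifP => _; case: ifP => _;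
  rewrite ?mule0 ?mul0e// -EFinM ltry.
Qed.

(** A countable base by rectangles whose closures stay in the open set; it yields both the
    measurability of open sets and the countable cover in [fundamental_lemma]. *)
Lemma rat_rect (U : set (R * R)) x : nbhs x U ->
  exists q : rat * rat * (rat * rat),
    orect (ratr q.1.1) (ratr q.1.2) (ratr q.2.1) (ratr q.2.2) x /\
    crect (ratr q.1.1) (ratr q.1.2) (ratr q.2.1) (ratr q.2.2) `<=` U.
Proof.
move=> [[A B] /= [/nbhs_ballP[e1 /= e10 Ae1] /nbhs_ballP[e2 /= e20 Be2]] ABU].
have H (y e : R) : 0 < e -> exists p q : rat, [/\ y - e < ratr p, ratr p < y,
    y < ratr q & ratr q < y + e].
  move=> e0.
  have [p] : exists q : rat, ratr q \in `]y - e, y[ by apply: rat_in_itvoo; lra.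
  have [q] : exists q : rat, ratr q \in `]y, y + e[ by apply: rat_in_itvoo; lra.
  by rewrite !in_itv/= => /andP[? ?] /andP[? ?]; exists p, q.
have [p1 [q1 [h1 h2 h3 h4]]] := H x.1 _ e10.
have [p2 [q2 [h5 h6 h7 h8]]] := H x.2 _ e20.
exists ((p1, q1), (p2, q2)) => /=; split.
  by split => /=; rewrite in_itv/=; apply/andP.
move=> y [/=]; rewrite !in_itv/= => /andP[? ?] /andP[? ?]; apply: ABU; split => /=.
  by apply: Ae1; rewrite /ball/= ltr_norml; apply/andP; split; lra.
by apply: Be2; rewrite /ball/= ltr_norml; apply/andP; split; lra.
Qed.

Lemma open_plane_measurable (U : set (R * R)) : open U -> measurable (U : set T2).
Proof.
move=> oU.
pose F (q : rat * rat * (rat * rat)) : set T2 :=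
  [set x | orect (ratr q.1.1) (ratr q.1.2) (ratr q.2.1) (ratr q.2.2) x /\
    crect (ratr q.1.1) (ratr q.1.2) (ratr q.2.1) (ratr q.2.2) `<=` U].
have -> : U = \bigcup_q F q.
  apply/seteqP; split=> [x Ux|x [q _ [+ qU]]].
    have [q [xq qU]] := rat_rect (open_nbhs_nbhs (conj oU Ux)).
    by exists q.
  by move=> /orect_crect/qU.
apply: countable_bigcupT_measurable => // q.
have [qU|nqU] := pselect (crect (ratr q.1.1) (ratr q.1.2) (ratr q.2.1) (ratr q.2.2) `<=` U).
  rewrite (_ : F q = orect (ratr q.1.1) (ratr q.1.2) (ratr q.2.1) (ratr q.2.2)).
    exact: orect_measurable.
  by apply/seteqP; split=> [x []|x ?].
by rewrite (_ : F q = set0)//; apply/seteqP; split=> [x []|].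
Qed.

Lemma continuous_plane_measurable (f : R * R -> R) : continuous f ->
  measurable_fun setT (f : T2 -> measurableTypeR R).
Proof.
move=> /continuousP cf.
apply: (@measurability _ _ T2 (measurableTypeR R) setT f _ (RGenOInfty.measurableE R)) => _ [_ [a ->] <-].
by rewrite setTI; apply: open_plane_measurable; apply: cf; exact: interval_open.
Qed.

Lemma compact_in_crect (K : set (R * R)) : compact K ->
  exists2 M : R, 0 < M & K `<=` crect (- M) M (- M) M.
Proof.
move=> /compact_bounded[M [_ HM]]; exists (`|M| + 1); first by rewrite ltr_wpDl.
move=> x Kx; have : `|x| <= `|M| + 1.
  by apply: HM Kx; rewrite ltr_pwDr// ler_norm.
rewrite [`|x|]prod_normE ge_max => /andP[h1 h2].
by split => /=; rewrite in_itv/=; rewrite -ler_norml.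
Qed.

Lemma compact_supp_integrable (f : R * R -> R) (K : set (R * R)) : continuous f ->
  compact K -> (forall x, ~ K x -> f x = 0) -> mu.-integrable setT (EFin \o f).
Proof.
move=> cf cK f0; have [M M0 KM] := compact_in_crect cK.
pose Q : set T2 := crect (- M) M (- M) M.
have mQ : measurable Q by exact: crect_measurable.
have mf := continuous_plane_measurable cf.
have : mu.-integrable Q (EFin \o f).
  apply: measurable_bounded_integrable => //.
  - exact: crect_finite.
  - exact: measurable_funTS.
  have : bounded_set (f @` Q).
    apply: compact_bounded; apply: continuous_compact; last exact: crect_compact.
    exact: continuous_subspaceT.
  move=> [N [rN HN]]; exists N; split => // z Nz y Qy.
  by apply: (HN z Nz); exists y.
move=> /(integrable_mkcond _ mQ).1.
apply: eq_integrable => // x _; rewrite patchE; case: ifPn => //= nx.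
by rewrite f0// => /KM; rewrite notin_setE in nx.
Qed.

End Plane.

Section IntegralDerivative.
Context {R : realType}.
Local Notation mu := (@leb2 R).
Local Notation dir := (@dir R).

Lemma int_line0 (F f : R -> R) (M : R) : 0 < M -> continuous f ->
  (forall t, is_derive t (1 : R) F (f t)) ->
  (forall t, M < `|t| -> F t = 0 /\ f t = 0) ->
  (\int[@lebesgue_measure R]_t (f t)%:E = 0)%E.
Proof.
move=> M0 cf dF F0; pose N := M + 1.
have NN : - N < N by rewrite /N; lra.
have MN : M < `|N| by rewrite ger0_norm /N; lra.
have MN' : M < `|- N| by rewrite normrN.
have cF : continuous F.
  by move=> t; apply: differentiable_continuous; apply/derivable1_diffP; have [] := dF t.
have := @continuous_FTC2 R f F (- N) N NN.
rewrite (F0 _ MN).1 (F0 _ MN').1 subee// => h.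
rewrite -[RHS]h.
- rewrite [RHS]integral_mkcond; apply: eq_integral => t _; rewrite patchE.
  case: ifPn => // nt; rewrite (F0 t _).2//.
  rewrite ltNge; apply: contra nt => tM; rewrite inE/= in_itv/= -ler_norml.
  by rewrite (le_trans tM)// lerDl.
- exact: continuous_subspaceT.
- split.
  + by move=> t _; have [] := dF t.
  + by apply: cvg_at_right_filter; exact: cF.
  + by apply: cvg_at_left_filter; exact: cF.
- by move=> t _; rewrite derive1E; have [_] := dF t.
Qed.

(** Coordinate [t] on axis [j] and [s] on the other one, so that both directions of differentiation
    share the same argument along lines. *)
Definition axpt (j : 'I_2) (t s : R) : R * R := if j == ord0 then (t, s) else (s, t).

Lemma axptE j t s : axpt j t s = t *: dir j + axpt j 0 s.
Proof.
have sA (r : R) : r%:A = r :> R^o by rewrite /GRing.scale/= mulr1.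
by rewrite /axpt /Defs.dir; case: (j == ord0); congr pair;
  rewrite /= ?sA ?scaler0 ?addr0 ?add0r.
Qed.

Lemma continuous_axpt j s : continuous (axpt j ^~ s).
Proof.
move=> t; rewrite /axpt; case: (j == ord0).
  by apply: (@cvg_pair _ _ _ (nbhs t) (nbhs t) (nbhs s)); [exact: cvg_id|exact: cvg_cst].
by apply: (@cvg_pair _ _ _ (nbhs t) (nbhs s) (nbhs t)); [exact: cvg_cst|exact: cvg_id].
Qed.

Lemma is_derive_axpt (h : R * R -> R) j t s (d : R) :
  is_derive (axpt j t s) (dir j) h d ->
  is_derive t (1 : R) (fun t => h (axpt j t s)) d.
Proof.
rewrite axptE => /is_derive_line hd.
by rewrite (_ : (fun _ => _) = fun t => h (t *: dir j + axpt j 0 s))//; apply/funext => r; rewrite axptE.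
Qed.

Lemma test_fun_bounded_supp (Om : set (R * R)) h : test_fun Om h ->
  exists2 M : R, 0 < M & forall j t s, M < `|t| ->
    h (axpt j t s) = 0 /\ forall i, 'D_(dir i) h (axpt j t s) = 0.
Proof.
move=> th; have /test_funP[_ [K [cK KO K0]]] := th.
have [M M0 KM] := compact_in_crect cK; exists M => // j t s Mt.
have nK : ~ crect (- M) M (- M) M (axpt j t s).
  move=> [] /=; rewrite !in_itv/= /axpt -!ler_norml.
  by case: (j == ord0) => /= h1 h2; move: Mt; rewrite ltNge ?h1 ?h2.
split; first by apply: K0 => /KM.
move=> i.
rewrite (@near_eq_derive _ _ _ _ (cst 0)); first exact: derive_cst.
have oK : open (~` crect (- M) M (- M) M).
  by apply: closed_openC; apply: compact_closed; [exact: plane_hausdorff|exact: crect_compact].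
by near=> y; apply: K0 => /KM; near: y; exact: open_nbhs_nbhs.
Unshelve. all: by end_near. Qed.

Lemma test_fun_integrable (Om : set (R * R)) h : test_fun Om h ->
  mu.-integrable setT (EFin \o h).
Proof.
move=> th; have /test_funP[_ [K [cK _ K0]]] := th.
by apply: (compact_supp_integrable (test_fun_continuous th) cK).
Qed.

(** Fubini with the inner integral along the axis of differentiation: on each line it is the
    increment of a function vanishing at both ends. *)
Lemma int_derive0 (Om : set (R * R)) h j : test_fun Om h -> \int[mu]_x 'D_(dir j) h x = 0.
Proof.
move=> th; have [M M0 hM] := test_fun_bounded_supp th.
have tD := test_fun_derive j th.
have ig := test_fun_integrable tD.
have cD := test_fun_continuous tD.
have line s : (\int[@lebesgue_measure R]_t ('D_(dir j) h (axpt j t s))%:E = 0)%E.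
  apply: (@int_line0 (fun t => h (axpt j t s)) _ _ M0).
  - move=> t; exact: (@continuous_comp _ _ _ (fun t => axpt j t s) ('D_(dir j) h) t
      (@continuous_axpt j s t) (cD _)).
  - by move=> t; apply: is_derive_axpt; exact: test_fun_is_derive th.
  - by move=> t Mt; have [h1 h2] := hM j t s Mt.
rewrite /Rintegral; case: (eqVneq j ord0) => j0.
  rewrite -(integral21_prod_meas1 ig) /fubini_G.
  under eq_integral => y _.
    rewrite /= (_ : (\int[_]_x _)%E = 0%E); last first.
      by rewrite -[RHS](line y); apply: eq_integral => x _; rewrite /axpt j0.
    over.
  by rewrite integral0.
rewrite -(integral12_prod_meas1 ig) /fubini_F.
under eq_integral => y _.
  rewrite /= (_ : (\int[_]_x _)%E = 0%E); last first.
    by rewrite -[RHS](line y); apply: eq_integral => x _; rewrite /axpt (negbTE j0).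
  over.
by rewrite integral0.
Qed.

End IntegralDerivative.

(** * Functions annihilated by all test functions *)

Section FundamentalLemma.
Context {R : realType}.
Local Notation mu := (@leb2 R).
Local Notation T2 := (measurableTypeR R * measurableTypeR R)%type.

Lemma orectI (a1 b1 a2 b2 c1 d1 c2 d2 : R) :
  orect a1 b1 a2 b2 `&` orect c1 d1 c2 d2 =
  orect (Num.max a1 c1) (Num.min b1 d1) (Num.max a2 c2) (Num.min b2 d2).
Proof.
apply/seteqP; split=> [x [[/= h1 h2] [/= h3 h4]]|x [/= h1 h2]].
  move: h1 h2 h3 h4; rewrite !in_itv/= => /andP[? ?] /andP[? ?] /andP[? ?] /andP[? ?].
  by split => /=; rewrite in_itv/= gt_max lt_min; do 2 (apply/andP; split => //); apply/andP.
move: h1 h2; rewrite !in_itv/= !gt_max !lt_min.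
move=> /andP[/andP[? ?] /andP[? ?]] /andP[/andP[? ?] /andP[? ?]].
by split; split; rewrite /= in_itv/=; apply/andP.
Qed.

Definition orects : set (set (R * R)) :=
  [set A | exists a1 b1 a2 b2, A = orect a1 b1 a2 b2].

Lemma orects_setI : setI_closed orects.
Proof.
move=> _ _ [a1 [b1 [a2 [b2 ->]]]] [c1 [d1 [c2 [d2 ->]]]].
by rewrite orectI; do 4 eexists.
Qed.

(** Provides a generator stable under intersection, as the pi-lambda argument requires, for which
    approximating test functions are explicit. *)
Lemma plane_measurableE : @measurable _ T2 = <<s orects >>.
Proof.
apply/seteqP; split; last first.
  apply: smallest_sub; first exact: sigma_algebra_measurable.
  by move=> _ [a1 [b1 [a2 [b2 ->]]]]; exact: orect_measurable.
rewrite measurable_prod_measurableType.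
apply: smallest_sub; first exact: smallest_sigma_algebra.
have oall (r : R) : exists n : nat, - n%:R < r < n%:R.
  exists (Num.truncn `|r|).+1; rewrite -ltr_norml; exact: truncnS_gt.
pose G := g_sigma_algebraType orects.
have bigU (F : nat -> set G) : (forall n, <<s orects >> (F n)) -> <<s orects >> (\bigcup_n F n).
  by move=> h; apply: (@bigcupT_measurable _ G).
have m1 : measurable_fun setT (fst : G -> measurableTypeR R).
  apply: (@measurability _ _ G (measurableTypeR R) setT fst _ (RGenOpens.measurableE R)).
  move=> _ [_ [a [b ->]] <-]; rewrite setTI.
  have -> : fst @^-1` `]a, b[ = \bigcup_n (orect a b (- n%:R) n%:R : set G).
    apply/seteqP; split=> [x /= h|x [n _ []]//].
    by have [n hn] := oall x.2; exists n => //; split => //=; rewrite in_itv.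
  by apply: bigU => n; apply: sub_sigma_algebra; do 4 eexists.
have m2 : measurable_fun setT (snd : G -> measurableTypeR R).
  apply: (@measurability _ _ G (measurableTypeR R) setT snd _ (RGenOpens.measurableE R)).
  move=> _ [_ [a [b ->]] <-]; rewrite setTI.
  have -> : snd @^-1` `]a, b[ = \bigcup_n (orect (- n%:R) n%:R a b : set G).
    apply/seteqP; split=> [x /= h|x [n _ []]//].
    by have [n hn] := oall x.1; exists n => //; split => //=; rewrite in_itv.
  by apply: bigU => n; apply: sub_sigma_algebra; do 4 eexists.
move=> _ [A mA [B mB <-]].
have -> : A `*` B = (fst @^-1` A) `&` (snd @^-1` B) by [].
apply: (@measurableI _ G).
  by have := m1 (@measurableT _ G) _ mA; rewrite setTI.
by have := m2 (@measurableT _ G) _ mB; rewrite setTI.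
Qed.

Definition bump (a b : R) (n : nat) (t : R) : R :=
  sstep (n%:R * (t - a)) * sstep (n%:R * (b - t)).

Lemma bump_ge0 a b n t : 0 <= bump a b n t.
Proof. by rewrite mulr_ge0 ?sstep_ge0. Qed.

Lemma bump_le1 a b n t : bump a b n t <= 1.
Proof. by rewrite -[leRHS]mulr1 ler_pM ?sstep_ge0 ?sstep_le1. Qed.

Lemma bump_eq0 a b n t : ~~ (a < t < b) -> bump a b n t = 0.
Proof.
rewrite negb_and -!leNgt => /orP[h|h]; rewrite /bump.
  by rewrite sstep_eq0 ?mul0r// mulr_ge0_le0// subr_le0.
by rewrite [sstep (_ * (b - t))]sstep_eq0 ?mulr0// mulr_ge0_le0// subr_le0.
Qed.

Lemma bump_eq1 a b t : a < t < b -> exists N, forall n, (N <= n)%N -> bump a b n t = 1.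
Proof.
move=> /andP[ta tb].
have H (r : R) : 0 < r -> exists N, forall n, (N <= n)%N -> sstep (n%:R * r) = 1.
  move=> r0; exists (Num.truncn `|r^-1|).+1 => n Nn; apply: sstep_eq1.
  rewrite -ler_pdivrMr// mul1r (le_trans (ler_norm _))// (le_trans (ltW (truncnS_gt _)))//.
  by rewrite ler_nat.
have [N1 H1] := H (t - a) ltac:(lra); have [N2 H2] := H (b - t) ltac:(lra).
exists (maxn N1 N2) => n; rewrite geq_max => /andP[n1 n2].
by rewrite /bump H1// H2// mulr1.
Qed.

Lemma Ck_affine k (f : R * R -> R) (c e : R) : Ck k f -> Ck k (fun x => c * f x + e).
Proof. by move=> Cf; apply: CkD; [apply: CkM => //; exact: Ck_cst|exact: Ck_cst]. Qed.

Lemma Ck_bump k a b n (f : R * R -> R) : Ck k f -> Ck k (fun x => bump a b n (f x)).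
Proof.
move=> Cf; apply: CkM; apply: Ck_sstep.
  by have := Ck_affine n%:R (- (n%:R * a)) Cf; congr Ck; apply/funext => x; ring.
by have := Ck_affine (- n%:R) (n%:R * b) Cf; congr Ck; apply/funext => x; ring.
Qed.

(** For every [n] it vanishes off the open rectangle and lies between 0 and 1, so its pointwise
    limit is the indicator and the domination needs [f] only on the closed rectangle. *)
Definition bump2 (a1 b1 a2 b2 : R) n (x : R * R) : R := bump a1 b1 n x.1 * bump a2 b2 n x.2.

Lemma bump2_test (Om : set (R * R)) a1 b1 a2 b2 n :
  crect a1 b1 a2 b2 `<=` Om -> test_fun Om (bump2 a1 b1 a2 b2 n).
Proof.
move=> cO; apply/test_funP; split.
  by apply/smoothP => k; apply: CkM; apply: Ck_bump; [exact: Ck_fst|exact: Ck_snd].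
exists (crect a1 b1 a2 b2); split => //; first exact: crect_compact.
move=> x nx; rewrite /bump2.
have [h1|h1] := boolP (a1 < x.1 < b1); last by rewrite bump_eq0// mul0r.
rewrite [bump a2 _ _ _]bump_eq0 ?mulr0//; apply/negP => h2; apply: nx.
by apply: orect_crect; split; rewrite /= in_itv.
Qed.

Lemma bump2_ge0 a1 b1 a2 b2 n x : 0 <= bump2 a1 b1 a2 b2 n x.
Proof. by rewrite mulr_ge0 ?bump_ge0. Qed.

Lemma bump2_le1 a1 b1 a2 b2 n x : bump2 a1 b1 a2 b2 n x <= 1.
Proof. by rewrite -[leRHS]mulr1 ler_pM ?bump_ge0 ?bump_le1. Qed.

Lemma bump2_cvg a1 b1 a2 b2 x :
  bump2 a1 b1 a2 b2 n x @[n --> \oo] --> (\1_(orect a1 b1 a2 b2) x : R).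
Proof.
have [[h1 h2]|nx] := pselect (orect a1 b1 a2 b2 x).
  rewrite indicE mem_set//; apply: cvg_near_cst.
  have [N1 H1] := bump_eq1 h1; have [N2 H2] := bump_eq1 h2.
  exists (maxn N1 N2) => // n /=; rewrite geq_max => /andP[n1 n2].
  by rewrite /bump2 H1// H2// mulr1.
rewrite indicE memNset//; apply: cvg_near_cst; apply: nearW => n; rewrite /bump2.
have [h1|h1] := boolP (a1 < x.1 < b1); last by rewrite bump_eq0// mul0r.
rewrite [bump a2 _ _ _]bump_eq0 ?mulr0//; apply/negP => h2; apply: nx.
by split; rewrite /= in_itv.
Qed.

(** In place of mollifiers, products of steps tend to the indicator of an open rectangle. Hence [f]
    integrates to zero over rectangles, and by the pi-lambda argument over all measurable subsets of
    one. *)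
Lemma fundamental_lemma (Om : set (R * R)) (f : T2 -> R) : open Om ->
  measurable_fun (Om : set T2) f ->
  (forall K : set (R * R), compact K -> K `<=` Om -> (\int[mu]_(x in K) `|f x|%:E < +oo)%E) ->
  (forall phi : R * R -> R, test_fun Om phi -> \int[mu]_(x in Om) (f x * phi x) = 0) ->
  {ae mu, forall x, Om x -> f x = 0}.
Proof.
move=> oOm mf fK f0; have mOm := open_plane_measurable oOm.
have rect0 a1 b1 a2 b2 : crect a1 b1 a2 b2 `<=` Om ->
    mu.-integrable (orect a1 b1 a2 b2 : set T2) (EFin \o f) /\
    \int[mu]_(x in orect a1 b1 a2 b2) f x = 0.
  move=> cO; set Q : set T2 := crect a1 b1 a2 b2; set P : set T2 := orect a1 b1 a2 b2.
  have mQ : measurable Q by exact: crect_measurable.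
  have mP : measurable P by exact: orect_measurable.
  have iQ : mu.-integrable Q (EFin \o f).
    apply/integrableP; split.
      by apply/measurable_EFinP; apply: measurable_funS mf.
    by apply: fK => //; exact: crect_compact.
  have PQ : P `<=` Q by exact: orect_crect.
  split; first exact: integrableS iQ.
  have mfO : measurable_fun setT (f \_ Om) by exact: (measurable_restrictT f mOm).1 mf.
  have mb n : measurable_fun setT (bump2 a1 b1 a2 b2 n : T2 -> R).
    by apply: continuous_plane_measurable; exact: (test_fun_continuous (bump2_test n cO)).
  have m1 n : measurable_fun setT (fun x : T2 => ((f \_ Om) x * bump2 a1 b1 a2 b2 n x)%:E).
    by apply/measurable_EFinP; exact: measurable_funM.
  have m2 : measurable_fun setT (fun x : T2 => ((f \_ Om) x * \1_P x)%:E).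
    by apply/measurable_EFinP; exact: measurable_funM.
  have c1 : {ae mu, forall x, setT x ->
      ((f \_ Om) x * bump2 a1 b1 a2 b2 n x)%:E @[n --> \oo] --> ((f \_ Om) x * \1_P x)%:E}.
    apply: aeW => x _; apply: cvg_EFin; first exact: nearW.
    by apply: cvgM; [exact: cvg_cst|exact: bump2_cvg].
  have b2_ x n : setT x -> (`|((f \_ Om) x * bump2 a1 b1 a2 b2 n x)%:E| <=
      ((abse \o (EFin \o f)) \_ Q) x)%E.
    move=> _; rewrite [in leRHS]patchE; case: ifPn => [xQ|nQ].
      have -> : (f \_ Om) x = f x.
        by rewrite patchE mem_set//; rewrite inE in xQ; exact: cO.
      by rewrite /= lee_fin normrM ler_piMr// ger0_norm ?bump2_ge0 ?bump2_le1.
    have -> : bump2 a1 b1 a2 b2 n x = 0.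
      rewrite /bump2; have [h1|h1] := boolP (a1 < x.1 < b1); last by rewrite bump_eq0// mul0r.
      rewrite [bump a2 _ _ _]bump_eq0 ?mulr0//; apply: contra nQ => h2; rewrite inE.
      by apply: orect_crect; split; rewrite /= in_itv.
    by rewrite /= mulr0 normr0.
  have iabs : mu.-integrable setT ((abse \o (EFin \o f)) \_ Q).
    by apply/(integrable_mkcond _ mQ)/integrable_abse.
  have c2 : {ae mu, forall x n, setT x -> (`|((f \_ Om) x * bump2 a1 b1 a2 b2 n x)%:E| <=
      ((abse \o (EFin \o f)) \_ Q) x)%E}.
    by apply: aeW => x n Tx; exact: b2_.
  have [_ _ h] := dominated_convergence measurableT m1 m2 c1 iabs c2.
  have z n : (\int[mu]_x ((f \_ Om) x * bump2 a1 b1 a2 b2 n x)%:E = 0)%E.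
    have := f0 _ (bump2_test n cO); rewrite Rintegral_mkcond /Rintegral.
    have -> : (fun x => (((fun x => f x * bump2 a1 b1 a2 b2 n x) \_ Om) x)%:E) =
        (fun x => ((f \_ Om) x * bump2 a1 b1 a2 b2 n x)%:E).
      by apply/funext => x; rewrite !patchE; case: ifP => //; rewrite mul0r.
    move=> h0; rewrite -[LHS]fineK ?h0//; apply: integrable_fin_num => //.
    apply: (le_integrable measurableT (m1 n) _ iabs) => x Tx.
    apply: (le_trans (b2_ x n Tx)); rewrite [leRHS]gee0_abs// patchE.
    by case: ifP => // _; exact: abse_ge0.
  move/cvg_lim : h => h; rewrite Rintegral_mkcond /Rintegral.
  have -> : (fun x => ((f \_ P) x)%:E) = (fun x => ((f \_ Om) x * \1_P x)%:E).
    apply/funext => x; rewrite !patchE indicE; case: ifPn => xP; last by rewrite mulr0.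
    by rewrite mem_set ?mulr1//; apply/cO/PQ; rewrite inE in xP.
  rewrite -h// (_ : [sequence _]_n = cst 0%E); last by apply/funext => n /=; exact: z.
  by rewrite lim_cst//; exact: ereal_hausdorff.
have ae_rect a1 b1 a2 b2 : crect a1 b1 a2 b2 `<=` Om ->
    mu.-negligible [set x | orect a1 b1 a2 b2 x /\ f x != 0].
  move=> cO; have [iP fP] := rect0 _ _ _ _ cO.
  set P : set T2 := orect a1 b1 a2 b2.
  have mP : measurable P by exact: orect_measurable.
  have iF : mu.-integrable setT (EFin \o (f \_ P)).
    have := (integrable_mkcond _ mP).1 iP.
    by apply: eq_integrable => // x _; rewrite /= !patchE; case: ifP.
  (* The intersection with another rectangle is a rectangle whose closure is still in [Om], so the
     case already treated covers the generators. *)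
  have F0 E : measurable E -> \int[mu]_(x in E) (f \_ P) x = 0.
    apply: (Rintegral_eq0_pi_lambda plane_measurableE orects_setI iF).
      by rewrite -Rintegral_mkcond.
    move=> _ [c1 [d1 [c2 [d2 ->]]]]; rewrite -Rintegral_mkcondr orectI.
    set a1' := Num.max _ _; set b1' := Num.min _ _.
    set a2' := Num.max _ _; set b2' := Num.min _ _.
    have [ne|] := pselect (orect a1' b1' a2' b2' !=set0); last first.
      by move=> /set0P/negP/negPn/eqP ->; rewrite Rintegral_set0.
    have [x [/= x1 x2]] := ne; move: x1 x2; rewrite !in_itv/= => x1 x2.
    apply: (rect0 _ _ _ _ _).2 => y [/= y1 y2]; apply: cO.
    move: y1 y2; rewrite !in_itv/= => /andP[h1 h2] /andP[h3 h4].
    have g1 : a1 <= a1' by rewrite le_max lexx orbT.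
    have g2 : a2 <= a2' by rewrite le_max lexx orbT.
    have g3 : b1' <= b1 by rewrite ge_min lexx orbT.
    have g4 : b2' <= b2 by rewrite ge_min lexx orbT.
    by split; rewrite /= in_itv/=; apply/andP; split; lra.
  have := @integral_ae_eq _ _ _ mu setT measurableT (cst 0%E) (EFin \o (f \_ P)) iF _ _.
  move=> /(_ _ _)[]//.
    move=> E _ mE; rewrite integral0 -[LHS]fineK; first by rewrite -/(Rintegral _ _ _) F0.
    by apply: integrable_fin_num => //; exact: integrableS iF.
  move=> N [mN N0 HN]; exists N; split => // x [Px /eqP nfx]; apply: HN => /= h.
  by apply: nfx; have := h I; rewrite patchE mem_set// => -[].
(* Rational rectangles with closure in [Om] cover [Om], so the exceptional set is a countable union
   of negligible sets. *)
pose F (n : nat) : set T2 := if unpickle n is Some q then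
  [set x | [/\ orect (ratr q.1.1) (ratr q.1.2) (ratr q.2.1) (ratr q.2.2) x,
     crect (ratr q.1.1) (ratr q.1.2) (ratr q.2.1) (ratr q.2.2) `<=` Om & f x != 0]]
  else set0.
have : mu.-negligible (\bigcup_n F n).
  apply: negligible_bigcup => n; rewrite /F.
  case: (unpickle n) => [q|]; last exact: negligible_set0.
  have [qO|nqO] := pselect (crect (ratr q.1.1) (ratr q.1.2) (ratr q.2.1) (ratr q.2.2) `<=` Om).
    by apply: negligibleS (ae_rect _ _ _ _ qO) => x [].
  by apply: negligibleS (negligible_set0 _) => x [].
apply: negligibleS => x /= /not_implyP[Ox /eqP nfx].
have [q [xq qO]] := rat_rect (open_nbhs_nbhs (conj oOm Ox)).
exists (pickle q); first exact: I.
by rewrite /F pickleK; split; [exact: xq|exact: qO|exact: nfx].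
Qed.

End FundamentalLemma.

(** * Weak derivatives *)

Section WeakDerivative.
Context {R : realType}.
Local Notation mu := (@leb2 R).
Local Notation T2 := (measurableTypeR R * measurableTypeR R)%type.
Local Notation dir := (@dir R).
Local Notation re := (@complex.Re R).
Local Notation im := (@complex.Im R).
Implicit Types (Om : set (R * R)) (u w : R * R -> R[i]) (phi : R * R -> R).

Lemma compact_plane_measurable (K : set (R * R)) : compact K -> measurable (K : set T2).
Proof.
move=> cK; rewrite -[K]setCK; apply: measurableC; apply: open_plane_measurable.
by apply: closed_openC; apply: compact_closed => //; exact: plane_hausdorff.
Qed.

Lemma loc_integrable_mul Om (f : T2 -> R) phi : open Om ->
  measurable_fun (Om : set T2) f ->
  (forall K : set (R * R), compact K -> K `<=` Om ->
     (\int[mu]_(x in K) `|f x|%:E < +oo)%E) ->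
  test_fun Om phi ->
  mu.-integrable (Om : set T2) (EFin \o (fun x => f x * phi x)).
Proof.
move=> oOm mf fK tphi; have mOm := open_plane_measurable oOm.
have /test_funP[_ [K [cK KO K0]]] := tphi.
have mK := compact_plane_measurable cK.
have mphi : measurable_fun setT (phi : T2 -> R).
  by apply: continuous_plane_measurable; exact: test_fun_continuous tphi.
have iK : mu.-integrable (K : set T2) (EFin \o f).
  apply/integrableP; split; last exact: fK.
  by apply/measurable_EFinP; apply: measurable_funS mf.
have [C HC] : exists C : R, forall x, `|phi x| <= C.
  have : bounded_set (phi @` K).
    apply: compact_bounded; apply: continuous_compact cK.
    by apply: continuous_subspaceT; exact: test_fun_continuous tphi.
  move=> [M [_ HM]]; exists (`|M| + 1) => x.
  have [Kx|/K0 ->] := pselect (K x); last by rewrite normr0 addr_ge0.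
  by apply: (HM (`|M| + 1)); [rewrite ltr_pwDr// ler_norm|exists x].
have iC : mu.-integrable (Om : set T2) ((fun x => (C%:E * (EFin \o f) x)%E) \_ K).
  apply/(integrable_restrict mu mK mOm); rewrite setIidr//; exact: integrableZl.
apply: le_integrable iC => //.
  apply/measurable_EFinP; apply: measurable_funM => //; exact: measurable_funTS.
move=> x _; rewrite patchE; case: ifPn => [xK|nK].
  rewrite /= lee_fin !normrM mulrC ler_wpM2r//.
  by rewrite (le_trans (HC x))// ler_norm.
by rewrite /= (K0 x) ?mulr0 ?normr0//; rewrite notin_setE in nK.
Qed.

Lemma loc_integrable_re Om u : open Om -> loc_integrable Om u ->
  measurable_fun (Om : set T2) (re \o u) /\
  forall K : set (R * R), compact K -> K `<=` Om ->
     (\int[mu]_(x in K) `|re (u x)|%:E < +oo)%E.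
Proof.
move=> oOm [[mr mi] H]; split => // K cK KO; apply: le_lt_trans (H K cK KO).
have mK := compact_plane_measurable cK.
have mr' : measurable_fun (K : set T2) (re \o u) by apply: measurable_funS mr => //; exact: open_plane_measurable.
have mi' : measurable_fun (K : set T2) (im \o u) by apply: measurable_funS mi => //; exact: open_plane_measurable.
apply: ge0_le_integral => //.
- by apply/measurable_EFinP; exact: measurableT_comp.
- apply/measurable_EFinP.
  rewrite (_ : (fun x => cnorm (u x)) = (fun x => Num.sqrt (re (u x) ^+ 2 + im (u x) ^+ 2))).
    apply: (measurableT_comp (continuous_measurable_fun (@sqrt_continuous R))).
    by apply: measurable_funD; exact: measurable_funX.
  by apply/funext => x; rewrite /cnorm; case: (u x).
- by move=> x _; rewrite lee_fin re_le_cnorm.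
Qed.

Lemma cnormMi (z : R[i]) : cnorm (z * 'i%C) = cnorm z.
Proof.
case: z => a b; rewrite /cnorm /=; congr Num.sqrt.
by rewrite !mulr0 !mulr1 sub0r addr0 sqrrN addrC.
Qed.

Lemma loc_integrable_im Om u : open Om -> loc_integrable Om u ->
  measurable_fun (Om : set T2) (im \o u) /\
  forall K : set (R * R), compact K -> K `<=` Om ->
     (\int[mu]_(x in K) `|im (u x)|%:E < +oo)%E.
Proof.
move=> oOm [[mr mi] H].
have E : (re \o (fun x => u x * 'i%C)) = (fun x => - im (u x)).
  by apply/funext => x /=; rewrite reM /= mulr0 mulr1 sub0r.
have l : loc_integrable Om (fun x => u x * 'i%C).
  split; last by move=> K cK KO; under eq_integral do rewrite cnormMi; exact: H.
  split; first by rewrite -/(re \o (fun x => u x * 'i%C)) E; exact: measurableT_comp.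
  rewrite (_ : (fun x => im _) = (fun x => re (u x)))//.
  by apply/funext => x; rewrite imM/= mulr0 mulr1 addr0.
have [m1 h1] := loc_integrable_re oOm l.
split => // K cK KO; apply: le_lt_trans (h1 K cK KO).
rewrite le_eqVlt; apply/orP; left; apply/eqP; apply: eq_integral => x _.
by rewrite (_ : re (u x * 'i%C) = - im (u x)) ?normrN//; rewrite reM/= mulr0 mulr1 sub0r.
Qed.

(* A complex identity splits into two real ones of the same form, so the weak
   derivative can be handled one real component at a time. *)
Lemma is_wderivP Om j u w : is_wderiv Om j u w <->
  [/\ loc_integrable Om u, loc_integrable Om w,
   forall phi, test_fun Om phi -> \int[mu]_(x in Om) (re (u x) * 'D_(dir j) phi x)
     = - \int[mu]_(x in Om) (re (w x) * phi x) &
   forall phi, test_fun Om phi -> \int[mu]_(x in Om) (im (u x) * 'D_(dir j) phi x)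
     = - \int[mu]_(x in Om) (im (w x) * phi x)].
Proof.
have rE z (r : R) : re (z * r%:C%C) = re z * r by rewrite reM /= mulr0 subr0.
have iE z (r : R) : im (z * r%:C%C) = im z * r by rewrite imM /= mulr0 add0r.
split=> [[lu lw H]|[lu lw H1 H2]]; split => // phi tphi.
- have /(congr1 re) := H phi tphi; rewrite reN /=.
  by under eq_Rintegral do rewrite rE; under [in RHS]eq_Rintegral do rewrite rE.
- have /(congr1 im) := H phi tphi; rewrite imN /=.
  by under eq_Rintegral do rewrite iE; under [in RHS]eq_Rintegral do rewrite iE.
have h1 := H1 phi tphi; have h2 := H2 phi tphi.
rewrite /cint.
under eq_Rintegral do rewrite rE; under [X in Complex _ X]eq_Rintegral do rewrite iE.
rewrite h1 h2; congr Complex; congr (- _); apply: eq_Rintegral => x _.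
  by rewrite rE.
by rewrite iE.
Qed.

(** The difference of two weak derivatives annihilates all test functions. This makes the
    representative picked by [wderiv] comparable with any explicit one. *)
Lemma wderiv_unique Om j u w w' : open Om -> is_wderiv Om j u w -> is_wderiv Om j u w' ->
  {ae mu, forall x, Om x -> w x = w' x}.
Proof.
move=> oOm /is_wderivP[_ lw H1 H2] /is_wderivP[_ lw' H1' H2'].
have [mr ir] := loc_integrable_re oOm lw; have [mi ii] := loc_integrable_im oOm lw.
have [mr' ir'] := loc_integrable_re oOm lw'; have [mi' ii'] := loc_integrable_im oOm lw'.
have mOm := open_plane_measurable oOm.
have main (f g : T2 -> R) : measurable_fun (Om : set T2) f -> measurable_fun (Om : set T2) g ->
    (forall K : set (R * R), compact K -> K `<=` Om -> (\int[mu]_(x in K) `|f x|%:E < +oo)%E) ->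
    (forall K : set (R * R), compact K -> K `<=` Om -> (\int[mu]_(x in K) `|g x|%:E < +oo)%E) ->
    (forall phi, test_fun Om phi -> \int[mu]_(x in Om) (f x * phi x) = \int[mu]_(x in Om) (g x * phi x)) ->
    {ae mu, forall x, Om x -> f x - g x = 0}.
  move=> mf mg lf lg fg.
  apply: (@fundamental_lemma _ Om (fun x => f x - g x)) => //.
  - exact: measurable_funB.
  - move=> K cK KO; have mK := compact_plane_measurable cK.
    have mfK : measurable_fun (K : set T2) f by apply: measurable_funS mf.
    have mgK : measurable_fun (K : set T2) g by apply: measurable_funS mg.
    apply: (@le_lt_trans _ _ (\int[mu]_(x in K) (`|f x|%:E + `|g x|%:E))%E).
      apply: ge0_le_integral => //.
      + by apply/measurable_EFinP; apply: measurableT_comp => //; exact: measurable_funB.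
      + by apply: emeasurable_funD; apply/measurable_EFinP; exact: measurableT_comp.
      + by move=> x _; rewrite -EFinD lee_fin ler_normB.
    rewrite ge0_integralD//; [|by apply/measurable_EFinP; exact: measurableT_comp..].
    by apply: lte_add_pinfty; [exact: lf|exact: lg].
  - move=> phi tphi.
    under eq_Rintegral do rewrite mulrBl.
    rewrite RintegralB//; [|exact: loc_integrable_mul..].
    by rewrite fg// subrr.
have A1 := main _ _ mr mr' ir ir' _; have A2 := main _ _ mi mi' ii ii' _.
have : forall phi, test_fun Om phi ->
    \int[mu]_(x in Om) (re (w x) * phi x) = \int[mu]_(x in Om) (re (w' x) * phi x).
  by move=> phi tphi; apply: oppr_inj; rewrite -H1// H1'.
move=> /A1{}A1.
have : forall phi, test_fun Om phi ->
    \int[mu]_(x in Om) (im (w x) * phi x) = \int[mu]_(x in Om) (im (w' x) * phi x).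
  by move=> phi tphi; apply: oppr_inj; rewrite -H2// H2'.
move=> /A2; apply: (@filterS2 _ _ (ae_filter_ringOfSetsType mu) _ _ _ _ A1) => x h1 h2 Ox.
have := h1 Ox; have := h2 Ox; rewrite /=; case: (w x) (w' x) => [p q] [p' q'] /=.
by move=> /eqP; rewrite subr_eq0 => /eqP -> /eqP; rewrite subr_eq0 => /eqP ->.
Qed.

Lemma wderivP Om j u : (exists w, is_wderiv Om j u w) -> is_wderiv Om j u (wderiv Om j u).
Proof. by move=> h; rewrite /wderiv; apply: xgetPex. Qed.

End WeakDerivative.

(** * Weak derivatives through the real L_2 product *)

Section Jets.
Context {R : realType}.
Local Notation mu := (@leb2 R).
Local Notation T2 := (measurableTypeR R * measurableTypeR R)%type.
Local Notation dir := (@dir R).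
Local Notation re := (@complex.Re R).
Local Notation im := (@complex.Im R).
Implicit Types (Om : set (R * R)) (u w : R * R -> R[i]) (phi : R * R -> R).

(** With [c] equal to 1 or ['i], the real product with [emb c phi] extracts the real or the
    imaginary part tested against [phi]. *)
Definition emb (c : R[i]) phi : R * R -> R[i] := fun x => c * (phi x)%:C%C.

Lemma rdot_emb1 (z : R[i]) (r : R) : rdot z (1 * r%:C%C) = re z * r.
Proof. by rewrite /rdot reM imM /=; ring. Qed.

Lemma rdot_embi (z : R[i]) (r : R) : rdot z ('i%C * r%:C%C) = im z * r.
Proof. by rewrite /rdot reM imM /=; ring. Qed.

Lemma Rintegral_supp Om (f : T2 -> R) : (forall x, ~ Om x -> f x = 0) ->
  \int[mu]_(x in Om) f x = \int[mu]_x f x.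
Proof.
move=> f0; rewrite Rintegral_mkcond; apply: eq_Rintegral => x _.
rewrite patchE; case: ifPn => // nx; rewrite notin_setE in nx.
by rewrite f0.
Qed.

Lemma test_sqint Om phi : test_fun Om phi -> @sqint _ T2 R mu phi.
Proof.
move=> tphi; split.
  by apply: continuous_plane_measurable; exact: test_fun_continuous tphi.
have : test_fun Om (fun x => phi x * phi x) by apply: test_funM => //; case: tphi.
move=> /test_fun_integrable; exact: eq_integrable.
Qed.

Lemma emb_l2 c Om phi : test_fun Om phi -> l2 (emb c phi).
Proof.
move=> /test_sqint s; have h (r : R) : @sqint _ T2 R mu (fun x => r * phi x).
  have := sqint_lin r 0 s s; congr sqint; apply/funext => x.
  by rewrite mul0r addr0.
split.
  have := h (re c); congr sqint; apply/funext => x.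
  by rewrite /emb /= reM /= mulr0 subr0.
have := h (im c); congr sqint; apply/funext => x.
by rewrite /emb /= imM /= mulr0 add0r.
Qed.

Lemma int_by_parts Om j f phi : smooth f -> test_fun Om phi ->
  \int[mu]_x (f x * 'D_(dir j) phi x) = - \int[mu]_x ('D_(dir j) f x * phi x).
Proof.
move=> sf tphi; have tf := test_funM tphi sf.
have := int_derive0 j tf.
have sD : smooth ('D_(dir j) f).
  by apply/smoothP => k; move/smoothP/(_ k.+1) : sf => [_ /(_ j)[]].
have E x : 'D_(dir j) (fun x => f x * phi x) x =
    f x * 'D_(dir j) phi x + 'D_(dir j) f x * phi x.
  have /smoothP/(_ 1%N) C1 := sf.
  have d1 := Ck_is_derive j x C1; have d2 := test_fun_is_derive j x tphi.
  have [_ ->] := is_deriveM d1 d2.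
  by rewrite /GRing.scale/= [phi x * _]mulrC.
have -> : \int[mu]_x 'D_(dir j) (fun x => f x * phi x) x =
    \int[mu]_x (f x * 'D_(dir j) phi x + 'D_(dir j) f x * phi x).
  by apply: eq_Rintegral => x _; rewrite E.
rewrite RintegralD//.
- by move/eqP; rewrite addr_eq0 => /eqP.
- exact: test_fun_integrable (test_funM (test_fun_derive j tphi) sf).
- exact: test_fun_integrable (test_funM tphi sD).
Qed.

(** On a compact set |u| <= 1 + |u|^2, and the set has finite measure. *)
Lemma l2_loc_integrable Om u : open Om -> l2 (zext Om u) -> loc_integrable Om u.
Proof.
move=> oOm lu; have mOm := open_plane_measurable oOm; split.
  by apply/(cmeasurable_restrict u mOm)/l2_measurable.
move=> K cK KO; have mK := compact_plane_measurable cK.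
have /l2P[mcu uoo] := lu.
have [M M0 KM] := compact_in_crect cK.
have muK : (mu (K : set T2) < +oo)%E.
  apply: le_lt_trans (crect_finite (- M) M (- M) M); apply: le_measure => //; rewrite inE//.
  exact: crect_measurable.
have mru : measurable_fun setT (fun x => rdot (zext Om u x) (zext Om u x) : R).
  by have [? ?] := mcu; apply: measurable_funD; exact: measurable_funM.
apply: (@le_lt_trans _ _ (\int[mu]_(x in K) (1 + (rdot (zext Om u x) (zext Om u x))%:E))%E).
  apply: ge0_le_integral => //.
  - by move=> x _; rewrite lee_fin cnorm_ge0.
  - apply/measurable_EFinP.
    have h : measurable_fun (K : set T2) (fun x => Num.sqrt (rdot (zext Om u x) (zext Om u x))).
      apply: (measurableT_comp (continuous_measurable_fun (@sqrt_continuous R))).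
      exact: measurable_funTS.
    apply: eq_measurable_fun h => x; rewrite inE => Kx.
    by rewrite -cnorm_sqr sqrtr_sqr ger0_norm ?cnorm_ge0// /zext mem_set//; exact: KO.
  - apply: emeasurable_funD => //; apply/measurable_EFinP; exact: measurable_funTS.
  - move=> x Kx; rewrite -EFinD lee_fin /zext mem_set; last exact: KO.
    rewrite -cnorm_sqr; have := sqr_ge0 (cnorm (u x) - 1); have := sqr_ge0 (cnorm (u x)); nra.
rewrite ge0_integralD//.
- apply: lte_add_pinfty; first by rewrite integral_cst// mul1e.
  apply: le_lt_trans uoo; apply: ge0_subset_integral => //.
  + exact/measurable_EFinP.
  + by move=> x _; rewrite lee_fin rdot_ge0.
- by move=> x _; rewrite lee_fin rdot_ge0.
- apply/measurable_EFinP; exact: measurable_funTS.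
Qed.

(** Rephrases weak differentiability as identities between L_2 products, a form stable under L_2
    limits. *)
Lemma wderiv_eqP Om j u w : open Om -> l2 (zext Om u) -> l2 (zext Om w) ->
  (forall c phi, c \in [:: 1; 'i%C] -> test_fun Om phi ->
     rip (zext Om u) (emb c ('D_(dir j) phi)) = - rip (zext Om w) (emb c phi)) ->
  is_wderiv Om j u w.
Proof.
move=> oOm lu lw H.
have E1 (v : R * R -> R[i]) (phi : R * R -> R) : \int[mu]_(x in Om) (re (v x) * phi x) =
    rip (zext Om v) (emb 1 phi).
  rewrite Rintegral_mkcond; apply: eq_Rintegral => x _; rewrite /emb rdot_emb1 patchE /zext.
  by case: ifP => //; rewrite mul0r.
have E2 (v : R * R -> R[i]) (phi : R * R -> R) : \int[mu]_(x in Om) (im (v x) * phi x) =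
    rip (zext Om v) (emb 'i%C phi).
  rewrite Rintegral_mkcond; apply: eq_Rintegral => x _; rewrite /emb rdot_embi patchE /zext.
  by case: ifP => //; rewrite mul0r.
apply/is_wderivP; split; [exact: l2_loc_integrable|exact: l2_loc_integrable| |].
  by move=> phi tphi; rewrite !E1 H// inE eqxx.
by move=> phi tphi; rewrite !E2 H// !inE eqxx orbT.
Qed.

Definition cD (j : 'I_2) u : R * R -> R[i] :=
  fun x => Complex ('D_(dir j) (re \o u) x) ('D_(dir j) (im \o u) x).

Lemma ctest_fun_cD Om j u : ctest_fun Om u -> ctest_fun Om (cD j u).
Proof. by move=> [t1 t2]; split; exact: test_fun_derive. Qed.

Lemma ctest_funW Om Om' u : Om `<=` Om' -> ctest_fun Om u -> ctest_fun Om' u.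
Proof. by move=> OO [t1 t2]; split; exact: test_funW OO _. Qed.

Lemma ctest_l2 Om u : ctest_fun Om u -> l2 u.
Proof. by move=> [t1 t2]; split; [exact: test_sqint t1|exact: test_sqint t2]. Qed.

Lemma ctest_eq0 Om u x : ctest_fun Om u -> ~ Om x -> u x = 0.
Proof.
move=> [t1 t2] nx; have := test_fun_eq0 t1 nx; have := test_fun_eq0 t2 nx.
by case: (u x) => a b /= -> ->.
Qed.

Lemma zext_id Om u : (forall x, ~ Om x -> u x = 0) -> zext Om u = u.
Proof.
move=> u0; apply/funext => x; rewrite /zext; case: ifPn => // nx.
by rewrite u0//; rewrite notin_setE in nx.
Qed.

Lemma rip_ibp Om Om' c j u phi : c \in [:: 1; 'i%C] -> ctest_fun Om' u -> test_fun Om phi ->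
  rip u (emb c ('D_(dir j) phi)) = - rip (cD j u) (emb c phi).
Proof.
move=> cc [[s1 _ _] [s2 _ _]] tphi; rewrite /rip /emb.
move: cc; rewrite !inE => /orP[/eqP ->|/eqP ->].
  under eq_Rintegral do rewrite rdot_emb1; under [in RHS]eq_Rintegral do rewrite rdot_emb1.
  exact: int_by_parts s1 tphi.
under eq_Rintegral do rewrite rdot_embi; under [in RHS]eq_Rintegral do rewrite rdot_embi.
exact: int_by_parts s2 tphi.
Qed.

Lemma ctest_is_wderiv Om Om' j u : open Om -> ctest_fun Om' u -> is_wderiv Om j u (cD j u).
Proof.
move=> oOm tu; have mOm := open_plane_measurable oOm.
apply: wderiv_eqP => //.
- exact: (l2_restrict mOm (ctest_l2 tu)).1.
- exact: (l2_restrict mOm (ctest_l2 (ctest_fun_cD j tu))).1.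
move=> c phi cc tphi.
have E v psi : test_fun Om psi -> rip (zext Om v) (emb c psi) = rip v (emb c psi).
  move=> tpsi; apply: eq_Rintegral => x _; rewrite /zext; case: ifPn => // nx.
  rewrite /emb (test_fun_eq0 tpsi); last by rewrite notin_setE in nx.
  by rewrite mulr0 /rdot/= !mulr0.
by rewrite !E//; [exact: rip_ibp tu tphi|exact: test_fun_derive].
Qed.

End Jets.

(** * The Dirichlet space *)

Section Triples.
Context {R : realType}.
Local Notation mu := (@leb2 R).
Local Notation T2 := (measurableTypeR R * measurableTypeR R)%type.
Local Notation re := (@complex.Re R).
Local Notation im := (@complex.Im R).
Local Notation tri := ('I_3 -> R * R -> Rcomplex R).
Implicit Types (Om : set (R * R)) (u w : R * R -> R[i]) (U W : tri).

(* A triple stands for a function and its two first-order derivatives. *)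
Definition mktri u (g : 'I_2 -> R * R -> R[i]) : tri :=
  fun k => if unlift ord0 k is Some j then g j else u.

Lemma mktri0 u g : mktri u g ord0 = u.
Proof. by rewrite /mktri unlift_none. Qed.

Lemma mktriS u g j : mktri u g (lift ord0 j) = g j.
Proof. by rewrite /mktri liftK. Qed.

Lemma ord3P (P : 'I_3 -> Prop) : P ord0 -> (forall j : 'I_2, P (lift ord0 j)) ->
  forall k, P k.
Proof. by move=> P0 PS k; case: (unliftP ord0 k) => [j|] ->. Qed.

Definition l2t U := forall k, l2 (U k).
Definition ript U W : R := \sum_k rip (U k) (W k).
Definition nsqt U := ript U U.
(** [jetC] takes classical derivatives on the whole plane; [jet] takes the chosen weak derivatives
    in [Om], extended by zero. For a test function the two agree almost everywhere in [Om]. *)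
Definition jetC u : tri := mktri u (cD^~ u).
Definition jet Om u : tri := mktri (zext Om u) (fun j => zext Om (wderiv Om j u)).
Definition aet U W := forall k, {ae mu, forall x, U k x = W k x}.

Lemma l2t_subspace : subspace l2t.
Proof.
split; first by move=> k; exact: l2_0.
by move=> a U W lU lW k; apply: l2_lin.
Qed.

Lemma l2tB U W : l2t U -> l2t W -> l2t (U - W).
Proof. exact: subspaceB l2t_subspace. Qed.

Lemma ript_lin W : l2t W -> linear_on l2t (ript^~ W).
Proof.
move=> lW a U U' lU lU'; rewrite /ript mulr_sumr -big_split/=.
by apply: eq_bigr => k _; exact: (rip_lin (lW k) a (lU k) (lU' k)).
Qed.

Lemma riptC U W : ript U W = ript W U.
Proof. by apply: eq_bigr => k _; exact: ripC. Qed.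

Lemma nsqt_ge0 U : 0 <= nsqt U.
Proof. by apply: sumr_ge0 => k _; exact: nsq_ge0. Qed.

Lemma nsq_le_nsqt U k : nsq (U k) <= nsqt U.
Proof.
rewrite /nsqt /ript (bigD1 k)//= lerDl; apply: sumr_ge0 => i _; exact: nsq_ge0.
Qed.

Lemma nsqtD U W : l2t U -> l2t W -> nsqt (U + W) <= 2 * nsqt U + 2 * nsqt W.
Proof.
move=> lU lW; rewrite /nsqt /ript !mulr_sumr -big_split/=.
by apply: ler_sum => k _; exact: nsqD.
Qed.

Lemma nsqtN U : nsqt (- U) = nsqt U.
Proof.
apply: eq_bigr => k _; apply: eq_Rintegral => x _.
by rewrite /rdot !reimE; ring.
Qed.

Lemma nsqtBC U W : nsqt (U - W) = nsqt (W - U).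
Proof. by rewrite -nsqtN opprB. Qed.

Lemma aet_trans U W Z : aet U W -> aet W Z -> aet U Z.
Proof.
move=> UW WZ k.
by apply: (@filterS2 _ _ (ae_filter_ringOfSetsType mu) _ _ _ _ (UW k) (WZ k)) => x -> ->.
Qed.

Lemma aetB U U' W W' : aet U U' -> aet W W' -> aet (U - W) (U' - W').
Proof.
move=> UU WW k.
by apply: (@filterS2 _ _ (ae_filter_ringOfSetsType mu) _ _ _ _ (UU k) (WW k)) => x; rewrite !fctE => -> ->.
Qed.

Lemma aet_ript U U' W W' : l2t U -> l2t U' -> l2t W -> l2t W' -> aet U U' -> aet W W' ->
  ript U W = ript U' W'.
Proof.
by move=> lU lU' lW lW' UU WW; apply: eq_bigr => k _; apply: eq_ae_rip => //; exact: l2_measurable.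
Qed.

Lemma ctest_jet_l2t Om u : ctest_fun Om u -> l2t (jetC u).
Proof.
move=> tu; apply: ord3P => [|j]; rewrite /jetC ?mktri0 ?mktriS; first exact: ctest_l2 tu.
exact: ctest_l2 (ctest_fun_cD j tu).
Qed.

Lemma Lpnorm2E Om u : Lpnorm Om 2%:E u =
  sqrte (\int[mu]_x (rdot (zext Om u x) (zext Om u x))%:E)%E.
Proof.
rewrite /Lpnorm unlock -poweR12_sqrt; last first.
  by apply: integral_ge0 => x _; rewrite lee_fin rdot_ge0.
congr poweR; apply: eq_integral => x _ /=.
rewrite powR_mulrn// real_normK ?num_real// patchE /zext.
by case: ifPn => _ /=; rewrite ?cnorm_sqr// expr0n /rdot/= !mulr0 addr0.
Qed.

Lemma Lp2P Om u : measurable (Om : set T2) -> Lp Om 2%:E u <-> l2 (zext Om u).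
Proof.
move=> mOm; have sq (y : \bar R) : (0 <= y)%E -> (sqrte y < +oo)%E <-> (y < +oo)%E.
  by case: y => [r|//|//] _; rewrite /= !ltry.
rewrite l2P -(cmeasurable_restrict u mOm) /Lp Lpnorm2E.
have /sq h : (0 <= \int[mu]_x (rdot (zext Om u x) (zext Om u x))%:E)%E.
  by apply: integral_ge0 => x _; rewrite lee_fin rdot_ge0.
by split=> -[h1 h2]; split => //; apply/h.
Qed.

Lemma Lpnorm2_nsq Om u : l2 (zext Om u) -> Lpnorm Om 2%:E u = (Num.sqrt (nsq (zext Om u)))%:E.
Proof.
move=> lu; rewrite Lpnorm2E.
rewrite (_ : integral _ _ _ = (nsq (zext Om u))%:E)//.
rewrite /nsq /rip -Rintegral_EFin//; last exact: rip_integrable.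
by move=> x; exact: rdot_ge0.
Qed.

(** [wderiv] need not be the square-integrable derivative that [sobolev] supplies; equality almost
    everywhere transfers the norm bound. *)
Lemma sobolev1_jet Om u : open Om -> sobolev Om 2%:E 1 u ->
  l2t (jet Om u) /\ forall j, is_wderiv Om j u (wderiv Om j u).
Proof.
move=> oOm; have mOm := open_plane_measurable oOm.
move=> [/(Lp2P _ mOm) lu H].
have W j : is_wderiv Om j u (wderiv Om j u).
  by apply: wderivP; have [w ww _] := H j; exists w.
split => //; apply: ord3P => [|j]; rewrite /jet ?mktri0 ?mktriS//.
have [w ww /(Lp2P _ mOm) lw] := H j.
have [mr mi] := l2_measurable lw.
have mw : cmeasurable_fun setT (zext Om (wderiv Om j u)).
  by apply/(cmeasurable_restrict _ mOm); have [_ []] := W j.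
have e : {ae mu, forall x, zext Om w x = zext Om (wderiv Om j u) x}.
  have := wderiv_unique oOm ww (W j).
  apply: (@filterS _ _ (ae_filter_ringOfSetsType mu)) => x h.
  by rewrite /zext; case: ifPn => // xO; apply: h; rewrite inE in xO.
apply/l2P; split => //; move/l2P : lw => [mcw].
rewrite (_ : (\int[_]_x _)%E = (\int[mu]_x (rdot (zext Om w x) (zext Om w x))%:E)%E)//.
have mm v : cmeasurable_fun setT v -> measurable_fun setT (fun x : T2 => (rdot (v x) (v x))%:E).
  by move=> [? ?]; apply/measurable_EFinP; apply: measurable_funD; exact: measurable_funM.
apply: ge0_ae_eq_integral => //; [exact: mm|exact: mm|..].
- by move=> x _; rewrite lee_fin rdot_ge0.
- by move=> x _; rewrite lee_fin rdot_ge0.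
- by move: e; apply: (@filterS _ _ (ae_filter_ringOfSetsType mu)) => x -> _.
Qed.

Lemma sobolev1_intro Om u (w : 'I_2 -> R * R -> R[i]) : open Om -> l2 (zext Om u) ->
  (forall j, is_wderiv Om j u (w j)) -> (forall j, l2 (zext Om (w j))) ->
  sobolev Om 2%:E 1 u /\ aet (jet Om u) (mktri (zext Om u) (fun j => zext Om (w j))).
Proof.
move=> oOm lu ww lw; have mOm := open_plane_measurable oOm; split.
  split; first exact/Lp2P.
  by move=> j; exists (w j) => //; exact/Lp2P.
apply: ord3P => [|j]; rewrite /jet ?mktri0 ?mktriS; first exact: aeW.
have W : is_wderiv Om j u (wderiv Om j u) by apply: wderivP; exists (w j).
have := wderiv_unique oOm W (ww j).
apply: (@filterS _ _ (ae_filter_ringOfSetsType mu)) => x h.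
by rewrite /zext; case: ifPn => // xO; apply: h; rewrite inE in xO.
Qed.

Lemma W12normE Om u : open Om -> sobolev Om 2%:E 1 u ->
  W12norm Om u = (Num.sqrt (nsqt (jet Om u)))%:E.
Proof.
move=> oOm su; have [lj _] := sobolev1_jet oOm su.
have l0 : l2 (zext Om u) by have := lj ord0; rewrite /jet mktri0.
have lS j : l2 (zext Om (wderiv Om j u)) by have := lj (lift ord0 j); rewrite /jet mktriS.
rewrite /W12norm Lpnorm2_nsq// (eq_bigr (fun j => (nsq (zext Om (wderiv Om j u)))%:E)).
  rewrite sumEFin -EFin_expe sqr_sqrtr ?nsq_ge0// -EFinD /=; congr (Num.sqrt _)%:E.
  rewrite /nsqt /ript [in RHS]big_ord_recl /jet mktri0; congr (_ + _).
  by apply: eq_bigr => j _; rewrite mktriS.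
by move=> j _; rewrite Lpnorm2_nsq// -EFin_expe sqr_sqrtr ?nsq_ge0.
Qed.

Lemma is_wderivB Om j u u' w w' : open Om -> is_wderiv Om j u w -> is_wderiv Om j u' w' ->
  l2 (zext Om u) -> l2 (zext Om w) -> l2 (zext Om u') -> l2 (zext Om w') ->
  is_wderiv Om j (u \- u') (w \- w').
Proof.
move=> oOm /is_wderivP[iu iw H1 H2] /is_wderivP[iu' iw' H1' H2'] lu lw lu' lw'.
have zB v v' : zext Om (v \- v') = zext Om v - zext Om v'.
  by apply/funext => x; rewrite /zext !fctE; case: ifPn => // _; rewrite subr0.
have loc := l2_loc_integrable oOm.
apply/is_wderivP; split.
- by apply: loc; rewrite zB; exact: l2B.
- by apply: loc; rewrite zB; exact: l2B.
- move=> phi tphi; have tD := test_fun_derive j tphi.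
  have i1 v psi : loc_integrable Om v -> test_fun Om psi ->
      mu.-integrable (Om : set T2) (EFin \o (fun x => re (v x) * psi x)).
    by move=> lv tpsi; have [m h] := loc_integrable_re oOm lv; exact: loc_integrable_mul m h tpsi.
  have mOm := open_plane_measurable oOm.
  under eq_Rintegral do rewrite reD reN mulrBl.
  rewrite RintegralB//; [|exact: i1..].
  under [in RHS]eq_Rintegral do rewrite reD reN mulrBl.
  rewrite RintegralB//; [|exact: i1..].
  by rewrite H1// H1'// opprD.
- move=> phi tphi; have tD := test_fun_derive j tphi.
  have i1 v psi : loc_integrable Om v -> test_fun Om psi ->
      mu.-integrable (Om : set T2) (EFin \o (fun x => im (v x) * psi x)).
    by move=> lv tpsi; have [m h] := loc_integrable_im oOm lv; exact: loc_integrable_mul m h tpsi.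
  have mOm := open_plane_measurable oOm.
  under eq_Rintegral do rewrite imD imN mulrBl.
  rewrite RintegralB//; [|exact: i1..].
  under [in RHS]eq_Rintegral do rewrite imD imN mulrBl.
  rewrite RintegralB//; [|exact: i1..].
  by rewrite H2// H2'// opprD.
Qed.

Lemma zextB Om u w : zext Om (u \- w) = zext Om u - zext Om w.
Proof. by apply/funext => x; rewrite /zext !fctE; case: ifPn => // _; rewrite subr0. Qed.

Lemma sobolev1B Om u w : open Om -> sobolev Om 2%:E 1 u -> sobolev Om 2%:E 1 w ->
  sobolev Om 2%:E 1 (u \- w) /\ aet (jet Om (u \- w)) (jet Om u - jet Om w).
Proof.
move=> oOm su sw; have [lu wu] := sobolev1_jet oOm su; have [lw ww] := sobolev1_jet oOm sw.
have l0 v : l2t (jet Om v) -> l2 (zext Om v) by move/(_ ord0); rewrite /jet mktri0.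
have lS v j : l2t (jet Om v) -> l2 (zext Om (wderiv Om j v)).
  by move/(_ (lift ord0 j)); rewrite /jet mktriS.
have [||| su' a] := @sobolev1_intro Om (u \- w) (fun j => wderiv Om j u \- wderiv Om j w) oOm.
- by rewrite zextB; apply: l2B; exact: l0.
- by move=> j; apply: is_wderivB => //; [exact: l0|exact: lS|exact: l0|exact: lS].
- by move=> j; rewrite zextB; apply: l2B; exact: lS.
split => //; apply: aet_trans a _.
apply: ord3P => [|j]; rewrite ?fctE /jet ?mktri0 ?mktriS ?zextB; exact: aeW.
Qed.

End Triples.

(** * The Dirichlet space as a closure of test functions *)

Section DirichletSpace.
Context {R : realType}.
Local Notation mu := (@leb2 R).
Local Notation T2 := (measurableTypeR R * measurableTypeR R)%type.
Local Notation dir := (@dir R).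
Local Notation re := (@complex.Re R).
Local Notation im := (@complex.Im R).
Local Notation tri := ('I_3 -> R * R -> Rcomplex R).
Implicit Types (Om : set (R * R)) (u v w : R * R -> R[i]) (U W : tri).

(* Its elements vanish almost everywhere outside Om, so the spaces are nested
   when the domains are. *)
Definition Vsp Om U := l2t U /\ forall e : R, 0 < e ->
  exists2 u, ctest_fun Om u & nsqt (U - jetC u) < e.

Lemma VspW Om Om' U : Om `<=` Om' -> Vsp Om U -> Vsp Om' U.
Proof.
move=> OO [lU H]; split => // e e0; have [u tu ue] := H e e0.
by exists u => //; exact: ctest_funW tu.
Qed.

Lemma Vsp_jetC Om u : ctest_fun Om u -> Vsp Om (jetC u).
Proof.
move=> tu; split; first exact: ctest_jet_l2t tu.
move=> e e0; exists u => //; rewrite subrr (_ : nsqt 0 = 0)//.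
apply: big1 => k _; rewrite /rip /Rintegral.
under eq_integral do rewrite /rdot /= !mul0r addr0.
by rewrite integral0.
Qed.

Lemma nsqtZ (a : R) U : l2t U -> nsqt (a *: U) = a ^+ 2 * nsqt U.
Proof.
move=> lU; rewrite /nsqt /ript mulr_sumr; apply: eq_bigr => k _.
rewrite /rip -RintegralZl//; last exact: rip_integrable.
by apply: eq_Rintegral => x _; rewrite /rdot !fctE !re_scale !im_scale; ring.
Qed.

Lemma ctest_lin Om (a : R) u v : ctest_fun Om u -> ctest_fun Om v ->
  ctest_fun Om ((a *: (u : R * R -> Rcomplex R) + v)) /\
  jetC (a *: (u : R * R -> Rcomplex R) + v) = a *: jetC u + jetC v.
Proof.
move=> [ru iu] [rv iv].
have Er : re \o (a *: (u : R * R -> Rcomplex R) + v) = (fun x => a * re (u x) + re (v x)).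
  by apply/funext => x; rewrite /= reD re_scale.
have Ei : im \o (a *: (u : R * R -> Rcomplex R) + v) = (fun x => a * im (u x) + im (v x)).
  by apply/funext => x; rewrite /= imD im_scale.
have tl (f g : R * R -> R) : test_fun Om f -> test_fun Om g ->
    test_fun Om (fun x => a * f x + g x).
  by move=> tf tg; apply: test_funD => //; exact: test_funM tf (smooth_cst a).
have dl (f g : R * R -> R) j x : test_fun Om f -> test_fun Om g ->
    'D_(dir j) (fun x => a * f x + g x) x = a * 'D_(dir j) f x + 'D_(dir j) g x.
  move=> tf tg; have d1 := test_fun_is_derive j x tf; have d2 := test_fun_is_derive j x tg.
  have [_] := is_deriveD (is_deriveZ a d1) d2.
  by [].
split; first by split; [move: Er|move: Ei]; rewrite /comp => ->; exact: tl.
apply/funext; apply: ord3P => [|j]; first by rewrite !fctE /jetC !mktri0.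
rewrite !fctE /jetC !mktriS; apply/funext => x; rewrite /cD Er Ei !dl//.
Qed.

Lemma Vsp_subspace Om : subspace (Vsp Om).
Proof.
have [l0 lL] := @l2t_subspace R; split.
  have [t0] : ctest_fun Om (fun=> 0 : R[i]).
    by split; apply/test_funP; split; [exact: smooth_cst|exists set0; split => //; exact: compact0
      |exact: smooth_cst|exists set0; split => //; exact: compact0].
  move=> t1; have := Vsp_jetC (conj t0 t1).
  congr Vsp; apply/funext; apply: ord3P => [|j]; rewrite /jetC ?mktri0// ?mktriS.
  by apply/funext => x; rewrite /cD /= !derive_cst.
move=> a U W [lU HU] [lW HW]; split; first exact: lL.
move=> e e0.
have e1 : 0 < e / (4 * (a ^+ 2 + 1)).
  by rewrite divr_gt0// mulr_gt0// ltr_wpDl// sqr_ge0.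
have e2 : 0 < e / 4 by rewrite divr_gt0.
have [u tu ue] := HU _ e1; have [w tw we] := HW _ e2.
have [t J] := ctest_lin a tu tw; eexists; first exact: t.
rewrite J (_ : _ - _ = a *: (U - jetC u) + (W - jetC w)); last first.
  by rewrite scalerBr opprD addrACA.
have lu := ctest_jet_l2t tu; have lw := ctest_jet_l2t tw.
have lUu := l2tB lU lu; have lWw := l2tB lW lw.
have laU : l2t (a *: (U - jetC u)) by exact: subspaceZ (@l2t_subspace R) lUu.
apply: (le_lt_trans (nsqtD laU lWw)); rewrite nsqtZ//.
have : nsqt (U - jetC u) * (4 * (a ^+ 2 + 1)) < e by rewrite -ltr_pdivlMr// mulr_gt0// ltr_wpDl// sqr_ge0.
have := nsqt_ge0 (U - jetC u); have := sqr_ge0 a; nra.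
Qed.

(** The limit is taken in each L_2 factor; that it is again approximated by test functions is the
    triangle inequality through one term of the sequence. *)
Lemma Vsp_hilbert Om : semi_hilbert (Vsp Om) ript.
Proof.
split.
- exact: Vsp_subspace.
- by move=> W [lW _] a U U' [lU _] [lU' _]; exact: ript_lin.
- by move=> U W _ _; exact: riptC.
- by move=> U _; exact: nsqt_ge0.
move=> U_ VU cau; have lU n k : l2 (U_ n k) by have [] := VU n.
have /choice[L HL] k : exists l, l2 l /\ cvg_for rip (U_ ^~ k) l.
  have [|l ll lc] := @l2_complete R (U_ ^~ k) (fun n => lU n k); last by exists l.
  move=> e /cau[N HN]; exists N => m n Nm Nn.
  by apply: le_lt_trans (HN m n Nm Nn); exact: (nsq_le_nsqt (U_ m - U_ n) k).
have lL : l2t L by move=> k; have [] := HL k.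
have cL : cvg_for ript U_ L.
  move=> e e0; have e3 : 0 < e / 3 by rewrite divr_gt0.
  have [N0 H0] := (HL ord0).2 _ e3.
  have [N1 H1] := (HL (lift ord0 ord0)).2 _ e3.
  have [N2 H2] := (HL (lift ord0 (lift ord0 ord0))).2 _ e3.
  exists (maxn N0 (maxn N1 N2)) => n; rewrite !geq_max => /and3P[n0 n1 n2].
  rewrite /ript !big_ord_recl big_ord0 addr0.
  by have := H0 n n0; have := H1 n n1; have := H2 n n2; rewrite /= !fctE; lra.
exists L => //; split => // e e0; have e4 : 0 < e / 4 by rewrite divr_gt0.
have [N HN] := cL _ e4; have [_ /(_ _ e4)[u tu ue]] := VU N; exists u => //.
have lu := ctest_jet_l2t tu; have lN : l2t (U_ N) by move=> k; exact: lU.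
rewrite (_ : L - _ = (L - U_ N) + (U_ N - jetC u)); last by rewrite addrA subrK.
apply: (le_lt_trans (nsqtD (l2tB lL lN) (l2tB lN lu))).
by rewrite (nsqtBC L); have := HN N (leqnn N); rewrite /nsqt; move: ue; rewrite /nsqt; lra.
Qed.

Lemma jetC_eq0 Om u k x : ctest_fun Om u -> ~ Om x -> jetC u k x = 0.
Proof.
move=> tu nx; move: k; apply: ord3P => [|j]; rewrite /jetC ?mktri0 ?mktriS.
  exact: ctest_eq0 tu nx.
exact: ctest_eq0 (ctest_fun_cD j tu) nx.
Qed.

(** Test functions vanish off [Om], so the norm of [U] there is at most its distance to any of
    them. *)
Lemma Vsp_supp Om U : open Om -> Vsp Om U -> aet (fun k => zext Om (U k)) U.
Proof.
move=> oOm [lU HU] k; have mOm := open_plane_measurable oOm.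
have mC : measurable (~` Om : set T2) by exact: measurableC.
have [lC _] := l2_restrict mC (lU k).
have : nsq (zext (~` Om) (U k)) = 0.
  apply/eqP; rewrite eq_le nsq_ge0 andbT; apply/ler_addgt0Pl => e e0; rewrite addr0.
  have [u tu ue] := HU e e0; apply: le_trans (ltW ue).
  apply: le_trans (nsq_le_nsqt _ k); apply: le_nsq => //.
    exact: l2tB lU (ctest_jet_l2t tu) k.
  move=> x; rewrite /zext; case: ifPn => [xC|_]; last by rewrite {1}/rdot/= !mul0r addr0 rdot_ge0.
  by rewrite inE in xC; rewrite !fctE (jetC_eq0 k tu xC) subr0.
move=> /(nsq_eq0 lC); apply: (@filterS _ _ (ae_filter_ringOfSetsType mu)) => x.
rewrite /zext; have [xO|xO] := pselect (Om x); first by rewrite (mem_set xO).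
by rewrite (memNset xO) mem_set.
Qed.

Lemma Vsp_is_wderiv Om U j : open Om -> Vsp Om U ->
  is_wderiv Om j (U ord0) (U (lift ord0 j)).
Proof.
move=> oOm VU; have mOm := open_plane_measurable oOm; have supp := Vsp_supp oOm VU.
have [lU HU] := VU.
have lz k := (l2_restrict mOm (lU k)).1.
apply: wderiv_eqP => // c phi cc tphi.
have tD := test_fun_derive j tphi; have lp := emb_l2 c tphi; have lD := emb_l2 c tD.
have E k v : l2 v -> rip (zext Om (U k)) v = rip (U k) v.
  move=> lv; apply: eq_ae_rip; try exact: l2_measurable; last exact: aeW.
  exact: supp.
rewrite !E//; apply/eqP; rewrite -addr_eq0; set X := _ + _.
pose a := Num.sqrt (nsq (emb c ('D_(dir j) phi))); pose b := Num.sqrt (nsq (emb c phi)).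
have a0 : 0 <= a by exact: sqrtr_ge0.
have b0 : 0 <= b by exact: sqrtr_ge0.
(* Integration by parts is exact for test functions, so the defect [X] depends only on [U - jetC u],
   which is arbitrarily small. *)
have XX (e : R) : 0 < e -> `|X| <= e * a + e * b.
  move=> e0; have [u tu ue] := HU (e ^+ 2) (exprn_gt0 2 e0).
  have lu := ctest_jet_l2t tu; have ibp := rip_ibp j cc tu tphi.
  have -> : X = rip ((U - jetC u) ord0) (emb c ('D_(dir j) phi)) +
      rip ((U - jetC u) (lift ord0 j)) (emb c phi).
    rewrite !fctE (linear_onB (rip_lin lD) (lU _) (lu _)) (linear_onB (rip_lin lp) (lU _) (lu _)).
    by rewrite /jetC mktri0 mktriS /X; move: ibp; set s := rip _ _ => ->; ring.
  have ld := l2tB lU lu.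
  apply: le_trans (ler_normD _ _) _; apply: lerD; apply: rip_le => //; try exact: ltW.
  - exact: le_trans (nsq_le_nsqt _ _) (ltW ue).
  - by rewrite sqr_sqrtr ?nsq_ge0.
  - exact: le_trans (nsq_le_nsqt _ _) (ltW ue).
  - by rewrite sqr_sqrtr ?nsq_ge0.
rewrite -normr_eq0 eq_le normr_ge0 andbT; apply/ler_addgt0Pl => e e0; rewrite addr0.
have e1 : 0 < e / (a + b + 1) by rewrite divr_gt0// ltr_wpDl// addr_ge0.
apply: (le_trans (XX _ e1)); rewrite -mulrDr mulrAC ler_pdivrMr ?ltr_wpDl// ?addr_ge0//.
by rewrite ler_pM2l//; lra.
Qed.

Lemma ctest_sobolev Om Om' u : open Om -> ctest_fun Om' u ->
  sobolev Om 2%:E 1 u /\ aet (jet Om u) (fun k => zext Om (jetC u k)).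
Proof.
move=> oOm tu; have mOm := open_plane_measurable oOm; have lu := ctest_jet_l2t tu.
have [||| su a] := @sobolev1_intro R Om u (cD^~ u) oOm.
- by have := (l2_restrict mOm (lu ord0)).1; rewrite /jetC mktri0.
- by move=> j; exact: ctest_is_wderiv oOm tu.
- by move=> j; have := (l2_restrict mOm (lu (lift ord0 j))).1; rewrite /jetC mktriS.
split => //; apply: aet_trans a _.
by apply: ord3P => [|j]; rewrite /jetC ?mktri0 ?mktriS; exact: aeW.
Qed.

(** Test functions of [Om] vanish identically on a graph that misses [Om], so the approximants of
    [U] themselves witness the zero trace. [W12_0_Vsp] is the converse for strips. *)
Lemma Vsp_W12_0 Om (S : set (R -> R)) U : open Om ->
  (forall g, S g -> forall t, ~ Om (t, g t)) -> Vsp Om U ->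
  W12_0 Om S (U ord0) /\ aet (jet Om (U ord0)) U.
Proof.
move=> oOm SO VU; have mOm := open_plane_measurable oOm; have [lU HU] := VU.
have lz k := (l2_restrict mOm (lU k)).1.
have [||| su a] := @sobolev1_intro R Om (U ord0) (fun j => U (lift ord0 j)) oOm => //.
  by move=> j; exact: Vsp_is_wderiv.
have aU : aet (jet Om (U ord0)) U.
  apply: aet_trans a _; apply: aet_trans (Vsp_supp oOm VU).
  by apply: ord3P => [|j]; rewrite ?mktri0 ?mktriS; exact: aeW.
split => //; split => // g Sg.
have /choice[phi phiE] n : exists u, ctest_fun Om u /\ nsqt (U - jetC u) < (n.+1%:R^-1) ^+ 2.
  by have [|u tu ue] := HU (n.+1%:R^-1 ^+ 2); [rewrite exprn_gt0// invr_gt0|exists u].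
exists phi; split.
- by move=> n; have [tu _] := phiE n; exact: ctest_funW tu.
- have En n : W12norm Om (U ord0 \- phi n) = (Num.sqrt (nsqt (U - jetC (phi n))))%:E.
    have [tu _] := phiE n; have [sp ap] := ctest_sobolev oOm tu.
    have [sd ad] := sobolev1B oOm su sp.
    rewrite W12normE//; congr (Num.sqrt _)%:E.
    have ld := (sobolev1_jet oOm sd).1; have lu := ctest_jet_l2t tu.
    have aa : aet (jet Om (U ord0 \- phi n)) (U - jetC (phi n)).
      apply: aet_trans ad _; apply: aetB => //; apply: aet_trans ap _ => k.
      apply: aeW => x; rewrite zext_id// => y; exact: jetC_eq0 tu.
    by apply: aet_ript => //; exact: l2tB.
  under eq_fun do rewrite En.
  apply: cvg_EFin; first exact: nearW.
  apply: (@squeeze_cvgr _ _ _ _ (cst 0) (fun n => n.+1%:R^-1)).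
  + apply: nearW => n /=; rewrite sqrtr_ge0/=.
    rewrite -[leRHS]ger0_norm ?invr_ge0// -sqrtr_sqr ler_sqrt ?sqr_ge0// ltW//.
    by have [] := phiE n.
  + exact: cvg_cst.
  + exact: cvg_harmonic.
- have En n : curve_L2norm g (fun t => phi n (t, g t) - 0) = 0%E.
    have [tu _] := phiE n; rewrite /curve_L2norm.
    under eq_integral => t _ do
      rewrite (ctest_eq0 tu (SO g Sg t)) subr0 cnorm0 expr0n mul0r.
    by rewrite integral0 sqrte0.
  under eq_fun do rewrite En; exact: cvg_cst.
Qed.

End DirichletSpace.

(** * Functions with zero trace are limits of test functions *)

Section Layer.
Context {R : realType}.
Local Notation mu := (@leb2 R).
Local Notation lam := (@lebesgue_measure R).
Local Notation T1 := (measurableTypeR R).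
Local Notation T2 := (measurableTypeR R * measurableTypeR R)%type.
Local Notation dir := (@dir R).

Lemma continuous_itv_integrable (f : R -> R) a b : continuous f ->
  lam.-integrable `[a, b] (EFin \o f).
Proof.
move=> cf; apply: continuous_compact_integrable; first exact: segment_compact.
exact: continuous_subspaceT.
Qed.

Lemma is_derive_continuous (F f : R -> R) : (forall t, is_derive t (1 : R) F (f t)) ->
  continuous F.
Proof.
by move=> dF t; apply: differentiable_continuous; apply/derivable1_diffP; have [] := dF t.
Qed.

Lemma increment_sqr_le_lt (F f : R -> R) (y c : R) : y < c -> continuous f ->
  (forall t, is_derive t (1 : R) F (f t)) ->
  (F c - F y) ^+ 2 <= (c - y) * \int[lam]_(t in `[y, c]) (f t) ^+ 2.
Proof.
move=> yc cf dF.
have cF := is_derive_continuous dF.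
have cf2 : continuous (fun t => f t ^+ 2).
  by move=> t; under eq_fun do rewrite expr2; apply: cvgM; exact: cf.
have i1 := continuous_itv_integrable y c cf.
have i2 := continuous_itv_integrable y c cf2.
have I1 : \int[lam]_(t in `[y, c]) f t = F c - F y.
  rewrite /Rintegral (@continuous_FTC2 R f F y c yc)//.
  - exact: continuous_subspaceT.
  - split.
    + by move=> t _; have [] := dF t.
    + by apply: cvg_at_right_filter; exact: cF.
    + by apply: cvg_at_left_filter; exact: cF.
  - by move=> t _; rewrite derive1E; have [_] := dF t.
set I2 := \int[lam]_(t in _) _; set D := F c - F y; pose l := c - y.
have l0 : 0 < l by rewrite subr_gt0.
(* The mean of [f]: expanding the integral of (f - r)^2 gives Cauchy-Schwarz against constants. *)
pose r := D / l.
have : 0 <= \int[lam]_(t in `[y, c]) (f t - r) ^+ 2.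
  by apply: Rintegral_ge0 => t _; exact: sqr_ge0.
have -> : \int[lam]_(t in `[y, c]) (f t - r) ^+ 2 =
    \int[lam]_(t in `[y, c]) ((f t ^+ 2 - (2 * r) * f t) + r ^+ 2).
  by apply: eq_Rintegral => t _; ring.
have mi : measurable (`[y, c] : set T1) by exact: measurable_itv.
have i3 : lam.-integrable `[y, c] (EFin \o (fun t => (2 * r) * f t)).
  have := integrableZl mi (2 * r) i1.
  by apply: eq_integrable => // x _ /=.
have i4 : lam.-integrable `[y, c] (EFin \o (fun t => f t ^+ 2 - (2 * r) * f t)).
  have := integrableB mi i2 i3.
  by apply: eq_integrable => // x _ /=.
have i5 : lam.-integrable `[y, c] (EFin \o (fun=> r ^+ 2)).
  by apply: continuous_itv_integrable => t; exact: cvg_cst.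
have ml : lam `[y, c] = l%:E.
  by rewrite lebesgue_measure_itv/= lte_fin yc -EFinD.
have -> : \int[lam]_(t in `[y, c]) ((f t ^+ 2 - 2 * r * f t) + r ^+ 2) =
    I2 - 2 * r * D + r ^+ 2 * l.
  rewrite (RintegralD mi i4 i5) (RintegralB mi i2 i3) (RintegralZl _ mi i1) I1.
  by rewrite (Rintegral_cst _ mi); congr (_ + _ * _); exact: (congr1 fine ml).
move=> h.
have E : I2 - 2 * r * D + r ^+ 2 * l = I2 - D ^+ 2 / l.
  by rewrite /r; field; rewrite gt_eqF.
by move: h; rewrite E subr_ge0 ler_pdivrMr// mulrC.
Qed.

Lemma increment_sqr_le (F f : R -> R) (a b y c : R) : a <= y <= b -> a <= c <= b ->
  continuous f -> (forall t, is_derive t (1 : R) F (f t)) ->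
  (F y - F c) ^+ 2 <= (b - a) * \int[lam]_(t in `[a, b]) (f t) ^+ 2.
Proof.
move=> /andP[ay yb] /andP[ac cb] cf dF.
have cf2 : continuous (fun t => f t ^+ 2).
  by move=> t; under eq_fun do rewrite expr2; apply: cvgM; exact: cf.
have main p q : a <= p -> p < q -> q <= b ->
    (F q - F p) ^+ 2 <= (b - a) * \int[lam]_(t in `[a, b]) (f t) ^+ 2.
  move=> ap pq qb; apply: (le_trans (increment_sqr_le_lt pq cf dF)).
  apply: ler_pM; [lra|by apply: Rintegral_ge0 => t _; exact: sqr_ge0|lra|].
  have iab := continuous_itv_integrable a b cf2.
  have ipq := continuous_itv_integrable p q cf2.
  rewrite -lee_fin !fineK; [|exact: integrable_fin_num..].
  apply: ge0_subset_integral => //.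
  - apply/measurable_EFinP; apply: measurable_funTS; exact: continuous_measurable_fun.
  - by move=> t _; rewrite lee_fin sqr_ge0.
  - by move=> t /=; rewrite !in_itv/= => /andP[? ?]; apply/andP; split; lra.
have [yc|cy|->] := ltgtP y c.
- by rewrite -sqrrN opprB; exact: main.
- exact: main.
- by rewrite subrr expr0n/= mulr_ge0 ?Rintegral_ge0//; [lra|move=> t _; exact: sqr_ge0].
Qed.

(** Integrate F(t)^2 <= 2 F(c)^2 + 2 (F(t) - F(c))^2 over a segment of length [delta], and bound the
    increment by the derivative. *)
Lemma segment_layer_le (F f : R -> R) (a c delta : R) : 0 < delta -> a <= c <= a + delta ->
  continuous f -> (forall t, is_derive t (1 : R) F (f t)) ->
  (\int[lam]_(t in `]a, (a + delta)%R[) (F t ^+ 2)%R%:E <=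
   (2 * delta)%R%:E * (F c ^+ 2)%R%:E +
   (2 * delta ^+ 2)%R%:E * \int[lam]_(t in `]a, (a + delta)%R[) (f t ^+ 2)%R%:E)%E.
Proof.
move=> d0 ac cf dF; have cF := is_derive_continuous dF.
have cf2 : continuous (fun t => f t ^+ 2).
  by move=> t; under eq_fun do rewrite expr2; apply: cvgM; exact: cf.
have mf2 : measurable_fun setT (fun t => f t ^+ 2) by exact: continuous_measurable_fun.
have iI := continuous_itv_integrable a (a + delta) cf2.
set I := \int[lam]_(t in `[a, (a + delta)]) (f t) ^+ 2.
have -> : (\int[lam]_(t in `]a, (a + delta)%R[) (f t ^+ 2)%R%:E = I%:E)%E.
  rewrite fineK; last exact: integrable_fin_num.
  rewrite [RHS]integral_itv_bndoo//; apply/measurable_EFinP.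
  exact: measurable_funTS.
pose K := 2 * F c ^+ 2 + 2 * (delta * I).
apply: (@le_trans _ _ (\int[lam]_(t in `]a, (a + delta)%R[) K%:E)%E).
  apply: ge0_le_integral => //.
  - by move=> t _; rewrite lee_fin sqr_ge0.
  - apply/measurable_EFinP; apply: measurable_funTS; apply: measurable_funX.
    exact: continuous_measurable_fun.
  - move=> t /=; rewrite in_itv/= => /andP[at_ ta].
    have := @increment_sqr_le F f a (a + delta) t c _ ac cf dF.
    rewrite (ltW at_) (ltW ta) => /(_ isT); rewrite -/I.
    have -> : a + delta - a = delta by ring.
    rewrite lee_fin /K; have := sqr_ge0 (F t - 2 * F c); lra.
rewrite integral_cst//= lebesgue_measure_itv/= lte_fin ltrDl d0 -EFinD -!EFinM lee_fin.
by rewrite /K; lra.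
Qed.

Definition layer (lo : R -> R) (delta : R) : set (R * R) :=
  [set x | lo x.1 < x.2 < lo x.1 + delta].

Lemma strip_open (lo hi : R -> R) : continuous lo -> continuous hi ->
  open [set x : R * R | lo x.1 < x.2 < hi x.1].
Proof.
move=> clo chi.
have c1 : continuous (fun x : R * R => x.2 - lo x.1).
  move=> x; apply: cvgB; first exact: cvg_snd.
  by apply: continuous_comp; [exact: cvg_fst|exact: clo].
have c2 : continuous (fun x : R * R => hi x.1 - x.2).
  move=> x; apply: cvgB; last exact: cvg_snd.
  by apply: continuous_comp; [exact: cvg_fst|exact: chi].
have -> : [set x : R * R | lo x.1 < x.2 < hi x.1] =
    (fun x : R * R => x.2 - lo x.1) @^-1` [set y | 0 < y] `&`
    (fun x : R * R => hi x.1 - x.2) @^-1` [set y | 0 < y].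
  apply/seteqP; split=> [x /= /andP[h1 h2]|x [/= h1 h2]].
    by rewrite !subr_gt0.
  by rewrite -subr_gt0 h1 -subr_gt0.
by apply: openI; apply: open_comp => //; exact: open_gt.
Qed.

Lemma layer_open lo delta : continuous lo -> open (layer lo delta).
Proof.
move=> clo; apply: (@strip_open lo (fun t => lo t + delta)) => // t.
by apply: cvgD; [exact: clo|exact: cvg_cst].
Qed.

(** The lower edge [lo] of the layer and the curve [c] carrying the trace are separate arguments,
    because at the top boundary of the strip the curve is the upper edge. *)
Lemma layer_estimate (lo c : R -> R) (delta : R) (f : R * R -> R) :
  0 < delta -> continuous lo -> continuous c -> (forall t, lo t <= c t <= lo t + delta) ->
  test_fun setT f ->
  (\int[mu]_(x in layer lo delta) (f x ^+ 2)%R%:E <=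
   (2 * delta)%R%:E * \int[lam]_t (f (t, c t) ^+ 2)%R%:E +
   (2 * delta ^+ 2)%R%:E *
     \int[mu]_(x in layer lo delta) ('D_(dir (lift ord0 ord0)) f x ^+ 2)%R%:E)%E.
Proof.
move=> d0 clo cc loc tf; pose L : set T2 := layer lo delta.
have mL : measurable L by apply: open_plane_measurable; exact: layer_open.
pose j : 'I_2 := lift ord0 ord0; pose g := 'D_(dir j) f.
have tg : test_fun setT g by exact: test_fun_derive.
have mf : measurable_fun setT (f : T2 -> R).
  by apply: continuous_plane_measurable; exact: test_fun_continuous tf.
have mg : measurable_fun setT (g : T2 -> R).
  by apply: continuous_plane_measurable; exact: test_fun_continuous tg.
have mr (h : T2 -> R) : measurable_fun setT h ->
    measurable_fun setT ((fun x => (h x ^+ 2)%R%:E) \_ L).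
  move=> mh; apply: (measurable_restrictT _ mL).1.
  by apply: measurable_funTS; apply/measurable_EFinP; exact: measurable_funX.
have r0 (h : T2 -> R) x : (0 <= ((fun x => (h x ^+ 2)%R%:E) \_ L) x)%E.
  by rewrite patchE; case: ifP => // _; rewrite lee_fin sqr_ge0.
have sl (h : T2 -> R) t : (\int[lam]_y ((fun x => (h x ^+ 2)%R%:E) \_ L) (t, y) =
    \int[lam]_(y in `]lo t, (lo t + delta)%R[) (h (t, y) ^+ 2)%R%:E)%E.
  rewrite [RHS]integral_mkcond; apply: eq_integral => y _; rewrite !patchE.
  rewrite (_ : ((t, y) \in L) = (y \in `]lo t, (lo t + delta)%R[%classic))//.
rewrite [leLHS](@integral_mkcond _ T2 R mu L).
rewrite [X in (_ <= _ + _ * X)%E](@integral_mkcond _ T2 R mu L).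
rewrite (fubini_tonelli1 _ (mr f mf) (r0 f)) (fubini_tonelli1 _ (mr g mg) (r0 g)).
rewrite /fubini_F; under eq_integral do rewrite sl.
under [X in (_ <= _ + _ * X)%E]eq_integral do rewrite sl.
have mc : measurable_fun setT (fun t : T1 => (f (t, c t) ^+ 2)%R%:E).
  apply/measurable_EFinP; apply: measurable_funX; apply: continuous_measurable_fun.
  move=> t; apply: (@continuous_comp _ _ _ (fun t => (t, c t)) f).
    by apply: (@cvg_pair _ _ _ (nbhs t) (nbhs t) (nbhs (c t))); [exact: cvg_id|exact: cc].
  exact: test_fun_continuous tf _.
have mI (h : T2 -> R) : measurable_fun setT h ->
    measurable_fun setT (fun t => \int[lam]_(y in `]lo t, (lo t + delta)%R[) (h (t, y) ^+ 2)%R%:E)%E.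
  move=> mh; have := @measurable_fun_fubini_tonelli_F _ _ T1 T1 R lam _ (mr h mh) (r0 h).
  by rewrite /fubini_F; under eq_fun do rewrite sl.
have I0 (h : T2 -> R) t : (0 <= \int[lam]_(y in `]lo t, (lo t + delta)%R[) (h (t, y) ^+ 2)%R%:E)%E.
  by apply: integral_ge0 => y _; rewrite lee_fin sqr_ge0.
have d20 : (0 <= 2 * delta :> R) by lra.
have d30 : (0 <= 2 * delta ^+ 2 :> R) by rewrite mulr_ge0// sqr_ge0.
rewrite -ge0_integralZl_EFin//; last by move=> t _; rewrite lee_fin sqr_ge0.
rewrite -ge0_integralZl_EFin//; last by exact: mI.
rewrite -ge0_integralD//; last 4 first.
- by move=> t _; rewrite mule_ge0// lee_fin sqr_ge0.
- by apply: measurable_funeM.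
- by move=> t _; rewrite mule_ge0.
- by apply: measurable_funeM; exact: mI.
apply: ge0_le_integral => //.
- exact: mI.
- apply: emeasurable_funD; apply: measurable_funeM => //; exact: mI.
- move=> t _; apply: (@segment_layer_le (fun y => f (t, y)) (fun y => g (t, y))) => //.
  + move=> y; apply: (@continuous_comp _ _ _ (fun y => (t, y)) g).
      by apply: (@cvg_pair _ _ _ (nbhs y) (nbhs t) (nbhs y)); [exact: cvg_cst|exact: cvg_id].
    exact: test_fun_continuous tg _.
  + move=> y; have := @is_derive_axpt R f j y t (g (t, y)); rewrite /axpt /=; apply.
    exact: test_fun_is_derive tf.
Qed.

End Layer.

(** * Smooth approximation of Lipschitz curves *)

Section Interpolation.
Context {R : realType}.
Local Notation dir := (@dir R).

(** For the slope in [smooth_interp]: at each point only the step whose transition zone contains it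
    contributes to the derivative. *)
Lemma sum_single_le (n : nat) (F : 'I_n -> R) (C : R) : 0 <= C ->
  (forall k, `|F k| <= C) -> (forall k l, F k != 0 -> F l != 0 -> k = l) ->
  `|\sum_k F k| <= C.
Proof.
move=> C0 FC F1; have [[k Fk]|h] := pselect (exists k, F k != 0).
  rewrite (bigD1 k)//= big1 ?addr0// => l lk; apply/eqP; apply: contraNT lk => Fl.
  by apply/eqP; exact: F1.
rewrite big1 ?normr0// => k _; apply/eqP; apply: contra_notT h => Fk.
by exists k.
Qed.

(** A cut-off following a curve must be smooth although the curve is only Lipschitz. The
    approximation is a staircase of smooth steps through the values on a grid of mesh [h]: a jump of
    at most L h is spread over a length [h], so the slope bound does not depend on the accuracy
    [r]. *)
Lemma smooth_interp (gamma : R -> R) (L M r : R) : 0 <= L -> 0 < r ->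
  (forall s t, `|gamma s - gamma t| <= L * `|s - t|) ->
  exists psi : R * R -> R, [/\ smooth psi,
    forall x, `|x.1| <= M -> `|psi x - gamma x.1| <= r &
    forall j x, `|'D_(dir j) psi x| <= L * @sstep_bound R].
Proof.
move=> L0 r0 gL.
(* Two errors of size L h, one from the nearest grid value and one from the step in progress, must
   add up to at most [r]. *)
pose h := r / (2 * (L + 1)).
have h0 : 0 < h by rewrite divr_gt0//; lra.
have Lh : 2 * (L * h) <= r.
  have : h * (2 * (L + 1)) = r by rewrite divfK// gt_eqF//; lra.
  by nra.
(* The grid points (k - N) h with k <= 2 N cover |x_1| <= M. *)
pose N := (Num.truncn (`|M| / h)).+1.
have MN : `|M| < N%:R * h by rewrite -ltr_pdivrMr//; exact: truncnS_gt.
pose a (k : nat) := gamma ((k%:R - N%:R) * h).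
pose arg (k : nat) (x : R * R) := h^-1 * x.1 + (N%:R - k%:R).
pose psin n (x : R * R) := a 0%N + \sum_(k < n) (a k.+1 - a k) * sstep (arg k x).
have aL k : `|a k.+1 - a k| <= L * h.
  apply: (le_trans (gL _ _)); rewrite ler_wpM2l// -mulrBl -natr1.
  by rewrite (_ : _ - _ - _ = 1)//; [rewrite mul1r ger0_norm// ltW|ring].
have S0 : 0 <= @sstep_bound R by rewrite mulr_ge0// expR_ge0.
have Carg k i : Ck k (arg i) by apply: Ck_affine; exact: Ck_fst.
have Cpsi k n : Ck k (psin n).
  elim: n => [|n IH].
    by rewrite /psin; under eq_fun do rewrite big_ord0 addr0; exact: Ck_cst.
  rewrite (_ : psin n.+1 = (fun x => psin n x + (a n.+1 - a n) * sstep (arg n x))).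
    by apply: CkD => //; apply: CkM; [exact: Ck_cst|exact: Ck_sstep].
  by apply/funext => x; rewrite /psin big_ord_recr/= addrA.
have /choice[ds dsE] := @is_derive_sstep R.
pose e (j : 'I_2) : R := if j == ord0 then h^-1 else 0.
have darg j k x : is_derive x (dir j) (arg k) (e j).
  have d1 := is_deriveD (is_deriveZ h^-1 (is_derive_fst j x)) (is_derive_cst (N%:R - k%:R : R^o) x (dir j)).
  apply: (is_derive_eq d1); rewrite /e /GRing.scale/= addr0.
  by case: ifP; rewrite ?mulr1 ?mulr0.
have dpsi j n x : is_derive x (dir j) (psin n)
    (\sum_(k < n) (a k.+1 - a k) * (ds (arg k x) * e j)).
  elim: n => [|n IH].
    rewrite big_ord0 /psin; under eq_fun do rewrite big_ord0 addr0.
    exact: is_derive_cst.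
  rewrite (_ : psin n.+1 = (fun x => psin n x + (a n.+1 - a n) * sstep (arg n x))); last first.
    by apply/funext => y; rewrite /psin big_ord_recr/= addrA.
  rewrite big_ord_recr/=.
  have [ds1 _ _] := dsE (arg n x).
  exact: is_deriveD IH (is_deriveZ (a n.+1 - a n) (is_derive_comp1 ds1 (darg j n x))).
exists (psin (N + N)%N); split.
- by apply/smoothP.
- move=> x xM; pose y := h^-1 * x.1 + N%:R.
  have /andP[y0 y1] : 0 <= y < (N + N)%:R.
    have : `|x.1| < N%:R * h by apply: le_lt_trans MN; rewrite (le_trans xM)// ler_norm.
    rewrite ltr_norml => /andP[h1 h2].
    have h3 : h^-1 * x.1 < N%:R by rewrite mulrC ltr_pdivrMr.
    have h4 : - N%:R < h^-1 * x.1 by rewrite mulrC ltr_pdivlMr// mulNr.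
    by rewrite /y natrD; apply/andP; split; lra.
  pose m := Num.truncn y.
  have /andP[my ym] : m%:R <= y < m.+1%:R by apply: truncn_itv.
  have argE k : arg k x = y - k%:R by rewrite /arg /y; ring.
  (* Steps before the grid cell of [x] are complete and telescope; later ones have not begun. *)
  have psiE n : psin n x = if (n <= m)%N then a n else a m + (a m.+1 - a m) * sstep (y - m%:R).
    elim: n => [|n IH]; first by rewrite /psin big_ord0 addr0.
    rewrite {1}/psin big_ord_recr/= addrA -/(psin n x) IH argE.
    have [nm|mn|<-] := ltngtP n m.
    - rewrite sstep_eq1 ?mulr1; first by ring.
      have : n.+1%:R <= m%:R :> R by rewrite ler_nat.
      by rewrite -natr1; lra.
    - rewrite [sstep (y - n%:R)]sstep_eq0 ?mulr0 ?addr0//.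
      have : m.+1%:R <= n%:R :> R by rewrite ler_nat.
      by lra.
    - by [].
  have mNN : (m < N + N)%N by rewrite -(ltr_nat R); exact: le_lt_trans y1.
  rewrite psiE leqNgt mNN/=.
  have xE : x.1 = (y - N%:R) * h by rewrite /y addrK mulrAC mulVf ?mul1r// gt_eqF.
  have g1 : `|a m - gamma x.1| <= L * h.
    apply: (le_trans (gL _ _)); rewrite ler_wpM2l// xE -mulrBl.
    rewrite (_ : m%:R - N%:R - (y - N%:R) = - (y - m%:R)); last by ring.
    have ym0 : 0 <= y - m%:R by rewrite subr_ge0.
    have ym1 : y - m%:R <= 1 by move: ym; rewrite -natr1; lra.
    have yh : 0 <= (y - m%:R) * h by rewrite mulr_ge0// ltW.
    by rewrite mulNr normrN (ger0_norm yh); nra.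
  have g2 : `|(a m.+1 - a m) * sstep (y - m%:R)| <= L * h.
    rewrite normrM (ger0_norm (sstep_ge0 _)) -[leRHS]mulr1 ler_pM ?sstep_ge0 ?sstep_le1//.
  rewrite addrAC; apply: (le_trans (ler_normD _ _)).
  by move: g1 g2; lra.
- move=> j x; have [_ ->] := dpsi j (N + N)%N x.
  apply: sum_single_le; first by rewrite mulr_ge0.
  + move=> k; rewrite !normrM mulrA.
    have e1 : `|e j| <= h^-1.
      have hi : 0 <= h^-1 by rewrite invr_ge0 ltW.
      by rewrite /e; case: ifP => _; rewrite ?normr0 ?ger0_norm.
    have [_ d1 _] := dsE (arg k x).
    apply: (@le_trans _ _ (L * h * @sstep_bound R * h^-1)).
      have p1 : `|a k.+1 - a k| * `|ds (arg k x)| <= L * h * @sstep_bound R.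
        by apply: ler_pM => //; exact: aL.
      by apply: ler_pM => //; rewrite mulr_ge0.
    have -> : L * h * @sstep_bound R * h^-1 = L * @sstep_bound R.
      by rewrite mulrAC mulfK// gt_eqF.
    by [].
  + move=> k l; rewrite !mulf_eq0 !negb_or => /and3P[_ k1 _] /and3P[_ l1 _].
    have H i : ds (arg i x) != 0 -> 0 < arg i x < 1.
      by have [_ _ z] := dsE (arg i x); apply: contraNT => /z ->.
    have /andP[k2 k3] := H _ k1; have /andP[l2 l3] := H _ l1.
    move: k2 k3 l2 l3; rewrite /arg => k2 k3 l2 l3.
    have kl : (k < l.+1)%N by rewrite -(ltr_nat R) -[ltRHS]natr1; lra.
    have lk : (l < k.+1)%N by rewrite -(ltr_nat R) -[ltRHS]natr1; lra.
    by apply/val_inj/eqP; rewrite eqn_leq -ltnS kl -ltnS lk.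
Qed.

End Interpolation.

(** * Norms in a thin layer at the boundary *)

Section BoundaryLayer.
Context {R : realType}.
Local Notation mu := (@leb2 R).
Local Notation lam := (@lebesgue_measure R).
Local Notation T1 := (measurableTypeR R).
Local Notation T2 := (measurableTypeR R * measurableTypeR R)%type.
Local Notation re := (@complex.Re R).
Local Notation im := (@complex.Im R).
Local Notation tri := ('I_3 -> R * R -> Rcomplex R).
Local Notation j2 := (lift ord0 ord0 : 'I_2).
Implicit Types (Om D : set (R * R)) (u v w f : R * R -> Rcomplex R) (U W : tri).

Definition zt D U : tri := fun k => zext D (U k).

Lemma l2t_zt D U : measurable (D : set T2) -> l2t U -> l2t (zt D U).
Proof. by move=> mD lU k; exact: (l2_restrict mD (lU k)).1. Qed.

Lemma nsqt_zt_le D U : measurable (D : set T2) -> l2t U -> nsqt (zt D U) <= nsqt U.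
Proof. by move=> mD lU; apply: ler_sum => k _; exact: (l2_restrict mD (lU k)).2. Qed.

Lemma zextE D D' u : D `<=` D' -> zext D (zext D' u) = zext D u.
Proof.
move=> DD; apply/funext => x; rewrite /zext; case: ifPn => // xD.
by rewrite mem_set//; apply: DD; rewrite inE in xD.
Qed.

Lemma l2_le2 (a b : R) u v w : cmeasurable_fun setT u -> l2 v -> l2 w ->
  (forall x, rdot (u x) (u x) <= a * rdot (v x) (v x) + b * rdot (w x) (w x)) ->
  nsq u <= a * nsq v + b * nsq w.
Proof.
move=> [mr mi] lv lw uvw; have iv := rip_integrable lv lv; have iw := rip_integrable lw lw.
have ivw := integrable_lin a b iv iw.
have iu : mu.-integrable setT (EFin \o (fun x => rdot (u x) (u x))).
  apply: (le_integrable_real _ ivw).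
    by apply: measurable_funD; exact: measurable_funM.
  by move=> x; rewrite ger0_norm ?rdot_ge0.
have h (c : R) (g : T2 -> R) : mu.-integrable setT (EFin \o g) ->
    mu.-integrable setT (EFin \o (fun x => c * g x)).
  move=> ig; have := integrableZl measurableT c ig.
  by apply: eq_integrable => // x _ /=; rewrite EFinM.
rewrite /nsq /rip -!RintegralZl// -RintegralD//; [|exact: h..].
exact: le_Rintegral.
Qed.

(** Dominated convergence: every point lies in only finitely many of the sets. *)
Lemma nsq_zext_small (D : nat -> set T2) u : l2 u -> (forall n, measurable (D n)) ->
  (forall x, exists N, forall n, (N <= n)%N -> ~ D n x) ->
  forall e : R, 0 < e -> exists N, forall n, (N <= n)%N -> nsq (zext (D n) u) < e.
Proof.
move=> lu mD D0 e e0.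
have iu := rip_integrable lu lu.
pose g n (x : T2) := (rdot (zext (D n) u x) (zext (D n) u x))%:E.
have lz n := (l2_restrict (mD n) lu).1.
have mg n : measurable_fun setT (g n) by have /integrableP[] := rip_integrable (lz n) (lz n).
have m0 : measurable_fun setT (cst 0%E : T2 -> \bar R) by exact: measurable_cst.
have c1 : {ae mu, forall x, setT x -> g n x @[n --> \oo] --> (cst 0%E : T2 -> \bar R) x}.
  apply: aeW => x _; apply: cvg_near_cst; have [N HN] := D0 x.
  exists N => // n /= Nn; rewrite /g /zext memNset; last exact: HN.
  by rewrite /rdot/= !mul0r addr0.
have c2 : {ae mu, forall x n, setT x -> (`|g n x| <= (EFin \o (fun x => rdot (u x) (u x))) x)%E}.
  apply: aeW => x n _; rewrite /g /= lee_fin ger0_norm ?rdot_ge0//.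
  by rewrite /zext; case: ifP => // _; rewrite {1}/rdot/= !mul0r addr0 rdot_ge0.
have [_ _] := dominated_convergence measurableT mg m0 c1 iu c2.
rewrite integral0 => /fine_cvgP[_ /cvgrPdist_lt/(_ _ e0)[N _ HN]].
exists N => n Nn; have := HN n Nn; rewrite /= sub0r normrN => h.
by apply: le_lt_trans h; exact: ler_norm.
Qed.

Lemma nsqt_zt_small (D : nat -> set T2) U : l2t U -> (forall n, measurable (D n)) ->
  (forall x, exists N, forall n, (N <= n)%N -> ~ D n x) ->
  forall e : R, 0 < e -> exists n, nsqt (zt (D n) U) < e.
Proof.
move=> lU mD D0 e e0; have e3 : 0 < e / 3 by rewrite divr_gt0.
have H k := nsq_zext_small (lU k) mD D0 e3.
have [N0 H0] := H ord0; have [N1 H1] := H (lift ord0 ord0).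
have [N2 H2] := H (lift ord0 (lift ord0 ord0)).
pose n := maxn N0 (maxn N1 N2); exists n; rewrite /nsqt /ript !big_ord_recl big_ord0 addr0.
have n0 : (N0 <= n)%N by rewrite leq_maxl.
have n1 : (N1 <= n)%N by rewrite leq_max leq_maxl orbT.
have n2 : (N2 <= n)%N by rewrite leq_max leq_maxr orbT.
by have := H0 n n0; have := H1 n n1; have := H2 n n2; rewrite /nsq /zt /=; lra.
Qed.

Lemma nsq_zextE D u : measurable (D : set T2) -> l2 u ->
  ((nsq (zext D u))%:E = \int[mu]_(x in D) (re (u x) ^+ 2)%R%:E +
    \int[mu]_(x in D) (im (u x) ^+ 2)%R%:E)%E.
Proof.
move=> mD lu; have lz := (l2_restrict mD lu).1.
have [mr mi] := l2_measurable lu.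
rewrite -ge0_integralD//.
- rewrite [RHS](@integral_mkcond _ T2 R mu D).
  rewrite /nsq /rip Rintegral_EFin; [|by move=> x; exact: rdot_ge0|exact: rip_integrable].
  apply: eq_integral => x _; rewrite patchE /zext; case: ifP => // _.
  by rewrite /rdot/= !mul0r addr0.
- by move=> x _; rewrite lee_fin sqr_ge0.
- by apply/measurable_EFinP; apply: measurable_funTS; exact: measurable_funX.
- by move=> x _; rewrite lee_fin sqr_ge0.
- by apply/measurable_EFinP; apply: measurable_funTS; exact: measurable_funX.
Qed.

Lemma layer_nsq (lo c : R -> R) (delta tau : R) f : 0 < delta ->
  continuous lo -> continuous c -> (forall t, lo t <= c t <= lo t + delta) ->
  ctest_fun setT f ->
  (\int[lam]_t (re (f (t, c t)) ^+ 2)%R%:E <= tau%:E)%E ->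
  (\int[lam]_t (im (f (t, c t)) ^+ 2)%R%:E <= tau%:E)%E ->
  nsq (zext (layer lo delta) f) <=
    4 * delta * tau + 2 * delta ^+ 2 * nsq (zext (layer lo delta) (cD j2 f)).
Proof.
move=> d0 clo cc loc tf tr ti; have [tre tim] := tf.
have mL : measurable (layer lo delta : set T2) by apply: open_plane_measurable; exact: layer_open.
have lf := ctest_l2 tf; have lD := ctest_l2 (ctest_fun_cD j2 tf).
have h1 := layer_estimate d0 clo cc loc tre.
have h2 := layer_estimate d0 clo cc loc tim.
have d20 : (0 <= (2 * delta)%R%:E)%E by rewrite lee_fin; lra.
rewrite -lee_fin nsq_zextE// EFinD !EFinM nsq_zextE//.
apply: (le_trans (leeD h1 h2)).
rewrite addeACA -!muleDr//; last 2 first.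
- by rewrite ge0_adde_def// inE; apply: integral_ge0 => x _; rewrite lee_fin sqr_ge0.
- by rewrite ge0_adde_def// inE; apply: integral_ge0 => x _; rewrite lee_fin sqr_ge0.
apply: leeD; last by rewrite -!EFinM.
rewrite -!EFinM (_ : 4 * delta * tau = 2 * delta * (tau + tau)); last by ring.
by rewrite (EFinM (2 * delta)); apply: lee_wpmul2l => //; rewrite EFinD; exact: leeD.
Qed.

(** The arc-length weight is at least 1, so the curve norm dominates the plain L_2 norm in the
    parameter. *)
Lemma curve_bound (gamma : R -> R) (eta : R) f : continuous gamma ->
  measurable_fun setT (derive1 gamma : T1 -> R) -> 0 <= eta -> ctest_fun setT f ->
  (curve_L2norm gamma (fun t => (f (t, gamma t) - 0)%R : R[i]) < eta%:E)%E ->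
  (\int[lam]_t (re (f (t, gamma t)) ^+ 2)%R%:E <= (eta ^+ 2)%R%:E)%E /\
  (\int[lam]_t (im (f (t, gamma t)) ^+ 2)%R%:E <= (eta ^+ 2)%R%:E)%E.
Proof.
move=> cg mg e0 [tr ti]; rewrite /curve_L2norm.
set I := integral _ _ _ => Ie.
have I0 : (0 <= I)%E.
  by apply: integral_ge0 => t _; rewrite lee_fin mulr_ge0// ?sqr_ge0// sqrtr_ge0.
have Ieta : (I <= (eta ^+ 2)%R%:E)%E.
  move: Ie I0; case: I => [r||]//=; rewrite !lte_fin !lee_fin => h r0.
  rewrite -(sqr_sqrtr r0) ler_pXn2r ?nnegrE ?sqrtr_ge0//; exact: ltW.
have comp (h : R * R -> R) : test_fun setT h -> measurable_fun setT (fun t : T1 => h (t, gamma t)).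
  move=> th; apply: continuous_measurable_fun => t.
  apply: (@continuous_comp _ _ _ (fun t => (t, gamma t)) h).
    by apply: (@cvg_pair _ _ _ (nbhs t) (nbhs t) (nbhs (gamma t))); [exact: cvg_id|exact: cg].
  exact: test_fun_continuous th _.
have mre := comp _ tr; have mim := comp _ ti.
have mI : measurable_fun setT (fun t : T1 =>
    (cnorm (f (t, gamma t) - 0) ^+ 2 * Num.sqrt (1 + (derive1 gamma t) ^+ 2))%R%:E).
  apply/measurable_EFinP; apply: measurable_funM.
    rewrite (_ : (fun t => cnorm _ ^+ 2) = (fun t => re (f (t, gamma t)) ^+ 2 + im (f (t, gamma t)) ^+ 2)).
      by apply: measurable_funD; exact: measurable_funX.
    by apply/funext => t; rewrite subr0 cnorm_sqr /rdot !expr2.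
  apply: (measurableT_comp (continuous_measurable_fun (@sqrt_continuous R))).
  by apply: measurable_funD; [exact: measurable_cst|exact: measurable_funX].
have w1 (t : R) : 1 <= Num.sqrt (1 + (derive1 gamma t) ^+ 2).
  by rewrite -[leLHS]sqrtr1 ler_sqrt ?lerDl ?sqr_ge0// addr_ge0// sqr_ge0.
split; apply: le_trans Ieta; apply: ge0_le_integral => //.
- by move=> t _; rewrite lee_fin sqr_ge0.
- by apply/measurable_EFinP; exact: measurable_funX.
- move=> t _; rewrite lee_fin subr0 cnorm_sqr -[leLHS]mulr1 ler_pM ?sqr_ge0//.
  by rewrite /rdot expr2 lerDl -expr2 sqr_ge0.
- by move=> t _; rewrite lee_fin sqr_ge0.
- by apply/measurable_EFinP; exact: measurable_funX.
- move=> t _; rewrite lee_fin subr0 cnorm_sqr -[leLHS]mulr1 ler_pM ?sqr_ge0//.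
  by rewrite /rdot expr2 lerDr -expr2 sqr_ge0.
Qed.

End BoundaryLayer.

(** * Cutting off at one boundary curve *)

Section Cutoff.
Context {R : realType}.
Local Notation T1 := (measurableTypeR R).
Local Notation T2 := (measurableTypeR R * measurableTypeR R)%type.
Local Notation dir := (@dir R).
Local Notation re := (@complex.Re R).
Local Notation im := (@complex.Im R).
Local Notation tri := ('I_3 -> R * R -> Rcomplex R).
Local Notation j2 := (lift ord0 ord0 : 'I_2).
Implicit Types (Om D : set (R * R)) (u v w f : R * R -> Rcomplex R) (U W : tri).

Lemma rdotZ (a : R) (z : Rcomplex R) : rdot (a *: z) (a *: z) = a ^+ 2 * rdot z z.
Proof. by rewrite /rdot re_scale im_scale; ring. Qed.

Lemma rdotB_le (z z' : R[i]) : rdot (z - z') (z - z') <= 2 * rdot z z + 2 * rdot z' z'.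
Proof.
rewrite /rdot !reimE; have := sqr_ge0 (re z + re z'); have := sqr_ge0 (im z + im z').
lra.
Qed.

Lemma rdot0 : rdot (0 : R[i]) 0 = 0. Proof. by rewrite /rdot/= !mul0r addr0. Qed.

Lemma ctest_mul Om (theta : R * R -> R) f : smooth theta -> ctest_fun Om f ->
  let g : R * R -> Rcomplex R := fun x => theta x *: f x in
  ctest_fun Om g /\
  forall j x, cD j g x = theta x *: (cD j f x : Rcomplex R) +
                         'D_(dir j) theta x *: f x.
Proof.
move=> st [tr ti] g.
have Er : re \o g = (fun x => theta x * re (f x)) by apply/funext => x; rewrite /= re_scale.
have Ei : im \o g = (fun x => theta x * im (f x)) by apply/funext => x; rewrite /= im_scale.
have dM (h : R * R -> R) j x : test_fun Om h -> 'D_(dir j) (fun x => theta x * h x) x =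
    theta x * 'D_(dir j) h x + 'D_(dir j) theta x * h x.
  move=> th; have /smoothP/(_ 1%N) C1 := st.
  have [_ ->] := is_deriveM (Ck_is_derive j x C1) (test_fun_is_derive j x th).
  by rewrite /GRing.scale/= [h x * _]mulrC.
split; first by split; [move: Er|move: Ei]; rewrite /comp => ->; exact: test_funM.
move=> j x; rewrite /cD Er Ei !dM//.
by case: (f x) => a b.
Qed.

(** Signed vertical distance to the curve, positive on the side of the domain: above the curve when
    [s] is true, below it otherwise. *)
Definition bdist (s : bool) (gamma : R -> R) (x : R * R) : R :=
  if s then x.2 - gamma x.1 else gamma x.1 - x.2.

Lemma jetC_ord0 f : jetC f ord0 = f. Proof. exact: mktri0. Qed.
Lemma jetC_lift f j : jetC f (lift ord0 j) = cD j f. Proof. exact: mktriS. Qed.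

Lemma smooth_cutoff (s : bool) (gamma : R -> R) (L M delta : R) : 0 <= L -> 0 < delta ->
  (forall p q, `|gamma p - gamma q| <= L * `|p - q|) ->
  exists theta : R * R -> R, [/\ smooth theta, forall x, 0 <= theta x <= 1,
    forall x, `|x.1| <= M -> delta <= bdist s gamma x ->
      theta x = 1 /\ forall j, 'D_(dir j) theta x = 0,
    forall x, `|x.1| <= M -> bdist s gamma x <= delta / 4 -> theta x = 0 &
    forall j x, `|'D_(dir j) theta x| <=
       @sstep_bound R * (1 + L * @sstep_bound R) * 4 / delta].
Proof.
move=> L0 d0 gL; set S := @sstep_bound R.
have S0 : 0 <= S by rewrite mulr_ge0// expR_ge0.
have d4 : 0 < delta / 4 by lra.
have [psi [spsi psig dpsi]] := smooth_interp M L0 d4 gL.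
pose sg : R := if s then 1 else -1.
have sg2 : `|sg| = 1 by rewrite /sg; case: ifP => _; rewrite ?normrN normr1.
(* For |x_1| <= M, [psi] is within delta/4 of the curve. The signed distance to [psi] is thus at
   least 3 delta/4 where that to the curve is at least [delta], and at most delta/2 where it is at
   most delta/4; the scaling sends these two bounds to 1 and 0. *)
pose arg (x : R * R) := (4 / delta * sg) * (x.2 + -1 * psi x) + (- 2).
have Carg k : Ck k arg.
  apply: Ck_affine; apply: CkD; first exact: Ck_snd.
  by apply: CkM; [exact: Ck_cst|exact: smooth_Ck].
have argE x : arg x = 4 / delta * (sg * (x.2 - psi x)) - 2 by rewrite /arg mulN1r mulrA.
have /choice[ds dsE] := @is_derive_sstep R.
have dth j x : is_derive x (dir j) (fun x => sstep (arg x)) (ds (arg x) * 'D_(dir j) arg x).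
  by have [d1 _ _] := dsE (arg x); exact: is_derive_comp1 d1 (Ck_is_derive j x (Carg 1%N)).
have close x : `|x.1| <= M -> `|sg * (x.2 - psi x) - bdist s gamma x| <= delta / 4.
  move=> xM; apply: le_trans (psig x xM); rewrite le_eqVlt; apply/orP; left; apply/eqP.
  rewrite /bdist /sg; case: ifP => _.
    by rewrite mul1r (_ : _ - _ = - (psi x - gamma x.1)) ?normrN//; ring.
  by congr (`|_|); ring.
exists (fun x => sstep (arg x)); split.
- by apply/smoothP => k; exact: Ck_sstep.
- by move=> x; rewrite sstep_ge0 sstep_le1.
- move=> x xM dx; have := close x xM; rewrite ler_norml => /andP[c1 c2].
  have a1 : 1 <= arg x.
    have : 3 / 4 * delta <= sg * (x.2 - psi x) by lra.
    rewrite argE => h; have : 3 <= 4 / delta * (sg * (x.2 - psi x)).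
      by rewrite mulrAC ler_pdivlMr//; lra.
    by lra.
  split; first exact: sstep_eq1.
  move=> j; have [_ ->] := dth j x; have [_ _ ->] := dsE (arg x); first by rewrite mul0r.
  by rewrite negb_and -!leNgt a1 orbT.
- move=> x xM dx; have := close x xM; rewrite ler_norml => /andP[c1 c2].
  apply: sstep_eq0; rewrite argE subr_le0 mulrAC ler_pdivrMr//; lra.
- move=> j x; have [_ ->] := dth j x; have [_ dS _] := dsE (arg x).
  have C2 : Ck 1 (fun x : R * R => x.2 + -1 * psi x).
    by apply: CkD; [exact: Ck_snd|apply: CkM; [exact: Ck_cst|exact: smooth_Ck]].
  have dps := is_deriveZ (-1) (Ck_is_derive j x (smooth_Ck 1 spsi)).
  have da := is_deriveD (is_deriveZ (4 / delta * sg) (is_deriveD (is_derive_snd j x) dps))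
     (is_derive_cst (-2 : R^o) x (dir j)).
  have [_ ->] : is_derive x (dir j) arg (4 / delta * sg *: ((if j == ord0 then 0 else 1) + -1 *: 'D_(dir j) psi x) + 0) := da.
  rewrite addr0 /GRing.scale/= mulN1r.
  rewrite !normrM sg2 mulr1 normfV [`|4|]ger0_norm// [`|delta|]gtr0_norm//.
  have assoc (p q r : R) : p * q * 4 / r = p * (4 / r * q) by ring.
  rewrite (assoc S).
  apply: ler_pM => //; first by rewrite mulr_ge0// divr_ge0// ltW.
  apply: ler_wpM2l; first by rewrite divr_ge0// ltW.
  apply: (le_trans (ler_normB _ _)); apply: lerD; last exact: dpsi.
  by case: ifP => _; rewrite ?normr0 ?normr1.
Qed.

(** The budget of [cut_boundary]: e/4 for the approximation error [qq], e/4 for the energy [yy] of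
    the given function in the layer, e/2 for the trace term [td]. *)
Lemma cut_arith (qq E1 yy td BYY c X q0 e : R) : 0 <= c -> E1 <= 2 * X + BYY ->
  BYY <= 24 * c * td + 12 * c * X -> (24 * c + 1) * td = e / 4 ->
  q0 * (2 + 4 * (2 + 12 * c)) = e / 4 -> 16 * (2 + 12 * c) * yy < e -> 0 < td ->
  0 <= X -> 0 <= qq -> X <= 2 * qq + 2 * yy -> qq < q0 -> 2 * qq + 2 * E1 < e.
Proof.
move=> c0 EEs BY T1e Q1 Y1 td0 X0 q1 EX q.
have h1 : 2 * qq + 2 * E1 <= 2 * qq + 2 * ((2 + 12 * c) * X + 24 * c * td) by nra.
have h2 : (2 + 12 * c) * X <= (2 + 12 * c) * (2 * qq + 2 * yy) by rewrite ler_wpM2l//; lra.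
have h3 : (2 + 4 * (2 + 12 * c)) * qq < (2 + 4 * (2 + 12 * c)) * q0 by rewrite ltr_pM2l//; lra.
nra.
Qed.

(** Cutting off in a layer of width [delta] costs delta^-2 times the squared norm of the function
    there. By [layer_nsq] that norm is of order delta times the squared trace plus delta^2 times the
    energy in the layer. The cost is thus the energy in the layer, small with [delta], plus the
    squared trace over [delta]; so the approximant is chosen after [delta], with a trace small
    compared to it. *)
Lemma cut_boundary Om (s : bool) (gamma : R -> R) (L delta0 : R) u (e : R) : open Om ->
  0 <= L -> 0 < delta0 ->
  (forall p q, `|gamma p - gamma q| <= L * `|p - q|) ->
  measurable_fun setT (derive1 gamma : T1 -> R) ->
  (forall x, Om x -> 0 < bdist s gamma x) ->
  (forall x, 0 < bdist s gamma x < delta0 -> Om x) ->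
  sobolev Om 2%:E 1 u -> is_trace Om gamma u (fun=> 0) -> 0 < e ->
  exists f (r : R), [/\ ctest_fun setT f, 0 < r,
    forall x, bdist s gamma x <= r -> f x = 0 &
    nsqt (jet Om u - zt Om (jetC f)) < e].
Proof.
move=> oOm L0 d00 gL mg Om0 Omd su [phi [tphi phiu phig]] e0.
have mOm := open_plane_measurable oOm.
have [lU wU] := sobolev1_jet oOm su; set U := jet Om u.
(* [C1 / delta] bounds the gradient of the cut-off. [K] counts how often the energy in the layer
   enters the cost: 2 from the damped derivatives and 12 C1^2 from the differentiated cut-off. *)
set S := @sstep_bound R; pose C1 := S * (1 + L * S) * 4; pose K := 2 + 12 * C1 ^+ 2.
have K0 : 2 <= K by rewrite /K lerDl mulr_ge0// sqr_ge0.
have cg : continuous gamma.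
  move=> t; apply/cvgrPdist_lt => a a0.
  have L1 : 0 < L + 1 by lra.
  exists (a / (L + 1)) => /=; first by rewrite divr_gt0.
  move=> y /=; rewrite ltr_pdivlMr// => h; apply: le_lt_trans (gL _ _) _.
  by apply: le_lt_trans h; rewrite mulrC ler_wpM2l// lerDl.
pose lo d t := if s then gamma t else gamma t - d.
have clo d : continuous (lo d).
  by move=> t; rewrite /lo; case: (s); [exact: cg|apply: cvgB; [exact: cg|exact: cvg_cst]].
have loE d x : layer (lo d) d x <-> 0 < bdist s gamma x < d.
  by rewrite /layer /lo /bdist/=; case: (s); split=> /andP[? ?]; apply/andP; split; lra.
pose dn (n : nat) := delta0 / n.+1%:R.
have dn0 n : 0 < dn n by rewrite divr_gt0.
have dn1 n : dn n <= delta0 by rewrite ler_pdivrMr// ler_peMr ?ler1n// ltW.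
pose Ln n : set T2 := layer (lo (dn n)) (dn n).
have mLn n : measurable (Ln n) by apply: open_plane_measurable; apply: layer_open; exact: clo.
have Lnout x : exists N, forall n, (N <= n)%N -> ~ Ln n x.
  have [b0|b0] := leP (bdist s gamma x) 0.
    by exists 0%N => n _ /loE/andP[h _]; rewrite ltNge b0 in h.
  exists (Num.truncn (delta0 / bdist s gamma x)).+1 => n Nn /loE/andP[_].
  apply/negP; rewrite -leNgt /dn ler_pdivrMr// mulrC -ler_pdivrMr//.
  by apply: (le_trans (ltW (truncnS_gt _))); rewrite ler_nat leqW.
have e1 : 0 < e / (16 * K) by rewrite divr_gt0// mulr_gt0//; lra.
have [n0 small] := nsqt_zt_small lU mLn Lnout e1.
set delta := dn n0; have d0 : 0 < delta := dn0 n0.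
set Lay := Ln n0 in small.
have LayO : Lay `<=` Om.
  move=> x /loE/andP[h1 h2]; apply: Omd; rewrite h1/=; apply: lt_le_trans h2 (dn1 n0).
have mLay : measurable Lay by exact: mLn.
pose q0 := e / (4 * (2 + 4 * K)); have q00 : 0 < q0 by rewrite divr_gt0// mulr_gt0//; lra.
pose tau := e * delta / (4 * (24 * C1 ^+ 2 + 1)).
have C10 : 0 <= C1 ^+ 2 by exact: sqr_ge0.
have tau0 : 0 < tau by rewrite divr_gt0// ?mulr_gt0//; lra.
have near0 (x_ : nat -> \bar R) (a : R) : x_ @ \oo --> 0%E -> 0 < a -> \forall n \near \oo, (x_ n < a%:E)%E.
  move=> x0 a0; have /x0 : nbhs (0%E : \bar R) [set y | (y < a%:E)%E].
    by apply: open_ereal_lt'; rewrite lte_fin.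
  by [].
have sq0 (a : R) : 0 < a -> 0 < Num.sqrt a by rewrite sqrtr_gt0.
have [N [HW HC]] : exists N, (W12norm Om (u \- phi N)%R < (Num.sqrt q0)%:E)%E /\
    (curve_L2norm gamma (fun t => (phi N (t, gamma t) - 0)%R) < (Num.sqrt tau)%:E)%E.
  have [N1 _ H1] := near0 _ _ phiu (sq0 _ q00).
  have [N2 _ H2] := near0 _ _ phig (sq0 _ tau0).
  by exists (maxn N1 N2); split; [apply: H1; exact: leq_maxl|apply: H2; exact: leq_maxr].
pose f : R * R -> Rcomplex R := phi N; rewrite -/f in HW HC; have tf : ctest_fun setT f by exact: tphi.
have lJ := ctest_jet_l2t tf; have lzJ : l2t (zt Om (jetC f)) by exact: l2t_zt.
have q : nsqt (U - zt Om (jetC f)) < q0.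
  have [sf af] := ctest_sobolev oOm tf; have [sd ad] := sobolev1B oOm su sf.
  have ld := (sobolev1_jet oOm sd).1.
  have aa : aet (jet Om (u \- f)) (U - zt Om (jetC f)).
    by apply: aet_trans ad _; apply: aetB => // k; exact: aeW.
  have eq_nsq : nsqt (jet Om (u \- f)) = nsqt (U - zt Om (jetC f)).
    by apply: aet_ript => //; exact: l2tB.
  by move: HW; rewrite W12normE// lte_fin ltr_sqrt// eq_nsq.
have [Hre Him] := curve_bound cg mg (sqrtr_ge0 tau) tf HC.
rewrite sqr_sqrtr ?(ltW tau0)// in Hre Him.
have [M1 M10 fM] := test_fun_bounded_supp tf.1.
have [M2 M20 fM'] := test_fun_bounded_supp tf.2.
pose M := Num.max M1 M2.
have fx0 x : M < `|x.1| -> f x = 0.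
  rewrite gt_max => /andP[h1 h2].
  have := (fM ord0 x.1 x.2 h1).1; have := (fM' ord0 x.1 x.2 h2).1.
  by rewrite /axpt/= -surjective_pairing; case: (f x) => a b /= -> ->.
have Jx0 k x : M < `|x.1| -> jetC f k x = 0.
  move=> h; move: k; apply: ord3P => [|j]; rewrite ?jetC_ord0 ?jetC_lift; first exact: fx0.
  move: h; rewrite gt_max => /andP[h1 h2].
  have := (fM ord0 x.1 x.2 h1).2 j; have := (fM' ord0 x.1 x.2 h2).2 j.
  by rewrite /axpt/= -surjective_pairing /cD => -> ->.
have [theta [st th01 th1 th0 dth]] := smooth_cutoff s M L0 d0 gL.
pose g : R * R -> Rcomplex R := fun x => theta x *: f x.
have [tg gD] : ctest_fun setT g /\ forall j x, cD j g x =
    theta x *: (cD j f x : Rcomplex R) + 'D_(dir j) theta x *: f x.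
  exact: (ctest_mul st tf).
have lg := ctest_jet_l2t tg; have lzg : l2t (zt Om (jetC g)) by exact: l2t_zt.
exists g, (delta / 4); split => //; first by rewrite divr_gt0.
  move=> x xd; rewrite /g; have [h|h] := leP `|x.1| M; last by rewrite fx0// scaler0.
  by rewrite th0// scale0r.
set X := nsqt (zt Lay (jetC f)); set Y := nsq (zext Lay f).
have EY : Y <= 4 * delta * tau + 2 * delta ^+ 2 * X.
  have := @layer_nsq R (lo delta) gamma delta tau f d0 (clo _) cg _ tf Hre Him.
  move=> /(_ _)/le_trans; apply.
    by move=> t; rewrite /lo; case: (s); apply/andP; split; lra.
  rewrite lerD2l; apply: ler_wpM2l; first by rewrite mulr_ge0// sqr_ge0.
  apply: le_trans (nsq_le_nsqt (zt Lay (jetC f)) (lift ord0 j2)).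
  by rewrite /zt jetC_lift.
pose B := C1 / delta.
have EE k : nsq ((zt Om (jetC f) - zt Om (jetC g)) k) <=
    2 * nsq (zext Lay (jetC f k)) + (2 * B ^+ 2) * Y.
  have lE := l2tB lzJ lzg.
  apply: l2_le2; [exact: l2_measurable (lE k)|exact: (l2_restrict mLay (lJ k)).1| |].
    by have := (l2_restrict mLay (lJ ord0)).1; rewrite jetC_ord0.
  move=> x; rewrite !fctE /zt.
  have B0 : 0 <= 2 * B ^+ 2 by rewrite mulr_ge0// sqr_ge0.
  have rhs0 : 0 <= 2 * rdot (zext Lay (jetC f k) x) (zext Lay (jetC f k) x) +
      2 * B ^+ 2 * rdot (zext Lay f x) (zext Lay f x).
    by apply: addr_ge0; apply: mulr_ge0 => //; exact: rdot_ge0.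
  have [xO|xO] := pselect (Om x); last by rewrite /zext (memNset xO) subrr rdot0.
  rewrite [zext Om _ x]/zext [zext Om _ x]/zext (mem_set xO).
  have [xM|xM] := leP `|x.1| M; last first.
    have -> : jetC g k x = 0.
      move: (k); apply: ord3P => [|j]; rewrite ?jetC_ord0 ?jetC_lift; first by rewrite /g fx0// scaler0.
      by rewrite gD fx0// -[cD j f]jetC_lift Jx0// !scaler0 addr0.
    by rewrite Jx0// subrr rdot0.
  have [xL|xL] := pselect (Lay x); last first.
    have bd : delta <= bdist s gamma x.
      by rewrite leNgt; apply/negP => h; apply: xL; apply/loE; rewrite h Om0.
    have [t1 dt0] := th1 x xM bd.
    have -> : jetC g k x = jetC f k x.
      move: (k); apply: ord3P => [|j]; rewrite ?jetC_ord0 ?jetC_lift; first by rewrite /g t1 scale1r.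
      by rewrite gD t1 scale1r dt0 scale0r addr0.
    by rewrite subrr rdot0.
  rewrite /zext (mem_set xL).
  have /andP[t0 t1] := th01 x.
  have tt : (1 - theta x) ^+ 2 <= 1 by rewrite -[leRHS](expr1n _ 2) ler_pXn2r ?nnegrE//; lra.
  move: (k); apply: ord3P => [|j]; rewrite ?jetC_ord0 ?jetC_lift.
    have -> : f x - g x = (1 - theta x) *: f x by rewrite scalerBl scale1r.
    rewrite rdotZ; have := rdot_ge0 (f x); have : 0 <= 2 * B ^+ 2 * rdot (f x) (f x).
      by rewrite mulr_ge0// rdot_ge0.
    nra.
  have -> : cD j f x - cD j g x = (1 - theta x) *: (cD j f x : Rcomplex R) - 'D_(dir j) theta x *: f x.
    by rewrite gD scalerBl scale1r opprD addrA.
  apply: (le_trans (rdotB_le _ _)); rewrite !rdotZ; apply: lerD.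
    by rewrite ler_wpM2l// ler_piMl// rdot_ge0.
  rewrite mulrA ler_wpM2r ?rdot_ge0// ler_wpM2l//.
  have dB : `|'D_(dir j) theta x| <= B by exact: dth.
  have B00 : 0 <= B by exact: le_trans dB.
  by rewrite -[leLHS]real_normK ?num_real// ler_pXn2r ?nnegrE.
have EEs : nsqt (zt Om (jetC f) - zt Om (jetC g)) <= 2 * X + 6 * B ^+ 2 * Y.
  apply: (le_trans (ler_sum _ (fun k _ => EE k))).
  rewrite big_split/= -mulr_sumr sumr_const card_ord -mulr_natl.
  by rewrite /X /nsqt /ript /nsq /zt; lra.
have EX : X <= 2 * nsqt (U - zt Om (jetC f)) + 2 * nsqt (zt Lay U).
  have -> : X = nsqt (zt Lay (zt Om (jetC f) - U) + zt Lay U).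
    rewrite /X; congr nsqt; apply/funext => k; apply/funext => x.
    rewrite !fctE /zt /zext; case: ifPn => [xL|_]; last by rewrite addr0.
    rewrite fctE mem_set; first by rewrite [RHS]subrK.
    by apply: LayO; rewrite inE in xL.
  have ld := l2tB lzJ lU.
  apply: le_trans (nsqtD (l2t_zt mLay ld) (l2t_zt mLay lU)) _; rewrite lerD2r ler_wpM2l//.
  by apply: le_trans (nsqt_zt_le mLay ld) _; rewrite nsqtBC.
rewrite (_ : U - _ = (U - zt Om (jetC f)) + (zt Om (jetC f) - zt Om (jetC g))); last first.
  by rewrite addrA subrK.
apply: le_lt_trans (nsqtD (l2tB lU lzJ) (l2tB lzJ lzg)) _.
have BY : 6 * B ^+ 2 * Y <= 24 * C1 ^+ 2 * (tau / delta) + 12 * C1 ^+ 2 * X.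
  apply: (@le_trans _ _ (6 * B ^+ 2 * (4 * delta * tau + 2 * delta ^+ 2 * X))).
    by rewrite ler_wpM2l// mulr_ge0// sqr_ge0.
  rewrite le_eqVlt; apply/orP; left; apply/eqP; rewrite /B; field; exact: lt0r_neq0.
have T1e : (24 * C1 ^+ 2 + 1) * (tau / delta) = e / 4.
  by rewrite /tau; field; rewrite (lt0r_neq0 d0)/= lt0r_neq0//; lra.
have Q1 : q0 * (2 + 4 * K) = e / 4.
  by rewrite /q0; field; rewrite lt0r_neq0//; lra.
have Y1 : 16 * K * nsqt (zt Lay U) < e.
  by rewrite mulrC -ltr_pdivlMr//; lra.
have td0 : 0 < tau / delta by rewrite divr_gt0.
have X0 := nsqt_ge0 (zt Lay (jetC f)); rewrite -/X in X0.
have q1 := nsqt_ge0 (U - zt Om (jetC f)).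
exact: (cut_arith C10 EEs BY T1e Q1 Y1 td0 X0 q1 EX q).
Qed.

End Cutoff.

(** * Gluing the cut-offs at the two boundary curves *)

Section Density.
Context {R : realType}.
Local Notation mu := (@leb2 R).
Local Notation T1 := (measurableTypeR R).
Local Notation dir := (@dir R).
Local Notation re := (@complex.Re R).
Local Notation im := (@complex.Im R).
Local Notation tri := ('I_3 -> R * R -> Rcomplex R).
Implicit Types (Om D : set (R * R)) (u v w f : R * R -> Rcomplex R) (U W P : tri).

Lemma cmeasurable_scale (h : R * R -> R) u : continuous h -> cmeasurable_fun setT u ->
  cmeasurable_fun setT (fun x => h x *: u x).
Proof.
move=> /continuous_plane_measurable mh [mr mi]; split.
  rewrite (_ : (fun x => re _) = (fun x => h x * re (u x))); first exact: measurable_funM.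
  by apply/funext => x; rewrite re_scale.
rewrite (_ : (fun x => im _) = (fun x => h x * im (u x))); first exact: measurable_funM.
by apply/funext => x; rewrite im_scale.
Qed.

Lemma cmeasurableD u v : cmeasurable_fun setT u -> cmeasurable_fun setT v ->
  cmeasurable_fun setT (fun x => u x + v x).
Proof.
move=> [mr mi] [mr' mi']; split.
  rewrite (_ : (fun x => re _) = (fun x => re (u x) + re (v x))); first exact: measurable_funD.
  by apply/funext => x; rewrite reD.
rewrite (_ : (fun x => im _) = (fun x => im (u x) + im (v x))); first exact: measurable_funD.
by apply/funext => x; rewrite imD.
Qed.

Lemma rdotD_le (z z' : R[i]) : rdot (z + z') (z + z') <= 2 * rdot z z + 2 * rdot z' z'.
Proof.
rewrite /rdot !reimE; have := sqr_ge0 (re z - re z'); have := sqr_ge0 (im z - im z').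
lra.
Qed.

(** The Leibniz rule on triples: [a] is a multiplier and [b k] stands for its derivative belonging
    to component [k]. The factor 6 is 2 for each of the three components. *)
Lemma product_jet_bound (a : R * R -> R) (b : 'I_3 -> R * R -> R) (B : R) P :
  continuous a -> (forall k, continuous (b k)) -> (forall x, a x ^+ 2 <= 1) ->
  (forall k x, b k x ^+ 2 <= B) -> l2t P ->
  let A : tri := fun k x => a x *: P k x + b k x *: P ord0 x in
  l2t A /\ nsqt A <= (2 + 6 * B) * nsqt P.
Proof.
move=> ca cb a1 bB lP A.
have mA k : cmeasurable_fun setT (A k).
  by apply: cmeasurableD; apply: cmeasurable_scale => //; exact: l2_measurable.
have B0 : 0 <= B by apply: le_trans (bB ord0 (0, 0)); exact: sqr_ge0.
have pA k x : rdot (A k x) (A k x) <= 2 * rdot (P k x) (P k x) + (2 * B) * rdot (P ord0 x) (P ord0 x).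
  apply: (le_trans (rdotD_le _ _)); rewrite !rdotZ; apply: lerD.
    by rewrite ler_wpM2l// ler_piMl// rdot_ge0.
  by rewrite -mulrA ler_wpM2l// ler_wpM2r// rdot_ge0.
have nA k : nsq (A k) <= 2 * nsq (P k) + (2 * B) * nsq (P ord0) by exact: l2_le2.
split.
  move=> k; apply/l2P; split => //.
  have iPk := rip_integrable (lP k) (lP k); have iP0 := rip_integrable (lP ord0) (lP ord0).
  have ii := integrable_lin 2 (2 * B) iPk iP0.
  have : mu.-integrable setT (EFin \o (fun x => rdot (A k x) (A k x))).
    apply: (le_integrable_real _ ii); last by move=> x; rewrite ger0_norm ?rdot_ge0.
    by have [? ?] := mA k; apply: measurable_funD; exact: measurable_funM.
  move=> iA; rewrite -Rintegral_EFin ?ltry// => x; exact: rdot_ge0.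
apply: (le_trans (ler_sum _ (fun k _ => nA k))).
rewrite big_split/= -mulr_sumr sumr_const card_ord -mulr_natl.
have := nsq_le_nsqt P ord0; rewrite -[\sum_k nsq (P k)]/(nsqt P); nra.
Qed.

(** [cut_boundary] gives one approximant vanishing near each boundary curve. A partition of unity in
    x_2 alone, with its transition between the heights [t0] and [d], glues them. A Lipschitz
    constant of any size is enough. *)
Lemma W12_0_Vsp (g : R -> R) (d t0 L : R) u : 0 <= L ->
  (forall p q, `|g p - g q| <= L * `|p - q|) ->
  measurable_fun setT (derive1 g : T1 -> R) ->
  (forall t, g t <= t0) -> t0 < d ->
  W12_0 (strip g d) [set g; (fun=> d)] u ->
  Vsp (strip g d) (jet (strip g d) u).
Proof.
move=> L0 gL mg gt0 t0d [su tr]; set Om := strip g d.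
have cg : continuous g.
  move=> t; apply/cvgrPdist_lt => a a0.
  have L1 : 0 < L + 1 by lra.
  exists (a / (L + 1)) => /=; first by rewrite divr_gt0.
  move=> y /=; rewrite ltr_pdivlMr// => h; apply: le_lt_trans (gL _ _) _.
  by apply: le_lt_trans h; rewrite mulrC ler_wpM2l// lerDl.
have oOm : open Om by apply: (@strip_open _ g (fun=> d)) => // t; exact: cvg_cst.
have mOm := open_plane_measurable oOm.
have [lU _] := sobolev1_jet oOm su; set U := jet Om u; split => // e e0.
pose d0 := d - t0; have d00 : 0 < d0 by rewrite subr_gt0.
set S := @sstep_bound R; pose B := (S * (3 / d0)) ^+ 2.
have B0 : 0 <= B by exact: sqr_ge0.
have e1 : 0 < e / (4 * (2 + 6 * B)) by rewrite divr_gt0// mulr_gt0//; lra.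
have [f1 [r1 [t1 r10 f1z n1]]] : exists f (r : R), [/\ ctest_fun setT f, 0 < r,
    forall x, bdist true g x <= r -> f x = 0 & nsqt (U - zt Om (jetC f)) < e / (4 * (2 + 6 * B))].
  apply: (cut_boundary oOm L0 d00 gL mg _ _ su _ e1).
  - by move=> x /andP[h _]; rewrite subr_gt0.
  - move=> x /andP[h1 h2]; have := gt0 x.1; rewrite /bdist/= in h1 h2.
    by move=> h3; apply/andP; split; move: h1 h2 h3; rewrite /d0; lra.
  - by apply: tr; left.
have [f2 [r2 [t2 r20 f2z n2]]] : exists f (r : R), [/\ ctest_fun setT f, 0 < r,
    forall x, bdist false (fun=> d) x <= r -> f x = 0 &
    nsqt (U - zt Om (jetC f)) < e / (4 * (2 + 6 * B))].
  apply: (cut_boundary oOm L0 d00 _ _ _ _ su _ e1).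
  - by move=> p q; rewrite subrr normr0 mulr_ge0.
  - rewrite (_ : derive1 (fun=> d) = cst 0); first exact: measurable_cst.
    by apply/funext => t; rewrite derive1E derive_cst.
  - by move=> x /andP[_ h]; rewrite subr_gt0.
  - move=> x /andP[h1 h2]; have := gt0 x.1; rewrite /bdist/= in h1 h2.
    by move=> h3; apply/andP; split; move: h1 h2 h3; rewrite /d0; lra.
  - by apply: tr; right.
(* The partition function is 0 up to height t0 + d0/3 and 1 from t0 + 2 d0/3 on. *)
pose arg (x : R * R) := 3 / d0 * x.2 + - (3 / d0 * t0 + 1).
have Carg k : Ck k arg by apply: Ck_affine; exact: Ck_snd.
pose chi x := sstep (arg x).
have schi : smooth chi by apply/smoothP => k; exact: Ck_sstep.
have argE x : arg x = 3 / d0 * (x.2 - t0) - 1 by rewrite /arg; ring.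
have dchi j x : ('D_(dir j) chi x) ^+ 2 <= B.
  have [ds [d1 dS _]] := is_derive_sstep (arg x).
  have [_ ->] : is_derive x (dir j) chi (ds * (3 / d0 *: (if j == ord0 then 0 else 1) + 0)).
    apply: is_derive_comp1 d1 _.
    exact: is_deriveD (is_deriveZ (3 / d0) (is_derive_snd j x)) (is_derive_cst _ _ _).
  have dd : 0 <= 3 / d0 by rewrite divr_ge0// ltW.
  rewrite addr0 /B exprMn [leRHS]exprMn; apply: ler_pM; rewrite ?sqr_ge0//.
    have S0 : 0 <= S by apply: le_trans dS.
    by rewrite -(real_normK (num_real ds)) ler_pXn2r ?nnegrE.
  by rewrite /GRing.scale/=; case: ifP => _; rewrite ?mulr1// mulr0 expr0n/= sqr_ge0.
have [tw Jw] := ctest_lin (-1) t1 t2; set w := _ *: _ + _ in tw Jw.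
pose v : R * R -> Rcomplex R := fun x => chi x *: w x.
have [tv vD] : ctest_fun setT v /\ forall j x, cD j v x =
    chi x *: (cD j w x : Rcomplex R) + 'D_(dir j) chi x *: w x by exact: ctest_mul.
have [tf Jf] := ctest_lin 1 tv t1; set f := _ *: _ + _ in tf Jf.
have fE x : f x = (1 - chi x) *: f1 x + chi x *: f2 x.
  rewrite /f /v /w !fctE scale1r scaleN1r scalerBl scale1r scalerDr scalerN.
  by rewrite addrC addrA addrAC.
pose r := Num.min r1 (Num.min r2 (d0 / 3)).
have rr1 : r <= r1 by rewrite /r ge_min lexx.
have rr2 : r <= r2 by rewrite /r !ge_min lexx orbT.
have rr3 : r <= d0 / 3 by rewrite /r !ge_min lexx !orbT.
have r0 : 0 < r by rewrite /r !lt_min r10 r20/= divr_gt0.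
(* Below the lower curve or closer than [r] to it, [f] coincides with [f1], and near the top with
   [f2]; each vanishes there. The bound r <= d0/3 keeps both zones off the transition. *)
have f0 x : ~ (r <= x.2 - g x.1 /\ r <= d - x.2) -> f x = 0.
  move=> /not_andP[] /negP; rewrite -ltNge => h; rewrite fE.
    have f1x : f1 x = 0 by apply: f1z; rewrite /bdist/= (le_trans (ltW h)).
    have chi0 : chi x = 0.
      apply: sstep_eq0; rewrite argE subr_le0 mulrAC ler_pdivrMr// mul1r.
      by have := gt0 x.1; lra.
    by rewrite f1x chi0 scaler0 scale0r addr0.
  have f2x : f2 x = 0 by apply: f2z; rewrite /bdist/= (le_trans (ltW h)).
  have chi1 : chi x = 1.
    apply: sstep_eq1; rewrite argE lerBrDr mulrAC ler_pdivlMr//.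
    by move: h rr3; rewrite /d0; lra.
  by rewrite f2x chi1 subrr scaler0 scale0r addr0.
have tfOm : ctest_fun Om f.
  have H (h : R[i] -> R) : h 0 = 0 -> test_fun setT (fun x => h (f x)) -> test_fun Om (fun x => h (f x)).
    move=> h0 /test_funP[sh [K [cK _ K0]]]; apply/test_funP; split => //.
    pose C := [set x : R * R | r <= x.2 - g x.1 /\ r <= d - x.2].
    exists (K `&` C); split.
    - apply: compact_closedI => //.
      have c1 : continuous (fun x : R * R => x.2 - g x.1).
        move=> x; apply: cvgB; first exact: cvg_snd.
        by apply: continuous_comp; [exact: cvg_fst|exact: cg].
      have c2 : continuous (fun x : R * R => d - x.2).
        by move=> x; apply: cvgB; [exact: cvg_cst|exact: cvg_snd].
      rewrite (_ : C = (fun x : R * R => x.2 - g x.1) @^-1` [set y | r <= y] `&`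
        (fun x : R * R => d - x.2) @^-1` [set y | r <= y])//.
      by apply: closedI; apply: preimage_closed => //; exact: closed_ge.
    - by move=> x [_ [h1 h2]]; apply/andP; split; lra.
    - move=> x /not_andP[/K0//|nC]; by rewrite f0.
  by have [h1 h2] := tf; split; exact: H.
exists f => //.
pose P : tri := U - zt Om (jetC f1); pose Q : tri := U - zt Om (jetC f2).
have lP : l2t P by apply: l2tB => //; apply: l2t_zt => //; exact: ctest_jet_l2t t1.
have lQ : l2t Q by apply: l2tB => //; apply: l2t_zt => //; exact: ctest_jet_l2t t2.
have cchi : continuous chi by have [] := smooth_Ck 0 schi.
have dchic j : continuous ('D_(dir j) chi).
  by have [_ /(_ j)[_ [C1 _]]] := smooth_Ck 1 schi.
pose b (k : 'I_3) : R * R -> R := if unlift ord0 k is Some j then 'D_(dir j) chi else (fun=> 0).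
have cb k : continuous (b k).
  by rewrite /b; case: (unlift ord0 k) => [j|]; [exact: dchic|move=> x; exact: cvg_cst].
have bB k x : b k x ^+ 2 <= B.
  by rewrite /b; case: (unlift ord0 k) => [j|]; [exact: dchi|rewrite expr0n].
have ch01 x : 0 <= chi x <= 1 by rewrite sstep_ge0 sstep_le1.
have sq1 (p : R) : 0 <= p <= 1 -> p ^+ 2 <= 1 by move=> /andP[p0 p1]; rewrite expr_le1.
have c1chi : continuous (fun x => 1 - chi x).
  by move=> x; apply: cvgB; [exact: cvg_cst|exact: cchi].
have cNb k : continuous (fun x => - b k x) by move=> x; apply: cvgN; exact: cb.
have bBN k x : (- b k x) ^+ 2 <= B by rewrite sqrrN.
have ch1 x : (1 - chi x) ^+ 2 <= 1 by apply: sq1; have /andP[? ?] := ch01 x; lra.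
have [lA nA] := @product_jet_bound (fun x => 1 - chi x) (fun k x => - b k x) B P c1chi cNb ch1 bBN lP.
have [lA' nA'] := @product_jet_bound chi b B Q cchi cb (fun x => sq1 _ (ch01 x)) bB lQ.
set A := (X in l2t X) in lA nA; set A' := (X in l2t X) in lA' nA'.
have ztE V k x : Om x -> zt Om V k x = V k x by move=> xO; rewrite /zt /zext mem_set.
have zt0 V k x : ~ Om x -> zt Om V k x = 0 by move=> xO; rewrite /zt /zext memNset.
have U0 k x : ~ Om x -> U k x = 0.
  by move=> xO; move: k; apply: ord3P => [|j]; rewrite /U /jet ?mktri0 ?mktriS /zext memNset.
(* The error is (1 - chi) times the first error plus chi times the second; the Leibniz terms involve
   only the difference of the two errors. *)
have E : U - jetC f = A + A'.
  apply/funext => k; apply/funext => x; rewrite !fctE /A /A' /P /Q !fctE.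
  have [xO|xO] := pselect (Om x); last first.
    by rewrite !zt0// !U0// (jetC_eq0 _ tfOm xO) !subr0 !scaler0 !addr0.
  have w0 : jetC w ord0 x = f2 x - f1 x.
    by rewrite /jetC mktri0 /w !fctE scaleN1r addrC.
  have v0 : jetC f k x = jetC f1 k x + (chi x *: (jetC f2 k x - jetC f1 k x) +
      b k x *: (jetC f2 ord0 x - jetC f1 ord0 x)).
    have wE l : jetC w l x = jetC f2 l x - jetC f1 l x.
      by rewrite Jw !fctE scaleN1r addrC.
    rewrite Jf !fctE scale1r addrC; congr (_ + _); rewrite -!wE.
    move: k; apply: ord3P => [|j]; rewrite /jetC ?mktri0 ?mktriS.
      by rewrite /b unlift_none scale0r addr0.
    by rewrite vD /b liftK.
  rewrite !ztE// v0; generalize (U k x) (U ord0 x) (jetC f1 k x) (jetC f2 k x)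
    (jetC f1 ord0 x) (jetC f2 ord0 x) (chi x) (b k x) => z1 z2 z3 z4 z5 z6 c' b'.
  case: z1 z2 z3 z4 z5 z6 => [p1 q1] [p2 q2] [p3 q3] [p4 q4] [p5 q5] [p6 q6].
  by apply/eqP; rewrite eq_complex /=; apply/andP; split; apply/eqP; ring.
rewrite E; apply: (le_lt_trans (nsqtD lA lA')).
have B6 : 0 < 2 + 6 * B by lra.
have : (2 + 6 * B) * nsqt P < e / 4.
  by rewrite mulrC -ltr_pdivlMr// -mulrA -invfM.
have : (2 + 6 * B) * nsqt Q < e / 4.
  by rewrite mulrC -ltr_pdivlMr// -mulrA -invfM.
lra.
Qed.

End Density.

(** * Stretching test functions *)

Section Stretch.
Context {R : realType}.
Local Notation mu := (@leb2 R).
Local Notation T2 := (measurableTypeR R * measurableTypeR R)%type.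
Local Notation dir := (@dir R).
Local Notation re := (@complex.Re R).
Local Notation im := (@complex.Im R).
Local Notation j2 := (lift ord0 ord0 : 'I_2).
Implicit Types (Om D : set (R * R)) (m h N : R * R -> R) (u v w f : R * R -> Rcomplex R).
Variable d : R.

Lemma stretchK (s : R) (x : R * R) : s != 0 -> stretch d s^-1 (stretch d s x) = x.
Proof. by move=> s0; case: x => a b; rewrite /stretch/=; congr pair; field. Qed.

Lemma test_fun_stretch Om Om' h s : 0 < s -> test_fun Om h ->
  (forall x, Om (stretch d s x) -> Om' x) -> test_fun Om' (fun x => h (stretch d s x)).
Proof.
move=> s0 /test_funP[sh [K [cK KO K0]]] OO; have s1 := lt0r_neq0 s0; apply/test_funP; split.
  by apply/smoothP => k; apply: Ck_stretch; exact: smooth_Ck.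
exists (stretch d s^-1 @` K); split.
- apply: continuous_compact => //; apply: continuous_subspaceT; exact: continuous_stretch.
- move=> _ [y /KO Ky <-]; apply: OO; have := @stretchK s^-1 y; rewrite invrK => -> //.
  by rewrite invr_neq0.
- move=> x nx; apply: K0 => Kx; apply: nx; exists (stretch d s x) => //; exact: stretchK.
Qed.

Lemma test_fun_bounded Om h : test_fun Om h -> exists2 C : R, 0 < C & forall x, `|h x| <= C.
Proof.
move=> th; have /test_funP[_ [K [cK _ K0]]] := th.
have : compact (h @` K).
  apply: continuous_compact => //; apply: continuous_subspaceT; exact: test_fun_continuous th.
move=> /compact_bounded[C [_ HC]]; exists (`|C| + 1); first by rewrite ltr_wpDl.
move=> x; have [xK|xK] := pselect (K x).
  by apply: HC; [rewrite ltr_pwDr// ler_norm|exists x].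
by rewrite K0// normr0 addr_ge0.
Qed.

(** A single rectangle carries all stretched functions with factor above 1/2; this is the domination
    for differentiating under the integral. *)
Lemma stretch_supp Om h : test_fun Om h -> exists2 M : R, 0 < M &
  forall s x, 2^-1 < s -> ~ crect (- M) M (- M) M x ->
    h (stretch d s x) = 0 /\ forall i, 'D_(dir i) h (stretch d s x) = 0.
Proof.
move=> th; have [M M0 HM] := test_fun_bounded_supp th.
pose N := 2 * M + 3 * `|d|; have d0 := normr_ge0 d.
exists N; first by rewrite /N; lra.
move=> s x s2 nx.
have [h1|h1] := ltP M `|x.1|.
  by have := HM ord0 x.1 (d - s * (d - x.2)) h1.
have [h2|h2] := ltP M `|d - s * (d - x.2)|.
  by have := HM j2 (d - s * (d - x.2)) x.1 h2.
case: nx; split => /=; rewrite in_itv/= -ler_norml; first by rewrite /N; lra.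
have h3 : s * `|d - x.2| <= M + `|d|.
  have s0 : 0 <= s by lra.
  rewrite -{1}(ger0_norm s0) -normrM -[X in `|X|](subKr d).
  by apply: (le_trans (ler_normB _ _)); lra.
have h4 : `|x.2| <= `|d| + `|d - x.2|.
  by rewrite -{1}(subKr d x.2); exact: ler_normB.
by have := normr_ge0 (d - x.2); rewrite /N; nra.
Qed.

Lemma is_derive_stretch_param Om h (s : R) x : test_fun Om h ->
  is_derive s (1 : R) (fun s => h (stretch d s x))
    (- (d - x.2) * 'D_(dir j2) h (stretch d s x)).
Proof.
move=> th; pose p t := h (axpt j2 t x.1).
have dp t : is_derive t (1 : R) p ('D_(dir j2) h (axpt j2 t x.1)).
  by apply: is_derive_axpt; exact: test_fun_is_derive th.
rewrite mulrC.
apply: (@is_derive1_comp _ p (fun s => d - s * (d - x.2))).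
have e : (fun s : R => d - s * (d - x.2)) = (fun s : R => (- (d - x.2)) *: s + d).
  by apply/funext => t; rewrite /GRing.scale/=; ring.
rewrite e -[X in is_derive _ _ _ X]addr0 -[X in is_derive _ _ _ (X + _)]mulr1.
exact: (is_deriveD (is_deriveZ (- (d - x.2)) (is_derive_id s (1 : R))) (is_derive_cst d s (1 : R))).
Qed.

Lemma weighted_integrable m (M : R) h (K : set (R * R)) : measurable_fun setT (m : T2 -> R) ->
  (forall x, `|m x| <= M) -> continuous h -> compact K -> (forall x, ~ K x -> h x = 0) ->
  mu.-integrable setT (EFin \o (fun x => m x * h x)).
Proof.
move=> mm mM ch cK h0.
have chn : continuous (fun x => `|h x|).
  by move=> x; apply: cvg_norm; exact: ch.
have hn0 x : ~ K x -> `|h x| = 0 by move=> /h0 ->; rewrite normr0.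
have ih := compact_supp_integrable chn cK hn0.
have iM := integrable_lin M 0 ih ih.
apply: (le_integrable_real _ iM).
  by apply: measurable_funM => //; exact: continuous_plane_measurable.
by move=> x; rewrite mul0r addr0 normrM ler_wpM2r.
Qed.

Lemma stretch_integral_derive m (M : R) Om h (s : R) : measurable_fun setT (m : T2 -> R) ->
  (forall x, `|m x| <= M) -> test_fun Om h -> 2^-1 < s < 3 ->
  is_derive s (1 : R) (fun s => \int[mu]_x (m x * h (stretch d s x)))
    (\int[mu]_x (m x * (- (d - x.2) * 'D_(dir j2) h (stretch d s x)))).
Proof.
move=> mm mM th s23; have [N N0 HN] := stretch_supp th.
have tD := test_fun_derive j2 th; have [C C0 HC] := test_fun_bounded tD.
pose Q := crect (- N) N (- N) N; have mQ : measurable (Q : set T2) by exact: crect_measurable.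
have M0 : 0 <= M by apply: le_trans (mM (0, 0)).
pose f (s : R) (x : T2) := m x * h (stretch d s x).
have df (t : R) x : is_derive t (1 : R) (f ^~ x) (m x * (- (d - x.2) * 'D_(dir j2) h (stretch d t x))).
  exact: (is_deriveZ (m x) (is_derive_stretch_param t x th)).
have p1 (t : R) x : partial1of2 f t x = m x * (- (d - x.2) * 'D_(dir j2) h (stretch d t x)).
  by rewrite partial1of2E; have [_ ->] := df t x.
pose c := M * ((`|d| + N) * C); have c0 : 0 <= c by rewrite !mulr_ge0// ?addr_ge0// ltW.
pose G (x : T2) := c * \1_Q x.
have G0 x : 0 <= G x by rewrite mulr_ge0// indicE.
have iQ : mu.-integrable setT (EFin \o \1_Q).
  apply: ge0_integrable; first exact: measurable_indic.
    by move=> x; rewrite indicE.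
  rewrite (@integral_indic _ T2 R mu setT)// setIT; exact: crect_finite.
have iG : mu.-integrable setT (EFin \o G).
  have := integrable_lin c 0 iQ iQ; apply: eq_integrable => // x _ /=.
  by rewrite mul0r addr0.
have Gub t x : 2^-1 < t -> `|partial1of2 f t x| <= G x.
  move=> t2; rewrite p1 /G indicE; have [xQ|xQ] := pselect (Q x); last first.
    by have [_ ->] := HN t x t2 xQ; rewrite !mulr0 normr0 memNset// mulr0.
  rewrite mem_set// mulr1 /c normrM; apply: ler_pM => //.
  rewrite normrM; apply: ler_pM => //; rewrite normrN.
  apply: (le_trans (ler_normB _ _)); rewrite lerD2l.
  by case: xQ => _ /=; rewrite in_itv/= -ler_norml.
(* An open interval around the range [1, 2] of the stretching factors in use. *)
pose I := `](2^-1 : R), (3 : R)[.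
have Is : [set` I] s by rewrite /= in_itv.
have It t : [set` I] t -> 2^-1 < t by rewrite /= in_itv/= => /andP[].
have intf t : [set` I] t -> mu.-integrable setT (EFin \o f t).
  move=> /It t2; apply: (weighted_integrable mm mM (K := Q)).
  - by move=> x; apply: continuous_comp; [exact: continuous_stretch|exact: test_fun_continuous th _].
  - exact: crect_compact.
  - by move=> x xQ; have [] := HN t x t2 xQ.
have derf t x : [set` I] t -> setT x -> derivable (f^~ x) t 1 by move=> _ _; have [] := df t x.
have Gub' t x : [set` I] t -> setT x -> `|partial1of2 f t x| <= G x by move=> /It t2 _; exact: Gub.
have D1 := @derivable_under_integral R _ T2 mu f setT measurableT s _ _ Is intf derf G G0 iG Gub'.
have D2 := @differentiation_under_integral R _ T2 mu f setT measurableT s _ _ Is intf derf G G0 iG Gub'.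
apply: DeriveDef => //; rewrite -derive1E D2.
by apply: eq_Rintegral => x _; rewrite p1.
Qed.

Lemma mean_value_le (F F' : R -> R) (k C : R) : 1 <= k <= 2 ->
  (forall s : R, 1 <= s <= k -> is_derive s (1 : R) F (F' s)) ->
  (forall s : R, 1 <= s <= k -> `|F' s| <= C) -> `|F k - F 1| <= C * (k - 1).
Proof.
move=> /andP[k1 k2] dF FC.
have dF' x : x \in `]1, k[ -> is_derive x (1 : R) F (F' x).
  by rewrite in_itv/= => /andP[x1 xk]; apply: dF; rewrite !ltW.
have cF : {within `[1, k], continuous F}.
  by apply: derivable_within_continuous => x; rewrite in_itv/= => h; have [] := dF x h.
have [c] := MVT_segment k1 dF' cF.
rewrite in_itv/= => h ->; rewrite normrM ler_pM//; first exact: FC.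
by rewrite ger0_norm// subr_ge0.
Qed.

Lemma stretch1 x : stretch d 1 x = x.
Proof. by case: x => p q; rewrite /stretch/= mul1r subKr. Qed.

(* The field along which the stretched function is transported: differentiating
   s * h(stretch d s x) in s gives the x_2-derivative of this flux. *)
Definition flux (s : R) h (x : R * R) : R := - (d - x.2) * h (stretch d s x).

Lemma flux_test Om Om' h s : 0 < s -> test_fun Om h ->
  (forall x, Om (stretch d s x) -> Om' x) -> test_fun Om' (flux s h) /\
  forall x, 'D_(dir j2) (flux s h) x =
    h (stretch d s x) + s * (- (d - x.2) * 'D_(dir j2) h (stretch d s x)).
Proof.
move=> s0 th OO; have ts := test_fun_stretch s0 th OO; split.
  apply: test_funM ts _; apply/smoothP => k.
  rewrite (_ : (fun x => _) = fun x : R * R => 1 * x.2 + - d); last first.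
    by apply/funext => x; ring.
  by apply: Ck_affine; exact: Ck_snd.
move=> x; have dh : is_derive x (dir j2) (fun y => h (stretch d s y)) (s * 'D_(dir j2) h (stretch d s x)).
  by have := is_derive_stretch (test_fun_is_derive j2 (stretch d s x) th).
have da : is_derive x (dir j2) (fun y : R * R => - (d - y.2)) 1.
  rewrite (_ : (fun y => _) = (fun y : R * R => y.2 + - d)); last by apply/funext => y; ring.
  by rewrite -[X in is_derive _ _ _ X]addr0; exact: (is_deriveD (is_derive_snd j2 x) (is_derive_cst _ _ _)).
have [_ ->] := is_deriveM da dh.
by rewrite /GRing.scale/=; ring.
Qed.

(** The factor [s] compensates the Jacobian of the stretching: with it, the derivative in [s] is a
    pure x_2-derivative of the flux, ready for integration by parts. *)
Lemma scaled_integral_derive m (M : R) Om h (s : R) : measurable_fun setT (m : T2 -> R) ->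
  (forall x, `|m x| <= M) -> test_fun Om h -> 2^-1 < s < 3 ->
  is_derive s (1 : R) (fun s => s * \int[mu]_x (m x * h (stretch d s x)))
    (\int[mu]_x (m x * 'D_(dir j2) (flux s h) x)).
Proof.
move=> mm mM th s23; have s0 : 0 < s by have /andP[] := s23; lra.
have dI := stretch_integral_derive mm mM th s23.
have [tf fD] := @flux_test Om setT h s s0 th (fun _ _ => I).
have ts := @test_fun_stretch Om setT h s s0 th (fun _ _ => I).
have int psi : test_fun setT psi -> mu.-integrable setT (EFin \o (fun x => m x * psi x)).
  move=> tpsi; have /test_funP[_ [K [cK _ K0]]] := tpsi.
  exact: weighted_integrable mm mM (test_fun_continuous tpsi) cK K0.
have i1 := int _ ts; have i2 := int _ (test_fun_derive j2 tf).
pose q x := m x * (- (d - x.2) * 'D_(dir j2) h (stretch d s x)).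
have iq : mu.-integrable setT (EFin \o q).
  have := integrable_lin s^-1 (- s^-1) i2 i1; apply: eq_integrable => // x _ /=; congr (_%:E).
  by rewrite fD /q; field; exact: lt0r_neq0.
have e : \int[mu]_x (m x * 'D_(dir j2) (flux s h) x) =
    s * \int[mu]_x q x + \int[mu]_x (m x * h (stretch d s x)).
  rewrite -RintegralZl// -RintegralD//; last first.
    by have := integrable_lin s 0 iq iq; apply: eq_integrable => // x _ /=; rewrite mul0r addr0.
  by apply: eq_Rintegral => x _; rewrite fD /q; ring.
rewrite e; have := is_deriveM (is_derive_id s (1 : R)) dI.
rewrite (_ : _ *: _ + _ *: _ = s * \int[mu]_x q x + \int[mu]_x (m x * h (stretch d s x)))//.
by rewrite /GRing.scale/= mulr1.
Qed.

(** Change of variables as constancy in [k]: with weight 1 the derivative in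
    [scaled_integral_derive] is the integral of a derivative of a test function, hence 0. *)
Lemma stretch_integral Om N (k : R) : 1 <= k <= 2 -> test_fun Om N ->
  k * \int[mu]_x N (stretch d k x) = \int[mu]_x N x.
Proof.
move=> k12 tN.
have m1 : measurable_fun setT (cst 1 : T2 -> R) by exact: measurable_cst.
have b1 (x : R * R) : `|cst 1 x| <= 1 :> R by rewrite normr1.
have itv (s : R) : 1 <= s <= k -> 2^-1 < s < 3 by case/andP: k12 => ? ? /andP[? ?]; apply/andP; split; lra.
have dF (s : R) : 1 <= s <= k ->
    is_derive s (1 : R) (fun s => s * \int[mu]_x (cst 1 x * N (stretch d s x)))
    (\int[mu]_x (cst 1 x * 'D_(dir j2) (flux s N) x)).
  by move=> /itv; exact: scaled_integral_derive m1 b1 tN.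
have F0 (s : R) : 1 <= s <= k -> `|\int[mu]_x (cst 1 x * 'D_(dir j2) (flux s N) x)| <= 0.
  move=> /itv/andP[s2 _]; have s0 : 0 < s by lra.
  have [tf _] := @flux_test Om setT N s s0 tN (fun _ _ => I).
  under eq_Rintegral do rewrite mul1r.
  by rewrite (int_derive0 _ tf) normr0.
have := mean_value_le k12 dF F0; rewrite mul0r normr_le0 subr_eq0 mul1r => /eqP.
under eq_Rintegral do rewrite mul1r.
by move=> ->; apply: eq_Rintegral => x _; rewrite stretch1 mul1r.
Qed.

Hypothesis d0 : 0 < d.
Local Notation Om0 := (strip (@flat R) d).

(** For [s >= 1] this keeps the flux a test function of the strip and bounds its weight d - x_2 by
    [d]. *)
Lemma stretch_strip (s : R) x : 1 <= s -> Om0 (stretch d s x) -> Om0 x /\ 0 <= d - x.2 <= d.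
Proof.
rewrite /strip /flat /stretch /= => s1 /andP[h1 h2].
have h3 : 0 < d - x.2 by nra.
have h4 : d - x.2 < d by nra.
by split; apply/andP; split; lra.
Qed.

Lemma stretch_integral_le (c k : R) (f : T2 -> R) Om N : 0 <= c -> 1 <= k <= 2 -> test_fun Om N ->
  (forall x, 0 <= N x) -> mu.-integrable setT (EFin \o f) ->
  (forall x, `|f x| <= c * N (stretch d k x)) -> `|\int[mu]_x f x| <= c * \int[mu]_x N x.
Proof.
move=> c0 k12 tN N0 intf fN; have k0 : 0 < k by have /andP[] := k12; lra.
have ts := @test_fun_stretch Om setT N k k0 tN (fun _ _ => I).
have iN := test_fun_integrable ts.
apply: (le_trans (le_normr_Rintegral measurableT intf)).
apply: (@le_trans _ _ (\int[mu]_x (c * N (stretch d k x)))).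
  apply: le_Rintegral => //; first by have := integrable_norm intf.
  by have := integrable_lin c 0 iN iN; apply: eq_integrable => // x _ /=; rewrite mul0r addr0.
rewrite RintegralZl// ler_wpM2l// -(stretch_integral k12 tN) ler_peMl//.
  by apply: Rintegral_ge0 => x _; exact: N0.
by have /andP[] := k12.
Qed.

(** The mean value theorem in the stretching factor. Since the flux is a test function of the strip,
    where the weak derivative [m'] is available, the x_2-derivative moves onto the coefficient. *)
Lemma stretch_weak_le m m' (M L k : R) h N : measurable_fun setT (m : T2 -> R) ->
  (forall x, `|m x| <= M) -> measurable_fun setT (m' : T2 -> R) -> (forall x, `|m' x| <= L) ->
  (forall psi, test_fun Om0 psi ->
    \int[mu]_x (m x * 'D_(dir j2) psi x) = - \int[mu]_x (m' x * psi x)) ->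
  test_fun Om0 h -> test_fun setT N -> (forall x, `|h x| <= N x) -> 1 <= k <= 2 ->
  `|k * \int[mu]_x (m x * h (stretch d k x)) - \int[mu]_x (m x * h x)| <=
    L * d * (\int[mu]_x N x) * (k - 1).
Proof.
move=> mm mM mm' mL wm th tN hN k12.
have L0 : 0 <= L by apply: le_trans (mL (0, 0)).
have itv (s : R) : 1 <= s <= k -> 2^-1 < s < 3 by case/andP: k12 => ? ? /andP[? ?]; apply/andP; split; lra.
have -> : \int[mu]_x (m x * h x) = 1 * \int[mu]_x (m x * h (stretch d 1 x)).
  by rewrite mul1r; apply: eq_Rintegral => x _; rewrite stretch1.
apply: (mean_value_le (F := fun s => s * \int[mu]_x (m x * h (stretch d s x))) k12) => s s1k.
  exact: scaled_integral_derive mm mM th (itv s s1k).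
have [s1 sk] := andP s1k; have s0 : 0 < s by lra.
have [tf _] := flux_test s0 th (fun x hx => (stretch_strip s1 hx).1).
rewrite wm// normrN.
have /test_funP[_ [K [cK _ K0]]] := tf.
apply: (@stretch_integral_le (L * d) s _ setT) => //.
- by rewrite mulr_ge0// ltW.
- by rewrite s1/=; have /andP[_ ?] := k12; lra.
- by move=> x; apply: le_trans (hN x).
- exact: weighted_integrable mm' mL (test_fun_continuous tf) cK K0.
- move=> x; rewrite normrM -mulrA; apply: ler_pM => //.
  rewrite /flux normrM normrN; have [xs|xs] := pselect (Om0 (stretch d s x)).
    have [_ /andP[h1 h2]] := stretch_strip s1 xs.
    by apply: ler_pM => //; rewrite ger0_norm.
  rewrite (test_fun_eq0 th xs) normr0 mulr0 mulr_ge0//; first exact: ltW.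
  exact: le_trans (normr_ge0 _) (hN _).
Qed.

(** [m] has no derivative at its disposal, so [h] is differentiated instead, and [N] has to dominate
    that derivative. *)
Lemma stretch_bounded_le m (M k : R) h N : measurable_fun setT (m : T2 -> R) ->
  (forall x, `|m x| <= M) -> test_fun Om0 h -> test_fun setT N ->
  (forall x, `|'D_(dir j2) h x| <= N x) -> 1 <= k <= 2 ->
  `|\int[mu]_x (m x * h (stretch d k x)) - \int[mu]_x (m x * h x)| <=
    M * d * (\int[mu]_x N x) * (k - 1).
Proof.
move=> mm mM th tN hN k12.
have M0 : 0 <= M by apply: le_trans (mM (0, 0)).
have itv (s : R) : 1 <= s <= k -> 2^-1 < s < 3 by case/andP: k12 => ? ? /andP[? ?]; apply/andP; split; lra.
have -> : \int[mu]_x (m x * h x) = \int[mu]_x (m x * h (stretch d 1 x)).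
  by apply: eq_Rintegral => x _; rewrite stretch1.
apply: (mean_value_le (F := fun s => \int[mu]_x (m x * h (stretch d s x))) k12) => s s1k.
  exact: stretch_integral_derive mm mM th (itv s s1k).
have [s1 sk] := andP s1k; have s0 : 0 < s by lra.
have tD := test_fun_derive j2 th.
have [tf _] := flux_test s0 tD (fun x hx => (stretch_strip s1 hx).1).
have /test_funP[_ [K [cK _ K0]]] := tf.
apply: (@stretch_integral_le (M * d) s _ setT) => //.
- by rewrite mulr_ge0// ltW.
- by rewrite s1/=; have /andP[_ ?] := k12; lra.
- by move=> x; apply: le_trans (hN x).
- exact: weighted_integrable mm mM (test_fun_continuous tf) cK K0.
- move=> x; rewrite normrM -mulrA; apply: ler_pM => //.
  rewrite normrM normrN; have [xs|xs] := pselect (Om0 (stretch d s x)).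
    have [_ /andP[h1 h2]] := stretch_strip s1 xs.
    by apply: ler_pM => //; rewrite ger0_norm.
  rewrite (test_fun_eq0 tD xs) normr0 mulr0 mulr_ge0//; first exact: ltW.
  exact: le_trans (normr_ge0 _) (hN _).
Qed.

Lemma test_fun_rdot Om u : ctest_fun Om u -> test_fun Om (fun x => rdot (u x) (u x)).
Proof. by move=> [t1 t2]; apply: test_funD; apply: test_funM => //; [case: t1|case: t2]. Qed.

Lemma nsq_stretch Om u (k : R) : ctest_fun Om u -> 1 <= k <= 2 ->
  k * nsq (fun x => u (stretch d k x)) = nsq u.
Proof. by move=> /test_fun_rdot tu k12; exact: (stretch_integral k12 tu). Qed.

Lemma ctest_stretch Om Om' u s : 0 < s -> ctest_fun Om u ->
  (forall x, Om (stretch d s x) -> Om' x) -> ctest_fun Om' (fun x => u (stretch d s x)).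
Proof.
move=> s0 [t1 t2] OO.
by split; [exact: test_fun_stretch s0 t1 OO|exact: test_fun_stretch s0 t2 OO].
Qed.

(** The increment p is paired with itself, which reduces the matter to the scalar function s |-> <p,
    u o stretch s>. Its derivative is at most d |p| |D u|, and after the mean value theorem one
    factor |p| cancels. *)
Lemma stretch_l2_le u (k : R) : ctest_fun Om0 u -> 1 <= k <= 2 ->
  nsq ((fun x => u (stretch d k x)) - u) <= (d * (k - 1)) ^+ 2 * nsq (cD j2 u).
Proof.
move=> tu k12; have [tr ti] := tu; have [k1 k2] := andP k12; have k0 : 0 < k by lra.
have tuk : ctest_fun Om0 (fun x => u (stretch d k x)).
  by apply: (ctest_stretch k0 tu) => x /(stretch_strip k1)[].
have [tp _] := ctest_lin (-1) tu tuk; set psi := (X in X - u).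
have psiE : psi - u = -1 *: u + (fun x => u (stretch d k x)).
  by rewrite scaleN1r addrC.
rewrite psiE; move: tp; set p := _ + _ => tp {psiE psi}.
have lp := ctest_l2 tp; have [tpr tpi] := tp; have [mpr mpi] := l2_measurable lp.
have [Cr _ HCr] := test_fun_bounded tpr; have [Ci _ HCi] := test_fun_bounded tpi.
have tD := ctest_fun_cD j2 tu; have [tDr tDi] := tD.
pose g s x : Rcomplex R := Complex (flux s ('D_(dir j2) (fun x => re (u x))) x)
  (flux s ('D_(dir j2) (fun x => im (u x))) x).
have tg s : 1 <= s -> ctest_fun Om0 (g s).
  move=> s1; have s0 : 0 < s by lra.
  split; first exact: (flux_test s0 tDr (fun x hx => (stretch_strip s1 hx).1)).1.
  exact: (flux_test s0 tDi (fun x hx => (stretch_strip s1 hx).1)).1.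
have split_int v : ctest_fun Om0 v ->
    rip p v = \int[mu]_x (re (p x) * re (v x)) + \int[mu]_x (im (p x) * im (v x)).
  move=> [t1 t2]; rewrite -RintegralD//; last 2 first.
  - by apply: test_fun_integrable; apply: test_funM t1 _; case: tpr.
  - by apply: test_fun_integrable; apply: test_funM t2 _; case: tpi.
pose E s := \int[mu]_x (re (p x) * re (u (stretch d s x))) + \int[mu]_x (im (p x) * im (u (stretch d s x))).
have itv (s : R) : 1 <= s <= k -> 2^-1 < s < 3 by move=> /andP[? ?]; apply/andP; split; lra.
have dE (s : R) : 1 <= s <= k -> is_derive s (1 : R) E (rip p (g s)).
  move=> s1k; rewrite split_int; last by apply: tg; case/andP: s1k.
  have dr := stretch_integral_derive mpr HCr tr (itv s s1k).
  have di := stretch_integral_derive mpi HCi ti (itv s s1k).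
  exact: is_deriveD dr di.
have E1k : nsq p = E k - E 1.
  have -> : E 1 = rip p u.
    by rewrite split_int// /E; congr (_ + _); apply: eq_Rintegral => x _; rewrite stretch1.
  have -> : E k = rip p (fun x => u (stretch d k x)) by rewrite split_int.
  rewrite (ripC p) (ripC p) -(linear_onB (rip_lin lp)) ?l2_subspace//; [|exact: ctest_l2 tuk|exact: ctest_l2 tu].
  by rewrite /p scaleN1r addrC.
set a := Num.sqrt (nsq p); set b := Num.sqrt (nsq (cD j2 u)).
have a0 : 0 <= a by exact: sqrtr_ge0.
have b0 : 0 <= b by exact: sqrtr_ge0.
have a2 : nsq p = a ^+ 2 by rewrite sqr_sqrtr// nsq_ge0.
have b2 : nsq (cD j2 u) = b ^+ 2 by rewrite sqr_sqrtr// nsq_ge0.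
have dEb (s : R) : 1 <= s <= k -> `|rip p (g s)| <= a * (d * b).
  move=> /andP[s1 sk]; have s0 : 0 < s by lra.
  apply: rip_le => //; [exact: ctest_l2 (tg s s1)|by rewrite mulr_ge0// ltW|by rewrite a2|].
  rewrite exprMn -b2.
  have tDs : ctest_fun Om0 (fun x => cD j2 u (stretch d s x)).
    by apply: (ctest_stretch s0 tD) => x /(stretch_strip s1)[].
  have lDs := ctest_l2 tDs.
  have [|_ h] := @l2_le R (d ^+ 2) (g s) _ (l2_measurable (ctest_l2 (tg s s1))) lDs.
    move=> x; rewrite /rdot /g /flux /=.
    have [xs|xs] := pselect (Om0 (stretch d s x)).
      have [_ /andP[h1 h2]] := stretch_strip s1 xs.
      have h3 : (d - x.2) ^+ 2 <= d ^+ 2 by rewrite ler_pXn2r ?nnegrE// ltW.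
      set y1 := 'D_ _ _ _; set y2 := 'D_ _ _ _.
      have := sqr_ge0 y1; have := sqr_ge0 y2; nra.
    have /= e1 := test_fun_eq0 tDr xs; have /= e2 := test_fun_eq0 tDi xs.
    by rewrite e1 e2 !mulr0 addr0 mulr0.
  have s12 : 1 <= s <= 2 by rewrite s1 (le_trans sk).
  have := nsq_stretch tD s12; move: (nsq_ge0 (fun x => cD j2 u (stretch d s x))) h.
  move: (nsq (fun x => cD j2 u (stretch d s x))) => y y0 h <-.
  by rewrite (le_trans h)// ler_wpM2l ?sqr_ge0// ler_peMl.
have := mean_value_le k12 dE dEb; rewrite -E1k a2 b2 ger0_norm ?sqr_ge0// => h.
have [->|/eqP an0] := pselect (a = 0).
  by rewrite expr0n/= mulr_ge0// sqr_ge0.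
have a00 : 0 < a by rewrite lt_def an0.
have : a <= d * (k - 1) * b.
  by rewrite -(ler_pM2l a00) -expr2; apply: le_trans h _; rewrite le_eqVlt; apply/orP; left; apply/eqP; ring.
by rewrite -exprMn ler_pXn2r ?nnegrE//; apply: mulr_ge0 => //; apply: mulr_ge0; [exact: ltW|by rewrite subr_ge0].
Qed.

End Stretch.

(** * Sesquilinear forms and their solutions *)

Section Forms.
Context {R : realType}.
Local Notation mu := (@leb2 R).
Local Notation T2 := (measurableTypeR R * measurableTypeR R)%type.
Local Notation tri := ('I_3 -> R * R -> Rcomplex R).
Local Notation coefs := ('I_3 -> 'I_3 -> R * R -> Rcomplex R).
Implicit Types (Om D : set (R * R)) (u v w f : R * R -> Rcomplex R) (U V W X : tri) (N : coefs).

Lemma ript_int U W : l2t U -> l2t W ->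
  ript U W = \int[mu]_x \sum_k rdot (U k x) (W k x) /\
  mu.-integrable setT (EFin \o (fun x : T2 => \sum_k rdot (U k x) (W k x))).
Proof.
move=> lU lW; have i k := rip_integrable (lU k) (lW k).
have D g h : mu.-integrable setT (EFin \o g) -> mu.-integrable setT (EFin \o h) ->
    mu.-integrable setT (EFin \o (fun x : T2 => g x + h x)).
  move=> ig ih; have := integrable_lin 1 1 ig ih; apply: eq_integrable => // x _ /=.
  by rewrite !mul1r.
have e : (fun x : T2 => \sum_k rdot (U k x) (W k x)) = (fun x : T2 => rdot (U ord0 x) (W ord0 x) +
    (rdot (U (lift ord0 ord0) x) (W (lift ord0 ord0) x) +
     rdot (U (lift ord0 (lift ord0 ord0)) x) (W (lift ord0 (lift ord0 ord0)) x))).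
  by apply/funext => x; rewrite !big_ord_recl big_ord0 addr0.
rewrite e; split; last by apply: (D) => //; exact: (D).
rewrite /ript !big_ord_recl big_ord0 addr0 RintegralD//; last exact: (D).
by rewrite RintegralD.
Qed.

Definition applyc N U : tri := fun k x => \sum_l N k l x * U l x.

(** The real part of a sesquilinear form. Component 0 of a triple is the function itself, so one 3
    by 3 matrix holds the coefficients of all orders. *)
Definition sform N U W := ript (applyc N U) W.

Definition bounded_coefs N (B : R) := (forall k l, cmeasurable_fun setT (N k l)) /\
  forall k l x, rdot (N k l x) (N k l x) <= B.

Lemma mulc_scale (a : R) (m z : Rcomplex R) : m * (a *: z) = a *: (m * z).
Proof. by case: m z => [p q] [r s]; congr Complex => /=; ring. Qed.

Lemma applycE N U k : applyc N U k = ((fun x => N k ord0 x * U ord0 x) : R * R -> Rcomplex R) +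
  (((fun x => N k (lift ord0 ord0) x * U (lift ord0 ord0) x) : R * R -> Rcomplex R) +
   (fun x => N k (lift ord0 (lift ord0 ord0)) x * U (lift ord0 (lift ord0 ord0)) x)).
Proof. by apply/funext => x; rewrite /applyc !big_ord_recl big_ord0 addr0. Qed.

Lemma applyc_lin N (a : R) U V : applyc N (a *: U + V) = a *: applyc N U + applyc N V.
Proof.
apply/funext => k; apply/funext => x; rewrite !fctE /applyc scaler_sumr -big_split/=.
by apply: eq_bigr => l _; rewrite -mulc_scale -mulrDr.
Qed.

(** The constant 12 is 3 rows times 4, from |a + b + c|^2 <= 4 (|a|^2 + |b|^2 + |c|^2). *)
Lemma applyc_l2t N B U : bounded_coefs N B -> l2t U ->
  l2t (applyc N U) /\ nsqt (applyc N U) <= 12 * B * nsqt U.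
Proof.
move=> [mN bN] lU; have H k l := l2_mul (mN k l) (bN k l) (lU l).
split=> [k|].
  by rewrite applycE; do 2![apply: l2D; first exact: (H _ _).1]; exact: (H _ _).1.
have K k : nsq (applyc N U k) <= 4 * B * nsqt U.
  pose F l : R * R -> Rcomplex R := fun x => N k l x * U l x.
  have lF l : l2 (F l) by exact: (H k l).1.
  have nF l : nsq (F l) <= B * nsq (U l) by exact: (H k l).2.
  rewrite applycE -[X in nsq X]/(F ord0 + (F (lift ord0 ord0) + F (lift ord0 (lift ord0 ord0)))).
  have l23 := l2D (lF (lift ord0 ord0)) (lF (lift ord0 (lift ord0 ord0))).
  apply: (le_trans (nsqD (lF ord0) l23)).
  move: (nsqD (lF (lift ord0 ord0)) (lF (lift ord0 (lift ord0 ord0)))) (nsq_ge0 (F ord0)).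
  move: (nF ord0) (nF (lift ord0 ord0)) (nF (lift ord0 (lift ord0 ord0))).
  rewrite /nsqt /ript !big_ord_recl big_ord0 addr0 -!/(nsq _).
  generalize (nsq (F ord0)) (nsq (F (lift ord0 ord0))) (nsq (F (lift ord0 (lift ord0 ord0))))
    (nsq (U ord0)) (nsq (U (lift ord0 ord0))) (nsq (U (lift ord0 (lift ord0 ord0))))
    (nsq (F (lift ord0 ord0) + F (lift ord0 (lift ord0 ord0)))) => p0 p1 p2 q0 q1 q2 r.
  lra.
rewrite {1}/nsqt /ript; apply: (le_trans (ler_sum _ (fun k _ => K k))).
rewrite sumr_const card_ord -[leLHS]mulr_natl; move: (nsqt U) => n.
by rewrite le_eqVlt; apply/orP; left; apply/eqP; ring.
Qed.

Lemma ript_linr U : l2t U -> linear_on l2t (ript U).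
Proof.
move=> lU a V W lV lW; rewrite !(riptC U); exact: ript_lin.
Qed.

Lemma ript_cauchy_schwarz U W : l2t U -> l2t W -> ript U W ^+ 2 <= nsqt U * nsqt W.
Proof.
apply: (ip_cauchy_schwarz l2t_subspace ript_lin) => [? ? ? ?|? ?]; first exact: riptC.
exact: nsqt_ge0.
Qed.

Lemma sform_linl N B W : bounded_coefs N B -> l2t W -> linear_on l2t (sform N ^~ W).
Proof.
move=> bN lW a U V lU lV; rewrite /sform applyc_lin.
by have [lNU _] := applyc_l2t bN lU; have [lNV _] := applyc_l2t bN lV; exact: ript_lin.
Qed.

Lemma sform_linr N B U : bounded_coefs N B -> l2t U -> linear_on l2t (sform N U).
Proof. by move=> bN lU; apply: ript_linr; exact: (applyc_l2t bN lU).1. Qed.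

Lemma sform_le N B U W : bounded_coefs N B -> l2t U -> l2t W ->
  sform N U W ^+ 2 <= 12 * B * (nsqt U * nsqt W).
Proof.
move=> bN lU lW; have [lNU nNU] := applyc_l2t bN lU.
apply: (le_trans (ript_cauchy_schwarz lNU lW)).
by rewrite mulrA ler_wpM2r// nsqt_ge0.
Qed.

(** A pointwise condition on all three components is inherited by every domain with the same
    constant; this is the source of uniformity in the domain. *)
Definition coercive_coefs N (c : R) := forall x (z : 'I_3 -> Rcomplex R),
  c * \sum_k rdot (z k) (z k) <= \sum_k rdot (\sum_l N k l x * z l) (z k).

Definition hermitian_coefs N := forall k l x, N k l x = conjc (N l k x).

Lemma sform_coercive N B c U : bounded_coefs N B -> coercive_coefs N c -> l2t U ->
  c * nsqt U <= sform N U U.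
Proof.
move=> bN cN lU; have [lNU _] := applyc_l2t bN lU.
have [e i] := ript_int lU lU; have [e' i'] := ript_int lNU lU.
rewrite /sform e' /nsqt e -RintegralZl//; apply: le_Rintegral => //.
  by have := integrable_lin c 0 i i; apply: eq_integrable => // x _ /=; rewrite mul0r addr0.
by move=> x _; exact: (cN x (fun k => U k x)).
Qed.

Lemma rdot_suml (I : Type) (r : seq I) (F : I -> Rcomplex R) (w : Rcomplex R) :
  rdot (\sum_(i <- r) F i) w = \sum_(i <- r) rdot (F i) w.
Proof.
elim: r => [|i r IH]; first by rewrite !big_nil /rdot/= !mul0r addr0.
by rewrite !big_cons -IH /rdot reD imD; ring.
Qed.

Lemma sform_sym N B U W : bounded_coefs N B -> hermitian_coefs N -> l2t U -> l2t W ->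
  sform N U W = sform N W U.
Proof.
move=> bN hN lU lW; have [lNU _] := applyc_l2t bN lU; have [lNW _] := applyc_l2t bN lW.
rewrite /sform (ript_int lNU lW).1 (ript_int lNW lU).1; apply: eq_Rintegral => x _.
transitivity (\sum_k \sum_l rdot (N k l x * U l x) (W k x)).
  by apply: eq_bigr => k _; rewrite rdot_suml.
rewrite exchange_big/=; apply: eq_bigr => l _; rewrite rdot_suml; apply: eq_bigr => k _.
by rewrite (hN k l) /rdot !reimE; ring.
Qed.

Section Solutions.
Variables (N : coefs) (B c : R).
Hypotheses (B0 : 0 <= B) (c0 : 0 < c) (bN : bounded_coefs N B) (cN : coercive_coefs N c).

Definition solves Om f U := Vsp Om U /\
  forall W, Vsp Om W -> sform N U W = rip f (W ord0).

Lemma solution_exists Om f : l2 f -> exists U, solves Om f U.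
Proof.
move=> lf; have VH := @Vsp_hilbert R Om.
have [|||||||U VU HU] := lax_milgram (B := sform N) (F := fun W => rip f (W ord0))
    (c := c) (M := 12 * B) (C := nsq f) VH _ _ c0 _ _ _ (nsq_ge0 f).
- by move=> W [lW _] a V X [lV _] [lX _]; exact: (sform_linl bN lW).
- by move=> W [lW _] a V X [lV _] [lX _]; exact: (sform_linr bN lW).
- by move=> V [lV _]; exact: sform_coercive bN cN lV.
- by rewrite mulr_ge0.
- by move=> V W [lV _] [lW _]; exact: sform_le.
- move=> a V W [lV _] [lW _]; rewrite !(ripC f); exact: (rip_lin lf a (lV _) (lW _)).
- move=> V [lV _]; apply: (le_trans (rip_cauchy_schwarz lf (lV _))).
  by rewrite ler_wpM2l ?nsq_ge0//; exact: nsq_le_nsqt.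
by exists U.
Qed.

Lemma solution_bound Om f U : l2 f -> solves Om f U -> c ^+ 2 * nsqt U <= nsq f.
Proof.
move=> lf [VU HU]; have [lU _] := VU.
have h1 : c * nsqt U <= rip f (U ord0) by rewrite -HU//; exact: sform_coercive bN cN lU.
have h2 := rip_cauchy_schwarz lf (lU ord0).
have h3 := nsq_le_nsqt U ord0; have n0 := nsqt_ge0 U; have f0 := nsq_ge0 f.
move: h1 h2 h3 n0 f0; generalize (rip f (U ord0)) (nsq (U ord0)) (nsqt U) (nsq f).
move=> r n0 n F h1 h2 h3 n00 F0.
have [->|/eqP nn] := pselect (n = 0); first by rewrite mulr0.
have n1 : 0 < n by rewrite lt_def nn.
have cn : 0 < c * n by rewrite mulr_gt0.
have : (c * n) ^+ 2 <= F * n.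
  have r0 := le_trans (ltW cn) h1.
  apply: (@le_trans _ _ (r ^+ 2)); first by rewrite ler_pXn2r ?nnegrE// ltW.
  by rewrite (le_trans h2)// ler_wpM2l.
by rewrite exprMn expr2 (expr2 n) !mulrA ler_pM2r// -expr2.
Qed.

(** The two loads agree on the smaller space, so [U' - U] is orthogonal to it, and in the second
    argument of the form [U'] may be replaced by [X]. *)
Lemma cea Om Om' f f' U U' X : Om' `<=` Om -> l2 f -> l2 f' -> solves Om f U -> solves Om' f' U' ->
  (forall W, Vsp Om' W -> rip f' (W ord0) = rip f (W ord0)) -> Vsp Om' X ->
  c ^+ 2 * nsqt (U' - U) <= 12 * B * nsqt (X - U).
Proof.
move=> OO lf lf' [VU HU] [VU' HU'] ff VX.
have [lU _] := VU; have [lU' _] := VU'; have [lX _] := VX.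
have lD := l2tB lU' lU; have lXU := l2tB lX lU.
have orth W : Vsp Om' W -> sform N (U' - U) W = 0.
  move=> VW; have [lW _] := VW.
  rewrite (linear_onB (sform_linl bN lW) lU' lU) HU'// HU//; last exact: VspW OO _.
  by rewrite ff// subrr.
have e : sform N (U' - U) (U' - U) = sform N (U' - U) (X - U).
  have SL := sform_linr bN lD.
  by rewrite (linear_onB SL lU' lU) (linear_onB SL lX lU) (orth _ VU') (orth _ VX).
have h1 := sform_coercive bN cN lD; have h2 := sform_le bN lD lXU.
rewrite e in h1; move: h1 h2 (nsqt_ge0 (U' - U)) (nsqt_ge0 (X - U)).
generalize (sform N (U' - U) (X - U)) (nsqt (U' - U)) (nsqt (X - U)) => s n m h1 h2 n0 m0.
have [->|/eqP nn] := pselect (n = 0); first by rewrite mulr0 !mulr_ge0.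
have n1 : 0 < n by rewrite lt_def nn.
have cn : 0 < c * n by rewrite mulr_gt0.
have : (c * n) ^+ 2 <= 12 * B * (n * m).
  have s0 := le_trans (ltW cn) h1.
  by apply: le_trans h2; rewrite ler_pXn2r ?nnegrE// ltW.
rewrite (_ : 12 * B * (n * m) = (12 * B * m) * n); last by ring.
by rewrite exprMn expr2 (expr2 n) !mulrA ler_pM2r// -expr2.
Qed.

End Solutions.

End Forms.

(** * Variation of a form under stretching *)

Section StretchForm.
Context {R : realType}.
Local Notation mu := (@leb2 R).
Local Notation T2 := (measurableTypeR R * measurableTypeR R)%type.
Local Notation dir := (@dir R).
Local Notation re := (@complex.Re R).
Local Notation im := (@complex.Im R).
Local Notation tri := ('I_3 -> R * R -> Rcomplex R).
Local Notation coefs := ('I_3 -> 'I_3 -> R * R -> Rcomplex R).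
Local Notation j2 := (lift ord0 ord0 : 'I_2).
Implicit Types (Om D : set (R * R)) (u v w f : R * R -> Rcomplex R) (U V W X : tri) (M : coefs).

(** The W_oo^1 condition in the x_2 direction only, with a derivative bounded at every point rather
    than almost everywhere. *)
Definition weakly_lipschitz (d L : R) (m : R * R -> R) := exists m' : R * R -> R,
  [/\ measurable_fun setT (m' : T2 -> R), forall x, `|m' x| <= L &
      forall psi, test_fun (strip (@flat R) d) psi ->
        \int[mu]_x (m x * 'D_(dir j2) psi x) = - \int[mu]_x (m' x * psi x)].

Lemma sform_sum M B U W : bounded_coefs M B -> l2t U -> l2t W ->
  sform M U W = \sum_k \sum_l rip (fun x => M k l x * U l x) (W k).
Proof.
move=> [mM bM] lU lW; have H k l := (l2_mul (mM k l) (bM k l) (lU l)).1.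
apply: eq_bigr => k _; rewrite applycE.
have RL := rip_lin (lW k).
rewrite (linear_onD RL (H _ _) (l2D (H _ _) (H _ _))) (linear_onD RL (H _ _) (H _ _)).
by rewrite !big_ord_recl big_ord0 addr0.
Qed.

Variable d : R.
Hypothesis d0 : 0 < d.
Local Notation Om0 := (strip (@flat R) d).

(** Stretching a product of two components produces one factor [k] for each x_2-derivative, in all
    [n] of them, whereas the Jacobian balances exactly one. The missing or surplus power costs
    another O(k - 1). *)
Lemma stretch_power_le m (B L k : R) h N (n : nat) : measurable_fun setT (m : T2 -> R) ->
  (forall x, `|m x| <= B) -> weakly_lipschitz d L m -> (n <= 2)%N ->
  test_fun Om0 h -> test_fun setT N -> (forall x, `|h x| <= N x) -> 1 <= k <= 2 ->
  `|k ^+ n * \int[mu]_x (m x * h (stretch d k x)) - \int[mu]_x (m x * h x)| <=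
    (2 * (L * d) + B) * (\int[mu]_x N x) * (k - 1).
Proof.
move=> mm mB [m' [mm' mL wm]] n2 th tN hN k12.
have := stretch_weak_le d0 mm mB mm' mL wm th tN hN k12.
have B0 : 0 <= B by apply: le_trans (mB (0, 0)).
have L0 : 0 <= L by apply: le_trans (mL (0, 0)).
have ih : mu.-integrable setT (EFin \o (fun x => m x * h x)).
  have /test_funP[_ [K [cK _ K0]]] := th.
  exact: weighted_integrable mm mB (test_fun_continuous th) cK K0.
have iN := test_fun_integrable tN.
have E1 : `|\int[mu]_x (m x * h x)| <= B * \int[mu]_x N x.
  apply: (le_trans (le_normr_Rintegral measurableT ih)).
  rewrite -RintegralZl//; apply: le_Rintegral => //.
  - by have := integrable_norm ih.
  - by have := integrable_lin B 0 iN iN; apply: eq_integrable => // x _ /=; rewrite mul0r addr0.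
  - by move=> x _; rewrite normrM ler_pM.
have N0 : 0 <= \int[mu]_x N x by apply: Rintegral_ge0 => x _; apply: le_trans (hN x).
move: E1 N0 k12; set E := \int[mu]_x (m x * h x); set Ek := \int[mu]_x (m x * h (stretch d k x)); set G := \int[mu]_x N x.
move: E Ek G => E Ek G {ih iN hN wm mB mL}.
have Ld0 : 0 <= L * d by rewrite mulr_ge0// ltW.
move: (L * d) Ld0 => l l0; rewrite !ler_norml => /andP[e1 e2] G0 /andP[k1 k2] /andP[h1 h2].
have kG : 0 <= (k - 1) * G by rewrite mulr_ge0// subr_ge0.
have klG : 0 <= l * ((k - 1) * G) by rewrite mulr_ge0.
have kBG : 0 <= B * ((k - 1) * G) by rewrite mulr_ge0.
have g1 : - (B * ((k - 1) * G)) <= (k - 1) * E by nra.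
have g2 : (k - 1) * E <= B * ((k - 1) * G) by nra.
case: n n2 => [|[|[|//]]] _.
(* With no power at hand, the balanced estimate controls k (Ek - E), and k >= 1 gives Ek - E. *)
- rewrite expr0 mul1r; have e : k * (Ek - E) = (k * Ek - E) - (k - 1) * E by ring.
  have q1 : k * (Ek - E) <= (l + B) * ((k - 1) * G) by nra.
  have q2 : - ((l + B) * ((k - 1) * G)) <= k * (Ek - E) by nra.
  have r0 : 0 <= (l + B) * ((k - 1) * G) by nra.
  have s1 : Ek - E <= (l + B) * ((k - 1) * G) by have := ler0P (Ek - E); case => ?; nra.
  have s2 : - ((l + B) * ((k - 1) * G)) <= Ek - E by have := ler0P (Ek - E); case => ?; nra.
  by apply/andP; split; nra.
- by rewrite expr1; apply/andP; split; nra.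
- have e : k ^+ 2 * Ek - E = k * (k * Ek - E) + (k - 1) * E by ring.
  have q1 : k * (k * Ek - E) <= 2 * (l * ((k - 1) * G)) by nra.
  have q2 : - (2 * (l * ((k - 1) * G))) <= k * (k * Ek - E) by nra.
  by rewrite e; apply/andP; split; nra.
Qed.

(** The number of factors [k] that the chain rule gives to a component: 1 for the x_2-derivative, 0
    for the others. *)
Definition wt (l : 'I_3) : nat := if unlift ord0 l is Some j then (j != ord0 : nat) else 0.

Lemma jetC_stretch Om u (k : R) l x : ctest_fun Om u ->
  jetC (fun x => u (stretch d k x)) l x = (k ^+ wt l) *: (jetC u l (stretch d k x) : Rcomplex R).
Proof.
move=> [t1 t2]; move: l; apply: ord3P => [|j]; rewrite /jetC /wt ?mktri0 ?mktriS ?unlift_none ?liftK.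
  by rewrite expr0 scale1r.
have D h : test_fun Om h -> 'D_(dir j) (fun x => h (stretch d k x)) x = k ^+ (j != ord0) * 'D_(dir j) h (stretch d k x).
  move=> th; have [_ ->] := is_derive_stretch (test_fun_is_derive j (stretch d k x) th).
  by case: (j == ord0).
by rewrite /cD (D _ t1) (D _ t2).
Qed.

(** [rprod] and [iprod] are the real part and minus the imaginary part of [a] times the conjugate of
    [b]. The real part of m a conj(b) is re(m) [rprod] + im(m) [iprod], which separates the
    coefficient from test functions. *)
Definition rprod (a b : R * R -> R[i]) (x : R * R) : R :=
  re (a x) * re (b x) + im (a x) * im (b x).

Definition iprod (a b : R * R -> R[i]) (x : R * R) : R :=
  re (a x) * im (b x) + -1 * (im (a x) * re (b x)).

Definition sprod (a b : R * R -> R[i]) (x : R * R) : R :=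
  rdot (a x) (a x) + rdot (b x) (b x).

Lemma rprod_test Om a b : ctest_fun Om a -> ctest_fun Om b -> test_fun Om (rprod a b).
Proof. by move=> [a1 a2] [b1 b2]; apply: test_funD; apply: test_funM => //; [case: a1|case: a2]. Qed.

Lemma iprod_test Om a b : ctest_fun Om a -> ctest_fun Om b -> test_fun Om (iprod a b).
Proof.
move=> [a1 a2] [b1 b2]; apply: test_funD.
  by apply: test_funM => //; case: a1.
by apply: test_funM; [apply: test_funM => //; case: a2|exact: smooth_cst].
Qed.

Lemma sprod_test Om a b : ctest_fun Om a -> ctest_fun Om b -> test_fun Om (sprod a b).
Proof. by move=> ta tb; apply: test_funD; exact: test_fun_rdot. Qed.

Lemma int_sprod Om a b : ctest_fun Om a -> ctest_fun Om b ->
  \int[mu]_x sprod a b x = nsq a + nsq b.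
Proof.
move=> ta tb; have la := ctest_l2 ta; have lb := ctest_l2 tb.
by rewrite RintegralD//; exact: rip_integrable.
Qed.

Lemma rprod_le a b x : `|rprod a b x| <= sprod a b x.
Proof.
rewrite ler_norml /rprod /sprod /rdot; move: (re (a x)) (im (a x)) (re (b x)) (im (b x)) => p q r s.
have := sqr_ge0 (p + r); have := sqr_ge0 (p - r); have := sqr_ge0 (q + s); have := sqr_ge0 (q - s).
have := sqr_ge0 p; have := sqr_ge0 q; have := sqr_ge0 r; have := sqr_ge0 s.
by move=> *; apply/andP; split; lra.
Qed.

Lemma iprod_le a b x : `|iprod a b x| <= sprod a b x.
Proof.
rewrite ler_norml /iprod /sprod /rdot; move: (re (a x)) (im (a x)) (re (b x)) (im (b x)) => p q r s.
have := sqr_ge0 (p + s); have := sqr_ge0 (p - s); have := sqr_ge0 (q + r); have := sqr_ge0 (q - r).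
have := sqr_ge0 p; have := sqr_ge0 q; have := sqr_ge0 r; have := sqr_ge0 s.
by move=> *; apply/andP; split; lra.
Qed.

Lemma rip_mulE (m a b : R * R -> R[i]) (B : R) Om : cmeasurable_fun setT m ->
  (forall x, `|re (m x)| <= B /\ `|im (m x)| <= B) -> ctest_fun Om a -> ctest_fun Om b ->
  rip (fun x => m x * a x) b =
    \int[mu]_x (re (m x) * rprod a b x) + \int[mu]_x (im (m x) * iprod a b x).
Proof.
move=> [mr mi] mB ta tb; have tr := rprod_test ta tb; have ti := iprod_test ta tb.
have /test_funP[_ [K [cK _ K0]]] := tr; have /test_funP[_ [K' [cK' _ K0']]] := ti.
rewrite -RintegralD//; last 2 first.
- exact: weighted_integrable mr (fun x => (mB x).1) (test_fun_continuous tr) cK K0.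
- exact: weighted_integrable mi (fun x => (mB x).2) (test_fun_continuous ti) cK' K0'.
by apply: eq_Rintegral => x _; rewrite /rprod /iprod /rdot !reimE; ring.
Qed.

Lemma rip_mul_stretch (m a b : R * R -> R[i]) (B L k : R) (n : nat) : cmeasurable_fun setT m ->
  (forall x, `|re (m x)| <= B /\ `|im (m x)| <= B) ->
  weakly_lipschitz d L (fun x => re (m x)) -> weakly_lipschitz d L (fun x => im (m x)) ->
  ctest_fun Om0 a -> ctest_fun Om0 b -> (n <= 2)%N -> 1 <= k <= 2 ->
  `|k ^+ n * rip (fun x => m x * a (stretch d k x)) (fun x => b (stretch d k x)) -
    rip (fun x => m x * a x) b| <= 2 * (2 * (L * d) + B) * (nsq a + nsq b) * (k - 1).
Proof.
move=> mm mB wr wi ta tb n2 k12; have k0 : 0 < k by case/andP: k12 => ? _; lra.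
have ts := sprod_test (ctest_funW (@subsetT _ _) ta) (ctest_funW (@subsetT _ _) tb).
have h1 := stretch_power_le mm.1 (fun x => (mB x).1) wr n2 (rprod_test ta tb) ts (rprod_le a b) k12.
have h2 := stretch_power_le mm.2 (fun x => (mB x).2) wi n2 (iprod_test ta tb) ts (iprod_le a b) k12.
rewrite (int_sprod ta tb) in h1 h2.
have tS c : ctest_fun Om0 c -> ctest_fun setT (fun x => c (stretch d k x)).
  by move=> tc; exact: ctest_stretch k0 tc _.
rewrite (rip_mulE mm mB ta tb) (rip_mulE mm mB (tS a ta) (tS b tb)).
rewrite mulrDr opprD addrACA; apply: (le_trans (ler_normD _ _)).
apply: (le_trans (lerD h1 h2)); rewrite le_eqVlt; apply/orP; left; apply/eqP; ring.
Qed.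

(* The zeroth-order coefficient is merely bounded; here the derivative falls on the test function. *)
Lemma rip_mul_stretch0 (m a : R * R -> R[i]) (B k : R) : cmeasurable_fun setT m ->
  (forall x, `|re (m x)| <= B /\ `|im (m x)| <= B) -> ctest_fun Om0 a -> 1 <= k <= 2 ->
  `|rip (fun x => m x * a (stretch d k x)) (fun x => a (stretch d k x)) -
    rip (fun x => m x * a x) a| <= B * d * (nsq a + nsq (cD j2 a)) * (k - 1).
Proof.
move=> mm mB ta k12; have k0 : 0 < k by case/andP: k12 => ? _; lra.
have [ta1 ta2] := ta; have tD := ctest_fun_cD j2 ta.
have ts := sprod_test (ctest_funW (@subsetT _ _) ta) (ctest_funW (@subsetT _ _) tD).
have i0 c x : iprod c c x = 0 by rewrite /iprod; ring.
have E Om c : ctest_fun Om c -> rip (fun x => m x * c x) c = \int[mu]_x (re (m x) * rprod c c x).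
  move=> tc; rewrite (rip_mulE mm mB tc tc) [X in _ + X](_ : _ = 0) ?addr0//.
  under eq_Rintegral do rewrite i0 mulr0.
  by rewrite /Rintegral integral0.
rewrite (E _ _ ta) (E setT _ (ctest_stretch k0 ta (fun _ _ => I))).
rewrite -(int_sprod ta tD).
apply: (stretch_bounded_le d0 mm.1 (fun x => (mB x).1) (rprod_test ta ta) ts _ k12) => x.
have dr := test_fun_is_derive j2 x ta1; have di := test_fun_is_derive j2 x ta2.
have [_ ->] := is_deriveD (is_deriveM dr dr) (is_deriveM di di).
pose r := 'D_(dir j2) (fun x => re (a x)) x; pose s := 'D_(dir j2) (fun x => im (a x)) x.
rewrite /sprod (_ : cD j2 a x = Complex r s)// -/r -/s ler_norml /GRing.scale/= /rdot /=.
move: (re (a x)) (im (a x)) r s => p q r s.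
have := sqr_ge0 (p + r); have := sqr_ge0 (p - r); have := sqr_ge0 (q + s); have := sqr_ge0 (q - s).
by move=> *; apply/andP; split; lra.
Qed.

(** The constant 36 is nine entries times 4. Entry (0,0) carries no Lipschitz condition and is
    treated by [rip_mul_stretch0]. *)
Lemma sform_stretch M (B L k : R) u : 0 <= B -> 0 <= L -> bounded_coefs M (B ^+ 2) ->
  (forall p l, (p, l) != (ord0, ord0) -> weakly_lipschitz d L (fun x => re (M p l x)) /\
     weakly_lipschitz d L (fun x => im (M p l x))) ->
  ctest_fun Om0 u -> 1 <= k <= 2 ->
  `|sform M (jetC (fun x => u (stretch d k x))) (jetC (fun x => u (stretch d k x))) - sform M (jetC u) (jetC u)| <=
    36 * (2 * (L * d) + B + B * d) * nsqt (jetC u) * (k - 1).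
Proof.
move=> B0 L0 bM wM tu k12; pose T x := u (stretch d k x).
rewrite -/T; have k0 : 0 < k by case/andP: k12 => ? _; lra.
have Ld0 : 0 <= L * d by rewrite mulr_ge0// ltW.
have Bd0 : 0 <= B * d by rewrite mulr_ge0// ltW.
have k10 : 0 <= k - 1 by rewrite subr_ge0; case/andP: k12.
have tT : ctest_fun setT T by exact: ctest_stretch k0 tu _.
have tJ l : ctest_fun Om0 (jetC u l).
  move: l; apply: ord3P => [|j]; rewrite /jetC ?mktri0 ?mktriS//; exact: ctest_fun_cD.
have [mM mB] := bM.
have MB p l x : `|re (M p l x)| <= B /\ `|im (M p l x)| <= B.
  have := mB p l x; rewrite /rdot -!expr2 => h.
  have h1 := sqr_ge0 (re (M p l x)); have h2 := sqr_ge0 (im (M p l x)).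
  by split; rewrite -(ler_pXn2r (ltn0Sn 1)) ?nnegrE// real_normK ?num_real//; apply: le_trans h; rewrite ?lerDl ?lerDr.
set C := 4 * (2 * (L * d) + B + B * d) * nsqt (jetC u) * (k - 1).
have nJ l : nsq (jetC u l) <= nsqt (jetC u) by exact: nsq_le_nsqt.
have X p l : `|rip (fun x => M p l x * jetC T l x) (jetC T p) -
    rip (fun x => M p l x * jetC u l x) (jetC u p)| <= C.
  have e : rip (fun x => M p l x * jetC T l x) (jetC T p) =
      k ^+ (wt l + wt p) * rip (fun x => M p l x * jetC u l (stretch d k x)) (fun x => jetC u p (stretch d k x)).
    have tS c : ctest_fun Om0 c -> ctest_fun setT (fun x => c (stretch d k x)).
      by move=> tc; exact: ctest_stretch k0 tc _.
    have ta := tS _ (tJ l); have tb := tS _ (tJ p).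
    have la := ctest_l2 ta; have lb := ctest_l2 tb.
    have lm := (l2_mul (mM p l) (mB p l) la).1.
    rewrite /rip -RintegralZl//; last exact: rip_integrable.
    apply: eq_Rintegral => x _; rewrite (jetC_stretch k l x tu) (jetC_stretch k p x tu).
    by rewrite mulc_scale /rdot !re_scale !im_scale exprD; ring.
  have wt1 q : (wt q <= 1)%N by rewrite /wt; case: (unlift ord0 q) => // j; case: eqP.
  have [[p0 l0]|pl] := eqVneq (p, l) (ord0, ord0).
    rewrite e p0 l0 /wt unlift_none expr0 mul1r.
    have := rip_mul_stretch0 (mM ord0 ord0) (MB ord0 ord0) (tJ ord0) k12.
    have -> : cD j2 (jetC u ord0) = jetC u (lift ord0 j2) by rewrite /jetC mktri0 mktriS.
    move=> h; apply: (le_trans h); rewrite /C.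
    have := nsq_ge0 (jetC u ord0); have := nsq_ge0 (jetC u (lift ord0 j2)).
    move: (nJ ord0) (nJ (lift ord0 j2)).
    generalize (nsq (jetC u ord0)) (nsq (jetC u (lift ord0 j2))) (nsqt (jetC u)) => n1 n2 n h1 h2 h3 h4.
    apply: ler_wpM2r => //; have := ler_wpM2l Bd0 h1; have := ler_wpM2l Bd0 h2.
    have : 0 <= (L * d) * n by rewrite mulr_ge0//; lra.
    have : 0 <= B * n by rewrite mulr_ge0//; lra.
    have : 0 <= B * d * n by rewrite mulr_ge0//; lra.
    lra.
  have [wr wi] := wM p l pl.
  have := rip_mul_stretch (mM p l) (MB p l) wr wi (tJ l) (tJ p) (leq_add (wt1 l) (wt1 p)) k12.
  rewrite e => h; apply: (le_trans h); rewrite /C.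
  have := nsq_ge0 (jetC u l); have := nsq_ge0 (jetC u p).
  move: (nJ l) (nJ p).
  generalize (nsq (jetC u l)) (nsq (jetC u p)) (nsqt (jetC u)) => n1 n2 n h1 h2 h3 h4.
  apply: ler_wpM2r => //; have := ler_wpM2l Ld0 h1; have := ler_wpM2l Ld0 h2.
  have := ler_wpM2l B0 h1; have := ler_wpM2l B0 h2.
  have : 0 <= B * d * n by rewrite mulr_ge0//; lra.
  lra.
have lT := ctest_jet_l2t tT; have lu := ctest_jet_l2t tu.
rewrite (sform_sum bM lT lT) (sform_sum bM lu lu) -sumrB.
apply: (le_trans (ler_norm_sum _ _ _)).
apply: (@le_trans _ _ (\sum_(p < 3) \sum_(l < 3) C)).
  apply: ler_sum => p _; rewrite -sumrB; apply: (le_trans (ler_norm_sum _ _ _)).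
  by apply: ler_sum => l _; exact: X.
rewrite !sumr_const !card_ord -mulrnA -[leLHS]mulr_natl /C; move: (nsqt _) => n.
by rewrite le_eqVlt; apply/orP; left; apply/eqP; ring.
Qed.

End StretchForm.

Ltac nonneg := repeat first [done | apply: divr_ge0 | apply: mulr_ge0 | apply: addr_ge0 | exact: sqr_ge0 | exact: ltW].

(** * The resolvent equation at i and its rate of convergence *)

Section Rate.
Context {R : realType}.
Local Notation dir := (@dir R).
Local Notation re := (@complex.Re R).
Local Notation im := (@complex.Im R).
Local Notation tri := ('I_3 -> R * R -> Rcomplex R).
Local Notation coefs := ('I_3 -> 'I_3 -> R * R -> Rcomplex R).
Local Notation j2 := (lift ord0 ord0 : 'I_2).
Implicit Types (Om D : set (R * R)) (u v w f F : R * R -> Rcomplex R) (U V W X : tri) (M : coefs).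

Definition ci (r : R) : R[i] := Complex 0 r.

Definition twist (z : R[i]) U : tri := fun k x => z * U k x.

(** Coefficients of the form plus [z] times the L_2 product. *)
Definition shiftc (z : R[i]) M : coefs :=
  fun k l x => M k l x + (if (k == ord0) && (l == ord0) then z else 0).

Definition rotc (z : R[i]) M : coefs := fun k l x => z * M k l x.

Lemma bounded_shiftc z M B : bounded_coefs M B -> bounded_coefs (shiftc z M) (2 * B + 2 * rdot z z).
Proof.
move=> [mM bM]; split=> [k l|k l x].
  rewrite /shiftc; have [mr mi] := mM k l; case: ifP => _.
    split; first by under eq_fun do rewrite reD; apply: measurable_funD.
    by under eq_fun do rewrite imD; apply: measurable_funD.
  by split; under eq_fun do rewrite addr0.
have := bM k l x; have := rdot_ge0 z; rewrite /shiftc; case: ifP => _.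
  move=> z0 h; rewrite -[z in _ + z]opprK; apply: (le_trans (rdotB_le _ _)).
  by rewrite (_ : rdot (- z) (- z) = rdot z z); [lra|rewrite /rdot !reimE; ring].
by rewrite addr0; have := rdot_ge0 (M k l x); lra.
Qed.

Lemma bounded_rotc z M B : bounded_coefs M B -> bounded_coefs (rotc z M) (rdot z z * B).
Proof.
move=> [mM bM]; split=> [k l|k l x]; last by rewrite /rotc rdotM ler_wpM2l// rdot_ge0.
by apply: cmeasurableM => //; split; exact: measurable_cst.
Qed.

Lemma l2_cmul (z : R[i]) u : l2 u -> l2 (fun x => z * u x : Rcomplex R) /\
  nsq (fun x => z * u x) <= rdot z z * nsq u.
Proof.
move=> lu; exact: (l2_mul (m := fun=> z)).
Qed.

(** The spaces are treated as real ones but are stable under complex factors, which permits testing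
    with i W and dividing by a complex number. *)
Lemma twist_Vsp Om z U : Vsp Om U -> Vsp Om (twist z U).
Proof.
move=> [lU HU]; split=> [k|e e0]; first exact: (l2_cmul z (lU k)).1.
have z0 := rdot_ge0 z; have e1 : 0 < e / (rdot z z + 1) by rewrite divr_gt0// ltr_wpDl.
have [u tu ue] := HU _ e1; have [tr ti] := tu.
pose w x : R[i] := Complex (re z * re (u x) + - im z * im (u x)) (re z * im (u x) + im z * re (u x)).
have tw : ctest_fun Om w.
  by split; apply: test_funD; apply: test_funM => //; exact: smooth_cst.
exists w => //; have lu := ctest_jet_l2t tu; have lw := ctest_jet_l2t tw.
have Jw : jetC w = twist z (jetC u).
  apply/funext => k; apply/funext => x; rewrite /twist.
  move: k; apply: ord3P => [|j]; rewrite /jetC ?mktri0 ?mktriS.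
    by rewrite /w; case: (u x) (z) => a b [p q]; congr Complex => /=; rewrite ?mulNr.
  have dr := test_fun_is_derive j x tr; have di := test_fun_is_derive j x ti.
  have [_ e1'] := is_deriveD (is_deriveZ (re z) dr) (is_deriveZ (- im z) di).
  have [_ e2'] := is_deriveD (is_deriveZ (re z) di) (is_deriveZ (im z) dr).
  rewrite [LHS](_ : _ = Complex (re z *: 'D_(dir j) (fun x => re (u x)) x + - im z *: 'D_(dir j) (fun x => im (u x)) x)
    (re z *: 'D_(dir j) (fun x => im (u x)) x + im z *: 'D_(dir j) (fun x => re (u x)) x)).
    set r := 'D_(dir j) (fun x => re (u x)) x; set s := 'D_(dir j) (fun x => im (u x)) x.
    rewrite (_ : cD j u x = Complex r s)//.
    by case: (z) => p q; congr Complex => /=; rewrite /GRing.scale/= ?mulNr.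
  by rewrite -e1' -e2'.
rewrite Jw (_ : _ - _ = twist z (U - jetC u)); last first.
  by apply/funext => k; apply/funext => x; rewrite /twist !fctE mulrBr.
have : nsqt (twist z (U - jetC u)) <= rdot z z * nsqt (U - jetC u).
  rewrite /nsqt /ript mulr_sumr; apply: ler_sum => k _.
  exact: (l2_cmul z (l2tB lU lu k)).2.
move=> h; apply: (le_lt_trans h).
move: ue; rewrite ltr_pdivlMr; last lra.
have := nsqt_ge0 (U - jetC u); nra.
Qed.

(* The resolvent equation at the point i, with its real part only: the imaginary
   part is the real part for the test element i W. *)
Definition rsolves M Om f U := Vsp Om U /\
  forall W, Vsp Om W -> sform M U W + rip (U ord0) (fun x => 'i%C * W ord0 x) = rip f (W ord0).

Variables (M : coefs) (B L K c d : R).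
Hypotheses (d0 : 0 < d) (B0 : 0 <= B) (L0 : 0 <= L) (K0 : 0 <= K) (c0 : 0 < c).
Hypothesis bM : bounded_coefs M (B ^+ 2).
Hypothesis hM : hermitian_coefs M.
Hypothesis cM : coercive_coefs (shiftc K%:C%C M) c.
Hypothesis wM : forall p l, (p, l) != (ord0, ord0) ->
  weakly_lipschitz d L (fun x => re (M p l x)) /\ weakly_lipschitz d L (fun x => im (M p l x)).
Local Notation Om0 := (strip (@flat R) d).

(** For a Hermitian form h with n the squared norm, the real part of (1 + iK)(h - i n) is h + K n.
    So [N], the coefficients of h - i multiplied by [z], inherits the coercivity of h + K. *)
Let z := Complex 1 K.
Let N := rotc z (shiftc (ci (-1)) M).

(** |z|^2 times the bound 2 B^2 + 2 for the entries after the shift by -i. *)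
Let BN := (1 + K ^+ 2) * (2 * B ^+ 2 + 2).

Let bN : bounded_coefs N BN.
Proof.
have := bounded_rotc z (bounded_shiftc (ci (-1)) bM); congr bounded_coefs.
by rewrite /BN /rdot /=; ring.
Qed.

Lemma sum_shiftc (a : R[i]) x (Z : 'I_3 -> Rcomplex R) k :
  \sum_l shiftc a M k l x * Z l = \sum_l M k l x * Z l + (if k == ord0 then a * Z ord0 else 0).
Proof.
rewrite /shiftc; under eq_bigr do rewrite mulrDl; rewrite big_split/=; congr (_ + _).
case: eqP => [_|_] /=; last by rewrite big1// => l _; rewrite mul0r.
by rewrite big_ord_recl/= big1 ?addr0// => l _; rewrite mul0r.
Qed.

(** A Hermitian quadratic form has real values, so its product with i has no real part. This removes
    the term i K h(Z,Z) from the twisted form. *)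
Lemma hermitian_isym x (Z : 'I_3 -> Rcomplex R) :
  \sum_k rdot (\sum_l M k l x * Z l) ('i%C * Z k) = 0.
Proof.
set T := LHS; suff : T = - T by move: T => T; lra.
transitivity (\sum_k \sum_l rdot (M k l x * Z l) ('i%C * Z k)).
  by apply: eq_bigr => k _; rewrite rdot_suml.
rewrite exchange_big/= -sumrN; apply: eq_bigr => l _; rewrite rdot_suml -sumrN.
by apply: eq_bigr => k _; rewrite (hM k l) /rdot !reimE /=; ring.
Qed.

Let cN : coercive_coefs N c.
Proof.
move=> x Z; apply: (le_trans (cM x Z)).
have h0 := hermitian_isym x Z.
rewrite le_eqVlt; apply/orP; left; apply/eqP.
transitivity (\sum_k rdot (\sum_l M k l x * Z l) (Z k) + K * rdot (Z ord0) (Z ord0)).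
  under eq_bigr do rewrite sum_shiftc.
  rewrite big_ord_recl [in RHS]big_ord_recl/= [RHS]addrAC; congr (_ + _); last first.
    by apply: eq_bigr => k _; rewrite addr0.
  by rewrite /rdot !reimE /=; ring.
have e k : rdot (\sum_l N k l x * Z l) (Z k) = (rdot (\sum_l M k l x * Z l) (Z k) -
    K * rdot (\sum_l M k l x * Z l) ('i%C * Z k)) + (if k == ord0 then K * rdot (Z ord0) (Z ord0) else 0).
  have -> : \sum_l N k l x * Z l = z * (\sum_l M k l x * Z l + (if k == ord0 then ci (-1) * Z ord0 else 0)).
    by rewrite -sum_shiftc mulr_sumr; apply: eq_bigr => l _; rewrite /N /rotc mulrA.
  by case: eqP => [->|_]; rewrite /rdot !reimE /=; ring.
under [RHS]eq_bigr do rewrite e.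
rewrite !big_split/= sumrN -mulr_sumr h0 mulr0 subr0; congr (_ + _).
by rewrite big_ord_recl/= big1 ?addr0.
Qed.

Lemma rip_conj (a : R[i]) u v : rip (fun x => a * u x) v = rip u (fun x => conjc a * v x).
Proof. by apply: eq_Rintegral => x _; rewrite /rdot !reimE; ring. Qed.

(** The factor [z] passes to the test triple as its conjugate, so the twisted equation is the
    original one with other test triples. *)
Lemma twisted_form U W : l2t U -> l2t W ->
  sform N U W = sform M U (twist (conjc z) W) + rip (U ord0) (fun x => 'i%C * (conjc z * W ord0 x)).
Proof.
move=> lU lW; have [lMU _] := applyc_l2t bM lU.
have lz k := (l2_cmul (conjc z) (lW k)).1; have lci := (l2_cmul (ci (-1)) (lU ord0)).1.
have e k x : applyc N U k x = z * (applyc M U k x + (if k == ord0 then ci (-1) * U ord0 x else 0)).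
  rewrite -(sum_shiftc (ci (-1)) x (fun l => U l x)) mulr_sumr.
  by apply: eq_bigr => l _; rewrite /N /rotc mulrA.
rewrite /sform /ript big_ord_recl [in RHS]big_ord_recl [RHS]addrAC; congr (_ + _).
  transitivity (rip (applyc M U ord0 + ((fun x => ci (-1) * U ord0 x) : R * R -> Rcomplex R)) (twist (conjc z) W ord0)).
    by rewrite /twist -rip_conj; congr rip; apply/funext => x; rewrite e.
  rewrite (linear_onD (rip_lin (lz ord0)) (lMU ord0) lci) rip_conj; congr (_ + _).
  congr rip; apply/funext => x; congr (_ * _).
  by rewrite /ci; congr Complex; rewrite ?oppr0// opprK.
apply: eq_bigr => k _; rewrite /twist -rip_conj; congr rip; apply/funext => x.
by rewrite e addr0.
Qed.

Lemma rsolvesP Om f U : l2 f -> rsolves M Om f U <-> solves N Om (fun x => z * f x) U.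
Proof.
move=> lf; split=> -[VU HU]; split => // W VW; have [lU _] := VU; have [lW _] := VW.
  rewrite twisted_form// HU ?rip_conj//; exact: twist_Vsp.
(* As [z] is invertible, testing the twisted equation with W / conj(z) returns the original one. *)
pose W' := twist (conjc z)^-1 W; have VW' : Vsp Om W' by exact: twist_Vsp.
have z0 : conjc z != 0.
  by rewrite /z eq_complex /= oner_eq0.
have e : twist (conjc z) W' = W.
  by apply/funext => k; apply/funext => x; rewrite /W' /twist mulrA divff// mul1r.
have := HU W' VW'; rewrite twisted_form//; last by case: VW'.
rewrite rip_conj; move/(congr1 (fun t => t ord0)) : (e); rewrite {1}/twist => ->.
rewrite e => <-; congr (_ + rip _ _); apply/funext => x.
by move/(congr1 (fun t => t ord0 x)) : e => <-.
Qed.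

Lemma rsolves_exists Om f : l2 f -> exists U, rsolves M Om f U.
Proof.
move=> lf; have BN0 : 0 <= BN by rewrite mulr_ge0// addr_ge0// ?mulr_ge0// sqr_ge0.
have [U HU] := solution_exists BN0 c0 bN cN Om (l2_cmul z lf).1.
by exists U; apply/rsolvesP.
Qed.

Lemma rsolves_bound Om f U : l2 f -> rsolves M Om f U -> c ^+ 2 * nsqt U <= (1 + K ^+ 2) * nsq f.
Proof.
move=> lf /(rsolvesP _ _ lf) HU; have [lz nz] := l2_cmul z lf.
apply: (le_trans (solution_bound c0 bN cN lz HU)); apply: (le_trans nz).
by rewrite (_ : rdot z z = 1 + K ^+ 2)// /rdot /=; ring.
Qed.

Lemma bounded_coefsW (P : coefs) (b b' : R) : b <= b' -> bounded_coefs P b -> bounded_coefs P b'.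
Proof. by move=> bb [mP bP]; split => // k l x; apply: le_trans (bP k l x) bb. Qed.

(** The Hermitian coercive form h + K in which energies are measured. Moving (K + i) U to the
    right-hand side, [U] solves its equation with the right-hand side [load f U]. *)
Let H := shiftc K%:C%C M.
Let BH := 2 * (B + K).

Let BH0 : 0 <= BH. Proof. by rewrite mulr_ge0// addr_ge0. Qed.

Let bH : bounded_coefs H (BH ^+ 2).
Proof.
apply: bounded_coefsW (bounded_shiftc K%:C%C bM).
rewrite /BH /rdot /= mulr0 addr0; have := mulr_ge0 B0 K0; have := sqr_ge0 B; have := sqr_ge0 K; nra.
Qed.

Let hH : hermitian_coefs H.
Proof.
move=> k l x; rewrite /H /shiftc (hM k l) andbC; case: (M l k x) => p q; case: ifP => _.
  by congr Complex => /=; rewrite ?addr0.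
by congr Complex => /=; rewrite ?addr0.
Qed.

Let load f U : R * R -> Rcomplex R := f + ((fun x => Complex K 1 * U ord0 x) : R * R -> Rcomplex R).

Let load_l2 f U : l2 f -> l2t U -> l2 (load f U) /\ nsq (load f U) <= 2 * nsq f + 2 * (1 + K ^+ 2) * nsqt U.
Proof.
move=> lf lU; have [l1 n1] := l2_cmul (Complex K 1) (lU ord0); split; first exact: l2D.
apply: (le_trans (nsqD lf l1)); rewrite lerD2l -mulrA ler_wpM2l//; apply: (le_trans n1).
rewrite (_ : rdot _ _ = 1 + K ^+ 2); last by rewrite /rdot /=; ring.
by rewrite ler_wpM2l ?nsq_le_nsqt// addr_ge0// sqr_ge0.
Qed.

Let hermitian_equation Om f U W : l2 f -> rsolves M Om f U -> Vsp Om W ->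
  sform H U W = rip (load f U) (W ord0).
Proof.
move=> lf [[lU VU] HU] VW; have [lW _] := VW; have [lMU _] := applyc_l2t bM lU.
have [lK _] := l2_cmul K%:C%C (lU ord0).
have -> : sform H U W = sform M U W + K * rip (U ord0) (W ord0).
  rewrite /sform /ript big_ord_recl [in RHS]big_ord_recl [RHS]addrAC; congr (_ + _).
    transitivity (rip (applyc M U ord0 + ((fun x => K%:C%C * U ord0 x) : R * R -> Rcomplex R)) (W ord0)).
      by congr rip; apply/funext => x; rewrite /applyc sum_shiftc.
    rewrite (linear_onD (rip_lin (lW ord0)) (lMU ord0) lK); congr (_ + _).
    rewrite -(linear_onZ K (@l2_subspace R) (rip_lin (lW ord0)) (lU ord0)); congr rip.
    by apply/funext => x; rewrite fctE; case: (U ord0 x) => p q; congr Complex => /=; ring.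
  by apply: eq_bigr => k _; congr rip; apply/funext => x; rewrite /applyc sum_shiftc addr0.
have [l1 _] := l2_cmul (Complex K 1) (lU ord0).
rewrite /load (linear_onD (rip_lin (lW ord0)) lf l1) -HU// -addrA; congr (_ + _).
have [li _] := l2_cmul 'i%C (lW ord0).
rewrite rip_conj.
have -> : rip (U ord0) (fun x => conjc (Complex K 1) * W ord0 x) =
    rip (K *: W ord0 - ((fun x => 'i%C * W ord0 x) : R * R -> Rcomplex R)) (U ord0).
  rewrite ripC; congr rip; apply/funext => x; rewrite !fctE.
  by case: (W ord0 x) => p q; congr Complex => /=; ring.
have RL := rip_lin (lU ord0).
rewrite (linear_onB RL (subspaceZ K (@l2_subspace R) (lW ord0)) li).
rewrite (linear_onZ K (@l2_subspace R) RL (lW ord0)) (ripC (W ord0)) (ripC _ (U ord0)); ring.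
Qed.

(* Stretching a test function close to U produces competitors for the smaller domain;
   their energy exceeds that of U by O(k - 1), because the derivatives fall on the
   coefficients, so no regularity of U is needed. *)
Let stretch_competitor f U (k e : R) u : l2 f -> rsolves M Om0 f U -> 1 <= k <= 2 ->
  ctest_fun Om0 u -> nsqt (jetC u - U) <= e ->
  c * nsqt (jetC (fun x => u (stretch d k x)) - U) <=
    (36 * (2 * (L * d) + BH + BH * d) * (k - 1)) * nsqt (jetC u) + (12 * BH ^+ 2 + 1) * e +
    d * (k - 1) * (nsq (load f U) + nsqt (jetC u)).
Proof.
move=> lf HU k12 tu ue; have k0 : 0 < k by case/andP: k12 => ? _; lra.
have k1 : 1 <= k by case/andP: k12.
have [VU _] := HU; have [lU _] := VU; pose T x := u (stretch d k x).
have tT : ctest_fun Om0 T by apply: (ctest_stretch k0 tu) => x /(stretch_strip k1)[].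
have lT := ctest_jet_l2t tT; have lu := ctest_jet_l2t tu.
have lTU := l2tB lT lU; have luU := l2tB lu lU.
have [lF _] := load_l2 lf lU.
have VT := Vsp_jetC tT; have Vu := Vsp_jetC tu.
have eqH W : Vsp Om0 W -> sform H U W = rip (load f U) (W ord0) by exact: hermitian_equation.
have c1 := sform_coercive bH cM lTU.
(* The energy distance of X to [U] is h(X,X) - 2 <load, X> up to a constant in X. Written for [T]
   and for [u] and subtracted, it leaves the change of the form, controlled by [sform_stretch], and
   a linear term. *)
have sT : sform H (jetC T - U) (jetC T - U) =
    sform H (jetC T) (jetC T) - 2 * rip (load f U) T + sform H U U.
  have SL := sform_linr bH lTU.
  rewrite (linear_onB SL lT lU) (linear_onB (sform_linl bH lT) lT lU) (linear_onB (sform_linl bH lU) lT lU).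
  rewrite (sform_sym bH hH lT lU) (eqH _ VT) /jetC mktri0; ring.
have su : sform H (jetC u - U) (jetC u - U) =
    sform H (jetC u) (jetC u) - 2 * rip (load f U) u + sform H U U.
  have SL := sform_linr bH luU.
  rewrite (linear_onB SL lu lU) (linear_onB (sform_linl bH lu) lu lU) (linear_onB (sform_linl bH lU) lu lU).
  rewrite (sform_sym bH hH lu lU) (eqH _ Vu) /jetC mktri0; ring.
have wH p l : (p, l) != (ord0, ord0) ->
    weakly_lipschitz d L (fun x => re (H p l x)) /\ weakly_lipschitz d L (fun x => im (H p l x)).
  move=> pl; have := wM pl; rewrite /H /shiftc.
  have -> : (p == ord0) && (l == ord0) = false by apply: negbTE; move: pl; rewrite xpair_eqE.
  by move=> [w1 w2]; split; [move: w1|move: w2]; congr weakly_lipschitz; apply/funext => x; rewrite addr0.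
have := sform_stretch d0 BH0 L0 bH wH tu k12; rewrite -/T ler_norml => /andP[_ hS].
(* The factor 12 BH^2 + 1 is an upper bound for the square root of 12 BH^2. *)
have hE : sform H (jetC u - U) (jetC u - U) <= (12 * BH ^+ 2 + 1) * e.
  have := sform_le bH luU luU; move: ue (nsqt_ge0 (jetC u - U)).
  move: (sform H _ _) (nsqt _) => s n ue n0 h.
  apply: (@le_trans _ _ ((12 * BH ^+ 2 + 1) * n)); last first.
    by rewrite ler_wpM2l// addr_ge0// mulr_ge0// sqr_ge0.
  have [s0|s0] := leP s 0; first by rewrite (le_trans s0)// mulr_ge0// addr_ge0// mulr_ge0// sqr_ge0.
  have b0 := sqr_ge0 BH; have y0 : 0 <= (12 * BH ^+ 2 + 1) * n by rewrite mulr_ge0// addr_ge0// mulr_ge0.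
  rewrite -(ler_pXn2r (ltn0Sn 1)) ?nnegrE//; last exact: ltW.
  apply: (le_trans h); rewrite [leRHS]exprMn -[n * n]/(n ^+ 2) ler_wpM2r ?sqr_ge0//.
  by move: (BH ^+ 2) b0 => X X0; nra.
(* The linear term: Cauchy-Schwarz with [stretch_l2_le], then the inequality of arithmetic and
   geometric means. *)
have hF : - (2 * (rip (load f U) T - rip (load f U) u)) <=
    d * (k - 1) * (nsq (load f U) + nsqt (jetC u)).
  have lT0 : l2 T := ctest_l2 tT; have lu0 : l2 u := ctest_l2 tu.
  rewrite !(ripC (load f U)) -(linear_onB (rip_lin lF) lT0 lu0).
  have h1 := rip_cauchy_schwarz (l2B lT0 lu0) lF.
  have h2 : nsq (T - u) <= (d * (k - 1)) ^+ 2 * nsqt (jetC u).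
    apply: (le_trans (stretch_l2_le d0 tu k12)); rewrite ler_wpM2l ?sqr_ge0//.
    by have := nsq_le_nsqt (jetC u) (lift ord0 j2); rewrite /jetC mktriS.
  move: h1 h2 (nsq_ge0 (load f U)) (nsqt_ge0 (jetC u)) (nsq_ge0 (T - u)).
  have a0 : 0 <= d * (k - 1) by rewrite mulr_ge0 ?subr_ge0// ltW.
  move: (d * (k - 1)) a0 (rip _ _) (nsq (T - u)) (nsq (load f U)) (nsqt (jetC u)).
  move=> a a0 r m p q h1 h2 p0 q0 m0.
  have h3 : r ^+ 2 <= (a * ((p + q) / 2)) ^+ 2.
    apply: (le_trans h1); apply: (@le_trans _ _ (a ^+ 2 * q * p)); first by rewrite ler_wpM2r.
    rewrite exprMn -mulrA ler_wpM2l ?sqr_ge0//.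
    by have := sqr_ge0 (p - q); lra.
  have h4 : `|r| <= a * ((p + q) / 2).
    rewrite -(ler_pXn2r (ltn0Sn 1)) ?nnegrE ?real_normK ?num_real//.
    by rewrite mulr_ge0// divr_ge0// addr_ge0.
  move: h4; rewrite ler_norml => /andP[h4 _].
  by rewrite (_ : a * (p + q) = 2 * (a * ((p + q) / 2))); [lra|field].
move: c1 sT su hS hE hF; rewrite -/T.
set s1 := sform H (jetC T - U) (jetC T - U); set s2 := sform H (jetC T) (jetC T).
set s3 := sform H (jetC u - U) (jetC u - U); set s4 := sform H (jetC u) (jetC u).
set s5 := sform H U U; set r1 := rip (load f U) T; set r2 := rip (load f U) u.
set n1 := nsqt (jetC T - U); set n2 := nsqt (jetC u); set n3 := nsq (load f U).
set y := (12 * BH ^+ 2 + 1) * e; set A1 := 36 * _; set A2 := d * (k - 1); set A3 := k - 1.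
move: s1 s2 s3 s4 s5 r1 r2 n1 n2 n3 y A1 A2 A3.
move=> s1 s2 s3 s4 s5 r1 r2 n1 n2 n3 y A1 A2 A3 h1 h2 h3 h4 h5 h6.
rewrite (_ : A1 * A3 * n2 = A1 * n2 * A3); last by ring.
by move: h1 h2 h3 h4 h5 h6; lra.
Qed.

(** [U] is only a limit of test functions, so the estimate first carries an error proportional to
    [e], which bounds the squared distance of a test function to [U]. The coefficient of [k - 1]
    involves neither [e] nor the domain, so [e] can tend to 0 at the end. *)
Lemma dirichlet_rate : exists2 C : R, 0 <= C &
  forall Om' f f' U U' k, Om' `<=` Om0 -> l2 f -> l2 f' -> 1 <= k <= 2 ->
    (forall x, Om0 (stretch d k x) -> Om' x) ->
    (forall W, Vsp Om' W -> rip f' (W ord0) = rip f (W ord0)) ->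
    rsolves M Om0 f U -> rsolves M Om' f' U' ->
    nsqt (U' - U) <= C * (k - 1) * nsq f.
Proof.
have BN0 : 0 <= BN by rewrite mulr_ge0// addr_ge0// ?mulr_ge0// sqr_ge0.
have dS0 : 0 <= d := ltW d0; have K20 := sqr_ge0 K.
pose S := 36 * (2 * (L * d) + BH + BH * d).
have S0 : 0 <= S by rewrite /S; nonneg.
(* [Q] is the a priori bound for [U], [P] the energy excess per unit of [k - 1], and [G] the
   constant of Cea's lemma divided by the coercivity constant of h + K. *)
pose Q := (1 + K ^+ 2) / c ^+ 2.
have Q0 : 0 <= Q by rewrite divr_ge0 ?addr_ge0// sqr_ge0.
pose P := (S + d) * (2 * Q) + d * (2 + 2 * (1 + K ^+ 2) * Q).
have P0 : 0 <= P by rewrite /P; nonneg.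
pose G := 12 * BN / (c ^+ 2 * c); have G0 : 0 <= G by rewrite /G; nonneg.
exists (G * P); first exact: mulr_ge0.
move=> Om' f f' U U' k OO lf lf' k12 sO ff HU HU'.
have [[lU VU] _] := HU; have k1 : 1 <= k by case/andP: k12.
have k0 : 0 < k by lra.
have nU : nsqt U <= Q * nsq f.
  rewrite /Q mulrAC ler_pdivlMr ?exprn_gt0// mulrC; exact: rsolves_bound lf HU.
have nF := (load_l2 lf lU).2.
suff X (e : R) : 0 < e -> e <= 1 -> nsqt (U' - U) <= G * P * (k - 1) * nsq f + e * (G * (2 * (S + d) + (12 * BH ^+ 2 + 1))).
  set j := G * (2 * (S + d) + (12 * BH ^+ 2 + 1)) in X.
  have j0 : 0 <= j by rewrite /j; nonneg.
  apply/ler_addgt0Pl => a a0.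
  have j1 : 0 < j + 1 by rewrite ltr_wpDl.
  have m0 : 0 < Num.min 1 (a / (j + 1)) by rewrite lt_min ltr01 divr_gt0.
  apply: (le_trans (X _ m0 _)); first by rewrite ge_min lexx.
  rewrite addrC lerD2r; apply: (@le_trans _ _ (a / (j + 1) * j)).
    by rewrite ler_wpM2r// ge_min lexx orbT.
  by rewrite mulrAC ler_pdivrMr//; apply: ler_wpM2l; [exact: ltW|rewrite lerDl].
move=> e0 e1; have [u tu ue] := VU e e0.
have ue' : nsqt (jetC u - U) <= e by rewrite nsqtBC ltW.
have tT := ctest_stretch k0 tu sO.
have h1 := stretch_competitor lf HU k12 tu ue'.
have [lz _] := l2_cmul z lf; have [lz' _] := l2_cmul z lf'.
have h2 : c ^+ 2 * nsqt (U' - U) <= 12 * BN * nsqt (jetC (fun x => u (stretch d k x)) - U).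
  apply: (cea BN0 c0 bN cN OO lz lz' _ _ _ (Vsp_jetC tT)); [exact/rsolvesP|exact/rsolvesP|].
  by move=> W VW; rewrite !rip_conj; exact: (ff _ (twist_Vsp (conjc z) VW)).
have h3 : nsqt (jetC u) <= 2 * nsqt U + 2 * e.
  rewrite -[jetC u](subrK U) addrC.
  have lu := ctest_jet_l2t tu.
  by apply: (le_trans (nsqtD lU (l2tB lu lU))); rewrite lerD2l ler_wpM2l.
move: h1 h2 h3 nU nF (nsqt_ge0 U) (nsq_ge0 f) (nsqt_ge0 (jetC u)).
rewrite -/S; move: (nsqt (jetC (fun x => u (stretch d k x)) - U)) (nsqt (U' - U)) => x y.
move: (nsqt (jetC u)) (nsqt U) (nsq f) (nsq (load f U)) => q p n m h1 h2 h3 h4 h5 p0 n0 q0.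
have kk : 0 <= k - 1 <= 1 by move: k12 => /andP[? ?]; apply/andP; split; lra.
move: (k - 1) kk h1 => s /andP[s0 s1] h1.
have q1 : q <= 2 * Q * n + 2 * e by move: h3 h4; lra.
have m1 : m <= 2 * n + 2 * (1 + K ^+ 2) * Q * n.
  apply: (le_trans h5); rewrite lerD2l -(mulrA _ Q) ler_wpM2l//.
  by rewrite mulr_ge0// addr_ge0.
have h6 : c * x <= P * s * n + e * (2 * (S + d) + (12 * BH ^+ 2 + 1)).
  apply: (le_trans h1).
  have t1 : S * s * q <= S * s * (2 * Q * n + 2 * e) by rewrite ler_wpM2l// mulr_ge0.
  have t2 : d * s * (m + q) <= d * s * (2 * n + 2 * (1 + K ^+ 2) * Q * n + (2 * Q * n + 2 * e)).
    by rewrite ler_wpM2l ?mulr_ge0// lerD.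
  have t3 : S * s * (2 * e) <= S * (2 * e).
    by rewrite -(mulrA S) ler_wpM2l// ler_piMl// mulr_ge0// ltW.
  have t4 : d * s * (2 * e) <= d * (2 * e).
    by rewrite -(mulrA d) ler_wpM2l// ler_piMl// mulr_ge0// ltW.
  move: t1 t2 t3 t4; rewrite /P; move: (12 * BH ^+ 2 + 1) (K ^+ 2) => b1 b2; lra.
have c2 : 0 < c ^+ 2 * c by rewrite mulr_gt0// exprn_gt0.
rewrite -(ler_pM2l c2).
have -> : c ^+ 2 * c * (G * P * s * n + e * (G * (2 * (S + d) + (12 * BH ^+ 2 + 1)))) =
   12 * BN * (P * s * n + e * (2 * (S + d) + (12 * BH ^+ 2 + 1))).
  rewrite /G; move: (P) (S) (BH) (BN) => P' S' b1 b2; field.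
  exact: lt0r_neq0.
apply: (@le_trans _ _ (12 * BN * (c * x))); last by rewrite ler_wpM2l// mulr_ge0.
have := ler_wpM2l (ltW c0) h2; move: (BN) => b h7.
have e2 : c * (12 * b * x) = 12 * b * (c * x) by ring.
have e3 : c * (c ^+ 2 * y) = c ^+ 2 * c * y by ring.
by rewrite -e2 -e3.
Qed.

End Rate.

(** * The coefficients of the operator *)

Section Coefficients.
Context {R : realType}.
Local Notation mu := (@leb2 R).
Local Notation T2 := (measurableTypeR R * measurableTypeR R)%type.
Local Notation dir := (@dir R).
Local Notation re := (@complex.Re R).
Local Notation im := (@complex.Im R).
Local Notation tri := ('I_3 -> R * R -> Rcomplex R).
Local Notation coefs := ('I_3 -> 'I_3 -> R * R -> Rcomplex R).
Local Notation j2 := (lift ord0 ord0 : 'I_2).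
Implicit Types (Om D : set (R * R)) (u v w f : R * R -> R[i]) (U V W X : tri) (M : coefs).

Lemma Loo_bound Om u : Lp Om +oo%E u ->
  exists2 b : R, 0 <= b & {ae mu, forall x, Om x -> cnorm (u x) <= b}.
Proof.
(* By convention the norm is 0 when the whole space is null; otherwise it is the essential
   supremum. *)
move=> [_]; rewrite /Lpnorm unlock; case: ifPn => [_|mu0 _]; last first.
  exists 0 => //; exists setT; split => //.
  by apply/eqP; rewrite eq_le measure_ge0 andbT leNgt.
set f := EFin \o _; set s := ess_sup _ _ => soo.
have := @ess_sup_ge _ T2 R mu (abse \o f); rewrite -/s => H.
exists `|fine s| => //; move: H; apply: (@filterS _ _ (ae_filter_ringOfSetsType mu)) => x /= h xO.
have fx : cnorm (u x) <= `|((cnorm \o u) \_ Om) x|.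
  by rewrite patchE mem_set//=; exact: ler_norm.
apply: (le_trans fx); move: h soo; case: (s) => [r||]//=; rewrite lee_fin => h _.
by apply: (le_trans h); exact: ler_norm.
Qed.

Variable d : R.
Local Notation Om0 := (strip (@flat R) d).

Lemma strip0_open : open Om0.
Proof. by apply: (@strip_open _ (@flat R) (fun=> d)) => t; exact: cvg_cst. Qed.

Lemma weakly_lipschitzW (L L' : R) (m : R * R -> R) : L <= L' ->
  weakly_lipschitz d L m -> weakly_lipschitz d L' m.
Proof.
by move=> LL [m' [mm' mL wm]]; exists m'; split => // x; apply: le_trans (mL x) LL.
Qed.

Lemma weakly_lipschitz_ae (p q m : R * R -> R) (L : R) : 0 <= L ->
  measurable_fun (Om0 : set T2) (p : T2 -> R) -> measurable_fun (Om0 : set T2) (q : T2 -> R) ->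
  {ae mu, forall x, Om0 x -> `|q x| <= L} ->
  (forall psi, test_fun Om0 psi -> \int[mu]_(x in Om0) (p x * 'D_(dir j2) psi x) =
     - \int[mu]_(x in Om0) (q x * psi x)) ->
  measurable_fun setT (m : T2 -> R) -> {ae mu, forall x, Om0 x -> m x = p x} ->
  weakly_lipschitz d L m.
Proof.
move=> L0 mp mq qL pq mm mpe; have mO := open_plane_measurable strip0_open.
pose q' (x : T2) : R := if x \in (Om0 : set T2) then q x else 0.
have mq' : measurable_fun setT q'.
  rewrite (_ : q' = q \_ (Om0 : set T2)); last by apply/funext => x; rewrite patchE.
  exact/(measurable_restrictT q mO).
(* Clamping to [-L, L] makes the bound hold everywhere and alters the derivative only on a null
   set. *)
pose m' x := Num.max (- L) (Num.min L (q' x)).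
have mm' : measurable_fun setT m'.
  apply: measurable_maxr; first exact: measurable_cst.
  by apply: measurable_minr => //; exact: measurable_cst.
exists m'; split => //.
  move=> x; rewrite ler_norml /m' le_max lexx/= ge_max ge_min lexx/= andbT; lra.
move=> psi tpsi; have tD := test_fun_derive j2 tpsi.
have mpsi := continuous_plane_measurable (test_fun_continuous tpsi).
have mD := continuous_plane_measurable (test_fun_continuous tD).
rewrite -!(@Rintegral_supp _ Om0); last 2 first.
- by move=> x nx; rewrite (test_fun_eq0 tpsi nx) mulr0.
- by move=> x nx; rewrite (test_fun_eq0 tD nx) mulr0.
have aeE (f g : T2 -> R) : measurable_fun (Om0 : set T2) f -> measurable_fun (Om0 : set T2) g ->
    {ae mu, forall x, Om0 x -> f x = g x} -> \int[mu]_(x in Om0) f x = \int[mu]_(x in Om0) g x.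
  move=> mf mg fg; congr fine; apply: ae_eq_integral => //; [exact/measurable_EFinP..|].
  move: fg; apply: (@filterS _ _ (ae_filter_ringOfSetsType mu)) => x h xO.
  by rewrite /= h.
transitivity (\int[mu]_(x in Om0) (p x * 'D_(dir j2) psi x)).
  apply: aeE.
  - by apply: measurable_funTS; apply: measurable_funM.
  - by apply: measurable_funM => //; exact: measurable_funTS.
  - move: mpe; apply: (@filterS _ _ (ae_filter_ringOfSetsType mu)) => x h xO.
    by rewrite h.
rewrite pq//; congr (- _); apply: aeE.
- by apply: measurable_funM => //; exact: measurable_funTS.
- by apply: measurable_funTS; apply: measurable_funM.
- move: qL; apply: (@filterS _ _ (ae_filter_ringOfSetsType mu)) => x h xO.
  have := h xO; rewrite ler_norml /m' /q' mem_set// => /andP[h1 h2].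
  by rewrite (min_idPr h2) (max_idPr h1).
Qed.

Lemma sobolev_weakly_lipschitz u : sobolev Om0 +oo%E 1 u -> exists2 L : R, 0 <= L &
  [/\ forall m : T2 -> R, measurable_fun setT m -> {ae mu, forall x, Om0 x -> m x = re (u x)} ->
        weakly_lipschitz d L m,
      forall m : T2 -> R, measurable_fun setT m -> {ae mu, forall x, Om0 x -> m x = im (u x)} ->
        weakly_lipschitz d L m &
      forall m : T2 -> R, measurable_fun setT m -> {ae mu, forall x, Om0 x -> m x = - im (u x)} ->
        weakly_lipschitz d L m].
Proof.
move=> [[[mr mi] _] /(_ j2)[w ww lw]].
have [[mwr mwi] _] := lw; have [L L0 bL] := Loo_bound lw.
have [_ _ wr wi] := (is_wderivP _ _ _ _).1 ww.
exists L => //; split=> m mm me.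
- apply: (weakly_lipschitz_ae L0 mr mwr _ wr mm me).
  move: bL; apply: (@filterS _ _ (ae_filter_ringOfSetsType mu)) => x h xO.
  exact: le_trans (re_le_cnorm _) (h xO).
- apply: (weakly_lipschitz_ae L0 mi mwi _ wi mm me).
  move: bL; apply: (@filterS _ _ (ae_filter_ringOfSetsType mu)) => x h xO.
  exact: le_trans (im_le_cnorm _) (h xO).
- have mN (f : T2 -> R) : measurable_fun (Om0 : set T2) f -> measurable_fun (Om0 : set T2) (fun x => - f x).
    by move=> mf; exact: measurableT_comp.
  apply: (weakly_lipschitz_ae (q := fun x => - im (w x)) L0 (mN _ mi) (mN _ mwi) _ _ mm me).
    move: bL; apply: (@filterS _ _ (ae_filter_ringOfSetsType mu)) => x h xO.
    by rewrite normrN; exact: le_trans (im_le_cnorm _) (h xO).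
  move=> psi tpsi.
  have tN : test_fun Om0 (fun x => -1 * psi x) by apply: test_funM => //; exact: smooth_cst.
  transitivity (\int[mu]_(x in Om0) (im (u x) * 'D_(dir j2) (fun x => -1 * psi x) x)).
    apply: eq_Rintegral => x _; have [_ ->] := is_deriveZ (-1) (test_fun_is_derive j2 x tpsi).
    by rewrite /GRing.scale/=; ring.
  by rewrite wi//; congr (- _); apply: eq_Rintegral => x _; ring.
Qed.

Lemma finite_bound (I : finType) (P : I -> R -> Prop) :
  (forall i b b', b <= b' -> P i b -> P i b') -> (forall i, exists b, P i b) ->
  exists2 b, 0 <= b & forall i, P i b.
Proof.
move=> PW /choice[b Pb]; exists (\sum_i `|b i|); first exact: sumr_ge0.
move=> i; apply: PW (Pb i); apply: (le_trans (ler_norm _)).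
by rewrite (bigD1 i)//= lerDl sumr_ge0.
Qed.

Lemma ae_ord3 (P : 'I_3 -> R * R -> Prop) : (forall k, {ae mu, forall x, P k x}) ->
  {ae mu, forall x, forall k, P k x}.
Proof.
move=> H; have F := ae_filter_ringOfSetsType mu.
have := @filterS3 _ _ F _ _ _ _ _ (H ord0) (H (lift ord0 ord0)) (H (lift ord0 (lift ord0 ord0))).
apply => x h0 h1 h2; apply: ord3P => // j.
by case: (unliftP ord0 j) => [i|] ->//; rewrite (ord1 i).
Qed.

Variables (A : 'I_2 -> 'I_2 -> R * R -> R[i]) (a : 'I_2 -> R * R -> R[i]) (a0 : R * R -> R) (c0 : R).
Hypotheses (c00 : 0 < c0)
  (A_W2oo : forall i j, sobolev Om0 +oo%E 2 (A i j))
  (a_W1oo : forall j, sobolev Om0 +oo%E 1 (a j))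
  (a0_Loo : Lp Om0 +oo%E (fun x => (a0 x)%:C%C))
  (A_elliptic : hermitian_elliptic Om0 A c0).

(* Index 0 stands for the function itself, index j + 1 for its j-th derivative. *)
Definition raw_coefs : coefs := fun k l =>
  match unlift ord0 k, unlift ord0 l with
  | Some i, Some j => A i j
  | None, Some j => a j
  | Some i, None => fun x => conjc (a i x)
  | None, None => fun x => (a0 x)%:C%C
  end.

Lemma cnorm_conj (w : R[i]) : cnorm (conjc w) = cnorm w.
Proof. by case: w => p q; rewrite /cnorm/= sqrrN. Qed.

Lemma A_W1oo i j : sobolev Om0 +oo%E 1 (A i j).
Proof.
have [lA H] := A_W2oo i j; split => // k; have [w ww [lw _]] := H k; by exists w.
Qed.

Lemma raw_Lp k l : cmeasurable_fun Om0 (raw_coefs k l) /\ exists b : R, {ae mu, forall x, Om0 x -> cnorm (raw_coefs k l x) <= b}.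
Proof.
have H u : Lp Om0 +oo%E u -> cmeasurable_fun Om0 u /\ exists b : R, {ae mu, forall x, Om0 x -> cnorm (u x) <= b}.
  by move=> lu; split; [case: lu|have [b _ hb] := Loo_bound lu; exists b].
move: k l; apply: ord3P => [|i]; apply: ord3P => [|j]; rewrite /raw_coefs ?unlift_none ?liftK.
- exact: H.
- by apply: H; have [] := a_W1oo j.
- have [|[mr mi] [b hb]] := H (a i); first by have [] := a_W1oo i.
  split; last by exists b; move: hb; apply: (@filterS _ _ (ae_filter_ringOfSetsType mu)) => x h xO; rewrite cnorm_conj; exact: h.
  split.
    by under eq_fun do rewrite re_conj.
  by under eq_fun do rewrite im_conj; exact: measurableT_comp.
- by apply: H; have [] := A_W2oo i j.
Qed.

(** Quantified over every [m] equal to the coefficient almost everywhere in the strip, because the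
    coefficients are later redefined on a null set and outside the strip. *)
Lemma raw_weak k l : (k, l) != (ord0, ord0) -> exists L : R, forall m : R * R -> R[i],
  cmeasurable_fun setT m -> {ae mu, forall x, Om0 x -> m x = raw_coefs k l x} ->
  weakly_lipschitz d L (fun x => re (m x)) /\ weakly_lipschitz d L (fun x => im (m x)).
Proof.
move: k l; apply: ord3P => [|i]; apply: ord3P => [|j]; rewrite /raw_coefs ?unlift_none ?liftK.
- by rewrite eqxx.
- move=> _; have [L _ [h1 h2 _]] := sobolev_weakly_lipschitz (a_W1oo j).
  exists L => m [mr mi] me; split; [apply: h1 => //|apply: h2 => //]; move: me;
  by apply: (@filterS _ _ (ae_filter_ringOfSetsType mu)) => x h xO; rewrite h.
- move=> _; have [L _ [h1 _ h2]] := sobolev_weakly_lipschitz (a_W1oo i).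
  exists L => m [mr mi] me; split; [apply: h1 => //|apply: h2 => //]; move: me;
  by apply: (@filterS _ _ (ae_filter_ringOfSetsType mu)) => x h xO; rewrite h// ?re_conj ?im_conj.
- move=> _; have [L _ [h1 h2 _]] := sobolev_weakly_lipschitz (A_W1oo i j).
  exists L => m [mr mi] me; split; [apply: h1 => //|apply: h2 => //]; move: me;
  by apply: (@filterS _ _ (ae_filter_ringOfSetsType mu)) => x h xO; rewrite h.
Qed.

(** Values for points off the strip or where the assumptions fail: Hermitian and elliptic with the
    same constant [c0]. *)
Definition default_coefs : coefs :=
  fun k l _ => if (k == l) && (k != ord0) then c0%:C%C else 0.

Definition elliptic_block M x := forall w : 'I_2 -> R[i],
  c0 * \sum_i rdot (w i) (w i) <=
  \sum_i \sum_j rdot (M (lift ord0 i) (lift ord0 j) x * w j) (w i).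

Lemma re_sum (I : Type) (r : seq I) (F : I -> R[i]) : re (\sum_(i <- r) F i) = \sum_(i <- r) re (F i).
Proof. by apply: (big_morph re) => // z w; exact: reD. Qed.

Lemma raw_elliptic : {ae mu, forall x, Om0 x -> elliptic_block raw_coefs x /\
  forall k l, raw_coefs k l x = conjc (raw_coefs l k x)}.
Proof.
move: A_elliptic; apply: (@filterS _ _ (ae_filter_ringOfSetsType mu)) => x h xO.
have [hA eA] := h xO; split.
  have nE (z : R[i]) : `|conjc z| ^+ 2 = (rdot z z)%:C%C.
    case: z => p q; rewrite normc_def -rmorphXn/= sqrrN sqr_sqrtr ?addr_ge0 ?sqr_ge0//.
  (* The hypothesis pairs A_ij with z_i and conj(z_j), the form with w_j and conj(w_i); conjugating
     the vector exchanges the roles. *)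
  move=> w; have := eA (fun i => conjc (w i)).
  rewrite (eq_bigr (fun i => (rdot (w i) (w i))%:C%C)); last by move=> i _; exact: nE.
  rewrite -rmorph_sum -rmorphM lecE => /andP[_] /= H.
  apply: (le_trans H); rewrite le_eqVlt; apply/orP; left; apply/eqP.
  rewrite re_sum; apply: eq_bigr => i _; rewrite re_sum; apply: eq_bigr => j _.
  by rewrite /raw_coefs !liftK /rdot !reimE; ring.
have cc (z : R[i]) : conjc (conjc z) = z by case: z => p q /=; rewrite opprK.
apply: ord3P => [|i]; apply: ord3P => [|j]; rewrite /raw_coefs ?unlift_none ?liftK ?cc//.
by rewrite /= oppr0.
Qed.

Lemma default_elliptic x : elliptic_block default_coefs x /\
  forall k l, default_coefs k l x = conjc (default_coefs l k x).
Proof.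
split=> [w|k l].
  rewrite mulr_sumr le_eqVlt; apply/orP; left; apply/eqP; apply: eq_bigr => i _.
  rewrite (bigD1 i)//= big1 ?addr0.
    by rewrite /default_coefs eqxx/= /rdot !reimE /=; ring.
  move=> j ji; rewrite /default_coefs (inj_eq lift_inj) eq_sym (negbTE ji)/=.
  by rewrite mul0r /rdot /= !mul0r addr0.
rewrite /default_coefs eq_sym; case: eqP => [->|]; first by case: ifP => _; rewrite /= ?oppr0.
by rewrite /= oppr0.
Qed.

(** Expand |(c0/2) w + conj(m) z|^2 >= 0 and divide by [c0]: half of the ellipticity absorbs a
    first-order term. *)
Lemma lower_order_bound (B : R) (m w z : R[i]) : rdot m m <= B ->
  - (c0 / 2 * rdot w w) - 2 * B / c0 * rdot z z <= 2 * rdot (m * w) z.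
Proof.
move=> mB; have := rdot_ge0 (Complex (c0 / 2) 0 * w + conjc m * z).
have -> : rdot (Complex (c0 / 2) 0 * w + conjc m * z) (Complex (c0 / 2) 0 * w + conjc m * z) =
    c0 ^+ 2 / 4 * rdot w w + rdot m m * rdot z z + c0 * rdot (m * w) z.
  by rewrite /rdot !reimE /=; field.
have := ler_wpM2r (rdot_ge0 z) mB; move: (rdot w w) (rdot (m * w) z) => W X h1 h2.
rewrite -(ler_pM2l c00).
have -> : c0 * (- (c0 / 2 * W) - 2 * B / c0 * rdot z z) = - (c0 ^+ 2 / 2 * W) - 2 * B * rdot z z.
  by field; exact: lt0r_neq0.
move: h1 h2; generalize (rdot z z) (rdot m m) => Z V h1 h2; lra.
Qed.

(** Garding's inequality in pointwise form. In the shift, 4 B / c0 pays for the first-order terms in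
    both directions, 1 + B for the zeroth-order coefficient, and the last c0 / 2 is the coercivity
    kept on the function itself. *)
Lemma coercive_of_elliptic M (B : R) : 0 <= B -> bounded_coefs M B -> hermitian_coefs M ->
  (forall x, elliptic_block M x) ->
  coercive_coefs (shiftc (4 * B / c0 + (1 + B) + c0 / 2)%:C%C M) (c0 / 2).
Proof.
move=> B0 [_ bM] hM eM x Z; set K := _ + c0 / 2.
under [leRHS]eq_bigr do rewrite sum_shiftc.
have -> : \sum_(k < 3) rdot (\sum_l M k l x * Z l + (if k == ord0 then K%:C%C * Z ord0 else 0)) (Z k) =
    \sum_(k < 3) \sum_(l < 3) rdot (M k l x * Z l) (Z k) + K * rdot (Z ord0) (Z ord0).
  rewrite big_ord_recl [in RHS]big_ord_recl/= [RHS]addrAC; congr (_ + _); last first.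
    by apply: eq_bigr => k _; rewrite addr0 rdot_suml.
  by rewrite -rdot_suml /rdot !reimE /=; ring.
have -> : \sum_(k < 3) \sum_(l < 3) rdot (M k l x * Z l) (Z k) =
    (rdot (M ord0 ord0 x * Z ord0) (Z ord0) +
     \sum_(i < 2) rdot (M ord0 (lift ord0 i) x * Z (lift ord0 i)) (Z ord0)) +
    (\sum_(i < 2) rdot (M (lift ord0 i) ord0 x * Z ord0) (Z (lift ord0 i)) +
     \sum_(i < 2) \sum_(j < 2) rdot (M (lift ord0 i) (lift ord0 j) x * Z (lift ord0 j)) (Z (lift ord0 i))).
  rewrite big_ord_recl; congr (_ + _); first by rewrite big_ord_recl.
  by rewrite -big_split; apply: eq_bigr => i _; rewrite big_ord_recl.
have -> : \sum_(k < 3) rdot (Z k) (Z k) =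
    rdot (Z ord0) (Z ord0) + \sum_(i < 2) rdot (Z (lift ord0 i)) (Z (lift ord0 i)).
  by rewrite big_ord_recl.
have e1 := eM x (fun j => Z (lift ord0 j)).
have -> : \sum_(i < 2) rdot (M (lift ord0 i) ord0 x * Z ord0) (Z (lift ord0 i)) =
    \sum_(i < 2) rdot (M ord0 (lift ord0 i) x * Z (lift ord0 i)) (Z ord0).
  apply: eq_bigr => i _; rewrite (hM (lift ord0 i)) /rdot !reimE; ring.
have e2 : - (c0 / 2 * \sum_(i < 2) rdot (Z (lift ord0 i)) (Z (lift ord0 i))) - 4 * B / c0 * rdot (Z ord0) (Z ord0) <=
    2 * \sum_(i < 2) rdot (M ord0 (lift ord0 i) x * Z (lift ord0 i)) (Z ord0).
  have h (j : 'I_2) : - (c0 / 2 * rdot (Z (lift ord0 j)) (Z (lift ord0 j))) - 2 * B / c0 * rdot (Z ord0) (Z ord0) <=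
      2 * rdot (M ord0 (lift ord0 j) x * Z (lift ord0 j)) (Z ord0).
    exact: lower_order_bound.
  rewrite [leRHS]mulr_sumr; apply: (@le_trans _ _ (\sum_(j < 2) (- (c0 / 2 * rdot (Z (lift ord0 j)) (Z (lift ord0 j))) -
    2 * B / c0 * rdot (Z ord0) (Z ord0)))); last by apply: ler_sum => j _; exact: h.
  rewrite [leRHS]big_split /= !sumrN -mulr_sumr lerD2l lerN2 sumr_const card_ord -[leLHS]mulr_natl.
  by rewrite le_eqVlt; apply/orP; left; apply/eqP; field; exact: lt0r_neq0.
have e3 : - ((1 + B) * rdot (Z ord0) (Z ord0)) <= rdot (M ord0 ord0 x * Z ord0) (Z ord0).
  have := bM ord0 ord0 x; have := rdot_ge0 (M ord0 ord0 x * Z ord0 + Z ord0).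
  have -> : rdot (M ord0 ord0 x * Z ord0 + Z ord0) (M ord0 ord0 x * Z ord0 + Z ord0) =
    rdot (M ord0 ord0 x) (M ord0 ord0 x) * rdot (Z ord0) (Z ord0) + rdot (Z ord0) (Z ord0) +
    2 * rdot (M ord0 ord0 x * Z ord0) (Z ord0) by rewrite /rdot !reimE; ring.
  move: (rdot (M _ _ _ * _) _) (rdot (M _ _ _) _) (rdot (Z ord0) _) (rdot_ge0 (Z ord0)) => X m zz z0 h1 h2.
  by have := ler_wpM2r z0 h2; have := mulr_ge0 B0 z0; lra.
move: e1 e2 e3; rewrite /K.
move: (rdot (M ord0 ord0 x * Z ord0) _) (\sum_(i < 2) rdot (Z (lift ord0 i)) _).
move: (\sum_(i < 2) rdot (M ord0 (lift ord0 i) x * _) _) (\sum_(i < 2) \sum_(j < 2) _).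
move: (rdot (Z ord0) (Z ord0)) (4 * B / c0) => z b X1 X2 X3 X4 h1 h2 h3.
rewrite !mulrDl; lra.
Qed.

(** The assumptions hold almost everywhere in the strip, while the form estimates want them at every
    point of the plane; a change of representative reconciles the two and leaves the forms on the
    strip unchanged. *)
Lemma admissible_coefs : exists M (B L : R), [/\ 0 <= B, 0 <= L & [/\ bounded_coefs M (B ^+ 2),
  hermitian_coefs M, forall x, elliptic_block M x,
  forall k l, (k, l) != (ord0, ord0) -> weakly_lipschitz d L (fun x => re (M k l x)) /\
    weakly_lipschitz d L (fun x => im (M k l x)) &
  {ae mu, forall x, Om0 x -> forall k l, M k l x = raw_coefs k l x}]].
Proof.
have mO := open_plane_measurable strip0_open.
have [||b b0 hb] := @finite_bound ('I_3 * 'I_3)%type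
    (fun kl (b : R) => {ae mu, forall x, Om0 x -> cnorm (raw_coefs kl.1 kl.2 x) <= b}).
- move=> kl b b' bb; apply: (@filterS _ _ (ae_filter_ringOfSetsType mu)) => x h xO.
  exact: le_trans (h xO) bb.
- by move=> [k l]; exact: (raw_Lp k l).2.
have [||L L0 hL] := @finite_bound ('I_3 * 'I_3)%type
    (fun kl (L : R) => kl != (ord0, ord0) -> forall m : R * R -> R[i],
      cmeasurable_fun setT m -> {ae mu, forall x, Om0 x -> m x = raw_coefs kl.1 kl.2 x} ->
      weakly_lipschitz d L (fun x => re (m x)) /\ weakly_lipschitz d L (fun x => im (m x))).
- move=> kl L L' LL h k0 m mm me; have [h1 h2] := h k0 m mm me.
  by split; [exact: weakly_lipschitzW h1|exact: weakly_lipschitzW h2].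
- move=> [k l]; have [kl|kl] := eqVneq (k, l) (ord0, ord0); first by exists 0 => /negP; rewrite kl.
  by have [L hL] := raw_weak kl; exists L => _.
have hb2 : {ae mu, forall x, forall k l, Om0 x -> cnorm (raw_coefs k l x) <= b}.
  by apply: ae_ord3 => k; apply: ae_ord3 => l; exact: (hb (k, l)).
have [Z [mZ Z0 ZP]] : {ae mu, forall x, Om0 x -> (elliptic_block raw_coefs x /\
    forall k l, raw_coefs k l x = conjc (raw_coefs l k x)) /\ forall k l, cnorm (raw_coefs k l x) <= b}.
  apply: (@filterS2 _ _ (ae_filter_ringOfSetsType mu) _ _ _ _ raw_elliptic hb2) => x h1 h2 xO.
  by split; [exact: h1|move=> k l; exact: h2].
(* Removing a measurable null set, not just the bad points, keeps the modified coefficients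
   measurable. *)
pose G : set T2 := Om0 `\` Z; have mG : measurable G by exact: measurableD.
have GP x : G x -> (elliptic_block raw_coefs x /\
    forall k l, raw_coefs k l x = conjc (raw_coefs l k x)) /\ forall k l, cnorm (raw_coefs k l x) <= b.
  by move=> [xO xZ]; apply: contrapT => h; apply: xZ; apply: ZP => /= /(_ xO).
pose M : coefs := fun k l x => if x \in G then raw_coefs k l x else default_coefs k l x.
have MG x : G x -> forall k l, M k l x = raw_coefs k l x by move=> Gx k l; rewrite /M mem_set.
have MN x : ~ G x -> forall k l, M k l x = default_coefs k l x by move=> Gx k l; rewrite /M memNset.
have mM k l : cmeasurable_fun setT (M k l).
  have mr (h : R[i] -> R) : measurable_fun (Om0 : set T2) (fun x : T2 => h (raw_coefs k l x)) ->
      measurable_fun setT (fun x : T2 => h (M k l x)).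
    move=> mh; rewrite (_ : setT = G `|` ~` G); last by rewrite setUv.
    apply/measurable_funU => //; first exact: measurableC.
    split.
      apply: (eq_measurable_fun (fun x : T2 => h (raw_coefs k l x))).
        by move=> x; rewrite inE => /MG ->.
      by apply: measurable_funS mh => // x [].
    apply: (eq_measurable_fun (fun x : T2 => h (default_coefs k l (0, 0)))); last exact: measurable_cst.
    by move=> x; rewrite inE => /MN ->.
  by have [[h1 h2] _] := raw_Lp k l; split; exact: mr.
have aeM : {ae mu, forall x, Om0 x -> forall k l, M k l x = raw_coefs k l x}.
  exists Z; split => // x /= h; apply: contrapT => xZ; apply: h => xO; exact: MG.
exists M, (b + c0), L; split => //; first by rewrite addr_ge0// ltW.
split => //.
- split=> // k l x; have [Gx|Gx] := pselect (G x).
    rewrite MG// -cnorm_sqr ler_pXn2r ?nnegrE ?cnorm_ge0 ?addr_ge0 ?(ltW c00)//.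
    by apply: (le_trans ((GP x Gx).2 k l)); rewrite lerDl ltW.
  rewrite MN// /default_coefs; case: ifP => _; rewrite /rdot /= ?mulr0 ?mul0r addr0 ?sqr_ge0//.
  by rewrite -expr2 ler_pXn2r ?nnegrE ?addr_ge0 ?(ltW c00)// lerDr.
- move=> k l x; have [Gx|Gx] := pselect (G x); first by rewrite !MG//; exact: (GP x Gx).1.2.
  by rewrite !MN//; exact: (default_elliptic x).2.
- move=> x w; have [Gx|Gx] := pselect (G x).
    have := (GP x Gx).1.1 w; congr (_ <= _); apply: eq_bigr => i _; apply: eq_bigr => j _.
    by rewrite MG.
  have := (default_elliptic x).1 w; congr (_ <= _); apply: eq_bigr => i _; apply: eq_bigr => j _.
  by rewrite MN.
- move=> k l kl; apply: (hL (k, l) kl (M k l)) => //.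
  by move: aeM; apply: (@filterS _ _ (ae_filter_ringOfSetsType mu)) => x h xO; exact: h.
Qed.

End Coefficients.

(** * The resolvent *)

Section Resolvent.
Context {R : realType}.
Local Notation mu := (@leb2 R).
Local Notation T1 := (measurableTypeR R).
Local Notation re := (@complex.Re R).
Local Notation im := (@complex.Im R).
Local Notation tri := ('I_3 -> R * R -> Rcomplex R).
Local Notation coefs := ('I_3 -> 'I_3 -> R * R -> Rcomplex R).
Implicit Types (Om D : set (R * R)) (u v w f F G : R * R -> R[i]) (U V W X : tri) (M : coefs).

Lemma ipE Om F G : ip Om F G =
  Complex (rip (zext Om F) (fun x => 1 * zext Om G x)) (rip (zext Om F) (fun x => 'i%C * zext Om G x)).
Proof.
rewrite /ip /cint; congr Complex; rewrite Rintegral_mkcond; apply: eq_Rintegral => x _;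
  rewrite patchE /zext; case: ifP => _.
- by rewrite /rdot !reimE /=; ring.
- by rewrite /rdot /= !mul0r addr0.
- by rewrite /rdot !reimE /=; ring.
- by rewrite /rdot /= !mul0r addr0.
Qed.

Variables (d : R) (A : 'I_2 -> 'I_2 -> R * R -> R[i]) (a : 'I_2 -> R * R -> R[i]) (a0 : R * R -> R).
Local Notation Om0 := (strip (@flat R) d).
Hypotheses (A_W2oo : forall i j, sobolev Om0 +oo%E 2 (A i j))
  (a_W1oo : forall j, sobolev Om0 +oo%E 1 (a j))
  (a0_Loo : Lp Om0 +oo%E (fun x => (a0 x)%:C%C)).
Local Notation raw := (raw_coefs A a a0).
Variables (M : coefs) (B : R).
Hypotheses (B0 : 0 <= B) (bM : bounded_coefs M (B ^+ 2))
  (rawM : {ae mu, forall x, Om0 x -> forall k l, M k l x = raw k l x}).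

(** Real and imaginary parts are treated at once: [h] is one of them and [t] is 1 or ['i]
    accordingly. *)
Lemma raw_form Om (h : R[i] -> R) (t : R[i]) u v : Om `<=` Om0 -> open Om ->
  (forall z w : R[i], h (z + w) = h z + h w) ->
  (forall F G, h (ip Om F G) = rip (zext Om F) (fun x => t * zext Om G x)) ->
  sobolev Om 2%:E 1 u -> sobolev Om 2%:E 1 v ->
  h (hform Om A a a0 u v) = sform M (jet Om u) (twist t (jet Om v)).
Proof.
move=> OO oOm hD hip su sv; have mO0 := open_plane_measurable (@strip0_open R d).
have [lu _] := sobolev1_jet oOm su; have [lv _] := sobolev1_jet oOm sv.
have h0 : h 0 = 0 by have := hD 0 0; rewrite addr0; move: (h 0) => y; lra.
have hS (I : Type) (r : seq I) (Q : I -> R[i]) : h (\sum_(i <- r) Q i) = \sum_(i <- r) h (Q i).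
  exact: (big_morph h hD h0).
have lt : l2t (twist t (jet Om v)) by move=> k; exact: (l2_cmul t (lv k)).1.
rewrite (sform_sum bM lu lt).
have E k l : rip (fun x => M k l x * jet Om u l x) (twist t (jet Om v) k) =
    rip (fun x => raw k l x * jet Om u l x) (twist t (jet Om v) k).
  have [mraw _] := raw_Lp A_W2oo a_W1oo a0_Loo k l.
  have mz := (cmeasurable_restrict (raw k l) mO0).1 mraw.
  have jz y : ~ Om0 y -> jet Om u l y = 0.
    move=> ny; have ny' : ~ Om y by move=> /OO.
    by move: l {mraw mz}; apply: ord3P => [|j]; rewrite /jet ?mktri0 ?mktriS /zext memNset.
  have -> : (fun x => raw k l x * jet Om u l x) = (fun x => zext Om0 (raw k l) x * jet Om u l x).
    apply/funext => x; rewrite /zext; case: ifPn => // nx.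
    by rewrite (jz x) ?mulr0//; rewrite notin_setE in nx.
  apply: eq_ae_rip.
  - by apply: cmeasurableM; [exact: bM.1|exact: l2_measurable].
  - by apply: cmeasurableM => //; exact: l2_measurable.
  - exact: l2_measurable.
  - exact: l2_measurable.
  - move: rawM; apply: (@filterS _ _ (ae_filter_ringOfSetsType mu)) => x hx.
    have [xO|xO] := pselect (Om0 x); first by rewrite /zext mem_set// hx.
    by rewrite (jz x xO) !mulr0.
  - exact: aeW.
under [RHS]eq_bigr do under eq_bigr do rewrite E.
rewrite big_ord_recl [in X in X + _]big_ord_recl.
under [X in _ = _ + X]eq_bigr do rewrite big_ord_recl.
rewrite big_split.
rewrite /hform !hD !hS.
have zM (m w : R * R -> R[i]) : zext Om (fun x => m x * w x) = (fun x => m x * zext Om w x).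
  by apply/funext => x; rewrite /zext; case: ifP => // _; rewrite mulr0.
have -> : \sum_(i < 2) h (\sum_(j < 2) ip Om (fun x => A i j x * wderiv Om j u x) (wderiv Om i v)) =
    \sum_(i < 2) \sum_(i0 < 2) rip (fun x => raw (lift ord0 i) (lift ord0 i0) x * jet Om u (lift ord0 i0) x)
       (twist t (jet Om v) (lift ord0 i)).
  apply: eq_bigr => i _; rewrite hS; apply: eq_bigr => j _.
  by rewrite hip zM /raw_coefs !liftK /twist /jet !mktriS.
have -> : \sum_(i < 2) h (ip Om (fun x => a i x * wderiv Om i u x) v) =
    \sum_(i < 2) rip (fun x => raw ord0 (lift ord0 i) x * jet Om u (lift ord0 i) x)
       (twist t (jet Om v) ord0).
  apply: eq_bigr => i _.
  by rewrite hip zM /raw_coefs liftK unlift_none /twist /jet mktriS mktri0.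
have -> : \sum_(i < 2) h (ip Om u (fun x => a i x * wderiv Om i v x)) =
    \sum_(i < 2) rip (fun x => raw (lift ord0 i) ord0 x * jet Om u ord0 x)
       (twist t (jet Om v) (lift ord0 i)).
  apply: eq_bigr => i _.
  rewrite hip zM /raw_coefs liftK unlift_none /twist /jet mktriS mktri0.
  by apply: eq_Rintegral => x _; rewrite /rdot !reimE; ring.
rewrite hip zM; set X00 := rip _ _; set X00' := rip _ _.
have -> : X00 = X00'.
  by rewrite /X00 /X00' /raw_coefs unlift_none /twist /jet !mktri0.
rewrite /=; ring.
Qed.

Lemma hformE Om u v : Om `<=` Om0 -> open Om -> sobolev Om 2%:E 1 u -> sobolev Om 2%:E 1 v ->
  hform Om A a a0 u v =
    Complex (sform M (jet Om u) (jet Om v)) (sform M (jet Om u) (twist 'i%C (jet Om v))).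
Proof.
move=> OO oOm su sv.
have tw1 : twist 1 (jet Om v) = jet Om v by apply/funext => k; apply/funext => x; rewrite /twist mul1r.
have := @raw_form Om re 1 u v OO oOm (@reD R) _ su sv; rewrite tw1 => <-; last by move=> F G; rewrite ipE.
have := @raw_form Om im 'i%C u v OO oOm (@imD R) _ su sv => <-; last by move=> F G; rewrite ipE.
by case: hform.
Qed.

Lemma rip_add_i (f u w : R * R -> Rcomplex R) : l2 f -> l2 u -> l2 w ->
  rip (fun x => f x + 'i%C * u x) w = rip f w - rip u (fun x => 'i%C * w x).
Proof.
move=> lf lu lw; have [li _] := l2_cmul 'i%C lu; have [lwi _] := l2_cmul 'i%C lw.
rewrite -[LHS]/(rip (f + ((fun x => 'i%C * u x) : R * R -> Rcomplex R)) w).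
rewrite (linear_onD (rip_lin lw) lf li) rip_conj; congr (_ + _).
rewrite ripC (ripC u) -mulN1r -(linear_onZ (-1) (@l2_subspace R) (rip_lin lu) lwi); congr rip.
by apply/funext => x; rewrite fctE; case: (w x) => p q; congr Complex => /=; ring.
Qed.

Section Strip.
Variables (g : R -> R) (t0 L c K : R).
Hypotheses (L0 : 0 <= L) (gL : forall p q, `|g p - g q| <= L * `|p - q|)
  (mg : measurable_fun setT (derive1 g : T1 -> R)) (g0 : forall t, 0 <= g t)
  (gt0 : forall t, g t <= t0) (t0d : t0 < d).
Hypotheses (K0 : 0 <= K) (c0 : 0 < c) (hM : hermitian_coefs M) (cM : coercive_coefs (shiftc K%:C%C M) c).
Let Om := strip g d.

Lemma strip_sub0 : Om `<=` Om0.
Proof. by move=> x /andP[h1 h2]; apply/andP; split => //; exact: le_lt_trans (g0 _) h1. Qed.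

Lemma strip_graph_open : open Om.
Proof.
apply: (@strip_open _ g (fun=> d)) => t; last exact: cvg_cst.
apply/cvgrPdist_lt => e e0; have L1 : 0 < L + 1 by rewrite ltr_wpDl.
exists (e / (L + 1)) => /=; first by rewrite divr_gt0.
move=> y /=; rewrite ltr_pdivlMr// => h; apply: le_lt_trans (gL _ _) _.
by apply: le_lt_trans h; rewrite mulrC ler_wpM2l// lerDl.
Qed.

Let oOm := strip_graph_open.
Let mOm := open_plane_measurable oOm.

Lemma strip_l2 f : Lp Om0 2%:E f -> l2 (zext Om f).
Proof.
move=> /(Lp2P _ (open_plane_measurable (@strip0_open R d))) lf.
by rewrite -(zextE f strip_sub0); exact: (l2_restrict mOm lf).1.
Qed.

(** [resolventD] chooses from a set, so the set must be inhabited before anything is known about its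
    value. A solution of the real equation provides an element; conversely the chosen element,
    whichever it is, solves the real equation. *)
Lemma resolvent_rsolves f : Lp Om0 2%:E f ->
  let u := resolventD g d A a a0 'i%C f in
  sobolev Om 2%:E 1 u /\ rsolves M Om (zext Om f) (jet Om u).
Proof.
move=> /strip_l2 lf u.
have noG : forall g', [set g; (fun=> d)] g' -> forall t, ~ Om (t, g' t).
  by move=> g' [->|->] t /andP[] /=; rewrite ltxx.
have zD v w : zext Om (fun x => v x + 'i%C * w x) = fun x => zext Om v x + 'i%C * zext Om w x.
  by apply/funext => x; rewrite /zext; case: ifP => // _; rewrite mulr0 addr0.
have j0 v : jet Om v ord0 = zext Om v by rewrite /jet mktri0.
have tw W : twist 1 W = W by apply/funext => k; apply/funext => x; rewrite /twist mul1r.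
pose S := [set u | exists2 w, HD g d A a a0 u w & {ae mu, forall x, Om x -> w x - 'i%C * u x = f x}].
have [u1 Su1] : exists u1, S u1.
  have [U HU] := rsolves_exists B0 K0 c0 bM hM cM Om lf; have [VU eU] := HU.
  have [W12u aU] := Vsp_W12_0 oOm noG VU.
  have [su _] := W12u; have [lj _] := sobolev1_jet oOm su; have [lU _] := VU.
  have lu0 : l2 (zext Om (U ord0)) by rewrite -j0.
  exists (U ord0), (fun x => f x + 'i%C * U ord0 x); last by apply: aeW => x _; rewrite addrK.
  split => //.
    apply/(Lp2P _ mOm); rewrite zD; exact: (l2D lf (l2_cmul 'i%C lu0).1).
  move=> v vW; have [sv _] := vW; have Vv := W12_0_Vsp L0 gL mg gt0 t0d vW.
  rewrite (hformE strip_sub0 oOm su sv) ipE zD.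
  (* Used for [W] and for [twist 'i W], this real identity gives both parts of the complex one. *)
  have key W : Vsp Om W -> sform M (jet Om (U ord0)) W =
      rip (fun x => zext Om f x + 'i%C * zext Om (U ord0) x) (W ord0).
    move=> VW; have [lW _] := VW.
    rewrite (rip_add_i lf lu0 (lW ord0)) -eU// /sform.
    have [lMj _] := applyc_l2t bM lj; have [lMU _] := applyc_l2t bM lU.
    have [li _] := l2_cmul 'i%C (lW ord0).
    have -> : ript (applyc M (jet Om (U ord0))) W = ript (applyc M U) W.
      apply: aet_ript => // k; last exact: aeW.
      move: (ae_ord3 aU); apply: (@filterS _ _ (ae_filter_ringOfSetsType mu)) => x h.
      by apply: eq_bigr => l _; rewrite h.
    have -> : rip (zext Om (U ord0)) (fun x => 'i%C * W ord0 x) = rip (U ord0) (fun x => 'i%C * W ord0 x).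
      apply: eq_ae_rip; try exact: l2_measurable; last exact: aeW.
      by have := aU ord0; rewrite j0.
    by rewrite addrK.
  rewrite (key _ Vv) (key _ (twist_Vsp 'i%C Vv)); congr Complex; last by rewrite /twist j0.
  by rewrite j0; congr rip; apply/funext => x; rewrite mul1r.
(* The existence of [u1] excludes the default value of [xget]. *)
have [w [uW lw eW] ae_w] : S u by exact: (@xgetPex _ (fun=> 0) S (ex_intro _ u1 Su1)).
have [su _] := uW; split => //; have Vu := W12_0_Vsp L0 gL mg gt0 t0d uW.
have [lj _] := sobolev1_jet oOm su; have lu0 : l2 (zext Om u) by rewrite -j0.
move/(Lp2P _ mOm) : lw => lw.
split => // W VW; have [lW _] := VW.
have [vW aW] := Vsp_W12_0 oOm noG VW; have [sv _] := vW; have [ljv _] := sobolev1_jet oOm sv.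
have [lMu _] := applyc_l2t bM lj.
have := congr1 re (eW _ vW); rewrite (hformE strip_sub0 oOm su sv) ipE /=.
have -> : sform M (jet Om u) (jet Om (W ord0)) = sform M (jet Om u) W.
  by apply: aet_ript => // k; exact: aeW.
move=> ->; have lzW : l2 (zext Om (W ord0)) by rewrite -j0.
have aW0 := aW ord0; rewrite j0 in aW0.
have -> : (fun x => 1 * zext Om (W ord0) x) = zext Om (W ord0) by apply/funext => x; rewrite mul1r.
have -> : rip (zext Om w) (zext Om (W ord0)) = rip (fun x => zext Om f x + 'i%C * zext Om u x) (W ord0).
  apply: eq_ae_rip => //; try exact: l2_measurable.
  - exact: l2_measurable (l2D lf (l2_cmul 'i%C lu0).1).
  - move: ae_w; apply: (@filterS _ _ (ae_filter_ringOfSetsType mu)) => x h.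
    rewrite /zext; case: ifPn => [xO|_]; last by rewrite mulr0 addr0.
    by rewrite -h ?subrK//; rewrite inE in xO.
by rewrite (rip_add_i lf lu0 (lW ord0)) j0 subrK.
Qed.

End Strip.

End Resolvent.

(** * The oscillating strip *)

Section Oscillation.
Context {R : realType}.
Local Notation T1 := (measurableTypeR R).

Lemma periodic_bounded (f : R -> R) : continuous f -> (forall t, f (t + 1) = f t) ->
  exists2 C : R, 0 < C & forall t, `|f t| <= C.
Proof.
move=> cf pf.
have pn (n : nat) t : f (t + n%:R) = f t.
  elim: n => [|n IH]; first by rewrite addr0.
  by rewrite -natr1 addrA pf.
have : compact (f @` `[0, 1]).
  by apply: continuous_compact; [exact: continuous_subspaceT|exact: segment_compact].
move=> /compact_bounded[C [_ HC]]; exists (`|C| + 1); first by rewrite ltr_wpDl.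
move=> t; pose r := t - (Num.floor t)%:~R.
have r01 : 0 <= r <= 1.
  have /andP[] := floor_itv t; rewrite intrD1 /r; move: (_%:~R) => z h1 h2.
  by apply/andP; split; lra.
have -> : f t = f r.
  rewrite -[in LHS](subrK (Num.floor t)%:~R t) -/r; case: (Num.floor t) => n; first exact: pn.
  by rewrite NegzE mulrNz -[in RHS](subrK n.+1%:R r) pn.
apply: HC; first by rewrite ltr_pwDr// ler_norm.
by exists r => //; rewrite /= in_itv.
Qed.

Variable b : R -> R.
Hypotheses (b_C2 : C2 b) (b_periodic : forall t, b (t + 1) = b t).

Lemma b_is_derive t : is_derive t (1 : R) b (derive1 b t).
Proof. by have [db _ _] := b_C2; apply: DeriveDef => //; rewrite derive1E. Qed.

Lemma b_continuous : continuous b.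
Proof.
move=> t; apply: differentiable_continuous; apply/derivable1_diffP.
by have [db _ _] := b_C2; exact: db.
Qed.

Lemma db_continuous : continuous (derive1 b).
Proof.
move=> t; apply: differentiable_continuous; apply/derivable1_diffP.
by have [_ db _] := b_C2; exact: db.
Qed.

Lemma db_periodic t : derive1 b (t + 1) = derive1 b t.
Proof.
have h : is_derive t (1 : R) (fun s : R => b (s + 1)) (derive1 b (t + 1) * 1).
  apply: (@is_derive1_comp _ b (fun s : R => s + 1)); first exact: b_is_derive.
  by rewrite -[X in is_derive _ _ _ X]addr0; exact: is_deriveD (is_derive_id _ _) (is_derive_cst _ _ _).
have e : (fun s : R => b (s + 1)) = b by apply/funext => s.
rewrite e mulr1 in h; have [_ <-] := h; by rewrite derive1E.
Qed.

Lemma osc_is_derive (e eps t : R) :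
  is_derive t (1 : R) (fun t => e * b (t / eps)) (e / eps * derive1 b (t / eps)).
Proof.
have h : is_derive t (1 : R) (fun s : R => b (s / eps)) (derive1 b (t / eps) * eps^-1).
  apply: (@is_derive1_comp _ b (fun s : R => s / eps)); first exact: b_is_derive.
  rewrite (_ : (fun s => _) = (fun s : R => eps^-1 *: s)); last first.
    by apply/funext => s; rewrite /GRing.scale/= mulrC.
  by rewrite -[X in is_derive _ _ _ X]mulr1; exact: is_deriveZ (is_derive_id _ _).
rewrite (_ : e / eps * _ = e *: (derive1 b (t / eps) * eps^-1)).
  exact: (is_deriveZ e h).
by rewrite /GRing.scale/=; ring.
Qed.

(** The factor e / eps may be unbounded in the application. The constant serves only the openness of
    the strip and the description of its Dirichlet space, and never enters the rate. *)
Lemma osc_lipschitz (e eps C p q : R) : 0 <= e -> 0 < eps -> (forall t, `|derive1 b t| <= C) ->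
  `|e * b (p / eps) - e * b (q / eps)| <= e / eps * C * `|p - q|.
Proof.
move=> e0 eps0 bC; pose g t := e * b (t / eps).
wlog qp : p q / q <= p.
  move=> H; have [/H//|pq] := leP q p.
  by rewrite distrC (distrC p); apply: H; exact: ltW.
have dg x : x \in `]q, p[ -> is_derive x (1 : R) g (e / eps * derive1 b (x / eps)).
  by move=> _; exact: osc_is_derive.
have cg : {within `[q, p], continuous g}.
  by apply: derivable_within_continuous => x _; have [] := osc_is_derive e eps x.
have [c _ E] := MVT_segment qp dg cg.
have ee0 : 0 <= e / eps := divr_ge0 e0 (ltW eps0).
by rewrite -[_ - _]/(g p - g q) E normrM ler_wpM2r// normrM (ger0_norm ee0) ler_wpM2l.
Qed.

Lemma osc_derive_measurable (e eps : R) :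
  measurable_fun setT (derive1 (fun t => e * b (t / eps)) : T1 -> R).
Proof.
have -> : derive1 (fun t => e * b (t / eps)) = (fun t => e / eps * derive1 b (t / eps)).
  by apply/funext => t; rewrite derive1E; have [_] := osc_is_derive e eps t.
apply: continuous_measurable_fun => t; apply: cvgM; first exact: cvg_cst.
apply: (@continuous_comp _ _ _ (fun t : R => t / eps) (derive1 b)); last exact: db_continuous.
by apply: cvgM; [exact: cvg_id|exact: cvg_cst].
Qed.

End Oscillation.

(** * Restriction of Sobolev functions to a smaller domain *)

Section Restriction.
Context {R : realType}.
Local Notation mu := (@leb2 R).
Implicit Types (Om D : set (R * R)).

(** A test function of the smaller set is one of the larger set, with the same integrals. *)
Lemma sobolev1_restrict Om Om' (u : R * R -> R[i]) : open Om -> open Om' -> Om' `<=` Om ->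
  sobolev Om 2%:E 1 u -> sobolev Om' 2%:E 1 u /\ aet (jet Om' u) (zt Om' (jet Om u)).
Proof.
move=> oOm oOm' OO su; have [lj wj] := sobolev1_jet oOm su.
have mOm' := open_plane_measurable oOm'.
have lz k := (l2_restrict mOm' (lj k)).1.
have l0 : l2 (zext Om' u) by have := lz ord0; rewrite /jet mktri0 zextE.
have lS j : l2 (zext Om' (wderiv Om j u)) by have := lz (lift ord0 j); rewrite /jet mktriS zextE.
have IE (q psi : R * R -> R) : test_fun Om' psi ->
    \int[mu]_(x in Om) (q x * psi x) = \int[mu]_(x in Om') (q x * psi x).
  move=> tpsi; have z D : Om' `<=` D -> \int[mu]_(x in D) (q x * psi x) = \int[mu]_x (q x * psi x).
    move=> OD; apply: (@Rintegral_supp R D (fun x => q x * psi x)) => x nx.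
    by rewrite (test_fun_eq0 tpsi) ?mulr0// => /OD.
  by rewrite (z Om OO) (z Om' (@subset_refl _ Om')).
have [||su' a] := @sobolev1_intro _ Om' u (fun j => wderiv Om j u) oOm' l0.
- move=> j; have [_ _ h1 h2] := (is_wderivP _ _ _ _).1 (wj j).
  apply/is_wderivP; split; try exact: l2_loc_integrable.
  + move=> phi tphi; have := h1 phi (test_funW OO tphi).
    rewrite (IE (fun x => complex.Re (u x)) _ (test_fun_derive j tphi)).
    by rewrite (IE (fun x => complex.Re (wderiv Om j u x)) _ tphi).
  + move=> phi tphi; have := h2 phi (test_funW OO tphi).
    rewrite (IE (fun x => complex.Im (u x)) _ (test_fun_derive j tphi)).
    by rewrite (IE (fun x => complex.Im (wderiv Om j u x)) _ tphi).
- exact: lS.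
split => //; apply: aet_trans a _.
by apply: ord3P => [|j]; rewrite /zt /jet ?mktri0 ?mktriS zextE//; exact: aeW.
Qed.

End Restriction.

Theorem theorem1p1 (R : realType) (d : R) (eta b : R -> R)
    (A : 'I_2 -> 'I_2 -> R * R -> R[i]) (a : 'I_2 -> R * R -> R[i])
    (a0 : R * R -> R) (c0 : R)
    (d_gt0 : 0 < d)
    (eta_ge0 : forall eps : R, 0 < eps -> 0 <= eta eps)
    (eta_to0 : eta eps @[eps --> 0^'+] --> (0 : R))
    (b_C2 : C2 b) (b_ge0 : forall t, 0 <= b t)
    (b_periodic : forall t, b (t + 1) = b t)
    (A_W2oo : forall i j, sobolev (Omega0 d) +oo%E 2 (A i j))
    (a_W1oo : forall j, sobolev (Omega0 d) +oo%E 1 (a j))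
    (a0_Loo : Lp (Omega0 d) +oo%E (fun x => (a0 x)%:C%C))
    (c0_gt0 : 0 < c0)
    (A_elliptic : hermitian_elliptic (Omega0 d) A c0) :
  exists eps0 C : R, [/\ 0 < eps0, 0 < C &
    forall eps : R, 0 < eps < eps0 ->
    forall f : R * R -> R[i], Lp (Omega0 d) 2%:E f ->
      (W12norm (Omega_eps eta b d eps)
         (resolventD (osc eta b eps) d A a a0 'i%C f \-
          resolventD flat d A a a0 'i%C f)%R
       <= (C * Num.sqrt (eta eps))%R%:E * Lpnorm (Omega0 d) 2%:E f)%E].
Proof.
have [M [B [L [B0 L0 [bM hM eM wM rawM]]]]] := admissible_coefs c0_gt0 A_W2oo a_W1oo a0_Loo A_elliptic.
have BB0 : 0 <= B ^+ 2 by exact: sqr_ge0.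
have cM := coercive_of_elliptic c0_gt0 BB0 bM hM eM.
set K := _ + c0 / 2 in cM.
have K0 : 0 <= K by have cc := ltW c0_gt0; rewrite /K; nonneg.
have c20 : 0 < c0 / 2 by rewrite divr_gt0.
have [S S0 HS] := dirichlet_rate d_gt0 B0 L0 K0 c20 bM hM cM wM.
have [C0 C00 bC0] := periodic_bounded (b_continuous b_C2) b_periodic.
have [C1 C10 bC1] := periodic_bounded (db_continuous b_C2) (db_periodic b_C2 b_periodic).
(* For eta below this bound the curve stays under height d/2, and the stretching factor is at most
   2. *)
have e00 : 0 < d / (2 * C0) by rewrite divr_gt0// mulr_gt0.
move/cvgrPdist_lt/(_ _ e00) : eta_to0 => [/= eps0 eps00 Heps].
pose S2 := S * (2 * C0 / d); have S20 : 0 <= S2 by rewrite mulr_ge0// divr_ge0 ?mulr_ge0 ?(ltW d_gt0) ?(ltW C00).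
(* The added 1 makes the constant positive even if [S2] is 0. *)
exists eps0, (Num.sqrt S2 + 1); split; [exact: eps00|by rewrite ltr_wpDl ?sqrtr_ge0|].
move=> eps /andP[p0 p1] f lf.
have eta0 := eta_ge0 eps p0.
have eta_small : eta eps < d / (2 * C0).
  have := Heps eps _ p0; rewrite /= sub0r normrN ger0_norm ?(ltW p0)// => /(_ p1).
  by rewrite sub0r normrN ger0_norm.
pose t := eta eps * C0; have t0 : 0 <= t by rewrite mulr_ge0// ltW.
have td : t < d / 2.
  by move: eta_small; rewrite ltr_pdivlMr ?mulr_gt0// /t => h; rewrite ltr_pdivlMr//; lra.
have t_lt_d : t < d by lra.
pose g := osc eta b eps.
have g0 s : 0 <= g s by rewrite mulr_ge0.
have gt s : g s <= t by rewrite ler_wpM2l// (le_trans (ler_norm _)).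
have gL p q : `|g p - g q| <= (eta eps / eps * C1) * `|p - q| by exact: osc_lipschitz.
have LL0 : 0 <= eta eps / eps * C1 by rewrite mulr_ge0 ?(ltW C10)// divr_ge0// ltW.
have mg : measurable_fun setT (derive1 g : measurableTypeR R -> R) by exact: osc_derive_measurable.
have [su ru] := resolvent_rsolves A_W2oo a_W1oo a0_Loo B0 bM rawM LL0 gL mg g0 gt t_lt_d K0 c20 hM cM lf.
have fL p q : `|@flat R p - flat q| <= 0 * `|p - q| by rewrite subrr normr0 mul0r.
have mf : measurable_fun setT (derive1 (@flat R) : measurableTypeR R -> R).
  rewrite (_ : derive1 _ = cst 0); first exact: measurable_cst.
  by apply/funext => s; rewrite derive1E derive_cst.
have f0 s : 0 <= @flat R s by [].
have ft s : @flat R s <= 0 by [].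
have [sv rv] := resolvent_rsolves A_W2oo a_W1oo a0_Loo B0 bM rawM (lexx 0) fL mf f0 ft d_gt0 K0 c20 hM cM lf.
move: su ru sv rv; set u := resolventD g _ _ _ _ _ _; set v := resolventD flat _ _ _ _ _ _ => su ru sv rv.
have OO := @strip_sub0 R d g g0.
have oOm : open (strip g d) := strip_graph_open LL0 gL.
have oO0 := @strip0_open R d.
have mOm := open_plane_measurable oOm.
(* The factor for which the height [t], an upper bound of the curve, is mapped to 0; then k - 1 = t
   / (d - t) is of order eta. *)
pose k := d / (d - t).
have dt : 0 < d - t by rewrite subr_gt0.
have k12 : 1 <= k <= 2.
  by rewrite /k ler_pdivlMr// ler_pdivrMr//; apply/andP; split; lra.
have k1 : k - 1 <= 2 * C0 / d * eta eps.
  have -> : k - 1 = t / (d - t) by rewrite /k; field; rewrite lt0r_neq0.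
  have -> : 2 * C0 / d * eta eps = (2 * t) / d by rewrite /t; ring.
  by rewrite ler_pdivlMr// mulrAC ler_pdivrMr//; nra.
have sO x : strip (@flat R) d (stretch d k x) -> strip g d x.
  move=> /andP[h1 h2]; rewrite /stretch /flat /= in h1 h2.
  have kk : 0 < k by case/andP: k12 => ? _; lra.
  have kd : k * (d - t) = d by rewrite /k divfK// lt0r_neq0.
  have h3 : 0 < d - x.2 by rewrite -(pmulr_rgt0 _ kk); lra.
  have h4 : d - x.2 < d - t by rewrite -(ltr_pM2l kk) kd; lra.
  by apply/andP; split; [apply: le_lt_trans (gt _) _|]; lra.
have lf0 : l2 (zext (strip flat d) f) := strip_l2 (le_refl 0) fL f0 lf.
have lfg : l2 (zext (strip g d) f) := strip_l2 LL0 gL g0 lf.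
(* The two loads are [f] cut to different strips, but [W] vanishes almost everywhere off the smaller
   one. *)
have ff W : Vsp (strip g d) W -> rip (zext (strip g d) f) (W ord0) = rip (zext (strip flat d) f) (W ord0).
  move=> VW; have [lW _] := VW; have supp := Vsp_supp oOm VW ord0.
  have [lz _] := l2_restrict mOm (lW ord0).
  rewrite -[RHS](@eq_ae_rip _ (zext (strip flat d) f) _ (zext (strip g d) (W ord0))); last 6 first.
  - exact: l2_measurable.
  - exact: l2_measurable.
  - exact: l2_measurable.
  - exact: l2_measurable.
  - exact: aeW.
  - exact: supp.
  rewrite -[LHS](@eq_ae_rip _ (zext (strip g d) f) _ (zext (strip g d) (W ord0))); last 6 first.
  - exact: l2_measurable.
  - exact: l2_measurable.
  - exact: l2_measurable.
  - exact: l2_measurable.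
  - exact: aeW.
  - exact: supp.
  apply: eq_Rintegral => x _; rewrite /zext; case: ifPn => [xO|_]; last by rewrite /rdot /= !mulr0.
  by rewrite mem_set//; apply: OO; rewrite inE in xO.
have rate := HS _ _ _ _ _ k OO lf0 lfg k12 sO ff rv ru.
have [sv' av] := sobolev1_restrict oO0 oOm OO sv.
have [sw aw] := sobolev1B oOm su sv'.
rewrite (W12normE oOm sw) (Lpnorm2_nsq lf0) -EFinM lee_fin.
have [lu _] := sobolev1_jet oOm su; have [lv _] := sobolev1_jet oO0 sv.
have [lw _] := sobolev1_jet oOm sw.
(* The rate concerns triples on the whole plane; passing to the smaller strip discards the part of
   the limit solution below the curve. *)
have E : nsqt (jet (strip g d) (u \- v)) = nsqt (zt (strip g d) (jet (strip g d) u - jet (strip flat d) v)).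
  have a1 : aet (jet (strip g d) (u \- v)) (zt (strip g d) (jet (strip g d) u - jet (strip flat d) v)).
    apply: aet_trans aw _.
    have -> : zt (strip g d) (jet (strip g d) u - jet (strip flat d) v) =
        jet (strip g d) u - zt (strip g d) (jet (strip flat d) v).
      apply/funext => l; apply/funext => x; rewrite !fctE /zt /zext !fctE; case: ifPn => // nx.
      rewrite subr0; move: l; apply: ord3P => [|j]; by rewrite /jet ?mktri0 ?mktriS /zext (negbTE nx).
    by apply: aetB => // l; exact: aeW.
  by apply: aet_ript => //; apply: l2t_zt => //; exact: l2tB.
have h1 : nsqt (jet (strip g d) (u \- v)) <= S2 * eta eps * nsq (zext (strip flat d) f).
  rewrite E; apply: (le_trans (nsqt_zt_le mOm (l2tB lu lv))); apply: (le_trans rate).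
  by rewrite ler_wpM2r ?nsq_ge0// /S2 -[leRHS]mulrA ler_wpM2l.
apply: (@le_trans _ _ (Num.sqrt (S2 * eta eps * nsq (zext (strip flat d) f)))).
  exact: ler_wsqrtr.
have Se0 : 0 <= S2 * eta eps by exact: mulr_ge0.
rewrite (sqrtrM _ Se0) (sqrtrM _ S20).
by apply: ler_wpM2r; [exact: sqrtr_ge0|apply: ler_wpM2r; [exact: sqrtr_ge0|rewrite lerDl]].
Qed.
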